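(* Let $T>0$. (Forward direction.) Let $\varphi=\varphi_t(r,z)$ be smooth and define $P$ by $P_t(s,z)=\varphi_t(r,z)+\frac{\Omega^2r^2}{2}$ with $2s=r_0^{-2}-r^{-2}$. Assume $\varphi$ is such that $P_t$ is convex, and let $\Psi_t$ be the Legendre transform of $P_t$. Let $u,\theta,\zeta$ be smooth functions such that $r\chi_{\Gamma_{\zeta_t}}(r,z)$ is a probability density for each fixed $t$. Let $\mathbf u=(v,w)$ be a smooth velocity field and define $V$ by $$V_t\circ\nabla P_t\circ\mathbf s=\frac{D^{\mathbf u}}{Dt}\big[\nabla P_t\circ\mathbf s\big].$$ If $u,(v,w),\varphi,\theta,\zeta$ satisfy (E1), (E2), (E3), (E4) and (ST), then $V$ is given by formula (VEL). Furthermore, assume that $\{\sigma_t\}$ is a family of probability measures, absolutely continuous with respect to Lebesgue measure, such that $\nabla P_t\circ\mathbf s$ pushes $r\chi_{\Gamma_{\zeta_t}}(r,z)\,dr\,dz$ forward to $\sigma_t$. If $(v,w),\zeta$ solve (E5) and (FB), then $$\frac{\partial\sigma_t}{\partial t}+\operatorname{div}(V_t\sigma_t)=0\qquad\text{in }(0,T)\times\mathbb R^2$$ in the sense of distributions. (Converse direction.) Let $\{\sigma_t\}_{t\in[0,T]}$ be a family of Borel probability measures on $\mathbb R^2$ with supports in a fixed ball of $\mathbb R^2_+$ and absolutely continuous with respect to Lebesgue measure. Assume that for each $t$, $(P^\sigma_t,\Psi^\sigma_t,\rho^\sigma_t)$ are smooth, with $P^\sigma_t,\Psi^\sigma_t$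 convex and Legendre transforms of each other, and $\rho^\sigma>0$. Assume moreover that $\nabla P^\sigma_t$ and $\nabla\Psi^\sigma_t$ are inverse of each other (on the interiors of their domains), that $$e(\partial_\Upsilon\Psi^\sigma_t)\det(\nabla^2_{\Upsilon,Z}\Psi^\sigma_t)=\sigma_t,\qquad\nabla_{\Upsilon,Z}\Psi^\sigma_t(\operatorname{spt}(\sigma_t))=D_{\rho^\sigma_t},$$ and that $$P^\sigma_t(\rho^\sigma_t(H),H)=\frac{\Omega^2r_0^2}{2(1-2r_0^2\rho^\sigma_t(H))}.$$ Define $\varphi^\sigma$ by $P^\sigma_t(s,z)=\varphi^\sigma_t(r,z)+\frac{\Omega^2r^2}2$ with $2s=r_0^{-2}-r^{-2}$; define $\zeta^\sigma$ by $r\chi_{\Gamma_{\zeta^\sigma_t}}(r,z)\,dr\,dz=e(s)\chi_{D_{\rho^\sigma_t}}(s,z)\,ds\,dz$ under the same change of variables; and define $u^\sigma,\theta^\sigma$ by $$(u^\sigma r+r^2\Omega)^2=\partial_sP^\sigma\circ\mathbf s,\quad u^\sigma r+r^2\Omega\ge0,\qquad\frac g{\theta_0}\theta^\sigma=\partial_zP^\sigma\circ\mathbf s.$$ Let $V^\sigma$ be the velocity field given by (VEL) with $\Psi$ replaced by $\Psi^\sigma$, and let $\mathbf u^\sigma=(v^\sigma,w^\sigma)$ be the velocity field such that $$\mathbf u^\sigma_t\circ\mathbf d\circ\nabla\Psi^\sigma_t=\frac{D^{V^\sigma}}{Dt}\big[\mathbf d\circ\nabla\Psi^\sigma_t\big].$$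 If $\{\sigma_t\}_{t\in[0,T]}$ and $V^\sigma$ solve $$\frac{\partial\sigma}{\partial t}+\operatorname{div}(\sigma V^\sigma_t)=0\ \text{ in }(0,T)\times\mathbb R^2,\qquad\sigma|_{t=0}=\sigma_0$$ in the sense of distributions, then $(u^\sigma,v^\sigma,w^\sigma),\theta^\sigma,\varphi^\sigma,\zeta^\sigma$ solve (E1)–(E5), (FB), (PB) and (ST).
   Context: $r_0,H,\Omega,g,\theta_0$ are positive constants; $F=F_t(r,z)$ and $S=S_t(r,z)$ are prescribed functions. $\mathbb R^2_+=[0,\infty)^2$. Domains and changes of variables: $\mathcal D=[0,\frac1{2r_0^2})\times[0,H]$; $\Gamma_{\zeta_t}=\{(r,z):0\le z\le H,\ r_0\le r\le\zeta(t,z)\}$; $D_\rho=\{(s,z):0\le z\le H,\ 0\le s\le\rho(z)\}$; $e(s)=\frac{r_0^4}{(1-2sr_0^2)^2}$; $\mathbf s:[r_0,\infty)\times[0,H]\to\mathcal D$, $\mathbf s(r,z)=(\frac12(r_0^{-2}-r^{-2}),z)$, with inverse $\mathbf d(s,z)=\big(\frac{r_0}{\sqrt{1-2r_0^2s}},z\big)$. $\chi$ denotes an indicator function. Under $2s=r_0^{-2}-r^{-2}$ one has $r\,dr\,dz=e(s)\,ds\,dz$. The Legendre transform of $P$ on $\mathcal D$ is $\Psi(q)=\sup_{p\in\mathcal D}(\langle p,q\rangle-P(p))$, $q=(\Upsilon,Z)$. For a vector field $X=(X_1,X_2)$ on a plane with coordinates $(x_1,x_2)$, $\frac{D^X}{Dt}=\frac{\partial}{\partial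 t}+X_1\frac{\partial}{\partial x_1}+X_2\frac{\partial}{\partial x_2}$; the coordinates are $(r,z)$ for $\mathbf u=(v,w)$, and $(\Upsilon,Z)$ for $V$. $\frac D{Dt}$ without superscript means $\frac{D^{\mathbf u}}{Dt}=\partial_t+v\partial_r+w\partial_z$. In the Monge–Ampère equation $\sigma_t$ also denotes the density of $\sigma_t$. Equations on $\Gamma_{\zeta_t}$: (E1) $\frac{Du}{Dt}+\frac{uv}r+2\Omega v=\frac1rF(t,r,z)$; (E2) $\frac{D\theta}{Dt}=S(t,r,z)$; (E3) $\frac{u^2}r+2\Omega u=\frac{\partial\varphi}{\partial r}$; (E4) $\frac{\partial\varphi}{\partial z}-g\frac\theta{\theta_0}=0$; (E5) $\frac1r\frac{\partial}{\partial r}(rv)+\frac{\partial w}{\partial z}=0$. (FB) $\langle(v_t,w_t),\mathbf n_t\rangle=0$ on $\{r=r_0\}\cup\{z=0\}\cup\{z=H\}$, where $\mathbf n_t$ is the unit outward normal to $\partial\Gamma_{\zeta_t}$, and $\frac{\partial\zeta_t}{\partial t}+w\frac{\partial\zeta_t}{\partial z}=v$ on $\{r=\zeta(t,z)\}$. (PB) $\varphi(t,\zeta(t,H),H)=0$. (ST) $\nabla_{r,z}\big(\varphi+\Omega^2\frac{r^2}2\big)$ is invertible. (VEL) $V_t=\Big(2\sqrt\Upsilon\,F_t\Big(\frac{r_0}{\sqrt{1-2r_0^2\,\partial\Psi/\partial\Upsilon}},\frac{\partial\Psi}{\partial Z}\Big),\ \frac g{\theta_0}S_t\Big(\frac{r_0}{\sqrt{1-2r_0^2\,\partial\Psi/\partial\Upsilon}},\frac{\partial\Psi}{\partial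 Z}\Big)\Big)$.
   Formalization: (ST) is read as injectivity on Γ of (r³∂_r,∂_z)(φ+Ω²r²/2)=∇P∘s; the forward part adds ur+r²Ω≥0; the converse takes F,S smooth, data jointly smooth in time and v,w continuous up to ∂Γ; (E1)–(E5) and (VEL) are taken in the interior of Γ. *)

(* Defs.v *)
From mathcomp Require Import all_boot all_order all_algebra.
From mathcomp Require Import all_classical all_reals all_analysis.
From mathcomp Require Import ring lra.

Set Implicit Arguments.
Unset Strict Implicit.
Unset Printing Implicit Defensive.

Import Order.TTheory GRing.Theory Num.Theory.
Import numFieldNormedType.Exports.

Local Open Scope classical_set_scope.
Local Open Scope ring_scope.

Section calculus.
Context {R : realType}.

(* Fields are curried, [f t x y], where (x, y) stands for (r, z), (s, z) or
   (Upsilon, Z); points of space-time have type [R * (R * R)]. *)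
Definition unc (f : R -> R -> R -> R) (x : R * (R * R)) : R :=
  f x.1 x.2.1 x.2.2.

Definition Dt (f : R -> R -> R -> R) : R -> R -> R -> R :=
  fun t x y => derive1 (fun a => f a x y) t.
Definition D1 (f : R -> R -> R -> R) : R -> R -> R -> R :=
  fun t x y => derive1 (fun a => f t a y) x.
Definition D2 (f : R -> R -> R -> R) : R -> R -> R -> R :=
  fun t x y => derive1 (fun a => f t x a) y.

Definition partial (i : 'I_3) (f : R -> R -> R -> R) : R -> R -> R -> R :=
  match val i with 0%N => Dt f | 1%N => D1 f | _ => D2 f end.

(* C^infinity on an open set U: all iterated partial derivatives are Frechet
   differentiable (hence continuous) at every point of U.  On a set A that need
   not be open, f is smooth if it is so on an open neighbourhood of A; the
   values of the total function f outside A play the role of a smooth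
   extension, and when A is the closure of its interior the derivatives on A do
   not depend on it. *)
Definition smooth_on (A : set (R * (R * R))) (f : R -> R -> R -> R) : Prop :=
  exists U : set (R * (R * R)), [/\ open U, A `<=` U &
    forall (l : seq 'I_3) (x : R * (R * R)),
      U x -> differentiable (unc (foldr partial f l)) x].

Definition grad (f : R -> R -> R -> R) (t x y : R) : R * R :=
  (D1 f t x y, D2 f t x y).

Definition hess_det (f : R -> R -> R -> R) (t x y : R) : R :=
  D1 (D1 f) t x y * D2 (D2 f) t x y - D2 (D1 f) t x y * D1 (D2 f) t x y.

Definition dot (p q : R * R) : R := p.1 * q.1 + p.2 * q.2.

Definition vfield (v w : R -> R -> R -> R) (t x y : R) : R * R :=
  (v t x y, w t x y).

Definition material (X : R -> R -> R -> R * R) (f : R -> R -> R -> R)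
    (t x y : R) : R :=
  Dt f t x y + (X t x y).1 * D1 f t x y + (X t x y).2 * D2 f t x y.

Definition legendre (A : set (R * R)) (h : R * R -> R) (q : R * R) : R :=
  sup [set dot p q - h p | p in A].

End calculus.

(* [plane R] is convertible to R * R; going through [measurableTypeR] gives the
   sigma-algebra on which [lebesgue_measure] is defined. *)
Notation plane R := (measurableTypeR R * measurableTypeR R)%type.
Notation leb2 R := (@lebesgue_measure R \x @lebesgue_measure R)%E.

Section measures.
Context {R : realType}.

Definition spt (mu : set (R * R) -> \bar R) : set (R * R) :=
  [set q | forall U : set (R * R), open U -> U q -> (0 < mu U)%E].

Definition test_function (A : set (R * (R * R))) (eta : R -> R -> R -> R) :=
  smooth_on setT eta /\
  exists K : set (R * (R * R)), [/\ compact K, K `<=` A &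
    forall x, ~ K x -> unc eta x = 0].

Definition space_int (sigma : R -> probability (plane R) R)
    (V : R -> R -> R -> R * R) (eta : R -> R -> R -> R) (t : R) : R :=
  \int[sigma t]_(q in spt (sigma t)) material V eta t q.1 q.2.

(* The integrals are taken over the supports, the only place where the
   velocities below are specified; the complements are null sets. *)
Definition weak_integrable (T : R) (sigma : R -> probability (plane R) R)
    (V : R -> R -> R -> R * R) (eta : R -> R -> R -> R) : Prop :=
  (forall t, 0 < t < T -> (sigma t).-integrable (spt (sigma t))
     (fun q => (material V eta t q.1 q.2)%:E)) /\
  (@lebesgue_measure R).-integrable `]0, T[
     (fun t => (space_int sigma V eta t)%:E).

Definition weak_int (T : R) (sigma : R -> probability (plane R) R)
    (V : R -> R -> R -> R * R) (eta : R -> R -> R -> R) : R :=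
  \int[@lebesgue_measure R]_(t in `]0, T[) space_int sigma V eta t.

Definition continuity_equation (T : R)
    (sigma : R -> probability (plane R) R) (V : R -> R -> R -> R * R) :=
  forall eta, test_function [set x | 0 < x.1 < T] eta ->
    weak_integrable T sigma V eta /\ weak_int T sigma V eta = 0.

(* The initial condition is encoded by test functions that need not vanish at
   t = 0. *)
Definition continuity_equation_init (T : R)
    (sigma : R -> probability (plane R) R) (V : R -> R -> R -> R * R) :=
  forall eta, test_function [set x | x.1 < T] eta ->
    weak_integrable T sigma V eta /\
    weak_int T sigma V eta + \int[sigma 0]_q eta 0 q.1 q.2 = 0.

End measures.

Section model.
Context {R : realType}.
Variables r0 H Om g th0 T : R.

Definition domD : set (R * R) :=
  [set p | 0 <= p.1 < (2 * r0 ^+ 2)^-1 /\ 0 <= p.2 <= H].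

Definition strip : set (R * R) := [set x | r0 <= x.1 /\ 0 <= x.2 <= H].

Definition Gam (zeta : R -> R -> R) (t : R) : set (R * R) :=
  [set x | 0 <= x.2 <= H /\ r0 <= x.1 <= zeta t x.2].

Definition Gam_int (zeta : R -> R -> R) (t : R) : set (R * R) :=
  [set x | 0 < x.2 < H /\ r0 < x.1 < zeta t x.2].

Definition Drho (rho : R -> R -> R) (t : R) : set (R * R) :=
  [set p | 0 <= p.2 <= H /\ 0 <= p.1 <= rho t p.2].

Definition Drho_int (rho : R -> R -> R) (t : R) : set (R * R) :=
  [set p | 0 < p.2 < H /\ 0 < p.1 < rho t p.2].

Definition e_ (s : R) : R := r0 ^+ 4 / (1 - 2 * s * r0 ^+ 2) ^+ 2.

(* [s_of] and [r_of] are the first components of the changes of variables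
   s(r, z) and d(s, z); the second components are the identity in z. *)
Definition s_of (r : R) : R := (r0 ^- 2 - r ^- 2) / 2.
Definition r_of (s : R) : R := r0 / Num.sqrt (1 - 2 * r0 ^+ 2 * s).

Definition P_of (phi : R -> R -> R -> R) : R -> R -> R -> R :=
  fun t s z => phi t (r_of s) z + Om ^+ 2 * r_of s ^+ 2 / 2.
Definition phi_of (P : R -> R -> R -> R) : R -> R -> R -> R :=
  fun t r z => P t (s_of r) z - Om ^+ 2 * r ^+ 2 / 2.

Definition Psi_of (P : R -> R -> R -> R) : R -> R -> R -> R :=
  fun t Y Z => legendre domD (fun p => P t p.1 p.2) (Y, Z).

(* Since r dr dz = e(s) ds dz, the identity of measures
   r chi_{Gamma_zeta} dr dz = e(s) chi_{D_rho} ds dz says that Gamma_zeta is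
   the preimage of D_rho under (r, z) |-> s(r, z): see [Gam_zeta_of] below. *)
Definition zeta_of (rho : R -> R -> R) : R -> R -> R :=
  fun t z => r_of (rho t z).

Definition VEL (F S Psi : R -> R -> R -> R) : R -> R -> R -> R * R :=
  fun t Y Z =>
    (2 * Num.sqrt Y * F t (r_of (D1 Psi t Y Z)) (D2 Psi t Y Z),
     g / th0 * S t (r_of (D1 Psi t Y Z)) (D2 Psi t Y Z)).

(* The partial differential equations hold for 0 < t < T in the interior of
   Gamma; the boundary is dealt with by FB and PB. *)
Definition in_fluid (zeta : R -> R -> R) (E : R -> R -> R -> Prop) : Prop :=
  forall t r z, 0 < t < T -> Gam_int zeta t (r, z) -> E t r z.

Definition E1 (F u v w : R -> R -> R -> R) (zeta : R -> R -> R) : Prop :=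
  in_fluid zeta (fun t r z => differentiable (unc u) (t, (r, z)) /\
    material (vfield v w) u t r z + u t r z * v t r z / r + 2 * Om * v t r z
    = r^-1 * F t r z).

Definition E2 (S v w theta : R -> R -> R -> R) (zeta : R -> R -> R) : Prop :=
  in_fluid zeta (fun t r z => differentiable (unc theta) (t, (r, z)) /\
    material (vfield v w) theta t r z = S t r z).

Definition E3 (u phi : R -> R -> R -> R) (zeta : R -> R -> R) : Prop :=
  in_fluid zeta (fun t r z => differentiable (unc phi) (t, (r, z)) /\
    u t r z ^+ 2 / r + 2 * Om * u t r z = D1 phi t r z).

Definition E4 (phi theta : R -> R -> R -> R) (zeta : R -> R -> R) : Prop :=
  in_fluid zeta (fun t r z => differentiable (unc phi) (t, (r, z)) /\
    D2 phi t r z - g * (theta t r z / th0) = 0).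

Definition E5 (v w : R -> R -> R -> R) (zeta : R -> R -> R) : Prop :=
  in_fluid zeta (fun t r z => [/\ differentiable (unc v) (t, (r, z)),
    differentiable (unc w) (t, (r, z)) &
    r^-1 * D1 (fun t' r' z' => r' * v t' r' z') t r z + D2 w t r z = 0]).

Definition FB (v w : R -> R -> R -> R) (zeta : R -> R -> R) : Prop :=
  forall t, 0 < t < T ->
  [/\ forall z, Gam zeta t (r0, z) -> dot (vfield v w t r0 z) (-1, 0) = 0,
      forall r, Gam zeta t (r, 0) -> dot (vfield v w t r 0) (0, -1) = 0,
      forall r, Gam zeta t (r, H) -> dot (vfield v w t r H) (0, 1) = 0 &
      forall z, 0 <= z <= H ->
        differentiable (fun x : R * R => zeta x.1 x.2) (t, z) /\
        derive1 (zeta ^~ z) t + w t (zeta t z) z * derive1 (zeta t) z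
        = v t (zeta t z) z].

Definition PB (phi : R -> R -> R -> R) (zeta : R -> R -> R) : Prop :=
  forall t, 0 < t < T -> phi t (zeta t H) H = 0.

(* Invertibility (onto its image) of the gradient of
   Phi = phi + Omega^2 r^2 / 2 on Gamma.  The radial derivative is taken with
   respect to the radial coordinate s of the convex potential P,
   d/ds = r^3 d/dr, so that the map is (r, z) |-> grad P_t (s(r, z)).  With the bare
   d/dr the condition does not follow from convexity: for
   P(s, z) = r_of s + z^2 / 2, the map (d/dr, d/dz) Phi = (1, z) is not
   injective although grad P is. *)
Definition ST (phi : R -> R -> R -> R) (zeta : R -> R -> R) : Prop :=
  let Phi := fun t r z => phi t r z + Om ^+ 2 * r ^+ 2 / 2 in
  forall t, 0 < t < T ->
  {in Gam zeta t &, injective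
     (fun x => (x.1 ^+ 3 * D1 Phi t x.1 x.2, D2 Phi t x.1 x.2))}.

Lemma Gam_zeta_of (rho : R -> R -> R) (t : R) (x : R * R) : 0 < r0 ->
  (forall z, 0 <= z <= H -> 0 <= rho t z < (2 * r0 ^+ 2)^-1) -> strip x ->
  Gam (zeta_of rho) t x <-> Drho rho t (s_of x.1, x.2).
Proof.
case: x => r z r0_gt0 hrho [/= r_ge hz]; have /andP[rho_ge0 rho_lt] := hrho z hz.
have r_gt0 : 0 < r by apply: lt_le_trans r_ge.
have r02 : 0 < r0 ^+ 2 by rewrite exprn_gt0.
have r2 : 0 < r ^+ 2 by rewrite exprn_gt0.
have d_gt0 : 0 < 1 - 2 * r0 ^+ 2 * rho t z.
  move: rho_lt; rewrite -[X in _ < X]div1r ltr_pdivlMr; first by lra.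
  by rewrite mulr_gt0.
have rr : r0 ^+ 2 <= r ^+ 2 by rewrite lerXn2r// nnegrE ltW.
have s_ge0 : 0 <= s_of r.
  by rewrite /s_of divr_ge0// subr_ge0 lef_pV2 ?posrE.
have -> : Gam (zeta_of rho) t (r, z) <-> r <= zeta_of rho t z.
  by rewrite /Gam/= hz r_ge; split => [[]|].
have -> : Drho rho t (s_of r, z) <-> s_of r <= rho t z.
  by rewrite /Drho/= hz s_ge0; split => [[]|].
rewrite /zeta_of /r_of ler_pdivlMr ?sqrtr_gt0//.
have -> : (r * Num.sqrt (1 - 2 * r0 ^+ 2 * rho t z) <= r0) =
    (r ^+ 2 * (1 - 2 * r0 ^+ 2 * rho t z) <= r0 ^+ 2).
  rewrite -[in RHS](sqr_sqrtr (ltW d_gt0)) -exprMn.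
  by rewrite ler_pXn2r// nnegrE ?mulr_ge0// ?sqrtr_ge0// ltW.
have -> : (s_of r <= rho t z) =
    (r ^+ 2 - r0 ^+ 2 <= 2 * rho t z * (r0 ^+ 2 * r ^+ 2)).
  have -> : r ^+ 2 - r0 ^+ 2 = (2 * s_of r) * (r0 ^+ 2 * r ^+ 2).
    by rewrite /s_of; field; rewrite !gt_eqF.
  by rewrite ler_pM2r ?mulr_gt0// ler_pM2l.
by split; lra.
Qed.

End model.

(* Main.v *)
From HB Require Import structures.
Require Import Defs.
From mathcomp Require Import all_boot all_order all_algebra.
From mathcomp Require Import all_classical all_reals all_analysis.
From mathcomp Require Import measurable_realfun.
From mathcomp Require Import ring lra.

Set Implicit Arguments.
Unset Strict Implicit.
Unset Printing Implicit Defensive.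

Import Order.TTheory GRing.Theory Num.Theory.
Import numFieldNormedType.Exports.

Local Open Scope classical_set_scope.
Local Open Scope ring_scope.

(** In the variables q = grad P_t(s(r, z)) the fluid is described by the image
    sigma_t of the mass r dr dz of its domain, and the inverse of the map
    (r, z) |-> q is given by the gradient of the Legendre transform Psi_t.

    In the forward direction the balances E3 and E4 say that grad P_t is, up to
    constants, (u r + Om r^2)^2 and theta, so that E1 and E2 give the derivative
    of q along the flow; the invertibility ST makes grad P_t(p) differ from
    grad P_t(s, z) away from p, hence Psi_t is differentiable there with
    gradient p, and the derivative of q is VEL (forward_velocity).  The weak
    continuity equation is the chain rule: the derivative along V of a test
    function eta at q is the derivative along the flow of
    h = eta(t, q(t, r, z)) (weak_form_flow), and the integral of the latter
    against r dr dz dt vanishes by incompressibility and by the boundary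
    conditions.  This last fact is the divergence theorem on a fixed box, after
    the moving domain is flattened by r = r0 + l (zeta(t, z) - r0)
    (flux_divergence, transport_flux, flux_eq0).

    In the converse direction, duality shows that grad P_t maps D_rho
    injectively into the support of sigma_t and that grad Psi_t inverts it.  The
    static relations E3, E4, PB and ST follow at once; E1 and E2 follow by
    differentiating the identity grad Psi_t(q(t, r, z)) = (s(r), z) along the flow
    and inverting its Jacobian matrix (material_G).

    The equation E5 and the condition FB are read off the weak continuity
    equation, and for this sigma_t must be identified with the image of
    r dr dz (sigma_formula).  Near the image of an interior point both measures
    agree on small rectangles: by the Monge-Ampere equation this is a change
    of variables, which is proved with the divergence theorem along the homotopy
    from q(t, .) to a translation (change_of_variables_box, local_degree,
    pushforward_near); the strict monotonicity of the gradient of a convex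
    function keeps the homotopy away from the point.  The rest of the plane is null
    for both measures: the image of the boundary is made of smooth curves
    (negligible_curve), and at the remaining points of the support Psi_t is affine
    in one coordinate direction, so that its Hessian determinant vanishes
    (legendre_flat, flat_outside).

    Then the transported mass of every function eta(t, q(t, r, z)) is zero.  By
    injectivity and compactness, such functions localize at any point of the
    closed fluid domain (local_test).  Near an interior point the mass balance
    tests the compression v + r dv/dr + r dw/dz, which must vanish; near
    a point of a face it tests the normal velocity relative to the face, and the
    edges are reached by continuity. *)

(** * Smooth functions of three variables *)

Lemma diff_epsP (R : realType) (V W : normedModType R) (f : V -> W) (L : {linear V -> W}) x :
  continuous L ->
  (forall e, 0 < e -> \forall h \near (0 : V), `|f (h + x) - f x - L h| <= e * `|h|) ->
  differentiable f x /\ 'd f x = L :> (V -> W).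
Proof.
move=> cL H.
have fE : f \o shift x = cst (f x) + L +o_ 0 id.
  apply/eqaddoP => _/posnumP[e].
  have := H e%:num ltac:(done); apply: filterS => h /=.
  by rewrite /cst !fctE/= opprD addrA.
have dE := diff_unique cL fE; split => //.
by apply/diff_locallyP; rewrite dE.
Qed.

Lemma near_eq_differentiable (R : realType) (V W : normedModType R) (f g : V -> W) (x : V) :
  (\near x, f x = g x) -> differentiable f x -> differentiable g x.
Proof.
move=> fg df.
have fgx : f x = g x by exact: nbhs_singleton fg.
apply: (proj1 (diff_epsP (diff_continuous df) _)) => e e0.
  have /eqaddoP/(_ e e0) := diff_locally df.
  have : \forall h \near (0 : V), f (h + x) = g (h + x).
    by move: fg; rewrite (near_shift 0 x)/= subr0.
  apply: filterS2 => h /= Eh.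
  by rewrite /cst !fctE/= opprD addrA Eh fgx.
Qed.

Section chain.
Context {R : realType}.
Implicit Types (f g h : R -> R -> R -> R) (x : R * (R * R)).

Lemma Dt_diff f x : differentiable (unc f) x ->
  Dt f x.1 x.2.1 x.2.2 = 'd (unc f) x (1, (0, 0)).
Proof.
move=> df; rewrite -deriveE// /Dt derive1E /derive; congr (lim _).
apply: (congr1 (fun F => F @ (0:R)^')).
apply/funext => k /=; rewrite /unc/=; case: x {df} => a [b c] /=.
by rewrite /GRing.scale/= !mulr0 ?add0r.
Qed.

Lemma D1_diff f x : differentiable (unc f) x ->
  D1 f x.1 x.2.1 x.2.2 = 'd (unc f) x (0, (1, 0)).
Proof.
move=> df; rewrite -deriveE// /D1 derive1E /derive; congr (lim _).
apply: (congr1 (fun F => F @ (0:R)^')).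
apply/funext => k /=; rewrite /unc/=; case: x {df} => a [b c] /=.
by rewrite /GRing.scale/= !mulr0 ?add0r.
Qed.

Lemma D2_diff f x : differentiable (unc f) x ->
  D2 f x.1 x.2.1 x.2.2 = 'd (unc f) x (0, (0, 1)).
Proof.
move=> df; rewrite -deriveE// /D2 derive1E /derive; congr (lim _).
apply: (congr1 (fun F => F @ (0:R)^')).
apply/funext => k /=; rewrite /unc/=; case: x {df} => a [b c] /=.
by rewrite /GRing.scale/= !mulr0 ?add0r.
Qed.

Lemma diff_unc f x (v : R * (R * R)) : differentiable (unc f) x ->
  'd (unc f) x v = v.1 * Dt f x.1 x.2.1 x.2.2 + v.2.1 * D1 f x.1 x.2.1 x.2.2 +
    v.2.2 * D2 f x.1 x.2.1 x.2.2.
Proof.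
move=> df; rewrite Dt_diff// D1_diff// D2_diff//.
have {1}-> : v = v.1 *: (1, (0, 0)) + v.2.1 *: (0, (1, 0)) +
    v.2.2 *: (0, (0, 1)) :> R * (R * R).
  case: v => a [b c]/=.
  congr pair; [|congr pair]; rewrite /GRing.scale/= /GRing.scale/=; ring.
by rewrite !linearD !linearZ.
Qed.

(** The chain rule along a curve, in terms of the coordinate derivatives. *)
Lemma is_derive_unc f (a b c : R -> R) (s a' b' c' : R) :
  differentiable (unc f) (a s, (b s, c s)) ->
  is_derive s 1 a a' -> is_derive s 1 b b' -> is_derive s 1 c c' ->
  is_derive s 1 (fun y => f (a y) (b y) (c y))
    (a' * Dt f (a s) (b s) (c s) + b' * D1 f (a s) (b s) (c s) +
     c' * D2 f (a s) (b s) (c s)).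
Proof.
move=> df da db dc.
have dabc : differentiable (fun y => (a y, (b y, c y))) s.
  apply: differentiable_pair; first exact/derivable1_diffP.
  by apply: differentiable_pair; exact/derivable1_diffP.
have dcomp : differentiable (unc f \o (fun y => (a y, (b y, c y)))) s.
  by apply: differentiable_comp.
apply: (@DeriveDef _ _ _ _ _ (unc f \o (fun y => (a y, (b y, c y))))).
  exact: diff_derivable.
have da1 : differentiable a s by exact/derivable1_diffP.
have db1 : differentiable b s by exact/derivable1_diffP.
have dc1 : differentiable c s by exact/derivable1_diffP.
have dbc : differentiable (fun y => (b y, c y)) s.
  exact: differentiable_pair.
have ea : 'd a s 1 = a' by rewrite -deriveE// derive_val.
have eb : 'd b s 1 = b' by rewrite -deriveE// derive_val.
have ec : 'd c s 1 = c' by rewrite -deriveE// derive_val.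
rewrite deriveE// (diff_comp dabc df)/= (diff_pair da1 dbc)/=.
rewrite (diff_pair db1 dc1)/= ea eb ec.
rewrite diff_unc//.
Qed.

Definition dir (i : 'I_3) : R * (R * R) :=
  match val i with 0%N => (1, (0, 0)) | 1%N => (0, (1, 0)) | _ => (0, (0, 1)) end.

Lemma partialE i f x : differentiable (unc f) x ->
  partial i f x.1 x.2.1 x.2.2 = 'd (unc f) x (dir i).
Proof.
move=> df; rewrite /partial /dir.
by case: (val i) => [|[|_]]; rewrite ?Dt_diff ?D1_diff ?D2_diff.
Qed.

Lemma near_partial i f g x : (\near x, unc f x = unc g x) ->
  partial i f x.1 x.2.1 x.2.2 = partial i g x.1 x.2.1 x.2.2.
Proof.
case: x => a [b c] fg; rewrite /partial /Dt /D1 /D2.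
case: (val i) => [|[|_]]; rewrite !derive1E; apply: near_eq_derive;
  rewrite ?oner_neq0//.
- have : {for a, continuous (fun y : R => (y, (b, c)))}.
    by apply: (cvg_pair cvg_id (cvg_cst _)).
  by move=> /(_ _ fg).
- have : {for b, continuous (fun y : R => (a, (y, c)))}.
    by apply: (cvg_pair (cvg_cst _) (cvg_pair cvg_id (cvg_cst _))).
  by move=> /(_ _ fg).
- have : {for c, continuous (fun y : R => (a, (b, y)))}.
    by apply: (cvg_pair (cvg_cst _) (cvg_pair (cvg_cst _) cvg_id)).
  by move=> /(_ _ fg).
Qed.

(** Differentiability of all partial derivatives of order at most n.  Unlike
    smoothness it passes to composed functions by induction on n. *)
Fixpoint Cn n (U : set (R * (R * R))) f : Prop :=
  (forall x, U x -> differentiable (unc f) x) /\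
  if n is m.+1 then forall i, Cn m U (partial i f) else True.

Lemma Cn_diff n U f x : Cn n U f -> U x -> differentiable (unc f) x.
Proof. by case: n => [|n] [+ _]; apply. Qed.

Lemma Cn_partial n U f i : Cn n.+1 U f -> Cn n U (partial i f).
Proof. by case=> _; exact. Qed.

Lemma CnW n U f : Cn n.+1 U f -> Cn n U f.
Proof.
by elim: n f => [|n IH] f [df H]; split=> // i; exact: IH.
Qed.

Lemma sub_Cn n U V f : V `<=` U -> Cn n U f -> Cn n V f.
Proof.
move=> VU; elim: n f => [|n IH] f [df H]; split=> //.
- by move=> x Vx; exact/df/VU.
- by move=> x Vx; exact/df/VU.
- by move=> i; exact: IH (H i).
Qed.

Lemma smooth_onP A f : smooth_on A f ->
  exists U, [/\ open U, A `<=` U & forall n, Cn n U f].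
Proof.
move=> [U [oU AU dU]]; exists U; split=> // n.
have : forall l x, U x -> differentiable (unc (foldr partial f l)) x.
  by move=> l x; exact: dU.
elim: n f {dU} => [|n IH] f dU.
  by split => // x; exact: (dU [::]).
split=> [x|i]; first exact: (dU [::]).
by apply: IH => l x; move: (dU (rcons l i) x); rewrite foldr_rcons.
Qed.

Lemma Cn_eq n U f g : open U -> (forall x, U x -> unc f x = unc g x) ->
  Cn n U f -> Cn n U g.
Proof.
move=> oU; elim: n f g => [|n IH] f g fg [df H];
  have nfg x : U x -> \forall y \near x, unc f y = unc g y by
    move=> Ux; have : \forall y \near x, U y by [exact: open_nbhs_nbhs];
    apply: filterS.
  by split => // x Ux; apply: near_eq_differentiable (df _ Ux); exact: nfg.
split=> [x Ux|i]; first by apply: near_eq_differentiable (df _ Ux); exact: nfg.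
by apply: IH (H i) => x Ux; exact/near_partial/nfg.
Qed.

Lemma Cn_cst n U (c : R) : Cn n U (fun _ _ _ => c).
Proof.
have pc i : partial i (fun _ _ _ => c) = fun _ _ _ => 0.
  apply/funext => t; apply/funext => x; apply/funext => y.
  by rewrite /partial /Dt /D1 /D2; case: (val i) => [|[|_]];
    rewrite derive1_cst.
have dc (d : R) x : differentiable (unc (fun _ _ _ => d)) x.
  exact: differentiable_cst.
suff : forall d, Cn n U (fun _ _ _ => d) by [].
elim: n => [|n IH] d; split => // i.
rewrite (_ : partial i _ = fun _ _ _ => 0)//.
apply/funext => t; apply/funext => x; apply/funext => y.
by rewrite /partial /Dt /D1 /D2; case: (val i) => [|[|_]]; rewrite derive1_cst.
Qed.

Lemma Cn_add n U f g : open U -> Cn n U f -> Cn n U g ->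
  Cn n U (fun t r z => f t r z + g t r z).
Proof.
move=> oU; elim: n f g => [|n IH] f g [df hf] [dg hg].
  by split => // x Ux; apply: (differentiableD (df _ Ux) (dg _ Ux)).
split=> [x Ux|i]; first exact: (differentiableD (df _ Ux) (dg _ Ux)).
apply: Cn_eq (IH _ _ (hf i) (hg i)) => // x Ux.
rewrite /unc [RHS]partialE; last exact: (differentiableD (df _ Ux) (dg _ Ux)).
by rewrite (diffD (df _ Ux) (dg _ Ux))/= -!partialE//; [exact: dg|exact: df].
Qed.

Lemma Cn_mul n U f g : open U -> Cn n U f -> Cn n U g ->
  Cn n U (fun t r z => f t r z * g t r z).
Proof.
move=> oU; elim: n f g => [|n IH] f g hf hg.
  split => // x Ux; apply: (differentiableM (Cn_diff hf Ux) (Cn_diff hg Ux)).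
split=> [x Ux|i].
  exact: (differentiableM (Cn_diff hf Ux) (Cn_diff hg Ux)).
apply: Cn_eq (Cn_add oU (IH _ _ (CnW hf) (Cn_partial i hg))
  (IH _ _ (Cn_partial i hf) (CnW hg))) => // x Ux.
have df := Cn_diff hf Ux; have dg := Cn_diff hg Ux.
rewrite /unc [RHS]partialE; last exact: (differentiableM df dg).
rewrite (diffM df dg) /unc (partialE i df) (partialE i dg) [X in _ + X = _]mulrC.
by [].
Qed.

Lemma Cn_opp n U f : open U -> Cn n U f -> Cn n U (fun t r z => - f t r z).
Proof.
move=> oU hf; apply: Cn_eq (Cn_mul oU (Cn_cst n U (-1)) hf) => // x Ux.
by rewrite /unc mulN1r.
Qed.

Lemma Cn_sub n U f g : open U -> Cn n U f -> Cn n U g ->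
  Cn n U (fun t r z => f t r z - g t r z).
Proof. by move=> oU hf hg; apply: Cn_add => //; exact: Cn_opp. Qed.

Lemma differentiable_fst (V W : normedModType R) (x : V * W) :
  differentiable (fst : V * W -> V) x.
Proof. by apply: linear_differentiable => y; exact: cvg_fst. Qed.

Lemma differentiable_snd (V W : normedModType R) (x : V * W) :
  differentiable (snd : V * W -> W) x.
Proof. by apply: linear_differentiable => y; exact: cvg_snd. Qed.

Lemma Cn_t n U : Cn n U (fun t _ _ => t).
Proof.
have d x : differentiable (unc (fun t _ _ => t)) x.
  exact: differentiable_fst.
case: n => [|n]; split => // i.
rewrite (_ : partial i _ = fun _ _ _ => (dir i).1); first exact: Cn_cst.
apply/funext => t; apply/funext => x; apply/funext => y.
by rewrite /partial /dir /Dt /D1 /D2; case: (val i) => [|[|_]]/=;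
  rewrite ?derive1_id ?derive1_cst.
Qed.

Lemma Cn_x n U : Cn n U (fun _ r _ => r).
Proof.
have d x : differentiable (unc (fun _ r _ => r)) x.
  apply: (@differentiable_comp _ _ _ _ snd fst).
    exact: differentiable_snd.
  exact: differentiable_fst.
case: n => [|n]; split => // i.
rewrite (_ : partial i _ = fun _ _ _ => (dir i).2.1); first exact: Cn_cst.
apply/funext => t; apply/funext => x; apply/funext => y.
by rewrite /partial /dir /Dt /D1 /D2; case: (val i) => [|[|_]]/=;
  rewrite ?derive1_id ?derive1_cst.
Qed.

Lemma Cn_y n U : Cn n U (fun _ _ z => z).
Proof.
have d x : differentiable (unc (fun _ _ z => z)) x.
  apply: (@differentiable_comp _ _ _ _ snd snd).
    exact: differentiable_snd.
  exact: differentiable_snd.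
case: n => [|n]; split => // i.
rewrite (_ : partial i _ = fun _ _ _ => (dir i).2.2); first exact: Cn_cst.
apply/funext => t; apply/funext => x; apply/funext => y.
by rewrite /partial /dir /Dt /D1 /D2; case: (val i) => [|[|_]]/=;
  rewrite ?derive1_id ?derive1_cst.
Qed.

Lemma differentiable_unc_comp f a b c x :
  differentiable (unc f) (unc a x, (unc b x, unc c x)) ->
  differentiable (unc a) x -> differentiable (unc b) x ->
  differentiable (unc c) x ->
  differentiable (unc (fun t r z => f (a t r z) (b t r z) (c t r z))) x.
Proof.
move=> df da db dc.
apply: (@differentiable_comp _ _ _ _ (fun x => (unc a x, (unc b x, unc c x)))
  (unc f)) => //.
by apply: differentiable_pair => //; exact: differentiable_pair.
Qed.

Lemma partial_comp f a b c x i :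
  differentiable (unc f) (unc a x, (unc b x, unc c x)) ->
  differentiable (unc a) x -> differentiable (unc b) x ->
  differentiable (unc c) x ->
  partial i (fun t r z => f (a t r z) (b t r z) (c t r z)) x.1 x.2.1 x.2.2 =
  unc (partial i a) x * unc (Dt f) (unc a x, (unc b x, unc c x)) +
  unc (partial i b) x * unc (D1 f) (unc a x, (unc b x, unc c x)) +
  unc (partial i c) x * unc (D2 f) (unc a x, (unc b x, unc c x)).
Proof.
move=> df da db dc.
rewrite partialE; last exact: differentiable_unc_comp.
have dbc : differentiable (fun x => (unc b x, unc c x)) x.
  exact: differentiable_pair.
have dabc : differentiable (fun x => (unc a x, (unc b x, unc c x))) x.
  exact: differentiable_pair.
rewrite (@diff_comp _ _ _ _ (fun x => (unc a x, (unc b x, unc c x)))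
  (unc f))//= !diff_pair//= diff_unc//=.
rewrite -(partialE i da) -(partialE i db) -(partialE i dc).
reflexivity.
Qed.

Lemma Cn_Dt n U f : Cn n.+1 U f -> Cn n U (Dt f).
Proof. by move/(@Cn_partial _ _ _ ord0). Qed.
Lemma Cn_D1 n U f : Cn n.+1 U f -> Cn n U (D1 f).
Proof. by move/(@Cn_partial _ _ _ (@Ordinal 3 1 isT)). Qed.
Lemma Cn_D2 n U f : Cn n.+1 U f -> Cn n U (D2 f).
Proof. by move/(@Cn_partial _ _ _ (@Ordinal 3 2 isT)). Qed.

Lemma Cn_comp n U V f a b c : open V ->
  (forall x, V x -> U (unc a x, (unc b x, unc c x))) ->
  Cn n U f -> Cn n V a -> Cn n V b -> Cn n V c ->
  Cn n V (fun t r z => f (a t r z) (b t r z) (c t r z)).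
Proof.
move=> oV VU; elim: n f => [|n IH] f hf ha hb hc.
  split=> // x Vx; apply: differentiable_unc_comp; [exact: (Cn_diff hf (VU _ Vx))|
    exact: (Cn_diff ha Vx)|exact: (Cn_diff hb Vx)|exact: (Cn_diff hc Vx)].
split=> [x Vx|i].
  apply: differentiable_unc_comp; [exact: (Cn_diff hf (VU _ Vx))|
    exact: (Cn_diff ha Vx)|exact: (Cn_diff hb Vx)|exact: (Cn_diff hc Vx)].
have ha' := CnW ha; have hb' := CnW hb; have hc' := CnW hc.
apply: Cn_eq (Cn_add oV (Cn_add oV
  (Cn_mul oV (Cn_partial i ha) (IH _ (Cn_Dt hf) ha' hb' hc'))
  (Cn_mul oV (Cn_partial i hb) (IH _ (Cn_D1 hf) ha' hb' hc')))
  (Cn_mul oV (Cn_partial i hc) (IH _ (Cn_D2 hf) ha' hb' hc'))) => // x Vx.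
rewrite [RHS](partial_comp i (Cn_diff hf (VU _ Vx)) (Cn_diff ha Vx)
  (Cn_diff hb Vx) (Cn_diff hc Vx)).
by [].
Qed.

Lemma Cn_inv n U f : open U -> (forall x, U x -> unc f x != 0) ->
  Cn n U f -> Cn n U (fun t r z => (f t r z)^-1).
Proof.
move=> oU f0; elim: n => [|n IH] hf.
  split=> // x Ux; exact: (differentiableV (Cn_diff hf Ux) (f0 _ Ux)).
split=> [x Ux|i]; first exact: (differentiableV (Cn_diff hf Ux) (f0 _ Ux)).
have h := IH (CnW hf).
apply: Cn_eq (Cn_opp oU (Cn_mul oU (Cn_mul oU h h) (Cn_partial i hf))) => //.
move=> x Ux; have df := Cn_diff hf Ux.
rewrite [RHS]partialE; last exact: (differentiableV df (f0 _ Ux)).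
rewrite (diffV df (f0 _ Ux)) /unc (partialE i df).
transitivity (- (unc f x) ^- 2 * 'd (unc f) x (dir i)); last by [].
by rewrite expr2 mulNr invfM.
Qed.

Lemma differentiable_unary (phi : R -> R) (dphi : R) f x :
  is_derive (unc f x) 1 phi dphi -> differentiable (unc f) x ->
  differentiable (unc (fun t r z => phi (f t r z))) x /\
  forall i, partial i (fun t r z => phi (f t r z)) x.1 x.2.1 x.2.2 =
    dphi * unc (partial i f) x.
Proof.
move=> dp df.
have dp1 : differentiable phi (unc f x) by exact/derivable1_diffP.
have d : differentiable (unc (fun t r z => phi (f t r z))) x.
  exact: (@differentiable_comp _ _ _ _ (unc f) phi).
split=> // i; rewrite partialE// (@diff_comp _ _ _ _ (unc f) phi)//=.
rewrite deriv1E// -partialE//= derive1E derive_val.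
by rewrite /GRing.scale/= mulrC.
Qed.

Lemma Cn_sqrt n U f : open U -> (forall x, U x -> 0 < unc f x) ->
  Cn n U f -> Cn n U (fun t r z => Num.sqrt (f t r z)).
Proof.
move=> oU f0; elim: n => [|n IH] hf.
  split=> // x Ux.
  exact: (differentiable_unary (is_derive1_sqrt (f0 _ Ux)) (Cn_diff hf Ux)).1.
have h := IH (CnW hf).
have s0 x : U x -> Num.sqrt (unc f x) != 0.
  by move=> Ux; rewrite gt_eqF// sqrtr_gt0 f0.
split=> [x Ux|i].
  exact: (differentiable_unary (is_derive1_sqrt (f0 _ Ux)) (Cn_diff hf Ux)).1.
have h2 := Cn_mul oU (Cn_cst n U 2) h.
have h20 x : U x -> unc (fun t r z => 2 * Num.sqrt (f t r z)) x != 0.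
  by move=> Ux; rewrite mulf_neq0// s0.
have h2i := Cn_inv oU h20 h2.
apply: Cn_eq (Cn_mul oU h2i (Cn_partial i hf)) => // x Ux.
rewrite [RHS](differentiable_unary (is_derive1_sqrt (f0 _ Ux)) (Cn_diff hf Ux)).2.
by [].
Qed.

End chain.

(** * Integrals over boxes and the divergence theorem *)

Section plane_measurability.
Context {R : realType}.

Lemma open_measurable2 (U : set (R * R)) : open U -> measurable (U : set (plane R)).
Proof.
move=> oU.
pose rect (a b c d : rat) : set (R * R) :=
  `]ratr a, ratr b[%classic `*` `]ratr c, ratr d[%classic.
pose G a b c d := if `[< rect a b c d `<=` U >] then rect a b c d else set0.
have -> : U = \bigcup_a \bigcup_b \bigcup_c \bigcup_d G a b c d.
  apply/seteqP; split=> [[x y] Uxy|[x y]]; last first.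
    move=> [a _ [b _ [c _ [d _]]]]; rewrite /G; case: ifPn => // /asboolP.
    by apply.
  have : nbhs (x, y) U by exact: open_nbhs_nbhs.
  move=> [[A B] [/nbhs_ballP[e1 /= e10 A1] /nbhs_ballP[e2 /= e20 B1]] AB].
  have [a] := @rat_in_itvoo R (x - e1) x ltac:(by rewrite ltrBlDr ltrDl).
  have [b] := @rat_in_itvoo R x (x + e1) ltac:(by rewrite ltrDl).
  have [c] := @rat_in_itvoo R (y - e2) y ltac:(by rewrite ltrBlDr ltrDl).
  have [d] := @rat_in_itvoo R y (y + e2) ltac:(by rewrite ltrDl).
  rewrite !in_itv/= => /andP[yd de] /andP[ec cy] /andP[xb be] /andP[ea ax].
  exists a => //; exists b => //; exists c => //; exists d => //.
  have sub : rect a b c d `<=` U.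
    move=> [x' y']; rewrite /rect/= !in_itv/= => -[/andP[h1 h2] /andP[h3 h4]].
    apply: AB; split => /=.
      by apply: A1; rewrite /ball/= ltr_norml; apply/andP; split; lra.
    by apply: B1; rewrite /ball/= ltr_norml; apply/andP; split; lra.
  rewrite /G; case: ifPn => [_|/asboolP//].
  by split => /=; rewrite in_itv/= ?ax ?cy.
do 4 (apply: bigcupT_measurable_rat => ?).
rewrite /G; case: ifPn => // _.
by apply: measurableX; exact: measurable_itv.
Qed.

Lemma closed_measurable2 (U : set (R * R)) : closed U ->
  measurable (U : set (plane R)).
Proof.
by move/closed_openC/open_measurable2/measurableC; rewrite setCK.
Qed.

Lemma continuous_measurable2 (f : R * R -> R) : continuous f ->
  measurable_fun setT (f : plane R -> R).
Proof.
move=> /continuousP cf; apply: (measurability _ (measurable_realfun.RGenOpens.measurableE R)).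
move=> _ [_ [a [b ->] <-]]; rewrite setTI.
by apply: open_measurable2; apply: cf; exact: interval_open.
Qed.
End plane_measurability.
Section integrals.
Context {R : realType}.
Local Notation mu := (@lebesgue_measure R).

Definition itg (a b : R) (f : R -> R) : R := \int[mu]_(x in `[a, b]) f x.

Lemma continuous_integrable (a b : R) (f : R -> R) : continuous f ->
  mu.-integrable `[a, b] (EFin \o f).
Proof.
move=> cf; apply: continuous_compact_integrable; first exact: segment_compact.
exact: continuous_subspaceT.
Qed.

Lemma itgD (a b : R) (f g : R -> R) : continuous f -> continuous g ->
  itg a b (fun x => f x + g x) = itg a b f + itg a b g.
Proof. by move=> cf cg; apply: RintegralD => //; exact: continuous_integrable. Qed.

Lemma itgB (a b : R) (f g : R -> R) : continuous f -> continuous g ->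
  itg a b (fun x => f x - g x) = itg a b f - itg a b g.
Proof. by move=> cf cg; apply: RintegralB => //; exact: continuous_integrable. Qed.

Lemma int_cst (a b c : R) : a <= b -> itg a b (fun _ => c) = c * (b - a).
Proof.
move=> ab; rewrite /itg Rintegral_cst//= lebesgue_measure_itv/=.
by move: ab; rewrite le_eqVlt lte_fin; case: ltgtP => //= -> _; rewrite subrr.
Qed.

Lemma eq_int (a b : R) (f g : R -> R) : (forall x, a <= x <= b -> f x = g x) ->
  itg a b f = itg a b g.
Proof.
by move=> fg; apply: eq_Rintegral => x; rewrite inE/= in_itv/= => /fg.
Qed.

Lemma int_ge0 (a b : R) (f : R -> R) : (forall x, a <= x <= b -> 0 <= f x) -> 0 <= itg a b f.
Proof.
by move=> f0; apply: Rintegral_ge0 => x; rewrite /= in_itv/= => /f0.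
Qed.

Lemma le_norm_int (a b : R) (f : R -> R) M : a <= b -> continuous f ->
  (forall x, a <= x <= b -> `|f x| <= M) -> `|itg a b f| <= M * (b - a).
Proof.
move=> ab cf fM.
have cnf : continuous (fun x => `|f x|).
  by move=> x; apply: cvg_norm; exact: cf.
apply: le_trans (le_normr_Rintegral _ _) _ => //; first exact: continuous_integrable.
rewrite -int_cst//; apply: le_Rintegral => //.
- exact: continuous_integrable.
- by apply: continuous_integrable; exact: cst_continuous.
Qed.

Lemma int_gt0 (a b : R) (f : R -> R) x0 : a < b -> continuous f ->
  (forall x, a <= x <= b -> 0 <= f x) -> a <= x0 <= b -> 0 < f x0 ->
  0 < itg a b f.
Proof.
move=> ab cf f0 /andP[ax xb] fx.
have /cvgrPdist_lt/(_ (f x0 / 2)) := cf x0.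
rewrite divr_gt0// => /(_ isT) /nbhs_ballP[d /= d0 Hd].
pose c := Num.max a (x0 - d / 2); pose c' := Num.min b (x0 + d / 2).
have cc : c < c' by rewrite /c /c' gt_max !lt_min; apply/andP; split; apply/andP; split; lra.
have sub x : c <= x <= c' -> a <= x <= b /\ f x0 / 2 <= f x.
  rewrite /c /c' ge_max le_min => /andP[/andP[h1 h2] /andP[h3 h4]].
  split; first by rewrite h1 h3.
  have : `|f x0 - f x| < f x0 / 2.
    by apply: Hd; rewrite /ball/= ltr_norml; apply/andP; split; lra.
  by rewrite ltr_norml => /andP[h5 h6]; lra.
have h : f x0 / 2 * (c' - c) <= itg c c' f.
  rewrite -(int_cst (f x0 / 2) (ltW cc)); apply: le_Rintegral => //.
  - by apply: continuous_integrable; exact: cst_continuous.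
  - exact: continuous_integrable.
  - by move=> x; rewrite /= in_itv/= => /sub[].
apply: (@lt_le_trans _ _ (itg c c' f)).
  by apply: lt_le_trans h; rewrite mulr_gt0// ?divr_gt0// subr_gt0.
rewrite /itg /Rintegral fine_le//.
- exact/integrable_fin_num/continuous_integrable.
- exact/integrable_fin_num/continuous_integrable.
apply: ge0_subset_integral => //.
- exact: measurable_int (continuous_integrable a b cf).
- by move=> x; rewrite /= !in_itv/= => /sub[].
Qed.

(** Uniform continuity in the integration variable, by compactness. *)
Lemma continuous_int (T : topologicalType) (a b : R) (F : T -> R -> R) :
  a <= b -> continuous (fun p : T * R => F p.1 p.2) ->
  continuous (fun x => itg a b (F x)).
Proof.
move=> ab cF x0.
have cFx x : continuous (F x).
  move=> y; apply: (@continuous_comp _ _ _ (fun y => (x, y))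
    (fun p : T * R => F p.1 p.2) y); last exact: cF.
  by apply: (cvg_pair (cvg_cst _) cvg_id).
apply/cvgrPdist_le => e e0.
have d0 : 0 < e / (b - a + 1) by rewrite divr_gt0//; lra.
have cover : forall y, `[a, b]%classic y ->
    \forall y' \near y & x \near x0,
      `|F x0 y' - F x y'| <= e / (b - a + 1).
  move=> y yab.
  have c0 := cF (x0, y).
  have /cvgrPdist_lt/(_ (e / (b - a + 1) / 2)) := c0.
  rewrite divr_gt0// => /(_ isT) [[A B] /= [Ax0 By] AB].
  exists (B, A) => //= -[y' x] /= [By' Ax].
  have h1 := AB (x0, y') (conj (nbhs_singleton Ax0) By').
  have h2 := AB (x, y') (conj Ax By').
  rewrite /= in h1 h2.
  rewrite (splitr (e / _)).
  rewrite (_ : F x0 y' - F x y' = (F x0 y - F x y') - (F x0 y - F x0 y')); last by ring.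
  by rewrite (le_trans (ler_normB _ _))// lerD// ltW.
have := (compact_near_coveringP _).1 (@segment_compact R a b) _ (nbhs x0)
  (fun x y => `|F x0 y - F x y| <= e / (b - a + 1)) _ cover.
move=> /(_ (nbhs_filter x0)); apply: filterS => x Hx.
rewrite -itgB//.
have cd : continuous (fun y => F x0 y - F x y).
  by move=> y; apply: cvgB; exact: cFx.
apply: (le_trans (le_norm_int (M := e / (b - a + 1)) ab cd _)).
  by move=> y yab; apply: Hx; rewrite /= in_itv.
rewrite -mulrA ger_pMr// mulrC ler_pdivrMr; lra.
Qed.

(* The integrand is cut off outside the rectangle, to bring it into the range
   of Fubini's theorem on the whole plane. *)
Lemma integrable_rect (a b c d : R) (F : R * R -> R) : continuous F ->
  (mu \x mu)%E.-integrable setT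
    (EFin \o (F \_ (`[a, b]%classic `*` `[c, d]%classic)) : plane R -> \bar R).
Proof.
move=> cF; set D := _ `*` _.
have mD : measurable (D : set (plane R)).
  by apply: measurableX; exact: measurable_itv.
have cD : compact D by apply: compact_setX; exact: segment_compact.
have fD : ((mu \x mu)%E D < +oo)%E.
  rewrite /D; have := product_measure1E mu mu.
  move=> /(_ `[a, b]%classic `[c, d]%classic (measurable_itv _) (measurable_itv _)) ->.
  have fin x y : (mu `[x, y]%classic < +oo)%E.
    exact/compact_finite_measure/segment_compact.
  apply: lte_mul_pinfty; [exact: measure_ge0| |exact: fin].
  by rewrite fin_num_abs gee0_abs ?measure_ge0//; exact: fin.
rewrite -restrict_EFin; apply/integrable_restrict => //; rewrite setTI.
apply: measurable_bounded_integrable => //.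
- by apply: measurable_funTS; exact: continuous_measurable2.
- have /compact_bounded[M [_ mrt]] := continuous_compact (continuous_subspaceT cF) cD.
  by exists M; split; rewrite ?num_real// => x Mx y Dy; apply: mrt => //; exists y.
Qed.

Lemma EFin_int (a b : R) (f : R -> R) : continuous f ->
  (itg a b f)%:E = (\int[mu]_(x in `[a, b]) (f x)%:E)%E.
Proof.
by move=> cf; rewrite fineK//; exact/integrable_fin_num/continuous_integrable.
Qed.

Lemma continuous_slice (T U V : topologicalType) (F : T -> U -> V) x :
  continuous (fun p : T * U => F p.1 p.2) -> continuous (F x).
Proof.
move=> cF y; apply: (@continuous_comp _ _ _ (fun y => (x, y))
  (fun p : T * U => F p.1 p.2) y); last exact: cF.
by apply: (cvg_pair (cvg_cst _) cvg_id).
Qed.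

Lemma continuous_flip (T U V : topologicalType) (F : T -> U -> V) :
  continuous (fun p : T * U => F p.1 p.2) ->
  continuous (fun p : U * T => F p.2 p.1).
Proof.
move=> cF [x y]; apply: (@continuous_comp _ _ _ (fun p : U * T => (p.2, p.1))
  (fun p : T * U => F p.1 p.2) (x, y)); last exact: cF.
by apply: (cvg_pair cvg_snd cvg_fst).
Qed.

Lemma int_int_prod (a b c d : R) (F : R -> R -> R) : c <= d ->
  continuous (fun p : R * R => F p.1 p.2) ->
  (itg a b (fun x => itg c d (F x)))%:E =
  (\int[mu]_x \int[mu]_y
    (EFin \o ((fun p : R * R => F p.1 p.2) \_
      (`[a, b]%classic `*` `[c, d]%classic))) (x, y))%E.
Proof.
move=> cd cF; rewrite EFin_int; last exact: continuous_int.
rewrite integral_mkcond; apply: eq_integral => x _ /=.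
rewrite patchE; case: ifPn => xab.
  rewrite EFin_int; last exact: continuous_slice.
  rewrite integral_mkcond; apply: eq_integral => y _ /=.
  by rewrite !patchE/= in_setX/= xab/=; case: ifPn.
rewrite -[LHS](integral0 mu setT); apply: eq_integral => y _ /=.
by rewrite patchE in_setX/= (negbTE xab).
Qed.

Lemma int_swap (a b c d : R) (F : R -> R -> R) : a <= b -> c <= d ->
  continuous (fun p : R * R => F p.1 p.2) ->
  itg a b (fun x => itg c d (F x)) = itg c d (fun y => itg a b (F ^~ y)).
Proof.
move=> ab cd cF; apply: EFin_inj; rewrite (int_int_prod _ _ cd cF).
rewrite (@int_int_prod c d a b (fun y x => F x y) ab (continuous_flip cF)).
rewrite (Fubini (integrable_rect a b c d cF)).
apply: eq_integral => y _; apply: eq_integral => x _ /=.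
by rewrite !patchE !in_setX/= andbC.
Qed.

Lemma int_FTC (a b : R) (F f : R -> R) : a <= b -> continuous f ->
  (forall x, a <= x <= b -> is_derive x 1 F (f x)) ->
  itg a b f = F b - F a.
Proof.
rewrite le_eqVlt => /predU1P[-> _ _|ab cf dF].
  by rewrite subrr /itg set_itv1 Rintegral_set1.
have cF x : a <= x <= b -> {for x, continuous F}.
  move=> /dF h; apply: differentiable_continuous.
  by apply/derivable1_diffP; exact: (@ex_derive _ _ _ _ _ _ _ h).
rewrite /itg /Rintegral (@continuous_FTC2 _ _ F)//.
- exact: continuous_subspaceT.
- split.
  + move=> x; rewrite in_itv/= => /andP[ax xb].
    by have := dF x; rewrite !ltW// => /(_ isT) h; exact: (@ex_derive _ _ _ _ _ _ _ h).
  + by apply: cvg_at_right_filter; apply: cF; rewrite lexx ltW.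
  + by apply: cvg_at_left_filter; apply: cF; rewrite lexx ltW.
- move=> x; rewrite in_itv/= => /andP[ax xb].
  by have := dF x; rewrite !ltW// derive1E => /(_ isT) h; rewrite derive_val.
Qed.

End integrals.
Opaque itg.
Section box_integrals.
Context {R : realType}.

Lemma continuous_pair (T U V : topologicalType) (f : T -> U) (g : T -> V) :
  continuous f -> continuous g -> continuous (fun x => (f x, g x)).
Proof. by move=> cf cg x; apply: (cvg_pair (cf x) (cg x)). Qed.

Lemma continuous_compo (T U V : topologicalType) (f : T -> U) (g : U -> V) :
  continuous f -> continuous g -> continuous (fun x => g (f x)).
Proof. by move=> cf cg x; apply: continuous_comp; [exact: cf|exact: cg]. Qed.

Lemma continuous_fst (U V : topologicalType) : continuous (@fst U V).
Proof. by move=> x; exact: cvg_fst. Qed.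

Lemma continuous_snd (U V : topologicalType) : continuous (@snd U V).
Proof. by move=> x; exact: cvg_snd. Qed.

Lemma continuous_add (T : topologicalType) (f g : T -> R) :
  continuous f -> continuous g -> continuous (fun x => f x + g x).
Proof. by move=> cf cg x; apply: cvgD; [exact: cf|exact: cg]. Qed.

Lemma continuous_sub (T : topologicalType) (f g : T -> R) :
  continuous f -> continuous g -> continuous (fun x => f x - g x).
Proof. by move=> cf cg x; apply: cvgB; [exact: cf|exact: cg]. Qed.

Lemma continuous_mul (T : topologicalType) (f g : T -> R) :
  continuous f -> continuous g -> continuous (fun x => f x * g x).
Proof. by move=> cf cg x; apply: cvgM; [exact: cf|exact: cg]. Qed.

Lemma continuous_pairl (T U : topologicalType) (x : T) :
  continuous (fun y : U => (x, y)).
Proof. by move=> y; apply: (cvg_pair (cvg_cst _) cvg_id). Qed.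

Lemma continuous_pairr (T U : topologicalType) (x : T) :
  continuous (fun y : U => (y, x)).
Proof. by move=> y; apply: (cvg_pair cvg_id (cvg_cst _)). Qed.

Lemma continuous_int2 (T : topologicalType) (a b c d : R)
    (F : T -> R -> R -> R) : a <= b -> c <= d ->
  continuous (fun p : T * (R * R) => F p.1 p.2.1 p.2.2) ->
  continuous (fun k => itg a b (fun x => itg c d (F k x))).
Proof.
move=> ab cd cF; apply: continuous_int => //.
apply: (@continuous_int _ (T * R)%type c d (fun p => F p.1 p.2)) => //.
apply: (continuous_compo (f := fun p : (T * R) * R => (p.1.1, (p.1.2, p.2)))
  (g := fun p : T * (R * R) => F p.1 p.2.1 p.2.2)) => //.
apply: continuous_pair; first exact: (continuous_compo (@continuous_fst _ _) (@continuous_fst _ _)).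
apply: continuous_pair; last exact: continuous_snd.
exact: (continuous_compo (@continuous_fst _ _) (@continuous_snd _ _)).
Qed.

Lemma continuous_int3 (T : topologicalType) (a1 b1 a2 b2 a3 b3 : R)
    (F : T -> R -> R -> R -> R) : a1 <= b1 -> a2 <= b2 -> a3 <= b3 ->
  continuous (fun p : T * (R * (R * R)) => F p.1 p.2.1 p.2.2.1 p.2.2.2) ->
  continuous (fun k => itg a1 b1 (fun t => itg a2 b2 (fun x => itg a3 b3 (F k t x)))).
Proof.
move=> ab1 ab2 ab3 cF; apply: continuous_int => //.
apply: (@continuous_int2 (T * R)%type a2 b2 a3 b3 (fun p => F p.1 p.2)) => //.
apply: (continuous_compo
  (f := fun p : (T * R) * (R * R) => (p.1.1, (p.1.2, p.2)))
  (g := fun p : T * (R * (R * R)) => F p.1 p.2.1 p.2.2.1 p.2.2.2)) => //.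
apply: continuous_pair; first exact: (continuous_compo (@continuous_fst _ _) (@continuous_fst _ _)).
apply: continuous_pair; last exact: continuous_snd.
exact: (continuous_compo (@continuous_fst _ _) (@continuous_snd _ _)).
Qed.

Lemma int3_swap (a1 b1 a2 b2 a3 b3 : R) (F : R -> R -> R -> R) :
  a1 <= b1 -> a2 <= b2 -> a3 <= b3 -> continuous (unc F) ->
  itg a1 b1 (fun t => itg a2 b2 (fun x => itg a3 b3 (F t x))) =
  itg a2 b2 (fun x => itg a3 b3 (fun y => itg a1 b1 (fun t => F t x y))).
Proof.
move=> ab1 ab2 ab3 cF.
have c3 : continuous (fun p : R * R => itg a3 b3 (F p.1 p.2)).
  apply: (@continuous_int _ (R * R)%type a3 b3 (fun p => F p.1 p.2)) => //.
  apply: (continuous_compo (f := fun p : (R * R) * R => (p.1.1, (p.1.2, p.2)))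
    (g := unc F)) => //.
  apply: continuous_pair; first exact: (continuous_compo (@continuous_fst _ _) (@continuous_fst _ _)).
  apply: continuous_pair; last exact: continuous_snd.
  exact: (continuous_compo (@continuous_fst _ _) (@continuous_snd _ _)).
rewrite (int_swap ab1 ab2 c3); apply: eq_int => x _.
rewrite int_swap//.
apply: (continuous_compo (f := fun p : R * R => (p.1, (x, p.2)))
    (g := unc F)) => //.
apply: continuous_pair; first exact: continuous_fst.
by apply: continuous_pair; [move=> ?; exact: cvg_cst|exact: continuous_snd].
Qed.

Lemma continuous_slice3 (F : R -> R -> R -> R) t x :
  continuous (unc F) -> continuous (F t x).
Proof.
move=> cF; apply: (continuous_compo (f := fun y => (t, (x, y))) (g := unc F)) => //.
exact: (continuous_compo (@continuous_pairl _ _ _) (@continuous_pairl _ _ _)).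
Qed.

Lemma continuous_int_slice (a b : R) (F : R -> R -> R -> R) t :
  a <= b -> continuous (unc F) -> continuous (fun x => itg a b (F t x)).
Proof.
move=> ab cF; apply: continuous_int => //.
apply: (continuous_compo (f := fun p : R * R => (t, p)) (g := unc F)) => //.
exact: continuous_pairl.
Qed.

Lemma int3D (a1 b1 a2 b2 a3 b3 : R) (F G : R -> R -> R -> R) :
  a1 <= b1 -> a2 <= b2 -> a3 <= b3 -> continuous (unc F) -> continuous (unc G) ->
  itg a1 b1 (fun t => itg a2 b2 (fun x => itg a3 b3
     (fun y => F t x y + G t x y))) =
  itg a1 b1 (fun t => itg a2 b2 (fun x => itg a3 b3 (F t x))) +
  itg a1 b1 (fun t => itg a2 b2 (fun x => itg a3 b3 (G t x))).
Proof.
move=> ab1 ab2 ab3 cF cG.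
rewrite -itgD; [|exact: continuous_int2|exact: continuous_int2].
apply: eq_int => t _; rewrite -itgD.
- by apply: eq_int => x _; rewrite itgD//; exact: continuous_slice3.
- exact: continuous_int_slice.
- exact: continuous_int_slice.
Qed.

Definition cl (a b x : R) := Num.max a (Num.min x b).

Lemma continuous_cl a b : continuous (cl a b).
Proof.
move=> x; apply: (@continuous_max _ _ (fun=> a) (fun y => Num.min y b)).
  exact: cvg_cst.
by apply: (@continuous_min _ _ id (fun=> b)) => //; exact: cvg_cst.
Qed.

Lemma cl_itv a b x : a <= b -> a <= cl a b x <= b.
Proof. by move=> ab; rewrite /cl le_max lexx/= ge_max ab ge_min lexx orbT. Qed.

Lemma cl_id a b x : a <= x <= b -> cl a b x = x.
Proof. by move=> /andP[ax xb]; rewrite /cl min_l// max_r. Qed.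

Definition cbox (a1 b1 a2 b2 a3 b3 : R) : set (R * (R * R)) :=
  [set p | [/\ a1 <= p.1 <= b1, a2 <= p.2.1 <= b2 & a3 <= p.2.2 <= b3]].
Definition obox (a1 b1 a2 b2 a3 b3 : R) : set (R * (R * R)) :=
  [set p | [/\ a1 < p.1 < b1, a2 < p.2.1 < b2 & a3 < p.2.2 < b3]].

Lemma obox_open a1 b1 a2 b2 a3 b3 : open (obox a1 b1 a2 b2 a3 b3).
Proof.
have -> : obox a1 b1 a2 b2 a3 b3 =
    fst @^-1` `]a1, b1[ `&` ((fun p => p.2.1) @^-1` `]a2, b2[ `&`
    (fun p => p.2.2) @^-1` `]a3, b3[).
  apply/seteqP; split=> [[t [x y]]|[t [x y]]] /=; rewrite /obox/= !in_itv/=.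
    by move=> [].
  by move=> [? [] ].
have c2 := @continuous_snd R (R * R)%type.
apply: openI; last apply: openI.
- by apply: open_comp => [x _|]; [exact: cvg_fst|exact: interval_open].
- apply: open_comp => [x _|]; last exact: interval_open.
  exact: (continuous_compo c2 (@continuous_fst _ _)).
- apply: open_comp => [x _|]; last exact: interval_open.
  exact: (continuous_compo c2 (@continuous_snd _ _)).
Qed.

Lemma obox_sub_cbox a1 b1 a2 b2 a3 b3 :
  obox a1 b1 a2 b2 a3 b3 `<=` cbox a1 b1 a2 b2 a3 b3.
Proof.
by move=> x [/andP[? ?] /andP[? ?] /andP[? ?]]; split; rewrite !ltW.
Qed.

Lemma continuous_clamp a1 b1 a2 b2 a3 b3 f :
  a1 <= b1 -> a2 <= b2 -> a3 <= b3 ->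
  {within cbox a1 b1 a2 b2 a3 b3, continuous (unc f)} ->
  continuous (unc (fun t x y => f (cl a1 b1 t) (cl a2 b2 x) (cl a3 b3 y))).
Proof.
move=> ab1 ab2 ab3 /subspace_continuousP cf x.
pose c (x : R * (R * R)) := (cl a1 b1 x.1, (cl a2 b2 x.2.1, cl a3 b3 x.2.2)).
have cc : continuous c.
  apply: continuous_pair.
    exact: (continuous_compo (@continuous_fst _ _) (@continuous_cl _ _)).
  have c2 := @continuous_snd R (R * R)%type.
  apply: continuous_pair.
    apply: (continuous_compo (continuous_compo c2 (@continuous_fst _ _)) (@continuous_cl _ _)).
  apply: (continuous_compo (continuous_compo c2 (@continuous_snd _ _)) (@continuous_cl _ _)).
have cb y : cbox a1 b1 a2 b2 a3 b3 (c y) by split; exact: cl_itv.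
apply: (@cvg_comp _ _ _ c (unc f) (nbhs x) (within (cbox a1 b1 a2 b2 a3 b3) (nbhs (c x)))); last exact: cf.
move=> A wA.
exact: (@filterS _ (nbhs x) _ (c @^-1` (fun y => cbox a1 b1 a2 b2 a3 b3 y -> A y))
  (c @^-1` A) (fun y h => h (cb y)) (cc x _ wA)).
Qed.

Lemma differentiable_within (U A : set (R * (R * R))) f : A `<=` U ->
  (forall x, U x -> differentiable (unc f) x) ->
  {within A, continuous (unc f)}.
Proof.
move=> AU df; apply: continuous_in_subspaceT => x /set_mem Ax.
exact/differentiable_continuous/df/AU.
Qed.

Lemma eq_at1 (f g : R -> R) : continuous f -> continuous g ->
  (forall k, 0 < k < 1 -> f k = g k) -> f 1 = g 1.
Proof.
move=> cf cg fg.
have hf : f k @[k --> (1 : R)^'-] --> f 1 by apply: cvg_at_left_filter; exact: cf.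
have hg : g k @[k --> (1 : R)^'-] --> g 1 by apply: cvg_at_left_filter; exact: cg.
apply: (cvg_unique (@Rhausdorff R) hf).
move: hg; apply: cvg_trans; apply: near_eq_cvg; near=> k.
rewrite fg//; apply/andP; split; near: k; first exact: nbhs_left_gt.
exact: nbhs_left_lt.
Unshelve. all: by end_near. Qed.

Section divergence.
Variables a1 b1 a2 b2 a3 b3 : R.
Hypotheses (ab1 : a1 < b1) (ab2 : a2 < b2) (ab3 : a3 < b3).
Let C := cbox a1 b1 a2 b2 a3 b3.
Let O := obox a1 b1 a2 b2 a3 b3.

Definition int3 (f : R -> R -> R -> R) :=
  itg a1 b1 (fun t => itg a2 b2 (fun x => itg a3 b3 (fun y => f t x y))).

Definition flux (f1 f2 f3 : R -> R -> R -> R) :=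
  itg a2 b2 (fun x => itg a3 b3 (fun y => f1 b1 x y - f1 a1 x y)) +
  itg a1 b1 (fun t => itg a3 b3 (fun y => f2 t b2 y - f2 t a2 y)) +
  itg a1 b1 (fun t => itg a2 b2 (fun x => f3 t x b3 - f3 t x a3)).

Definition clamp (f : R -> R -> R -> R) t x y :=
  f (cl a1 b1 t) (cl a2 b2 x) (cl a3 b3 y).

Lemma clampE f t x y : C (t, (x, y)) -> clamp f t x y = f t x y.
Proof. by move=> [? ? ?]; rewrite /clamp !cl_id. Qed.

Lemma clamp_int3 f : int3 f = int3 (clamp f).
Proof.
apply: eq_int => t ht; apply: eq_int => x hx; apply: eq_int => y hy.
by rewrite clampE.
Qed.

Lemma clamp_flux f1 f2 f3 :
  flux f1 f2 f3 = flux (clamp f1) (clamp f2) (clamp f3).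
Proof.
have [w1 w2 w3] : [/\ a1 <= b1, a2 <= b2 & a3 <= b3] by rewrite !ltW.
rewrite /flux; apply: congr2; first apply: congr2.
- apply: eq_int => x hx; apply: eq_int => y hy.
  by rewrite !clampE//; split => //=; rewrite lexx ?w1 ?w2 ?w3.
- apply: eq_int => x hx; apply: eq_int => y hy.
  by rewrite !clampE//; split => //=; rewrite lexx ?w1 ?w2 ?w3.
- apply: eq_int => x hx; apply: eq_int => y hy.
  by rewrite !clampE//; split => //=; rewrite lexx ?w1 ?w2 ?w3.
Qed.

Lemma clamp_continuous f : {within C, continuous (unc f)} ->
  continuous (unc (clamp f)).
Proof. by move=> cf; apply: continuous_clamp; rewrite ?ltW. Qed.

(** The fundamental theorem of calculus in each variable, the integrand being
    clamped to the box to make it continuous everywhere. *)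
Lemma divergence_smooth (U : set (R * (R * R))) f1 f2 f3 : C `<=` U ->
  Cn 1 U f1 -> Cn 1 U f2 -> Cn 1 U f3 ->
  int3 (fun t x y => Dt f1 t x y + D1 f2 t x y + D2 f3 t x y) =
  flux f1 f2 f3.
Proof.
move=> CU h1 h2 h3.
have cont f : Cn 0 U f -> continuous (unc (clamp f)).
  move=> hf; apply: clamp_continuous; apply: (differentiable_within CU) => x Ux.
  exact: Cn_diff hf Ux.
have [w1 w2 w3] : [/\ a1 <= b1, a2 <= b2 & a3 <= b3] by rewrite !ltW.
rewrite clamp_int3.
have c1 := cont _ (Cn_Dt h1); have c2 := cont _ (Cn_D1 h2).
have c3 := cont _ (Cn_D2 h3).
have c12 : continuous (unc (fun t x y => clamp (Dt f1) t x y + clamp (D1 f2) t x y)).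
  by move=> p; apply: cvgD; [exact: c1|exact: c2].
have dU x y t : a1 <= t <= b1 -> a2 <= x <= b2 -> a3 <= y <= b3 ->
    forall f, Cn 1 U f -> differentiable (unc f) (t, (x, y)).
  by move=> ht hx hy f hf; apply: (Cn_diff hf); exact: CU.
have cst0 (z s : R) : is_derive s 1 (fun=> z) 0 by exact: is_derive_cst.
rewrite /int3 (int3D w1 w2 w3 c12 c3) (int3D w1 w2 w3 c1 c2) /flux.
apply: congr2; first apply: congr2.
- rewrite (int3_swap w1 w2 w3 c1); apply: eq_int => x hx; apply: eq_int => y hy.
  apply: (@int_FTC _ _ _ (fun t => f1 t x y) (fun t => clamp (Dt f1) t x y)) => //.
    apply: (continuous_compo (f := fun t => (t, (x, y))) (g := unc (clamp (Dt f1)))) c1.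
    exact: continuous_pairr.
  move=> t ht; rewrite clampE//.
  have := @is_derive_unc R f1 id (fun=> x) (fun=> y) t 1 0 0 (dU _ _ _ ht hx hy _ h1).
  by rewrite !mul0r !addr0 mul1r; apply.
- apply: eq_int => t ht; rewrite int_swap//; last first.
    exact: (continuous_compo (@continuous_pairl _ _ t) c2).
  apply: eq_int => y hy.
  apply: (@int_FTC _ _ _ (fun x => f2 t x y) (fun x => clamp (D1 f2) t x y)) => //.
    apply: (continuous_compo (f := fun x => (t, (x, y))) (g := unc (clamp (D1 f2)))) c2.
    exact: (continuous_compo (@continuous_pairr _ _ _) (@continuous_pairl _ _ _)).
  move=> x hx; rewrite clampE//.
  have := @is_derive_unc R f2 (fun=> t) id (fun=> y) x 0 1 0 (dU _ _ _ ht hx hy _ h2).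
  by rewrite !mul0r !addr0 add0r mul1r; apply.
- apply: eq_int => t ht; apply: eq_int => x hx; 
  apply: (@int_FTC _ _ _ (fun y => f3 t x y) (fun y => clamp (D2 f3) t x y)) => //.
    exact: continuous_slice3.
  move=> y hy; rewrite clampE//.
  have := @is_derive_unc R f3 (fun=> t) (fun=> x) id y 0 0 1 (dU _ _ _ ht hx hy _ h3).
  by rewrite !mul0r !add0r mul1r; apply.
Qed.

Definition sc (k m x : R) := m + k * (x - m).

Lemma sc1 m x : sc 1 m x = x.
Proof. by rewrite /sc mul1r addrC subrK. Qed.

Lemma sc_itv k a b x : 0 < k < 1 -> a < b -> a <= x <= b ->
  a < sc k ((a + b) / 2) x < b.
Proof.
move=> /andP[k0 k1] ab /andP[ax xb]; rewrite /sc.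
have h1 : k * (a - b) <= k * (x - (a + b) / 2) * 2 by rewrite -mulrA ler_pM2l//; lra.
have h2 : k * (x - (a + b) / 2) * 2 <= k * (b - a) by rewrite -mulrA ler_pM2l//; lra.
have h3 : k * (b - a) < b - a by rewrite gtr_pMl// subr_gt0.
have h4 : k * (a - b) = - (k * (b - a)) by ring.
by apply/andP; split; lra.
Qed.

Lemma continuous_sc (T : topologicalType) (m : R) (k f : T -> R) :
  continuous k -> continuous f -> continuous (fun p => sc (k p) m (f p)).
Proof.
move=> ck cf p; apply: cvgD; first exact: cvg_cst.
by apply: cvgM; [exact: ck|apply: cvgB; [exact: cf|exact: cvg_cst]].
Qed.

Let m1 := (a1 + b1) / 2.
Let m2 := (a2 + b2) / 2.
Let m3 := (a3 + b3) / 2.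
Let scf k (f : R -> R -> R -> R) t x y := f (sc k m1 t) (sc k m2 x) (sc k m3 y).

Lemma is_derive_sc (k m x : R) : is_derive x 1 (sc k m) k.
Proof.
rewrite /sc; apply: is_derive_eq.
by rewrite add0r mul1r subr0 /GRing.scale/= mulr1.
Qed.

Let Cn_scf k f : Cn 1 O f -> Cn 1 [set p | O (sc k m1 p.1, (sc k m2 p.2.1, sc k m3 p.2.2))] (scf k f).
Proof.
move=> hf; set V := [set p | _].
have c2 := @continuous_snd R (R * R)%type.
have oV : open V.
  apply: (@open_comp _ _ (fun p => (sc k m1 p.1, (sc k m2 p.2.1, sc k m3 p.2.2)))); last exact: obox_open.
  move=> p _; move: p; apply: continuous_pair.
    by apply: continuous_sc => //; [move=> ?; exact: cvg_cst|exact: continuous_fst].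
  apply: continuous_pair; apply: continuous_sc => //.
  - by move=> ?; exact: cvg_cst.
  - exact: (continuous_compo c2 (@continuous_fst _ _)).
  - by move=> ?; exact: cvg_cst.
  - exact: (continuous_compo c2 (@continuous_snd _ _)).
have aff m h : Cn 1 V h -> Cn 1 V (fun t x y => sc k m (h t x y)).
  move=> hh; apply: Cn_add => //; first exact: Cn_cst.
  apply: Cn_mul => //; first exact: Cn_cst.
  by apply: Cn_sub => //; exact: Cn_cst.
apply: Cn_comp hf _ _ _ => //.
- by apply: aff; exact: Cn_t.
- by apply: aff; exact: Cn_x.
- by apply: aff; exact: Cn_y.
Qed.

Lemma continuous_scf (T : topologicalType) (f : R -> R -> R -> R)
    (k t x y : T -> R) : continuous (unc f) ->
  continuous k -> continuous t -> continuous x -> continuous y ->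
  continuous (fun p => scf (k p) f (t p) (x p) (y p)).
Proof.
move=> cf ck ct cx cy.
apply: (continuous_compo (f := fun p => (sc (k p) m1 (t p), (sc (k p) m2 (x p), sc (k p) m3 (y p))))
  (g := unc f)) => //.
apply: continuous_pair; first exact: continuous_sc.
by apply: continuous_pair; exact: continuous_sc.
Qed.

(** It is enough that the field be continuous on the closed box and smooth
    inside, provided its divergence extends continuously: the smooth case
    applies to the rescaled fields, and one lets the factor tend to 1. *)
Lemma divergence f1 f2 f3 g :
  {within C, continuous (unc f1)} -> {within C, continuous (unc f2)} ->
  {within C, continuous (unc f3)} -> {within C, continuous (unc g)} ->
  Cn 1 O f1 -> Cn 1 O f2 -> Cn 1 O f3 ->
  (forall t x y, O (t, (x, y)) ->
    Dt f1 t x y + D1 f2 t x y + D2 f3 t x y = g t x y) ->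
  int3 g = flux f1 f2 f3.
Proof.
move=> /clamp_continuous c1 /clamp_continuous c2 /clamp_continuous c3
  /clamp_continuous cg h1 h2 h3 divE.
have [w1 w2 w3] : [/\ a1 <= b1, a2 <= b2 & a3 <= b3] by rewrite !ltW.
pose L k := int3 (fun t x y => k * scf k (clamp g) t x y).
pose Fl k := flux (scf k (clamp f1)) (scf k (clamp f2)) (scf k (clamp f3)).
have cL : continuous L.
  apply: (@continuous_int3 R a1 b1 a2 b2 a3 b3
    (fun k t x y => k * scf k (clamp g) t x y)) => //.
  have cs1 := @continuous_snd R (R * (R * R))%type.
  have cs2 := @continuous_snd R (R * R)%type.
  move=> p; apply: cvgM; first exact: cvg_fst.
  move: p; apply: continuous_scf => //.
  - exact: continuous_fst.
  - exact: (continuous_compo cs1 (@continuous_fst _ _)).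
  - exact: (continuous_compo (continuous_compo cs1 cs2) (@continuous_fst _ _)).
  - exact: (continuous_compo (continuous_compo cs1 cs2) (@continuous_snd _ _)).
have cFl : continuous Fl.
  have cs1 := @continuous_snd R (R * R)%type.
  have cf0 := @continuous_fst R (R * R)%type.
  have cf1 := continuous_compo cs1 (@continuous_fst R R).
  have cf2 := continuous_compo cs1 (@continuous_snd R R).
  have cc (x : R) : continuous (fun p : R * (R * R) => x) by move=> ?; exact: cvg_cst.
  apply: continuous_add; first apply: continuous_add.
  - apply: (@continuous_int2 R a2 b2 a3 b3 (fun k x y =>
      scf k (clamp f1) b1 x y - scf k (clamp f1) a1 x y)) => //.
    by apply: continuous_sub; exact: continuous_scf.
  - apply: (@continuous_int2 R a1 b1 a3 b3 (fun k t y =>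
      scf k (clamp f2) t b2 y - scf k (clamp f2) t a2 y)) => //.
    by apply: continuous_sub; exact: continuous_scf.
  - apply: (@continuous_int2 R a1 b1 a2 b2 (fun k t x =>
      scf k (clamp f3) t x b3 - scf k (clamp f3) t x a3)) => //.
    by apply: continuous_sub; exact: continuous_scf.
have LFl k : 0 < k < 1 -> L k = Fl k.
  move=> k01.
  have scO t x y : C (t, (x, y)) -> O (sc k m1 t, (sc k m2 x, sc k m3 y)).
    by move=> [/= ht hx hy]; split; exact: sc_itv.
  have scC t x y : C (t, (x, y)) -> C (sc k m1 t, (sc k m2 x, sc k m3 y)).
    by move=> /scO; exact: obox_sub_cbox.
  have scE f t x y : C (t, (x, y)) -> scf k (clamp f) t x y = scf k f t x y.
    by move=> h; rewrite /scf clampE//; exact: scC.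
  have d1 f t x y : Cn 1 O f -> C (t, (x, y)) ->
      [/\ Dt (scf k f) t x y = k * scf k (Dt f) t x y,
       D1 (scf k f) t x y = k * scf k (D1 f) t x y &
       D2 (scf k f) t x y = k * scf k (D2 f) t x y].
    move=> hf hC; have df := Cn_diff hf (scO _ _ _ hC).
    split; rewrite /Dt /D1 /D2 derive1E.
    - have := @is_derive_unc R f (sc k m1) (fun=> sc k m2 x) (fun=> sc k m3 y)
        t k 0 0 df (is_derive_sc _ _ _) (is_derive_cst _ _ _) (is_derive_cst _ _ _).
      by rewrite !mul0r !addr0 => h; rewrite derive_val.
    - have := @is_derive_unc R f (fun=> sc k m1 t) (sc k m2) (fun=> sc k m3 y)
        x 0 k 0 df (is_derive_cst _ _ _) (is_derive_sc _ _ _) (is_derive_cst _ _ _).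
      by rewrite !mul0r !addr0 add0r => h; rewrite derive_val.
    - have := @is_derive_unc R f (fun=> sc k m1 t) (fun=> sc k m2 x) (sc k m3)
        y 0 0 k df (is_derive_cst _ _ _) (is_derive_cst _ _ _) (is_derive_sc _ _ _).
      by rewrite !mul0r !add0r => h; rewrite derive_val.
  have := @divergence_smooth _ (scf k f1) (scf k f2) (scf k f3) _
    (Cn_scf k h1) (Cn_scf k h2) (Cn_scf k h3).
  move=> /(_ _)/= E; rewrite /L /Fl.
  transitivity (flux (scf k f1) (scf k f2) (scf k f3)).
    rewrite -E; last by move=> [t [x y]]; exact: scO.
    apply: eq_int => t ht; apply: eq_int => x hx; apply: eq_int => y hy.
    have hC : C (t, (x, y)) by [].
    have [-> _ _] := d1 _ _ _ _ h1 hC.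
    have [_ -> _] := d1 _ _ _ _ h2 hC.
    have [_ _ ->] := d1 _ _ _ _ h3 hC.
    by rewrite scE// -!mulrDr /scf divE//; exact: scO.
  rewrite /flux; apply: congr2; first apply: congr2.
  - apply: eq_int => x hx; apply: eq_int => y hy.
    by rewrite !scE//; split => //=; rewrite lexx ?w1 ?w2 ?w3.
  - apply: eq_int => x hx; apply: eq_int => y hy.
    by rewrite !scE//; split => //=; rewrite lexx ?w1 ?w2 ?w3.
  - apply: eq_int => x hx; apply: eq_int => y hy.
    by rewrite !scE//; split => //=; rewrite lexx ?w1 ?w2 ?w3.
have := eq_at1 cL cFl LFl.
rewrite /L /Fl => E; rewrite clamp_int3 clamp_flux.
transitivity (int3 (fun t x y => 1 * scf 1 (clamp g) t x y)).
  apply: eq_int => t ht; apply: eq_int => x hx; apply: eq_int => y hy.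
  by rewrite mul1r /scf !sc1.
rewrite E /flux /scf; apply: congr2; first apply: congr2;
  by apply: eq_int => x hx; apply: eq_int => y hy; rewrite !sc1.
Qed.

End divergence.

End box_integrals.

(** * Smooth bump functions *)

Section bump.
Context {R : realType}.
Implicit Types p : {poly R}.

Lemma Cn_smooth_on A (f : R -> R -> R -> R) :
  (forall n, Cn n setT f) -> smooth_on A f.
Proof.
move=> hf; exists setT; split=> //; first exact: openT.
move=> l; elim/last_ind: l f hf => [|l i IH] f hf x _.
  exact: (Cn_diff (hf 0)).
by rewrite foldr_rcons; apply: IH => // n; exact: Cn_partial.
Qed.

Lemma exprn_le_expR k (y : R) : 0 <= y -> y ^+ k <= k`!%:R * expR y.
Proof.
move=> y0; case: k => [|k]; first by rewrite expr0 mul1r -expR0 ler_expR.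
rewrite mulrC -ler_pdivrMr ?ltr0n ?fact_gt0//.
by apply: le_trans (expR_ge1Dxn k y0); rewrite lerDr.
Qed.

Lemma poly_le_expR p k : exists M : R, forall y, 0 <= y ->
  `|p.[y]| * y ^+ k <= M * expR y.
Proof.
elim/poly_ind: p k => [|p c IH] k.
  by exists 0 => y y0; rewrite horner0 normr0 !mul0r.
have [M hM] := IH k.+1; exists (M + `|c| * k`!%:R) => y y0.
rewrite hornerMXaddC.
have h1 := hM y y0; have h2 := exprn_le_expR k y0.
have y0k : 0 <= y ^+ k by exact: exprn_ge0.
apply: (@le_trans _ _ (`|p.[y]| * y ^+ k.+1 + `|c| * y ^+ k)).
  rewrite exprS mulrA -mulrDl ler_wpM2r//.
  by rewrite (le_trans (ler_normD _ _))// normrM (ger0_norm y0).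
rewrite mulrDl lerD// -mulrA ler_wpM2l//.
Qed.

(** The functions x |-> p(1/x) exp(-1/x), continued by 0 for x <= 0: a class
    stable under differentiation, to which exp(-1/x) belongs. *)
Definition flat p (x : R) := if 0 < x then p.[x^-1] * expR (- x^-1) else 0.

Definition dflat p : {poly R} := (p - p^`()) * 'X ^+ 2.

Lemma near_eq_is_derive1 (f g : R -> R) (x df : R) :
  (\forall y \near x, f y = g y) -> is_derive x 1 f df -> is_derive x 1 g df.
Proof. exact: near_eq_is_derive. Qed.

Lemma is_derive1_cst (c x : R) : is_derive x 1 (fun _ : R => c) 0.
Proof. exact: is_derive_cst. Qed.

Lemma is_derive_flat p (x : R) : is_derive x 1 (flat p) (flat (dflat p) x).
Proof.
have [x0|x0|->] := ltgtP x 0.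
- have -> : flat (dflat p) x = 0 by rewrite /flat ltNge ltW.
  apply: (near_eq_is_derive1 _ (is_derive1_cst 0 x)).
  near=> z; rewrite /flat ifF//; apply/negbTE; rewrite -leNgt ltW//.
  by near: z; exact: lt_nbhsl.
- rewrite {2}/flat x0.
  have np : \forall z \near x, p.[z^-1] * expR (- z^-1) = flat p z.
    by near=> z; rewrite /flat ifT//; near: z; exact: lt_nbhsr.
  have dV : is_derive x 1 (fun z : R => z^-1) (- x ^- 2).
    have := @is_deriveV R id x 1 1 (lt0r_neq0 x0) (is_derive_id _ _).
    by rewrite /GRing.scale/= mulr1.
  have dp : is_derive x 1 (fun z => p.[z^-1]) (p^`().[x^-1] * - x ^- 2).
    have dP : is_derive (x^-1) 1 (horner p) (p^`().[x^-1]).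
      apply: DeriveDef; first exact: derivable_horner.
      by rewrite -derive1E -derivE.
    have := @is_derive1_comp _ (horner p) (fun z => z^-1) x _ _ dP dV.
    by [].
  have de : is_derive x 1 (fun z => expR (- z^-1)) (expR (- x^-1) * x ^- 2).
    have dN : is_derive x 1 (fun z : R => - z^-1) (x ^- 2).
      by have := is_deriveN dV; rewrite opprK.
    have := @is_derive1_comp _ expR (fun z => - z^-1) x _ _ (is_derive_expR _) dN.
    by [].
  apply: (near_eq_is_derive1 np).
  apply: (is_derive_eq (is_deriveM dp de)).
  rewrite /dflat !hornerE /GRing.scale/=.
  by field; rewrite gt_eqF.
- have -> : flat (dflat p) 0 = 0 by rewrite /flat ltxx.
  have [M hM] := poly_le_expR p 2.
  have M0 : 0 <= M.
    by have := hM 0 (lexx 0); rewrite expr0n/= mulr0 expR0 mulr1.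
  have bnd h : `|flat p h| <= M * h ^+ 2.
    rewrite /flat; case: ifPn => h0; last by rewrite normr0 mulr_ge0// sqr_ge0.
    rewrite normrM (ger0_norm (expR_ge0 _)) expRN.
    have := hM h^-1; rewrite invr_ge0 ltW// => /(_ isT).
    rewrite exprVn ler_pdivrMr ?exprn_gt0// => H.
    by rewrite ler_pdivrMr ?expR_gt0// mulrAC.
  have f0 : flat p 0 = 0 by rewrite /flat ltxx.
  have L0 : continuous (\0 : {linear R -> R}) by move=> ?; exact: cvg_cst.
  have [df dE] : differentiable (flat p) 0 /\ 'd (flat p) 0 = \0 :> (R -> R).
    apply: (diff_epsP L0) => e e0.
    have d0 : 0 < e / (M + 1) by rewrite divr_gt0//; lra.
    have := @nbhs0_lt R R _ d0; apply: filterS => h /=.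
    rewrite addr0 f0 !subr0 ltr_pdivlMr => [H|]; last by lra.
    apply: (le_trans (bnd h)); rewrite -real_normK ?num_real// expr2 mulrA ler_wpM2r//.
    by have := normr_ge0 h; nra.
  apply: DeriveDef; first exact/derivable1_diffP.
  by rewrite deriveE// dE.
Unshelve. all: by end_near. Qed.

Lemma Cn_flat n p U : Cn n U (fun t _ _ => flat p t).
Proof.
suff : Cn n setT (fun t _ _ => flat p t) by apply: sub_Cn.
have d q x : differentiable (unc (fun t _ _ => flat q t)) x /\
    forall i, partial i (fun t _ _ => flat q t) x.1 x.2.1 x.2.2 =
    flat (dflat q) x.1 * (dir i).1.
  have [h1 h2] := @differentiable_unary R (flat q) _ (fun t _ _ => t) x
    (is_derive_flat q x.1) (Cn_diff (Cn_t 0 setT) (I : setT x)).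
  split=> // i; rewrite h2 /unc partialE; last exact: (Cn_diff (Cn_t 0 setT)).
  congr (_ * _).
  by rewrite (_ : unc (fun t _ _ => t) = fst)// diff_lin//; exact: continuous_fst.
elim: n p => [|n IH] p; first by split => // x _; exact: (d p x).1.
split => [x _|i]; first exact: (d p x).1.
rewrite (_ : partial i _ = (fun t r z => flat (dflat p) t * (dir i).1)).
  apply: Cn_mul => //; first exact: openT.
  exact: Cn_cst.
apply/funext => t; apply/funext => r; apply/funext => z.
exact: (d p (t, (r, z))).2.
Qed.

(** A smooth function of one variable, positive exactly on ]c - e, c + e[. *)
Definition bump1 (c e x : R) := flat 1 (e - (x - c)) * flat 1 (e + (x - c)).

Lemma flat1_gt0 (x : R) : (0 < flat 1 x) = (0 < x).
Proof.
by rewrite /flat; case: ifPn; rewrite ?ltxx// hornerE mul1r expR_gt0.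
Qed.

Lemma flat1_ge0 (x : R) : 0 <= flat 1 x.
Proof. by rewrite /flat; case: ifPn => // _; rewrite hornerE mul1r expR_ge0. Qed.

Lemma bump1_ge0 c e x : 0 <= bump1 c e x.
Proof. by rewrite mulr_ge0// flat1_ge0. Qed.

Lemma bump1_gt0 c e x : `|x - c| < e -> 0 < bump1 c e x.
Proof.
rewrite ltr_norml => /andP[h1 h2].
by rewrite mulr_gt0// flat1_gt0; lra.
Qed.

Lemma bump1_eq0 c e x : e <= `|x - c| -> bump1 c e x = 0.
Proof.
rewrite ler_normr => /orP[h|h]; rewrite /bump1 /flat.
  by rewrite [in X in X * _]ifF ?mul0r//; apply/negbTE; rewrite -leNgt; lra.
by rewrite [in X in _ * X]ifF ?mulr0//; apply/negbTE; rewrite -leNgt; lra.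
Qed.

Definition bump (c : R * (R * R)) (e : R) (t x y : R) :=
  bump1 c.1 e t * bump1 c.2.1 e x * bump1 c.2.2 e y.

Lemma Cn_bump1 n U (k e : R) f : open U -> Cn n U f ->
  Cn n U (fun t x y => bump1 k e (f t x y)).
Proof.
move=> oU hf.
have cf g : Cn n U g -> Cn n U (fun t x y => flat 1 (g t x y)).
  move=> hg; apply: (@Cn_comp _ n setT U (fun t _ _ => flat 1 t) g g g) => //.
  exact: Cn_flat.
exact: (Cn_mul oU (cf _ (Cn_sub oU (Cn_cst n U e) (Cn_sub oU hf (Cn_cst n U k))))
  (cf _ (Cn_add oU (Cn_cst n U e) (Cn_sub oU hf (Cn_cst n U k))))).
Qed.

Lemma Cn_bump n U c e : open U -> Cn n U (bump c e).
Proof.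
move=> oU; exact: (Cn_mul oU (Cn_mul oU (Cn_bump1 c.1 e oU (Cn_t n U))
  (Cn_bump1 c.2.1 e oU (Cn_x n U))) (Cn_bump1 c.2.2 e oU (Cn_y n U))).
Qed.

Lemma bump_smooth A c e : smooth_on A (bump c e).
Proof. by apply: Cn_smooth_on => n; apply: Cn_bump; exact: openT. Qed.

Lemma bump_ge0 c e t x y : 0 <= bump c e t x y.
Proof. by rewrite mulr_ge0 ?bump1_ge0// mulr_ge0 ?bump1_ge0. Qed.

Lemma bump_gt0 (c x : R * (R * R)) e : `|x.1 - c.1| < e ->
  `|x.2.1 - c.2.1| < e -> `|x.2.2 - c.2.2| < e -> 0 < unc (bump c e) x.
Proof.
by move=> h1 h2 h3; rewrite mulr_gt0 ?bump1_gt0// mulr_gt0 ?bump1_gt0.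
Qed.

Lemma bump_eq0 (c x : R * (R * R)) e : e <= `|x.1 - c.1| \/
  e <= `|x.2.1 - c.2.1| \/ e <= `|x.2.2 - c.2.2| -> unc (bump c e) x = 0.
Proof.
by rewrite /unc /bump => -[|[|]] /bump1_eq0 ->; rewrite !(mul0r, mulr0).
Qed.

Lemma compact_cbox (a1 b1 a2 b2 a3 b3 : R) : compact (cbox a1 b1 a2 b2 a3 b3).
Proof.
have -> : cbox a1 b1 a2 b2 a3 b3 =
   `[a1, b1]%classic `*` (`[a2, b2]%classic `*` `[a3, b3]%classic).
  apply/seteqP; split=> [[t [x y]]|[t [x y]]] /=; rewrite /cbox/= !in_itv/=.
    by move=> [].
  by move=> [? []].
by apply: compact_setX; [|apply: compact_setX]; exact: segment_compact.
Qed.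

Lemma bump_test_function (A : set (R * (R * R))) c e :
  (forall x, `|x.1 - c.1| <= e -> `|x.2.1 - c.2.1| <= e ->
     `|x.2.2 - c.2.2| <= e -> A x) ->
  test_function A (bump c e).
Proof.
move=> hA; split; first exact: bump_smooth.
exists (cbox (c.1 - e) (c.1 + e) (c.2.1 - e) (c.2.1 + e) (c.2.2 - e) (c.2.2 + e)).
split; first exact: compact_cbox.
  move=> x [h1 h2 h3]; apply: hA; rewrite ler_norml; apply/andP; split; lra.
move=> x nx; apply: bump_eq0.
have [|h1] := leP e `|x.1 - c.1|; first by left.
have [|h2] := leP e `|x.2.1 - c.2.1|; first by right; left.
have [|h3] := leP e `|x.2.2 - c.2.2|; first by right; right.
exfalso; apply: nx; move: h1 h2 h3; rewrite !ltr_norml.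
by move=> /andP[? ?] /andP[? ?] /andP[? ?]; split; apply/andP; split; lra.
Qed.

End bump.

(** * Gradients of convex functions and the Legendre transform *)

Section convex_plane.
Context {R : realType}.
Implicit Types (f : R * R -> R) (p q g v : R * R) (D : set (R * R)).

Lemma convex_functionP D f : convex_function (E := (R * R)%type) D f ->
  forall p p' (k : R), D p -> D p' -> 0 <= k <= 1 ->
  f (k *: p' + (1 - k) *: p) <= k * f p' + (1 - k) * f p.
Proof.
move=> cf p p' k Dp Dp' /andP[k0 k1].
pose t := @Itv01 R k k0 k1.
have := cf t p' p; rewrite !inE => /(_ Dp' Dp).
by [].
Qed.

Definition is_grad f p g :=
  differentiable f p /\ forall v, 'd f p v = dot v g.

Lemma is_grad_cvg f p g v : is_grad f p g ->
  (k^-1 * (f (k *: v + p) - f p)) @[k --> (0 : R)^'+] --> dot v g.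
Proof.
move=> [df dE]; rewrite -dE -deriveE//.
by apply: cvg_dnbhs_at_right; exact: (diff_derivable df).
Qed.

Lemma is_grad_le f p g v (c e : R) : is_grad f p g -> 0 < e ->
  (forall k, 0 < k < e -> f (k *: v + p) <= f p + k * c) -> dot v g <= c.
Proof.
move=> /(@is_grad_cvg _ _ _ v) h e0 H.
apply: (@ler_cvg_to _ _ _ _ _ _ _ _ h (cvg_cst c)).
near=> k; have k0 : 0 < k by near: k; exact: nbhs_right_gt.
have ke : k < e by near: k; exact: nbhs_right_lt.
rewrite mulrC ler_pdivrMr// lerBlDl mulrC; apply: H; exact/andP.
Unshelve. all: by end_near. Qed.

Lemma is_grad_ge f p g v (c e : R) : is_grad f p g -> 0 < e ->
  (forall k, 0 < k < e -> f p + k * c <= f (k *: v + p)) -> c <= dot v g.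
Proof.
move=> /(@is_grad_cvg _ _ _ v) h e0 H.
apply: (@ler_cvg_to _ _ _ _ _ _ _ _ (cvg_cst c) h).
near=> k; have k0 : 0 < k by near: k; exact: nbhs_right_gt.
have ke : k < e by near: k; exact: nbhs_right_lt.
rewrite [X in _ <= X]mulrC ler_pdivlMr// lerBrDl [c * k]mulrC; apply: H; exact/andP.
Unshelve. all: by end_near. Qed.

(** A differentiable convex function lies above its tangent planes, also at
    boundary points of its domain. *)
Lemma convex_subgradient D f p g : convex_function (E := (R * R)%type) D f ->
  D p -> is_grad f p g -> forall p', D p' -> f p + dot (p' - p) g <= f p'.
Proof.
move=> cf Dp fg p' Dp'; rewrite -lerBrDl.
apply: (is_grad_le fg ltr01) => k /andP[k0 k1].
have k01 : 0 <= k <= 1 by rewrite !ltW.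
have := convex_functionP cf Dp Dp' k01.
have -> : k *: (p' - p) + p = k *: p' + (1 - k) *: p.
  by rewrite scalerBr scalerBl scale1r -addrA [- _ + _]addrC.
by move=> h; apply: (le_trans h); lra.
Qed.

Lemma dot_inj (g g' : R * R) : (forall v, dot v g <= dot v g') -> g = g'.
Proof.
case: g g' => a b [a' b'] h.
have := h (1, 0); have := h (-1, 0); have := h (0, 1); have := h (0, -1).
rewrite /dot/= => h1 h2 h3 h4; congr pair; lra.
Qed.

(** At an interior minimum of f - <., q> the gradient of f is q. *)
Lemma is_grad_min f p g q (e : R) : is_grad f p g -> 0 < e ->
  (forall p', `|p' - p| < e -> f p - dot p q <= f p' - dot p' q) -> g = q.
Proof.
move=> fg e0 H; apply/esym/dot_inj => v.
have d0 : 0 < e / (`|v| + 1) by rewrite divr_gt0// ltr_wpDl.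
apply: (is_grad_ge fg d0) => k /andP[k0 ke].
have : `|(k *: v + p) - p| < e.
  rewrite addrK normrZ gtr0_norm//; move: ke; rewrite ltr_pdivlMr ?ltr_wpDl//.
  by apply: le_lt_trans; rewrite ler_wpM2l ?ltW// ltrDl.
move=> /H; rewrite /dot/= /GRing.scale/=; lra.
Qed.

Lemma is_grad_uniq f p g g' : is_grad f p g -> is_grad f p g' -> g = g'.
Proof.
by move=> [_ h] [_ h']; apply: dot_inj => v; rewrite -h -h'.
Qed.

(** For a partial function of two variables, differentiability makes sense of
    the gradient made of partial derivatives. *)
Lemma is_grad_diff (F : R -> R -> R -> R) t p :
  differentiable (fun p => F t p.1 p.2) p ->
  is_grad (fun p => F t p.1 p.2) p (grad F t p.1 p.2).
Proof.
move=> dF; split => // v.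
have vE : v = v.1 *: (1, 0) + v.2 *: (0, 1) :> R * R.
  by case: v => a b/=; congr pair; rewrite /GRing.scale/= /GRing.scale/=; ring.
have E1 : 'D_(1, 0) (fun p => F t p.1 p.2) p = D1 F t p.1 p.2.
  rewrite /D1 derive1E /derive; congr (lim _).
  apply: (congr1 (fun G => G @ (0:R)^')); apply/funext => k /=.
  by rewrite /GRing.scale/= mulr0 add0r.
have E2 : 'D_(0, 1) (fun p => F t p.1 p.2) p = D2 F t p.1 p.2.
  rewrite /D2 derive1E /derive; congr (lim _).
  apply: (congr1 (fun G => G @ (0:R)^')); apply/funext => k /=.
  by rewrite /GRing.scale/= mulr0 add0r.
by rewrite {1}vE linearD !linearZ -!deriveE// E1 E2.
Qed.

Lemma is_grad_slice (F : R -> R -> R -> R) t p :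
  differentiable (unc F) (t, p) ->
  is_grad (fun p => F t p.1 p.2) p (grad F t p.1 p.2).
Proof.
move=> dF; apply: is_grad_diff.
exact: (@differentiable_comp _ _ _ _ (fun p : R * R => (t, p)) (unc F)).
Qed.

End convex_plane.
Section growth.
Context {R : realType}.
Implicit Types (f : R * R -> R) (p q v : R * R) (D : set (R * R)).

Lemma normr_prodE p : `|p| = Num.max `|p.1| `|p.2|.
Proof. by []. Qed.

Lemma dot_le v q : `|dot v q| <= 2 * `|v| * `|q|.
Proof.
have h1 : `|v.1| <= `|v| by rewrite normr_prodE le_max lexx.
have h2 : `|v.2| <= `|v| by rewrite normr_prodE le_max lexx orbT.
have h3 : `|q.1| <= `|q| by rewrite (normr_prodE q) le_max lexx.
have h4 : `|q.2| <= `|q| by rewrite (normr_prodE q) le_max lexx orbT.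
rewrite (le_trans (ler_normD _ _))// !normrM -mulrA mulr_natl mulr2n.
by rewrite lerD// ler_pM.
Qed.

Lemma dotBl p p' q : dot (p - p') q = dot p q - dot p' q.
Proof. by rewrite /dot/=; ring. Qed.

Lemma dotBr v q q' : dot v (q - q') = dot v q - dot v q'.
Proof. by rewrite /dot/=; ring. Qed.

Lemma dotZl (k : R) v q : dot (k *: v) q = k * dot v q.
Proof. by rewrite /dot/= /GRing.scale/=; ring. Qed.

Definition dotr q v := dot v q.

Lemma dotr_linear q : linear (dotr q).
Proof.
by move=> k a b; rewrite /dotr /dot/= /GRing.scale/= /GRing.scale/=; ring.
Qed.

HB.instance Definition _ q := GRing.isLinear.Build R (R * R)%type R _ (dotr q)
  (dotr_linear q).

Lemma continuous_dotr q : continuous (dotr q).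
Proof.
apply: continuous_add; apply: continuous_mul; try by move=> ?; exact: cvg_cst.
  exact: continuous_fst.
exact: continuous_snd.
Qed.

Definition cball p (e : R) : set (R * R) := [set p' | `|p' - p| <= e].
Definition sphere p (e : R) : set (R * R) := [set p' | `|p' - p| = e].

Lemma compact_cball p e : compact (cball p e).
Proof.
have -> : cball p e =
   `[p.1 - e, p.1 + e]%classic `*` `[p.2 - e, p.2 + e]%classic.
  apply/seteqP; split=> [[a b]|[a b]] /=; rewrite /cball/= !in_itv/= normr_prodE/=
    ge_max !ler_norml.
    by move=> /andP[/andP[? ?] /andP[? ?]]; split; apply/andP; split; lra.
  by move=> [/andP[? ?] /andP[? ?]]; apply/andP; split; apply/andP; split; lra.
by apply: compact_setX; exact: segment_compact.
Qed.

Lemma compact_sphere p e : compact (sphere p e).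
Proof.
have -> : sphere p e = cball p e `&` sphere p e.
  by apply/seteqP; split => [x|x []//]; rewrite /cball/sphere/= => h; split; rewrite ?h.
apply: compact_closedI; first exact: compact_cball.
have -> : sphere p e = (fun p' => `|p' - p|) @^-1` [set e] by [].
apply: closed_comp => [x _|]; last exact: closed_eq.
apply: cvg_norm; apply: cvgB => //; exact: cvg_cst.
Qed.

Lemma sphere_neq0 p e : 0 <= e -> sphere p e !=set0.
Proof.
move=> e0; exists (p.1 + e, p.2); rewrite /sphere/= normr_prodE/=.
by rewrite addrC addKr subrr normr0 ger0_norm// max_l.
Qed.

Lemma is_grad_of_linear f p q :
  (forall e, 0 < e -> \forall h \near (0 : R * R),
     `|f (h + p) - f p - dotr q h| <= e * `|h|) -> is_grad f p q.
Proof.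
by move=> H; have [df dE] := diff_epsP (@continuous_dotr q) H; split => // v; rewrite dE.
Qed.

Variables (D : set (R * R)) (f : R * R -> R).
Hypothesis cf : convex_function (E := (R * R)%type) D f.

(** A convex function lying strictly above an affine one on a sphere outgrows it
    linearly outside. *)
Lemma convex_growth p q e : D p -> 0 < e -> cball p e `<=` D ->
  {within cball p e, continuous f} ->
  (forall p', sphere p e p' -> f p + dot (p' - p) q < f p') ->
  exists2 d : R, 0 < d & forall p', D p' -> e <= `|p' - p| ->
    f p + dot (p' - p) q + d * `|p' - p| <= f p'.
Proof.
move=> Dp e0 BD cfB pos.
pose h p' := f p' - (f p + dot (p' - p) q).
have ch : {within sphere p e, continuous h}.
  have sub : sphere p e `<=` cball p e by move=> x; rewrite /cball/sphere/= => ->.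
  have := continuous_subspaceW sub cfB.
  move=> cfS x; apply: cvgB; first exact: cfS.
  have : continuous (fun p' => f p + dot (p' - p) q).
    apply: continuous_add; first by move=> ?; exact: cvg_cst.
    apply: (continuous_compo (g := dotr q)); last exact: continuous_dotr.
    by move=> y; apply: cvgB => //; exact: cvg_cst.
  by move=> /continuous_subspaceT; apply.
have [c] := compact_EVT_min (sphere_neq0 p (ltW e0)) (@compact_sphere p e) ch.
rewrite inE => Sc cmin.
have d0 : 0 < h c by rewrite /h subr_gt0; exact: pos.
exists (h c / e); first by rewrite divr_gt0.
move=> p' Dp' ep'.
have r0 : 0 < `|p' - p| by apply: lt_le_trans ep'.
pose k := e / `|p' - p|.
have k0 : 0 < k by rewrite divr_gt0.
have k1 : k <= 1 by rewrite ler_pdivrMr// mul1r.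
have k01 : 0 <= k <= 1 by rewrite ltW.
have := convex_functionP cf Dp Dp' k01.
set pk := _ + _.
have pkE : pk - p = k *: (p' - p).
  by rewrite /pk scalerBr scalerBl scale1r; rewrite addrA addrAC addrK.
have Spk : sphere p e pk.
  by rewrite /sphere/= pkE normrZ gtr0_norm// /k divfK// gt_eqF.
have := cmin pk; rewrite inE => /(_ Spk).
rewrite {2}/h pkE dotZl => h1 h2.
have h3 : h c <= k * (f p' - f p - dot (p' - p) q) by lra.
have : h c / k <= f p' - f p - dot (p' - p) q by rewrite ler_pdivrMr// mulrC.
rewrite /k invf_div mulrA => h4.
have -> : h c / e * `|p' - p| = h c * `|p' - p| / e by rewrite mulrAC.
lra.
Qed.

Lemma subgradient_strict p q e (G : R * R -> R * R) : 0 < e ->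
  cball p e `<=` D ->
  (forall p', cball p e p' -> is_grad f p' (G p')) -> G p = q ->
  (forall p', cball p e p' -> G p' = q -> p' = p) ->
  forall p', sphere p e p' -> f p + dot (p' - p) q < f p'.
Proof.
move=> e0 BD dG Gp uniq p' Sp'; rewrite ltNge; apply/negP => hp'.
have Bp : cball p e p by rewrite /cball/= subrr normr0 ltW.
have Bp' : cball p e p' by rewrite /cball/= Sp'.
have sub := convex_subgradient cf (BD _ Bp) (dG _ Bp).
have k01 : 0 <= (2^-1 : R) <= 1 by apply/andP; split; lra.
have := convex_functionP cf (BD _ Bp) (BD _ Bp') k01.
set m := _ + _ => hm.
have mE : m - p = 2^-1 *: (p' - p).
  by rewrite /m scalerBr scalerBl scale1r; rewrite addrA addrAC addrK.
have nm : `|m - p| = e / 2.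
  by rewrite mE normrZ Sp' gtr0_norm ?invr_gt0// mulrC.
have Bm : cball p e m by rewrite /cball/= nm; lra.
have e20 : 0 < e / 2 by rewrite divr_gt0.
have Gm : G m = q.
  apply: (is_grad_min (dG _ Bm) e20) => x hx.
  have Bx : cball p e x.
    rewrite /cball/= (_ : x - p = (x - m) + (m - p)); last by rewrite addrA subrK.
    rewrite (le_trans (ler_normD _ _))// nm; lra.
  have h1 := sub _ (BD _ Bx).
  have h2 : dot (m - p) q = 2^-1 * dot (p' - p) q by rewrite mE dotZl.
  move: h1 h2 hp' hm; rewrite Gp !dotBl; lra.
have := uniq _ Bm Gm => mp.
by move: nm; rewrite mp subrr normr0; lra.
Qed.

(** If the gradient of f takes the value q at the interior point p only, then
    every value near q is taken near p: minimize f - <., q'>. *)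
Lemma gradient_open p q e (G : R * R -> R * R) : 0 < e ->
  cball p e `<=` D ->
  (forall p', cball p e p' -> is_grad f p' (G p')) -> G p = q ->
  (forall p', cball p e p' -> G p' = q -> p' = p) ->
  \forall q' \near q, exists2 p', `|p' - p| < e & G p' = q'.
Proof.
move=> e0 BD dG Gp uniq.
have pos := subgradient_strict e0 BD dG Gp uniq.
have Bp : cball p e p by rewrite /cball/= subrr normr0 ltW.
have cfB : {within cball p e, continuous f}.
  apply: continuous_in_subspaceT => x /set_mem Bx.
  exact: (differentiable_continuous (dG _ Bx).1).
have [d d0 grow] := convex_growth (BD _ Bp) e0 BD cfB pos.
have d20 : 0 < d / 2 by rewrite divr_gt0.
apply/nbhs_ballP; exists (d / 2) => // q'; rewrite -ball_normE/= => hq.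
pose h p' := f p' - dot p' q'.
have ch : {within cball p e, continuous h}.
  move=> x; apply: cvgB; first exact: cfB.
  by have /continuous_subspaceT := @continuous_dotr q'; apply.
have [|c] := compact_EVT_min _ (@compact_cball p e) ch; first by exists p.
rewrite inE => Bc cmin.
have hc : `|c - p| < e.
  rewrite lt_neqAle Bc andbT; apply/eqP => Sc.
  have := grow c (BD _ Bc); rewrite Sc lexx => /(_ isT) h1.
  have := cmin p; rewrite inE => /(_ Bp); rewrite /h => h2.
  have h3 := dot_le (c - p) (q - q').
  move: h3; rewrite Sc dotBr !dotBl ler_norml => /andP[h4 _].
  have h5 : 2 * e * `|q - q'| < d * e by nra.
  by move: h1; rewrite dotBl; lra.
exists c => //.
have e10 : 0 < e - `|c - p| by rewrite subr_gt0.
apply: (is_grad_min (dG _ Bc) e10) => x hx.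
have := cmin x; rewrite inE; apply.
rewrite /cball/= (_ : x - p = (x - c) + (c - p)); last by rewrite addrA subrK.
by rewrite (le_trans (ler_normD _ _))//; lra.
Qed.

(** A strict maximizer p of <., q> - f, in the above quantitative sense, is the
    gradient at q of the Legendre transform. *)
Lemma legendre_is_grad p q e (G : R * R -> R * R) : 0 < e ->
  cball p e `<=` D ->
  (forall p', cball p e p' -> is_grad f p' (G p')) -> G p = q ->
  (forall p', cball p e p' -> G p' = q -> p' = p) ->
  is_grad (legendre D f) q p.
Proof.
move=> e0 BD dG Gp uniq.
have Bp : cball p e p by rewrite /cball/= subrr normr0 ltW.
have Dp := BD _ Bp.
have sub := convex_subgradient cf Dp (dG _ Bp).
have bnd e1 : 0 < e1 <= e -> exists2 d : R, 0 < d & forall w, `|w| <= d / 2 ->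
    dot p (q + w) - f p <= legendre D f (q + w) <=
    dot p (q + w) - f p + 2 * e1 * `|w|.
  move=> /andP[e10 e1e].
  have sub1 : cball p e1 `<=` cball p e by move=> x; rewrite /cball/= => /le_trans; apply.
  have BD1 : cball p e1 `<=` D by move=> x /sub1/BD.
  have dG1 x : cball p e1 x -> is_grad f x (G x) by move=> /sub1/dG.
  have uniq1 x : cball p e1 x -> G x = q -> x = p by move=> /sub1/uniq.
  have pos := subgradient_strict e10 BD1 dG1 Gp uniq1.
  have cfB : {within cball p e1, continuous f}.
    apply: continuous_in_subspaceT => x /set_mem Bx.
    exact: (differentiable_continuous (dG1 _ Bx).1).
  have [d d0 grow] := convex_growth Dp e10 BD1 cfB pos.
  exists d => // w hw.
  have ub x : D x -> dot x (q + w) - f x <= dot p (q + w) - f p + 2 * e1 * `|w|.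
    move=> Dx.
    have h1 := dot_le (x - p) w.
    have h2 : dot (x - p) w = dot x (q + w) - dot p (q + w) - dot (x - p) q.
      by rewrite /dot/=; ring.
    move: h1; rewrite ler_norml => /andP[_ h1].
    have w0 := normr_ge0 w.
    have [ex|xe] := leP e1 `|x - p|.
      have := grow _ Dx ex => h3.
      have h4 : 2 * `|x - p| * `|w| <= d * `|x - p| by nra.
      have h5 : 0 <= 2 * e1 * `|w| by rewrite !mulr_ge0// ltW.
      by lra.
    have := sub _ Dx; rewrite Gp => h3.
    have h4 : 2 * `|x - p| * `|w| <= 2 * e1 * `|w| by nra.
    by lra.
  have hs : has_sup [set dot x (q + w) - f x | x in D].
    split; first by exists (dot p (q + w) - f p); exists p.
    by exists (dot p (q + w) - f p + 2 * e1 * `|w|) => _ [x Dx <-]; exact: ub.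
  apply/andP; split.
    by apply: (sup_upper_bound hs); exists p.
  apply: sup_le_ub; first by case: hs.
  by move=> _ [x Dx <-]; exact: ub.
have hq : legendre D f q = dot p q - f p.
  have ee : 0 < e <= e by rewrite e0 lexx.
  have [d d0 hd] := bnd e ee; have := hd 0.
  rewrite normr0 mulr0 !addr0 => h; apply/eqP; rewrite eq_le andbC.
  by apply: h; rewrite divr_ge0// ltW.
apply: is_grad_of_linear => c c0.
pose e1 := Num.min e (c / 2).
have e1e : 0 < e1 <= e by rewrite /e1 lt_min e0 divr_gt0//= ge_min lexx.
have e1c : e1 <= c / 2 by rewrite /e1 ge_min lexx orbT.
have [d d0 hd] := bnd e1 e1e.
have d20 : 0 < d / 2 by rewrite divr_gt0.
have := @pseudometric_normed_Zmodule.nbhs0_le R (R * R)%type _ d20.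
apply: filterS => w hw.
have /andP[h1 h2] := hd w hw.
rewrite [w + q]addrC hq /dotr.
have h3 : dot p (q + w) = dot p q + dot w p by rewrite /dot/=; ring.
have w0 := normr_ge0 w.
have h4 : 2 * e1 * `|w| <= c * `|w| by rewrite ler_wpM2r//; lra.
by rewrite ler_norml; apply/andP; split; lra.
Qed.

End growth.
Section duality.
Context {R : realType}.
Implicit Types (p q v : R * R).
Variables (D : set (R * R)) (f Psi : R * R -> R) (G : R * R -> R * R) (M : R).
Hypothesis cf : convex_function (E := (R * R)%type) D f.
Hypothesis cPsi : convex_function (E := (R * R)%type) setT Psi.
Hypothesis D0 : D !=set0.
Hypothesis DM : forall p, D p -> `|p| <= M.
Hypothesis fG : forall p, D p -> is_grad f p (G p).
Hypothesis PsiE : forall q, Psi q = legendre D f q.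
Hypothesis fE : forall p, D p -> f p = legendre setT Psi p.

Lemma has_sup_legendre q : has_sup [set dot p q - f p | p in D].
Proof.
have [p0 Dp0] := D0; split; first by exists (dot p0 q - f p0); exists p0.
exists (2 * M * `|q - G p0| - f p0 + dot p0 (G p0)) => _ [p Dp <-].
have h1 := convex_subgradient cf Dp0 (fG Dp0) Dp.
have := dot_le p (q - G p0); rewrite ler_norml => /andP[_ h2].
have h3 : 2 * `|p| * `|q - G p0| <= 2 * M * `|q - G p0|.
  by rewrite ler_wpM2r// ler_wpM2l//; exact: DM.
by move: h1 h2; rewrite dotBl dotBr; lra.
Qed.

Lemma fenchel_young p q : D p -> dot p q - f p <= Psi q.
Proof.
by move=> Dp; rewrite PsiE; apply: (sup_upper_bound (has_sup_legendre q)); exists p.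
Qed.

Lemma fenchel_eq p q : is_grad Psi q p -> D p -> f p = dot p q - Psi q.
Proof.
move=> gP Dp; apply/eqP; rewrite eq_le; apply/andP; split; last first.
  by have := fenchel_young q Dp; lra.
rewrite fE//; apply: sup_le_ub.
  by exists (dot p q - Psi q), q => //; rewrite /dot; ring.
move=> _ [q' _ <-]; have := convex_subgradient cPsi I gP (p' := q') I.
rewrite dotBl; rewrite /dot/=; lra.
Qed.

Lemma legendre_subgradient p q : is_grad Psi q p -> D p ->
  forall p', D p' -> f p + dot (p' - p) q <= f p'.
Proof.
move=> gP Dp p' Dp'; have := fenchel_young q Dp'.
by rewrite (fenchel_eq gP Dp) dotBl; lra.
Qed.

Lemma subgradient_legendre p q g : D p ->
  (forall p', D p' -> f p + dot (p' - p) q <= f p') -> is_grad Psi q g -> g = p.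
Proof.
move=> Dp sub gP.
have Eq : Psi q = dot p q - f p.
  apply/eqP; rewrite eq_le fenchel_young// andbT PsiE.
  apply: sup_le_ub; first by exists (dot p q - f p), p.
  by move=> _ [p' Dp' <-]; have := sub _ Dp'; rewrite dotBl; lra.
apply: (is_grad_min gP ltr01) => q' _.
have := fenchel_young q' Dp; rewrite Eq /dot; lra.
Qed.

(** A gradient q of P at p makes p a subgradient of Psi at q, hence its gradient
    where Psi is differentiable. *)
Lemma grad_legendreK p q g : D p -> G p = q -> is_grad Psi q g -> g = p.
Proof.
move=> Dp <-; apply: subgradient_legendre => // p' Dp'.
exact: (convex_subgradient cf Dp (fG Dp) Dp').
Qed.

Lemma normr_dual v (k : R) : 0 <= k -> exists2 w : R * R, `|w| <= k & dot v w = `|v| * k.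
Proof.
move=> k0; rewrite normr_prodE.
have sgk (x : R) : `|Num.sg x * k| <= k.
  rewrite normrM normr_sg; case: eqP => _; first by rewrite mul0r.
  by rewrite mul1r ger0_norm.
have [h|h] := leP `|v.2| `|v.1|.
  exists (Num.sg v.1 * k, 0); first by rewrite normr_prodE/= ge_max normr0 k0 sgk.
  by rewrite /dot/= mulr0 addr0 mulrA [v.1 * _]mulrC -normrEsg.
exists (0, Num.sg v.2 * k); first by rewrite normr_prodE/= ge_max normr0 k0 sgk.
by rewrite /dot/= mulr0 add0r mulrA [v.2 * _]mulrC -normrEsg.
Qed.

(** Points far from the gradient p of Psi at q do not compete in the supremum
    defining Psi near q. *)
Lemma legendre_localize p q (d : R) : is_grad Psi q p -> D p -> 0 < d ->
  exists2 s : R, 0 < s & forall q' p', `|q' - q| < s -> D p' -> d <= `|p' - p| ->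
    dot p' q' - f p' <= Psi q' - s.
Proof.
move=> gP Dp d0.
have M0 : 0 <= M by apply: le_trans (DM Dp).
have d40 : 0 < d / 4 by rewrite divr_gt0.
have [k k0 hk] : exists2 k : R, 0 < k & forall w, `|w| <= k ->
    Psi (q + w) <= Psi q + dot w p + d / 4 * `|w|.
  have [dP dE] := gP.
  have /eqaddoP/(_ _ d40) := diff_locally dP.
  move=> /nbhs_normP[k /= k0 hk]; exists (k / 2); first by rewrite divr_gt0.
  move=> w wk.
  have := hk w; rewrite /= sub0r normrN => /(_ _).
  have wk' : `|w| < k by apply: le_lt_trans wk _; rewrite ltr_pdivrMr//; lra.
  move=> /(_ wk'); rewrite !fctE/= dE ler_norml [w + q]addrC => /andP[_].
  rewrite /cst; lra.
have big p' : D p' -> d <= `|p' - p| ->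
    dot p' q - f p' <= Psi q - k * (3 / 4 * d).
  move=> Dp' dp'; have [w wk wE] := normr_dual (p' - p) (ltW k0).
  have h1 := hk _ wk; have h2 := fenchel_young (q + w) Dp'.
  have h3 : dot p' (q + w) = dot p' q + dot p' w by rewrite /dot/=; ring.
  have h4 : dot w p = dot p w by rewrite /dot; ring.
  have h5 : d * k <= `|p' - p| * k by rewrite ler_wpM2r// ltW.
  have h6 : d / 4 * `|w| <= d / 4 * k by rewrite ler_wpM2l// ltW.
  by move: wE h2; rewrite dotBl h3; lra.
have kd0 : 0 < k * (3 / 4 * d) by rewrite !mulr_gt0.
pose s := k * (3 / 4 * d) / (4 * M + 1).
have s0 : 0 < s by rewrite divr_gt0//; lra.
have sE : s * (4 * M + 1) = k * (3 / 4 * d) by rewrite /s divfK//; lra.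
exists s => // q' p' hq Dp' dp'.
have h1 := big _ Dp' dp'.
have h2 := fenchel_young q' Dp.
have h3 := fenchel_eq gP Dp.
have h4 := dot_le p' (q' - q); have h5 := dot_le p (q' - q).
have h6 (x : R * R) : D x -> 2 * `|x| * `|q' - q| <= 2 * M * s.
  by move=> Dx; rewrite ler_pM ?mulr_ge0 ?ler_wpM2l ?DM// ltW.
have h7 := h6 _ Dp'; have h8 := h6 _ Dp.
move: h4 h5; rewrite !dotBr !ler_norml => /andP[_ h4] /andP[h5 _].
by move: sE; rewrite mulrDr mulr1; lra.
Qed.

(** Where the supremum defining Psi is attained on a face of D, away from the
    gradient of f there, Psi is affine in the direction normal to the face. *)
Lemma legendre_flat p q (nu : R * R) (c : R) (pr : R * R -> R * R) :
  is_grad Psi q p -> D p ->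
  (forall x, D x -> [/\ D (pr x), dot (pr x) nu = c, `|pr x - p| <= `|x - p| &
     exists2 k : R, 0 <= k & x - pr x = k *: nu]) ->
  {for p, continuous (fun x => dot nu (G x))} ->
  dot nu q < dot nu (G p) ->
  exists2 r : R, 0 < r & forall q' k, `|q' - q| < r -> `|q' + k *: nu - q| < r ->
    Psi (q' + k *: nu) = Psi q' + k * c.
Proof.
move=> gP Dp prD cG qG.
pose e := (dot nu (G p) - dot nu q) / 2.
have e0 : 0 < e by rewrite divr_gt0// subr_gt0.
have /cvgrPdist_lt/(_ _ e0) /nbhs_normP[d /= d0 hd] := cG.
have [s s0 loc] := legendre_localize gP Dp d0.
have nu0 : 0 < 2 * `|nu| + 1 by rewrite ltr_wpDl// mulr_ge0.
pose r := Num.min s (e / (2 * `|nu| + 1)).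
have r0 : 0 < r by rewrite /r lt_min s0 divr_gt0.
have main q' x : `|q' - q| < r -> D x ->
    dot x q' - f x <= Psi q' - s \/ dot x q' - f x <= dot (pr x) q' - f (pr x).
  rewrite /r lt_min => /andP[hs he] Dx.
  have [Dpr prc prp [k k0 xE]] := prD _ Dx.
  have [dx|xd] := leP d `|x - p|; first by left; exact: loc.
  right.
  have h1 : `|dot nu (G p) - dot nu (G (pr x))| < e.
    by apply: hd; rewrite /= distrC; exact: le_lt_trans xd.
  have h2 := dot_le nu (q' - q).
  have h3 : 2 * `|nu| * `|q' - q| <= e.
    move: he; rewrite ltr_pdivlMr// => he.
    by have := normr_ge0 (q' - q); have := normr_ge0 nu; nra.
  have h4 : dot nu q' <= dot nu (G (pr x)).
    move: h1 h2; rewrite dotBr ltr_norml ler_norml => /andP[_ h1] /andP[_ h2].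
    by rewrite /e in h1 h3; lra.
  have h5 := convex_subgradient cf Dpr (fG Dpr) Dx.
  have h6 : dot x q' = dot (pr x) q' + k * dot nu q'.
    by rewrite -dotZl -xE dotBl; ring.
  move: h5; rewrite xE dotZl => h5.
  by have : k * dot nu q' <= k * dot nu (G (pr x)); [rewrite ler_wpM2l|lra].
have half q' k : `|q' - q| < r -> `|q' + k *: nu - q| < r ->
    Psi (q' + k *: nu) <= Psi q' + k * c.
  move=> h1 h2.
  have : Psi (q' + k *: nu) <= Num.max (Psi (q' + k *: nu) - s) (Psi q' + k * c).
    rewrite {1}PsiE; apply: sup_le_ub; first by case: (has_sup_legendre (q' + k *: nu)).
    move=> _ [x Dx <-]; rewrite le_max.
    case: (main _ _ h2 Dx) => [->//|h]; apply/orP; right.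
    have [Dpr prc _ _] := prD _ Dx.
    apply: (le_trans h); have := fenchel_young q' Dpr.
    have : dot (pr x) (q' + k *: nu) = dot (pr x) q' + k * c.
      by rewrite -prc /dot/= /GRing.scale/=; ring.
    by lra.
  by rewrite le_max => /orP[|//]; lra.
exists r => // q' k h1 h2; apply/eqP; rewrite eq_le half//=.
have E : q' = (q' + k *: nu) + (- k) *: nu by rewrite scaleNr addrK.
have := half (q' + k *: nu) (- k) h2; rewrite -E => /(_ h1); lra.
Qed.

End duality.

(** * Images of weighted measures *)

Section weighted_pushforward.
Context d1 d2 (X : measurableType d1) (Y : measurableType d2) (R : realType).
Variables (mu : {measure set X -> \bar R}) (nu : {measure set Y -> \bar R}).
Variables (D : set X) (phi : X -> Y) (w : X -> R).
Hypothesis mD : measurable D.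
Hypothesis mphi : measurable_fun D phi.
Hypothesis mw : measurable_fun D w.
Hypothesis w0 : forall x, D x -> 0 <= w x.
Hypothesis nuE : forall A, measurable A ->
  (nu A = \int[mu]_(x in D `&` phi @^-1` A) (w x)%:E)%E.

Local Open Scope ereal_scope.
Import HBNNSimple.

Lemma ge0_integral_weighted_pushforward (F : Y -> \bar R) :
  measurable_fun setT F -> (forall y, 0 <= F y) ->
  \int[nu]_y F y = \int[mu]_(x in D) (F (phi x) * (w x)%:E).
Proof.
move=> mF F0; pose h := nnsfun_approx measurableT mF.
have hF y : (h n y)%:E @[n --> \oo] --> F y by apply: cvg_nnsfun_approx.
have mpre A : measurable A -> measurable (D `&` phi @^-1` A) by move=> mA; exact: mphi.
have mhphi n : measurable_fun D (fun x => (h n (phi x))%:E * (w x)%:E).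
  apply: emeasurable_funM; last exact/measurable_EFinP.
  by apply/measurable_EFinP; apply: (measurableT_comp _ mphi).
have -> : \int[nu]_y F y = limn (fun n => \int[nu]_y (h n y)%:E).
  rewrite -monotone_convergence//.
  - by apply: eq_integral => y _; apply/esym/cvg_lim.
  - by move=> n; exact/measurable_EFinP.
  - by move=> n y _; rewrite lee_fin.
  - by move=> y _ m n mn; rewrite lee_fin; exact/lefP/nd_nnsfun_approx.
have -> : \int[mu]_(x in D) (F (phi x) * (w x)%:E) =
    limn (fun n => \int[mu]_(x in D) ((h n (phi x))%:E * (w x)%:E)).
  rewrite -monotone_convergence//.
  - apply: eq_integral => x _; apply/esym/cvg_lim => //.
    by apply: cvgeZr => //; exact: hF.
  - by move=> n x Dx; rewrite mule_ge0// lee_fin// w0.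
  - move=> x Dx m n mn; apply: lee_wpmul2r; first by rewrite lee_fin w0.
    by rewrite lee_fin; exact/lefP/nd_nnsfun_approx.
congr (limn _); apply/funext => n.
rewrite integralT_nnsfun sintegralE.
transitivity (\int[mu]_(x in D) (\sum_(r \in range (h n))
    ((r * \1_(h n @^-1` [set r]) (phi x))%:E * (w x)%:E))); last first.
  apply: eq_integral => x _; rewrite [in RHS](fimfunE (h n) (phi x)).
  by rewrite -fsumEFin// ge0_mule_fsuml// => r; exact: nnfun_muleindic_ge0.
rewrite ge0_integral_fsum//; last 2 first.
- move=> r; apply: emeasurable_funM; last exact/measurable_EFinP.
  apply/measurable_EFinP.
  by apply: measurable_funM => //; apply: (measurableT_comp _ mphi).
- move=> r x Dx; rewrite mule_ge0 ?lee_fin ?w0//.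
  by have := nnfun_muleindic_ge0 (h n) r (phi x).
apply: eq_fsbigr => r _.
have mr : measurable (h n @^-1` [set r]) by [].
have [r0|r0] := ltP r 0%R.
  rewrite preimage_nnfun0// measure0 mule0 -[LHS](integral0 mu D).
  by apply: eq_integral => x _; rewrite indic0 mulr0 mul0e.
rewrite nuE// -ge0_integralZl//; last 3 first.
- exact: mpre.
- by apply: (measurable_funS mD) => //; exact/measurable_EFinP.
- by move=> x [Dx _]; rewrite lee_fin w0.
rewrite [in LHS]setIC integral_mkcondl; apply: eq_integral => x xD.
rewrite patchE indicE; case: ifPn => [h1|/negbTE h1].
  by rewrite (_ : _ \in _ = true) ?mulr1// inE; rewrite inE in h1.
by rewrite (_ : _ \in _ = false) ?mulr0 ?mul0e// -h1.
Qed.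

Lemma integral_weighted_pushforward (F : Y -> R) : measurable_fun setT F ->
  \int[nu]_y (F y)%:E = \int[mu]_(x in D) (F (phi x) * w x)%:E.
Proof.
move=> mF; rewrite integralE [RHS]integralE.
have mE : measurable_fun setT (EFin \o F) by exact/measurable_EFinP.
rewrite !ge0_integral_weighted_pushforward//; last 2 first.
- exact: measurable_funeneg.
- exact: measurable_funepos.
congr (_ - _); apply: eq_integral => x; rewrite inE => Dx.
- rewrite !funeposE -!EFin_max -EFinM; congr EFin.
  by rewrite maxr_pMl ?w0// mul0r.
- rewrite !funenegE -!EFinN -!EFin_max -EFinM; congr EFin.
  by rewrite maxr_pMl ?w0// mul0r mulNr.
Qed.
End weighted_pushforward.

(** * Integrals over the region below a graph *)

Section region.
Context {R : realType}.
Local Notation mu := (@lebesgue_measure R).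

Lemma continuous_within_comp (T U V : topologicalType) (A : set U) (f : U -> V)
    (c : T -> U) : {within A, continuous f} -> continuous c ->
  (forall y, A (c y)) -> continuous (fun x => f (c x)).
Proof.
move=> /subspace_continuousP cf cc cA x.
apply: (@cvg_comp _ _ _ c f (nbhs x) (within A (nbhs (c x)))); last exact: cf.
move=> B wB.
exact: (@filterS _ (nbhs x) _ (c @^-1` (fun y => A y -> B y))
  (c @^-1` B) (fun y h => h (cA y)) (cc x _ wB)).
Qed.

Lemma int_affine (a b : R) (f : R -> R) : a <= b -> continuous f ->
  itg a b f = itg 0 1 (fun l => (b - a) * f (a + l * (b - a))).
Proof.
rewrite le_eqVlt => /predU1P[->|ab] cf.
  rewrite subrr (@eq_int _ 0 1 _ (fun=> 0)); last by move=> x _; rewrite mul0r.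
  rewrite int_cst ?ler01// mul0r; apply/eqP; rewrite -normr_le0.
  have := le_norm_int (M := `|f b|) (lexx b) cf; rewrite subrr mulr0; apply.
  by move=> x; rewrite -eq_le => /eqP ->.
pose F (l : R) := a + l * (b - a).
have dF (x : R) : is_derive x 1 F (b - a).
  rewrite /F; apply: is_derive_eq.
  by rewrite !add0r /GRing.scale/=; ring.
have F' : derive1 F = fun=> b - a by apply/funext => x; rewrite derive1E derive_val.
have cF : continuous F.
  apply: continuous_add; first by move=> ?; exact: cvg_cst.
  by apply: (@continuous_mul _ _ id (fun=> b - a)) => ?; [exact: cvg_id|exact: cvg_cst].
have F0 : F 0 = a by rewrite /F mul0r addr0.
have F1 : F 1 = b by rewrite /F mul1r addrC subrK.
have cG : continuous (fun l => (b - a) * f (F l)).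
  by apply: continuous_mul; [move=> ?; exact: cvg_cst|exact: continuous_compo].
apply: EFin_inj; rewrite !EFin_int// -{1}F0 -{1}F1.
rewrite (@integration_by_substitution_increasing _ F f 0 1 ler01).
- by apply: eq_integral => x _; rewrite F' /= mulrC.
- by move=> x y _ _ xy; rewrite /F ltrD2l ltr_pM2r// subr_gt0.
- by rewrite F' => x _; exact: cvg_cst.
- by rewrite F'; exact: is_cvg_cst.
- by rewrite F'; exact: is_cvg_cst.
- split; [by move=> x _|exact/cvg_at_right_filter/cF|exact/cvg_at_left_filter/cF].
- exact: continuous_subspaceT.
Qed.

Variables (r0 H : R) (zeta : R -> R).
Hypothesis H0 : 0 <= H.
Hypothesis cz : {within `[0, H]%classic, continuous zeta}.
Hypothesis zr : forall z, 0 <= z <= H -> r0 <= zeta z.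

Definition region : set (R * R) := [set x | 0 <= x.2 <= H /\ r0 <= x.1 <= zeta x.2].

Let zc (z : R) := zeta (cl 0 H z).

Let continuous_zc : continuous zc.
Proof.
apply: (continuous_within_comp cz); first exact: continuous_cl.
by move=> y; rewrite /= in_itv/=; exact: cl_itv.
Qed.

Let regionE : region = [set x | 0 <= x.2 <= H /\ r0 <= x.1 <= zc x.2].
Proof.
apply/seteqP; split=> [[r z]|[r z]]; rewrite /region/= /zc => -[hz].
  by rewrite cl_id.
by rewrite cl_id.
Qed.

Let closed_le2 (f g : R * R -> R) : continuous f -> continuous g ->
  closed [set x | f x <= g x].
Proof.
move=> cf cg.
have -> : [set x | f x <= g x] = (fun x => g x - f x) @^-1` [set y | 0 <= y].
  by apply/seteqP; split=> x /=; rewrite subr_ge0.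
apply: closed_comp => [x _|]; last exact: closed_ge.
by apply: continuous_sub.
Qed.

Lemma closed_region : closed region.
Proof.
have c1 := @continuous_fst R R; have c2 := @continuous_snd R R.
have cc (x : R) : continuous (fun _ : R * R => x) by move=> ?; exact: cvg_cst.
have czc : continuous (fun x : R * R => zc x.2) by exact: (continuous_compo c2 continuous_zc).
rewrite regionE.
have -> : [set x : R * R | 0 <= x.2 <= H /\ r0 <= x.1 <= zc x.2] =
  ([set x | 0 <= x.2] `&` [set x | x.2 <= H]) `&`
  ([set x | r0 <= x.1] `&` [set x | x.1 <= zc x.2]).
  apply/seteqP; split=> x /=; first by move=> [/andP[-> ->] /andP[-> ->]].
  by move=> [[-> ->] [-> ->]].
by do !apply: closedI; exact: closed_le2.
Qed.

Let zmax : exists M : R, forall z, 0 <= z <= H -> zeta z <= M.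
Proof.
have [|c _ hc] := compact_EVT_max _ (@segment_compact R 0 H) cz.
  by exists 0; rewrite /= in_itv/= lexx.
by exists (zeta c) => z hz; apply: hc; rewrite inE/= in_itv.
Qed.

Lemma compact_region : compact region.
Proof.
have [M hM] := zmax.
have -> : region = (`[r0, M]%classic `*` `[0, H]%classic) `&` region.
  apply/seteqP; split=> [[r z]|x []//]; rewrite /region/= !in_itv/= => -[hz /andP[h1 h2]].
  by rewrite hz h1 h2 (le_trans h2)//; exact: hM.
apply: compact_closedI; last exact: closed_region.
by apply: compact_setX; exact: segment_compact.
Qed.

Lemma measurable_region : measurable (region : set (plane R)).
Proof. by apply: closed_measurable2; exact: closed_region. Qed.

(** A continuous function on a closed subset of the plane, continued by 0. *)
Lemma measurable_restrict2 (A : set (R * R)) (f : R * R -> R) : closed A ->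
  {within A, continuous f} -> measurable_fun setT (f \_ A : plane R -> R).
Proof.
move=> clA cf.
have mA := closed_measurable2 clA.
apply/(measurable_restrictT _ mA).
apply: (measurability _ (measurable_realfun.RGenOpens.measurableE R)).
move=> _ [_ [a [b ->] <-]].
have /open_subspaceP[V oV VE] : open ((f : subspace A -> R) @^-1` `]a, b[%classic).
  by move/continuousP: cf; apply; exact: interval_open.
have -> : A `&` f @^-1` `]a, b[%classic = V `&` A by rewrite VE setIC.
by apply: measurableI => //; exact: open_measurable2.
Qed.

Lemma integrable_region (f : R * R -> R) : {within region, continuous f} ->
  (mu \x mu)%E.-integrable setT (EFin \o (f \_ region) : plane R -> \bar R).
Proof.
move=> cf; have [M hM] := zmax.
have mR := measurable_region.
rewrite -restrict_EFin; apply/integrable_restrict => //; rewrite setTI.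
apply: measurable_bounded_integrable => //.
- apply: (@le_lt_trans _ _ ((mu \x mu)%E (`[r0, M]%classic `*` `[0, H]%classic))).
    apply: le_measure; rewrite ?inE//.
      by apply: measurableX; exact: measurable_itv.
    by move=> [r z] [/= hz /andP[h1 h2]]; rewrite !in_itv/= hz h1 (le_trans h2)//; exact: hM.
  rewrite product_measure1E; [|exact: measurable_itv|exact: measurable_itv].
  have fin x y : (mu `[x, y]%classic < +oo)%E.
    exact/compact_finite_measure/segment_compact.
  apply: lte_mul_pinfty; [exact: measure_ge0| |exact: fin].
  by rewrite fin_num_abs gee0_abs ?measure_ge0//; exact: fin.
- by apply/(measurable_restrictT _ mR); apply: measurable_restrict2 => //; exact: closed_region.
- have /compact_bounded[N [_ mrt]] := continuous_compact cf compact_region.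
  by exists N; split; rewrite ?num_real// => x Nx y Dy; apply: mrt => //; exists y.
Qed.

(** Over the region below the graph of zeta, with the coordinate
    r = r0 + l (zeta z - r0), 0 <= l <= 1. *)
Lemma integral_region (f : R * R -> R) : {within region, continuous f} ->
  (\int[(mu \x mu)%E]_(x in region) (f x)%:E =
   (itg 0 H (fun z => itg 0 1 (fun l =>
     (zeta z - r0) * f (r0 + l * (zeta z - r0), z))))%:E)%E.
Proof.
move=> cf; have iF := integrable_region cf.
rewrite integral_mkcond.
have -> : (\int[(mu \x mu)%E]_x (((fun x => (f x)%:E) \_ region) x) =
    \int[(mu \x mu)%E]_x ((EFin \o (f \_ region)) x))%E.
  by apply: eq_integral => x _; rewrite -restrict_EFin.
rewrite -(integral21_prod_meas1 iF).
pose g z l := (zc z - r0) * f (r0 + cl 0 1 l * (zc z - r0), cl 0 H z).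
have cg : continuous (fun p : R * R => g p.1 p.2).
  have c1 := continuous_compo (@continuous_fst R R) continuous_zc.
  have cc (x : R) : continuous (fun _ : R * R => x) by move=> ?; exact: cvg_cst.
  have cz0 := continuous_sub c1 (cc r0).
  apply: continuous_mul => //.
  apply: (continuous_within_comp (c := fun p : R * R =>
    (r0 + cl 0 1 p.2 * (zc p.1 - r0), cl 0 H p.1)) cf).
    apply: continuous_pair; last exact: (continuous_compo (@continuous_fst R R) (@continuous_cl _ _ _)).
    apply: continuous_add => //; apply: continuous_mul => //.
    exact: (continuous_compo (@continuous_snd R R) (@continuous_cl _ _ _)).
  move=> [z l]; have hz := cl_itv z H0; split=> //=.
  have /andP[l0 l1] := cl_itv l (@ler01 R).
  have h : 0 <= zc z - r0 by rewrite subr_ge0; exact: zr.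
  by rewrite -/(zc z); apply/andP; split; nra.
transitivity (\int[mu]_(z in `[0%R, H]) (itg 0 1 (g z))%:E)%E.
  rewrite [RHS]integral_mkcond; apply: eq_integral => z _.
  rewrite /fubini_G patchE; case: ifPn => [|zH]; last first.
    rewrite -[RHS](integral0 mu setT); apply: eq_integral => r _ /=.
    rewrite patchE ifF//; apply/negbTE; apply: contra zH.
    by rewrite !inE/= in_itv/= => -[].
  rewrite inE/= in_itv/= => hz.
  have zE : zc z = zeta z by rewrite /zc cl_id.
  pose k r := f (cl r0 (zeta z) r, z).
  have ck : continuous k.
    apply: (continuous_within_comp (c := fun r => (cl r0 (zeta z) r, z)) cf).
      exact: (continuous_compo (@continuous_cl _ _ _) (@continuous_pairr _ _ _)).
    by move=> r; split => //=; apply: cl_itv; exact: zr.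
  have -> : itg 0 1 (g z) = itg r0 (zeta z) k.
    rewrite [RHS]int_affine//; last exact: zr.
    apply: eq_int => l hl; rewrite /g zE /k (cl_id hz) (cl_id hl) cl_id//.
    have h : 0 <= zeta z - r0 by rewrite subr_ge0; exact: zr.
    by move: hl => /andP[l0 l1]; apply/andP; split; nra.
  rewrite EFin_int// [RHS]integral_mkcond; apply: eq_integral => r _ /=.
  rewrite !patchE; case: ifPn => [|h].
    rewrite inE/= => -[_ hr]; rewrite ifT; last by rewrite inE/= in_itv.
    by rewrite /k cl_id.
  rewrite ifF//; apply/negbTE; apply: contra h.
  by rewrite !inE/= in_itv/= => hr.
rewrite -EFin_int; last exact: (continuous_int ler01 cg).
congr EFin; apply: eq_int => z hz; apply: eq_int => l hl.
by rewrite /g /zc (cl_id hz) (cl_id hl).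
Qed.
End region.

(** * Measures on the plane and their supports *)

Section rational_rectangles.
Context {R : realType}.

Definition orect (a b c d : R) : set (R * R) :=
  `]a, b[%classic `*` `]c, d[%classic.

Lemma measurable_orect a b c d : measurable (orect a b c d : set (plane R)).
Proof. by apply: measurableX; exact: measurable_itv. Qed.

Lemma orectI a b c d a' b' c' d' : orect a b c d `&` orect a' b' c' d' =
  orect (Num.max a a') (Num.min b b') (Num.max c c') (Num.min d d').
Proof.
apply/seteqP; split=> [[x y]|[x y]]; rewrite /orect/= !in_itv/= !gt_max !lt_min.
  by move=> [[/andP[-> ->] /andP[-> ->]] [/andP[-> ->] /andP[-> ->]]].
by move=> [/andP[/andP[-> ->] /andP[-> ->]] /andP[/andP[-> ->] /andP[-> ->]]].
Qed.

(** A countable base of the plane. *)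
Definition rrect (n : nat) : set (R * R) :=
  if (unpickle n : option (rat * rat * (rat * rat))) is Some r then
    orect (ratr r.1.1) (ratr r.1.2) (ratr r.2.1) (ratr r.2.2) else set0.

Lemma measurable_rrect n : measurable (rrect n : set (plane R)).
Proof. by rewrite /rrect; case: unpickle => [r|//]; exact: measurable_orect. Qed.

Lemma rrect_basis (U : set (R * R)) q : nbhs q U ->
  exists n, rrect n q /\ rrect n `<=` U.
Proof.
case: q => x y [[A B] [/nbhs_ballP[e1 /= e10 A1] /nbhs_ballP[e2 /= e20 B1]] AB].
have [a] := @rat_in_itvoo R (x - e1) x ltac:(by rewrite ltrBlDr ltrDl).
have [b] := @rat_in_itvoo R x (x + e1) ltac:(by rewrite ltrDl).
have [c] := @rat_in_itvoo R (y - e2) y ltac:(by rewrite ltrBlDr ltrDl).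
have [d] := @rat_in_itvoo R y (y + e2) ltac:(by rewrite ltrDl).
rewrite !in_itv/= => /andP[yd de] /andP[ec cy] /andP[xb be] /andP[ea ax].
exists (pickle (a, b, (c, d))); rewrite /rrect pickleK/=; split.
  by rewrite /orect/=; rewrite !in_itv/= ax cy xb.
move=> [x' y']; rewrite /orect/= !in_itv/= => -[/andP[h1 h2] /andP[h3 h4]].
apply: AB; split => /=.
  by apply: A1; rewrite /ball/= ltr_norml; apply/andP; split; lra.
by apply: B1; rewrite /ball/= ltr_norml; apply/andP; split; lra.
Qed.

Lemma spt_closed (mu : set (R * R) -> \bar R) : closed (spt mu).
Proof.
rewrite -[spt mu]setCK; apply: open_closedC; rewrite openE => q /=.
move=> /existsNP[U /not_implyP[oU /not_implyP[Uq nU]]].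
apply: filterS (open_nbhs_nbhs (conj oU Uq)) => q' Uq' h; apply: nU.
exact: h.
Qed.

Lemma spt_null (mu : {measure set (plane R) -> \bar R}) : mu (~` spt mu) = 0%E.
Proof.
pose F n := if mu (rrect n) == 0%E then rrect n else set0.
have mF n : measurable (F n : set (plane R)).
  by rewrite /F; case: ifPn => // _; exact: measurable_rrect.
have F0 n : mu (F n) = 0%E by rewrite /F; case: ifPn => [/eqP//|_]; exact: measure0.
apply/eqP; rewrite eq_le measure_ge0 andbT.
have sub : ~` spt mu `<=` \bigcup_n F n.
  move=> q /= /existsNP[U /not_implyP[oU /not_implyP[Uq nU]]].
  have [n [nq nU']] := rrect_basis (open_nbhs_nbhs (conj oU Uq)).
  exists n => //; rewrite /F ifT//.
  rewrite eq_le measure_ge0 andbT; apply: (@le_trans _ _ (mu U)).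
    by apply: le_measure; rewrite ?inE//; [exact: measurable_rrect|exact: open_measurable2].
  by rewrite leNgt; apply/negP.
have mU : measurable (\bigcup_n F n : set (plane R)) by exact: bigcup_measurable.
apply: (@le_trans _ _ (mu (\bigcup_n F n))).
  apply: le_measure => //; rewrite inE//.
  by apply: measurableC; apply: closed_measurable2; exact: spt_closed.
have /negligibleP : mu.-negligible (\bigcup_n F n).
  by apply: negligible_bigcup => n; exists (F n); split => //; exact: F0.
by move=> /(_ mU) ->.
Qed.

Lemma spt_sub (mu : {measure set (plane R) -> \bar R}) (K : set (R * R)) :
  closed K -> mu (~` K) = 0%E -> spt mu `<=` K.
Proof.
move=> clK muK q hq; apply: contrapT => nKq.
have := hq (~` K) (closed_openC clK) nKq.
by rewrite muK ltxx.
Qed.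

Lemma measurable_plane : @measurable _ (plane R) =
  <<s [set A : set (plane R) | exists a b c d, A = orect a b c d] >>.
Proof.
set G := [set A | _]; apply/seteqP; split; last first.
  apply: smallest_sub; first exact: sigma_algebra_measurable.
  by move=> _ [a [b [c [d ->]]]]; exact: measurable_orect.
pose T := g_sigma_algebraType G.
have cover (a b : R) : fst @^-1` `]a, b[%classic = \bigcup_n orect a b (- n%:R) n%:R.
  apply/seteqP; split=> [[x y] hx|[x y] [n _ []]//]; exists (Num.truncn `|y|).+1 => //.
  have : `|y| < (Num.truncn `|y|).+1%:R by exact: truncnS_gt.
  by rewrite ltr_norml => hy; split => //=; rewrite in_itv.
have cover2 (a b : R) : snd @^-1` `]a, b[%classic = \bigcup_n orect (- n%:R) n%:R a b.
  apply/seteqP; split=> [[x y] hx|[x y] [n _ []]//]; exists (Num.truncn `|x|).+1 => //.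
  have : `|x| < (Num.truncn `|x|).+1%:R by exact: truncnS_gt.
  by rewrite ltr_norml => hy; split => //=; rewrite in_itv.
have mrect a b c d : (measurable (orect a b c d : set T)).
  by apply: sub_sigma_algebra; exists a, b, c, d.
have m1 : measurable_fun setT (fst : T -> measurableTypeR R).
  apply: (measurability _ (measurable_realfun.RGenOpens.measurableE R)).
  move=> _ [_ [a [b ->] <-]]; rewrite setTI cover.
  by apply: bigcup_measurable => n _.
have m2 : measurable_fun setT (snd : T -> measurableTypeR R).
  apply: (measurability _ (measurable_realfun.RGenOpens.measurableE R)).
  move=> _ [_ [a [b ->] <-]]; rewrite setTI cover2.
  by apply: bigcup_measurable => n _.
rewrite measurable_prod_measurableType.
apply: smallest_sub; first exact: smallest_sigma_algebra.
move=> _ [A mA [B mB <-]].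
have -> : A `*` B = (setT `&` fst @^-1` A) `&` (setT `&` snd @^-1` B).
  by rewrite !setTI.
by apply: (@measurableI _ T); [exact: m1|exact: m2].
Qed.

Lemma orect_measure_unique (m1 m2 : {measure set (plane R) -> \bar R}) :
  (m1 setT < +oo)%E -> (forall a b c d, m1 (orect a b c d) = m2 (orect a b c d)) ->
  forall A, measurable A -> m1 A = m2 A.
Proof.
move=> fin m12 A mA.
have := (@measure_unique _ R (plane R) _ (fun n => orect (- n%:R) n%:R (- n%:R) n%:R) measurable_plane).
move=> H; apply: H => //.
- move=> _ _ [a [b [c [d ->]]]] [a' [b' [c' [d' ->]]]]; rewrite orectI.
  by eexists; eexists; eexists; eexists.
- by move=> n; eexists; eexists; eexists; eexists.
- rewrite predeqE => -[x y]; split => // _.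
  exists (Num.truncn (Num.max `|x| `|y|)).+1 => //.
  have : Num.max `|x| `|y| < (Num.truncn (Num.max `|x| `|y|)).+1%:R by exact: truncnS_gt.
  by rewrite gt_max !ltr_norml => /andP[hx hy]; split => /=; rewrite in_itv.
- by move=> _ [a [b [c [d ->]]]].
- move=> n; apply: le_lt_trans fin; apply: le_measure; rewrite ?inE//.
  exact: measurable_orect.
Qed.

(** Two finite measures that agree on all small rectangles around each point of
    O agree on the measurable subsets of O. *)
Lemma measure_eq_local (m1 m2 : {measure set (plane R) -> \bar R})
    (O : set (R * R)) : (m1 setT < +oo)%E ->
  (forall q, O q -> exists2 U, nbhs q U & forall a b c d, orect a b c d `<=` U ->
     m1 (orect a b c d) = m2 (orect a b c d)) ->
  forall A : set (plane R), measurable A -> A `<=` O -> m1 A = m2 A.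
Proof.
move=> fin loc A mA AO.
pose good n := `[< forall a b c d, orect a b c d `<=` rrect n ->
     m1 (orect a b c d) = m2 (orect a b c d) >].
pose F n := if good n then rrect n else set0.
have mF n : measurable (F n : set (plane R)).
  by rewrite /F; case: ifPn => // _; exact: measurable_rrect.
have eqF n B : measurable (B : set (plane R)) -> m1 (B `&` F n) = m2 (B `&` F n).
  move=> mB; rewrite /F; case: ifPn => [/asboolP gn|_]; last by rewrite setI0 !measure0.
  have mn := measurable_rrect n.
  have := @orect_measure_unique (mrestr m1 mn) (mrestr m2 mn).
  apply => //=.
    by rewrite /mrestr setTI; apply: le_lt_trans fin; apply: le_measure; rewrite ?inE.
  move=> a b c d; rewrite /mrestr.
  have [r rE] : exists r : R * R * (R * R), orect a b c d `&` rrect n =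
      orect r.1.1 r.1.2 r.2.1 r.2.2.
    rewrite /rrect; case: unpickle => [r|].
      by rewrite orectI; eexists (_, _, (_, _)).
    exists (0, 0, (0, 0)); rewrite setI0; apply/esym/seteqP; split => // -[x y].
    by rewrite /orect/= !in_itv/= => -[/andP[h1 h2]]; lra.
  by rewrite rE; apply: gn; rewrite -rE; exact: subIsetr.
have AF : A = \bigcup_n (A `&` seqDU F n).
  rewrite -setI_bigcupr; apply/esym/setIidPl => q Aq; rewrite -seqDU_bigcup_eq.
  have [U Uq hU] := loc q (AO q Aq).
  have [n [nq nU]] := rrect_basis Uq.
  exists n => //; rewrite /F ifT//; apply/asboolP => a b c d sub; apply: hU.
  exact: subset_trans sub nU.
have mD n : measurable (A `&` seqDU F n).
  by apply: measurableI => //; apply: measurableD => //; apply: bigsetU_measurable.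
have tD : trivIset setT (fun n => A `&` seqDU F n).
  by apply: trivIset_setIl; exact: trivIset_seqDU.
rewrite AF !measure_bigcup//=; apply: eq_eseriesr => n _.
have -> : A `&` seqDU F n = (A `&` seqDU F n) `&` F n.
  by rewrite -setIA; congr (_ `&` _); rewrite setIidl// => x [].
exact: eqF.
Qed.

End rational_rectangles.

(** * Mixed derivatives and rules for partial derivatives *)

Section young.
Context {R : realType}.

Lemma is_grad_near (F : R * R -> R) p g (e : R) : is_grad F p g -> 0 < e ->
  \forall h \near (0 : R * R), `|F (h + p) - F p - dot h g| <= e * `|h|.
Proof.
move=> [dF dE] e0.
have /eqaddoP/(_ e e0) := diff_locally dF; apply: filterS => h /=.
by rewrite /cst !fctE/= dE opprD addrA.
Qed.

(** Young's theorem: where the first partial derivatives are differentiable, the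
    mixed second derivatives agree. *)
Lemma young (F Fx Fy : R -> R -> R) (a b r fxx fxy fyx fyy : R) : 0 < r ->
  (forall x y, `|x - a| < r -> `|y - b| < r ->
     is_derive x 1 (fun x => F x y) (Fx x y) /\ is_derive y 1 (F x) (Fy x y)) ->
  is_grad (fun p => Fx p.1 p.2) (a, b) (fxx, fxy) ->
  is_grad (fun p => Fy p.1 p.2) (a, b) (fyx, fyy) -> fxy = fyx.
Proof.
move=> r0 dF gx gy.
suff H e : 0 < e -> `|fxy - fyx| <= 4 * e.
  apply/eqP; rewrite -subr_eq0 -normr_le0; apply/ler_addgt0Pr => e e0.
  have e40 : 0 < e / 4 by rewrite divr_gt0.
  by rewrite add0r; have := H _ e40; lra.
move=> e0.
have [h /andP[h0 hr] [hx hy]] : exists2 h : R, 0 < h < r &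
    (forall u v : R, `|u| <= h -> `|v| <= h ->
      `|Fx (u + a) (v + b) - Fx a b - (u * fxx + v * fxy)| <= e * h) /\
    (forall u v : R, `|u| <= h -> `|v| <= h ->
      `|Fy (u + a) (v + b) - Fy a b - (u * fyx + v * fyy)| <= e * h).
  have := @filterI _ (nbhs (0 : R * R)) _ _ _ (is_grad_near gx e0) (is_grad_near gy e0).
  move=> /(_ (nbhs_filter _)) /nbhs_normP[k /= k0 hk].
  have k20 : 0 < Num.min k r / 2 by rewrite divr_gt0// lt_min k0.
  have kk : Num.min k r / 2 < k.
    by rewrite ltr_pdivrMr// (@le_lt_trans _ _ k)// ?ge_min ?lexx//; lra.
  have kr : Num.min k r / 2 < r.
    by rewrite ltr_pdivrMr// (@le_lt_trans _ _ r)// ?ge_min ?lexx ?orbT//; lra.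
  exists (Num.min k r / 2); first by rewrite k20.
  have nuv (u v : R) : `|u| <= Num.min k r / 2 -> `|v| <= Num.min k r / 2 ->
      `|(u, v)| <= Num.min k r / 2.
    by move=> h1 h2; rewrite normr_prodE/= ge_max h1.
  split=> u v h1 h2; have h3 := nuv _ _ h1 h2.
    have [|+ _] := hk (u, v); first by rewrite /= sub0r normrN (le_lt_trans h3).
    by move=> h; apply: (le_trans h); rewrite ler_wpM2l// ltW.
  have [|_ +] := hk (u, v); first by rewrite /= sub0r normrN (le_lt_trans h3).
  by move=> h; apply: (le_trans h); rewrite ler_wpM2l// ltW.
have in1 (x c : R) : c < x < h + c -> `|x - c| <= h.
  by move=> /andP[? ?]; rewrite ger0_norm; lra.
have nh : `|h| <= h by rewrite ger0_norm// ltW.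
have n0 : `|0 : R| <= h by rewrite normr0 ltW.
pose Dl := F (h + a) (h + b) - F (h + a) b - F a (h + b) + F a b.
have close (x c : R) : c <= x <= h + c -> `|x - c| < r.
  by move=> /andP[? ?]; rewrite ger0_norm; lra.
have h1 : `|Dl - h * (h * fxy)| <= 2 * e * h * h.
  pose phi x := F x (h + b) - F x b.
  have dphi x : a <= x <= h + a -> is_derive x 1 phi (Fx x (h + b) - Fx x b).
    move=> hx0; have [||d1 _] := dF x (h + b).
    - exact: close.
    - by apply: close; lra.
    have [||d2 _] := dF x b; [exact: close|by rewrite subrr normr0|].
    exact: is_deriveB.
  have [|x|x|c] := @MVT _ phi (fun x => Fx x (h + b) - Fx x b) a (h + a).
  - by lra.
  - by rewrite in_itv/= => /andP[? ?]; apply: dphi; rewrite !ltW.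
  - apply: derivable_within_continuous => y; rewrite in_itv/= => hy0.
    by have d := dphi y hy0; exact: ex_derive.
  rewrite in_itv/= => hc.
  have -> : phi (h + a) - phi a = Dl by rewrite /phi /Dl; ring.
  rewrite addrK => ->.
  have := hx (c - a) h (in1 _ _ hc) nh; have := hx (c - a) 0 (in1 _ _ hc) n0.
  rewrite !subrK add0r mul0r addr0 => e1 e2.
  have -> : (Fx c (h + b) - Fx c b) * h - h * (h * fxy) =
     h * ((Fx c (h + b) - Fx a b - ((c - a) * fxx + h * fxy)) -
         (Fx c b - Fx a b - (c - a) * fxx)) by ring.
  rewrite normrM (ger0_norm (ltW h0)) [X in _ <= X]mulrC ler_wpM2l ?(ltW h0)//.
  by rewrite (le_trans (ler_normB _ _))//; lra.
have h2 : `|Dl - h * (h * fyx)| <= 2 * e * h * h.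
  pose phi y := F (h + a) y - F a y.
  have dphi y : b <= y <= h + b -> is_derive y 1 phi (Fy (h + a) y - Fy a y).
    move=> hy0; have [||_ d1] := dF (h + a) y.
    - by apply: close; lra.
    - exact: close.
    have [||_ d2] := dF a y; [by rewrite subrr normr0|exact: close|].
    exact: is_deriveB.
  have [|x|x|c] := @MVT _ phi (fun y => Fy (h + a) y - Fy a y) b (h + b).
  - by lra.
  - by rewrite in_itv/= => /andP[? ?]; apply: dphi; rewrite !ltW.
  - apply: derivable_within_continuous => y; rewrite in_itv/= => hy0.
    by have d := dphi y hy0; exact: ex_derive.
  rewrite in_itv/= => hc.
  have -> : phi (h + b) - phi b = Dl by rewrite /phi /Dl; ring.
  rewrite addrK => ->.
  have := hy h (c - b) nh (in1 _ _ hc); have := hy 0 (c - b) n0 (in1 _ _ hc).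
  rewrite !subrK add0r mul0r add0r => e1 e2.
  have -> : (Fy (h + a) c - Fy a c) * h - h * (h * fyx) =
     h * ((Fy (h + a) c - Fy a b - (h * fyx + (c - b) * fyy)) -
         (Fy a c - Fy a b - (c - b) * fyy)) by ring.
  rewrite normrM (ger0_norm (ltW h0)) [X in _ <= X]mulrC ler_wpM2l ?(ltW h0)//.
  by rewrite (le_trans (ler_normB _ _))//; lra.
have hh : 0 < h * h by rewrite mulr_gt0.
have h3 : `|h * h * (fxy - fyx)| <= 4 * e * (h * h).
  have -> : h * h * (fxy - fyx) = (Dl - h * (h * fyx)) - (Dl - h * (h * fxy)) by ring.
  by rewrite (le_trans (ler_normB _ _))//; lra.
by move: h3; rewrite normrM (ger0_norm (ltW hh)) mulrC ler_pM2r.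
Qed.

End young.

Section partial_rules.
Context {R : realType}.
Implicit Types (f g : R -> R -> R -> R) (x : R * (R * R)).

Lemma partial_add i f g x : differentiable (unc f) x -> differentiable (unc g) x ->
  partial i (fun t r z => f t r z + g t r z) x.1 x.2.1 x.2.2 =
  unc (partial i f) x + unc (partial i g) x.
Proof.
move=> df dg; rewrite [LHS]partialE; last exact: (differentiableD df dg).
by rewrite (diffD df dg) /unc (partialE i df) (partialE i dg).
Qed.

Lemma partial_mul i f g x : differentiable (unc f) x -> differentiable (unc g) x ->
  partial i (fun t r z => f t r z * g t r z) x.1 x.2.1 x.2.2 =
  unc f x * unc (partial i g) x + unc g x * unc (partial i f) x.
Proof.
move=> df dg; rewrite [LHS]partialE; last exact: (differentiableM df dg).
by rewrite (diffM df dg) /unc (partialE i df) (partialE i dg).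
Qed.

Lemma partial_opp i f x : differentiable (unc f) x ->
  partial i (fun t r z => - f t r z) x.1 x.2.1 x.2.2 = - unc (partial i f) x.
Proof.
move=> df; rewrite [LHS]partialE; last exact: (differentiableN df).
by rewrite (diffN df) /unc (partialE i df).
Qed.

Lemma partial_sub i f g x : differentiable (unc f) x -> differentiable (unc g) x ->
  partial i (fun t r z => f t r z - g t r z) x.1 x.2.1 x.2.2 =
  unc (partial i f) x - unc (partial i g) x.
Proof.
move=> df dg; rewrite (@partial_add i f (fun t r z => - g t r z))//.
  by rewrite {2}/unc partial_opp.
exact: (differentiableN dg).
Qed.

Lemma Cn_young (U : set (R * (R * R))) f x : open U -> Cn 2 U f -> U x ->
  [/\ unc (D1 (Dt f)) x = unc (Dt (D1 f)) x,
      unc (D2 (Dt f)) x = unc (Dt (D2 f)) x &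
      unc (D2 (D1 f)) x = unc (D1 (D2 f)) x].
Proof.
case: x => t [a b] oU hf Ux.
have : nbhs (t, (a, b)) U by exact: open_nbhs_nbhs.
move=> /nbhs_normP[r /= r0 hr].
have near t' a' b' : `|t' - t| < r -> `|a' - a| < r -> `|b' - b| < r ->
    U (t', (a', b')).
  move=> h1 h2 h3; apply: hr => /=.
  have nE (y : R * (R * R)) :
    `|y| = Num.max `|y.1| (Num.max `|y.2.1| `|y.2.2|) by [].
  by rewrite distrC nE/= !gt_max h1 h2.
have df y : U y -> differentiable (unc f) y by move=> Uy; exact: (Cn_diff hf Uy).
have dt := Cn_diff (Cn_Dt hf) Ux.
have d1 := Cn_diff (Cn_D1 hf) Ux.
have d2 := Cn_diff (Cn_D2 hf) Ux.
have zz (c : R) : `|c - c| < r by rewrite subrr normr0.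
have dc (c s : R) : is_derive s 1 (fun _ : R => c) 0 by exact: is_derive_cst.
have di (s : R) : is_derive s 1 (fun s : R => s) 1 by exact: is_derive_id.
have isDt y : U y -> is_derive y.1 1 (fun s => f s y.2.1 y.2.2) (unc (Dt f) y).
  case: y => [y1 [y2 y3]] Uy.
  have := is_derive_unc (df _ Uy) (di y1) (dc y2 _) (dc y3 _).
  by rewrite !mul0r mul1r !addr0.
have isD1 y : U y -> is_derive y.2.1 1 (fun s => f y.1 s y.2.2) (unc (D1 f) y).
  case: y => [y1 [y2 y3]] Uy.
  have := is_derive_unc (df _ Uy) (dc y1 _) (di y2) (dc y3 _).
  by rewrite !mul0r mul1r addr0 add0r.
have isD2 y : U y -> is_derive y.2.2 1 (fun s => f y.1 y.2.1 s) (unc (D2 f) y).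
  case: y => [y1 [y2 y3]] Uy.
  have := is_derive_unc (df _ Uy) (dc y1 _) (dc y2 _) (di y3).
  by rewrite !mul0r mul1r !add0r.
have fstd (p : R * R) := @differentiable_fst R R R p.
have sndd (p : R * R) := @differentiable_snd R R R p.
have g01 k : differentiable (unc k) (t, (a, b)) ->
    is_grad (fun p : R * R => k p.1 p.2 b) (t, a) (Dt k t a b, D1 k t a b).
  move=> dk.
  suff h : differentiable (fun p : R * R => k p.1 p.2 b) (t, a).
    exact: (@is_grad_diff R (fun _ u v => k u v b) 0 (t, a) h).
  apply: (@differentiable_comp _ _ _ _ (fun p : R * R => (p.1, (p.2, b))) (unc k)) => //.
  by apply: differentiable_pair => //; apply: differentiable_pair.
have g02 k : differentiable (unc k) (t, (a, b)) ->
    is_grad (fun p : R * R => k p.1 a p.2) (t, b) (Dt k t a b, D2 k t a b).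
  move=> dk.
  suff h : differentiable (fun p : R * R => k p.1 a p.2) (t, b).
    exact: (@is_grad_diff R (fun _ u v => k u a v) 0 (t, b) h).
  apply: (@differentiable_comp _ _ _ _ (fun p : R * R => (p.1, (a, p.2))) (unc k)) => //.
  by apply: differentiable_pair => //; apply: differentiable_pair.
have g12 k : differentiable (unc k) (t, (a, b)) ->
    is_grad (fun p : R * R => k t p.1 p.2) (a, b) (D1 k t a b, D2 k t a b).
  exact: (@is_grad_slice _ k t (a, b)).
split.
- apply: (@young _ (fun u v => f u v b) (fun u v => Dt f u v b)
    (fun u v => D1 f u v b) t a r _ _ _ _ r0 _ (g01 _ dt) (g01 _ d1)) => u v hx hy.
  have h := near _ _ _ hx hy (zz b).
  by split; [exact: (isDt _ h)|exact: (isD1 _ h)].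
- apply: (@young _ (fun u v => f u a v) (fun u v => Dt f u a v)
    (fun u v => D2 f u a v) t b r _ _ _ _ r0 _ (g02 _ dt) (g02 _ d2)) => u v hx hy.
  have h := near _ _ _ hx (zz a) hy.
  by split; [exact: (isDt _ h)|exact: (isD2 _ h)].
- apply: (@young _ (fun u v => f t u v) (fun u v => D1 f t u v)
    (fun u v => D2 f t u v) a b r _ _ _ _ r0 _ (g12 _ d1) (g12 _ d2)) => u v hx hy.
  have h := near _ _ _ (zz t) hx hy.
  by split; [exact: (isD1 _ h)|exact: (isD2 _ h)].
Qed.

End partial_rules.

(** * Invariance of a weighted integral under a homotopy *)

Opaque Cn.
(** The divergence of f(phi) times the vector of 2x2 minors of the derivative of
    phi = (phi1, phi2) : R^3 -> R^2 vanishes. *)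
Lemma piola_algebra (K : comPzRingType)
    (A B C F u1 u2 u3 j1 j2 j3 v1 v2 v3 : K)
    (p0 p1 p2 s0 s1 s2 : K)
    (p01 p02 p10 p12 p20 p21 : K)
    (s01 s02 s10 s12 s20 s21 fY fZ : K) :
  A = F * u1 + j1 * v1 -> B = F * u2 + j2 * v2 -> C = F * u3 + j3 * v3 ->
  j1 = p1 * s2 - p2 * s1 -> j2 = p2 * s0 - p0 * s2 -> j3 = p0 * s1 - p1 * s0 ->
  u1 = (p1 * s02 + s2 * p01) - (p2 * s01 + s1 * p02) ->
  u2 = (p2 * s10 + s0 * p12) - (p0 * s12 + s2 * p10) ->
  u3 = (p0 * s21 + s1 * p20) - (p1 * s20 + s0 * p21) ->
  v1 = p0 * fY + s0 * fZ -> v2 = p1 * fY + s1 * fZ -> v3 = p2 * fY + s2 * fZ ->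
  p10 = p01 -> p20 = p02 -> p21 = p12 ->
  s10 = s01 -> s20 = s02 -> s21 = s12 ->
  A + B + C = 0.
Proof.
do 18 (move=> ->); ring.
Qed.

Arguments piola_algebra {K A B C F u1 u2 u3 j1 j2 j3 v1 v2 v3 p0 p1 p2 s0 s1 s2
  p01 p02 p10 p12 p20 p21 s01 s02 s10 s12 s20 s21 fY fZ}.

Lemma derive1_shift (R : realType) (c d x : R) :
  derive1 (fun x => c + (x - d)) x = 1.
Proof.
have h : is_derive x 1 (fun x => c + (x - d)) (0 + (1 - 0)).
  apply: is_deriveD; apply: is_deriveB.
by rewrite derive1E (@derive_val _ _ _ _ _ _ _ h) add0r subr0.
Qed.

Section change_of_variables.
Context {R : realType}.
Variables (g1 g2 : R -> R -> R) (W : set (R * R)).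
Hypothesis oW : open W.
Let U : set (R * (R * R)) := [set p | W p.2].
Hypothesis hg1 : Cn 2 U (fun _ => g1).
Hypothesis hg2 : Cn 2 U (fun _ => g2).
Variables (r1 z1 q1 q2 e : R).
Hypothesis e0 : 0 < e.
Hypothesis BW : forall r z, r1 - e <= r <= r1 + e -> z1 - e <= z <= z1 + e ->
  W (r, z).

(** The homotopy between a translation and the map (g1, g2). *)
Definition hom (g : R -> R -> R) (c : R -> R -> R) (t r z : R) :=
  (1 - t) * c r z + t * g r z.
Let phi1 := hom g1 (fun r _ => q1 + (r - r1)).
Let phi2 := hom g2 (fun _ z => q2 + (z - z1)).

Definition jac (g1 g2 : R -> R -> R) (r z : R) :=
  derive1 (g1 ^~ z) r * derive1 (g2 r) z - derive1 (g1 r) z * derive1 (g2 ^~ z) r.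

Variable f : R -> R -> R.
Hypothesis hf : Cn 1 setT (fun _ => f).
Hypothesis f0 : forall t r z, 0 <= t <= 1 -> r1 - e <= r <= r1 + e ->
  z1 - e <= z <= z1 + e -> (r = r1 - e \/ r = r1 + e) \/ (z = z1 - e \/ z = z1 + e) ->
  f (phi1 t r z) (phi2 t r z) = 0.

Let oU : open U.
Proof.
apply: (@open_comp _ _ (fun p : R * (R * R) => p.2)) => // x _.
exact: cvg_snd.
Qed.

Let Cn_hom g c : Cn 2 U (fun _ => g) -> Cn 2 U (fun _ => c) ->
  Cn 2 U (hom g c).
Proof.
move=> hg hc; have h1 := Cn_sub oU (Cn_cst 2 U 1) (Cn_t 2 U).
exact: (Cn_add oU (Cn_mul oU h1 hc) (Cn_mul oU (Cn_t 2 U) hg)).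
Qed.

Let Cn_phi1 : Cn 2 U phi1.
Proof.
exact (Cn_hom hg1
  (Cn_add oU (Cn_cst 2 U q1) (Cn_sub oU (Cn_x 2 U) (Cn_cst 2 U r1)))).
Qed.

Let Cn_phi2 : Cn 2 U phi2.
Proof.
exact (Cn_hom hg2
  (Cn_add oU (Cn_cst 2 U q2) (Cn_sub oU (Cn_y 2 U) (Cn_cst 2 U z1)))).
Qed.

Let fphi t r z := f (phi1 t r z) (phi2 t r z).

Let Cn_fphi : Cn 1 U fphi.
Proof.
by apply: (@Cn_comp _ 1 setT U (fun _ => f) (fun t _ _ => t)) => //;
  [exact: Cn_t|exact: CnW|exact: CnW].
Qed.

Let J (A B : (R -> R -> R -> R) -> R -> R -> R -> R) t r z :=
  A phi1 t r z * B phi2 t r z - B phi1 t r z * A phi2 t r z.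

Let Cn_J i j : Cn 1 U (J (partial i) (partial j)).
Proof.
exact: (Cn_sub oU
  (Cn_mul oU (Cn_partial i Cn_phi1) (Cn_partial j Cn_phi2))
  (Cn_mul oU (Cn_partial j Cn_phi1) (Cn_partial i Cn_phi2))).
Qed.

Let partial_J k i j x : U x -> unc (partial k (J (partial i) (partial j))) x =
  (unc (partial i phi1) x * unc (partial k (partial j phi2)) x +
   unc (partial j phi2) x * unc (partial k (partial i phi1)) x) -
  (unc (partial j phi1) x * unc (partial k (partial i phi2)) x +
   unc (partial i phi2) x * unc (partial k (partial j phi1)) x).
Proof.
move=> Ux; have d l p : Cn 2 U p -> differentiable (unc (partial l p)) x.
  by move=> hp; exact: (Cn_diff (Cn_partial l hp) Ux).
have d1 := d i _ Cn_phi1; have d2 := d j _ Cn_phi2.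
have d3 := d j _ Cn_phi1; have d4 := d i _ Cn_phi2.
rewrite [LHS](@partial_sub _ k (fun t r z => partial i phi1 t r z * partial j phi2 t r z)
  (fun t r z => partial j phi1 t r z * partial i phi2 t r z)).
- by rewrite -(partial_mul k d1 d2) -(partial_mul k d3 d4).
- exact: (differentiableM d1 d2).
- exact: (differentiableM d3 d4).
Qed.

Let partial_fphi k x : U x -> unc (partial k fphi) x =
  unc (partial k phi1) x * unc (D1 (fun _ => f)) (unc (fun t _ _ => t) x, (unc phi1 x, unc phi2 x)) +
  unc (partial k phi2) x * unc (D2 (fun _ => f)) (unc (fun t _ _ => t) x, (unc phi1 x, unc phi2 x)).
Proof.
move=> Ux.
have dt : differentiable (unc (fun t _ _ => t)) x by exact: (Cn_diff (Cn_t 0 U) Ux).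
rewrite [LHS](@partial_comp _ (fun _ => f) (fun t _ _ => t) phi1 phi2 x k)//.
- rewrite [X in _ * X + _ + _](_ : _ = 0) ?mulr0 ?add0r//.
  by rewrite /unc /Dt derive1_cst.
- exact: (Cn_diff hf).
- exact: (Cn_diff Cn_phi1 Ux).
- exact: (Cn_diff Cn_phi2 Ux).
Qed.

Let i0 : 'I_3 := @Ordinal 3 0 isT.
Let i1 : 'I_3 := @Ordinal 3 1 isT.
Let i2 : 'I_3 := @Ordinal 3 2 isT.

Let a1 := r1 - e. Let b1 := r1 + e. Let a2 := z1 - e. Let b2 := z1 + e.

(** The divergence theorem on [0, 1] times the box: the homotopy sends no lateral
    boundary point into the support of f, so that the two ends carry equal
    integrals. *)
Lemma change_of_variables_box :
  itg a1 b1 (fun r => itg a2 b2 (fun z => f (g1 r z) (g2 r z) * jac g1 g2 r z)) =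
  itg a1 b1 (fun r => itg a2 b2 (fun z => f (q1 + (r - r1)) (q2 + (z - z1)))).
Proof.
pose A t r z := fphi t r z * J (partial i1) (partial i2) t r z.
pose B t r z := fphi t r z * J (partial i2) (partial i0) t r z.
pose C t r z := fphi t r z * J (partial i0) (partial i1) t r z.
have hA : Cn 1 U A by exact: (Cn_mul oU Cn_fphi (Cn_J i1 i2)).
have hB : Cn 1 U B by exact: (Cn_mul oU Cn_fphi (Cn_J i2 i0)).
have hC : Cn 1 U C by exact: (Cn_mul oU Cn_fphi (Cn_J i0 i1)).
have ne : - e < e by rewrite (lt_trans _ e0)// oppr_lt0.
have ab1 : a1 < b1 by rewrite ltrD2l.
have ab2 : a2 < b2 by rewrite ltrD2l.
have CU : cbox 0 1 a1 b1 a2 b2 `<=` U.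
  by move=> [t [r z]] [/= _ h1 h2]; apply: BW.
have div0 t r z : U (t, (r, z)) -> Dt A t r z + D1 B t r z + D2 C t r z = 0.
  move=> Ux; have df := Cn_diff Cn_fphi Ux.
  have m k i j : partial k (fun t r z => fphi t r z * J (partial i) (partial j) t r z) t r z =
     unc fphi (t, (r, z)) * unc (partial k (J (partial i) (partial j))) (t, (r, z)) +
     unc (J (partial i) (partial j)) (t, (r, z)) * unc (partial k fphi) (t, (r, z)).
    by rewrite -(partial_mul k df (Cn_diff (Cn_J i j) Ux)).
  have [y1 y2 y3] := Cn_young oU Cn_phi1 Ux.
  have [y4 y5 y6] := Cn_young oU Cn_phi2 Ux.
  have JE i j : unc (J (partial i) (partial j)) (t, (r, z)) =
      unc (partial i phi1) (t, (r, z)) * unc (partial j phi2) (t, (r, z)) -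
      unc (partial j phi1) (t, (r, z)) * unc (partial i phi2) (t, (r, z)) by [].
  exact (piola_algebra (m i0 i1 i2) (m i1 i2 i0) (m i2 i0 i1)
    (JE i1 i2) (JE i2 i0) (JE i0 i1)
    (partial_J i0 i1 i2 Ux) (partial_J i1 i2 i0 Ux) (partial_J i2 i0 i1 Ux)
    (partial_fphi i0 Ux) (partial_fphi i1 Ux) (partial_fphi i2 Ux)
    y1 y2 y3 y4 y5 y6).
have zero (F : R -> R -> R) a b c d : a <= b -> c <= d ->
    (forall x y, a <= x <= b -> c <= y <= d -> F x y = 0) ->
    itg a b (fun x => itg c d (F x)) = 0.
  move=> ab cd F0; rewrite (@eq_int _ a b _ (fun=> 0)) ?int_cst ?mul0r// => x hx.
  by rewrite (@eq_int _ c d _ (fun=> 0)) ?int_cst ?mul0r// => y hy; exact: F0.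
have := divergence_smooth ltr01 ab1 ab2 CU hA hB hC.
have -> : int3 0 1 a1 b1 a2 b2 (fun t x y => Dt A t x y + D1 B t x y + D2 C t x y) = 0.
  rewrite /int3 (@eq_int _ 0 1 _ (fun=> 0)) ?int_cst ?mul0r ?ler01// => t ht.
  by apply: zero => [||r z hr hz]; rewrite ?(ltW ab1) ?(ltW ab2)// div0//; apply: BW.
rewrite /flux.
have ea1 : r1 - e <= a1 <= r1 + e by rewrite lexx lerD2l ltW.
have eb1 : r1 - e <= b1 <= r1 + e by rewrite lexx lerD2l ltW.
have ea2 : z1 - e <= a2 <= z1 + e by rewrite lexx lerD2l ltW.
have eb2 : z1 - e <= b2 <= z1 + e by rewrite lexx lerD2l ltW.
rewrite [X in _ + X + _](zero _ _ _ _ _ ler01 (ltW ab2)); last first.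
  by move=> t z ht hz; rewrite /B /fphi !f0 ?mul0r ?subrr//; left; [left|right].
rewrite [X in _ + X](zero _ _ _ _ _ ler01 (ltW ab1)); last first.
  by move=> t r ht hr; rewrite /C /fphi !f0 ?mul0r ?subrr//; right; [left|right].
rewrite !addr0 => /esym E.
have cA : continuous (unc (clamp 0 1 a1 b1 a2 b2 A)).
  apply: clamp_continuous => //; apply: (differentiable_within CU) => x Ux.
  exact: (Cn_diff hA Ux).
pose Ac := clamp 0 1 a1 b1 a2 b2 A.
have cAc t : continuous (fun p : R * R => Ac t p.1 p.2).
  exact: (continuous_compo (@continuous_pairl _ _ t) cA).
have AcE t r z : 0 <= t <= 1 -> a1 <= r <= b1 -> a2 <= z <= b2 -> Ac t r z = A t r z.
  by move=> h1 h2 h3; rewrite /Ac clampE.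
have t0 : 0 <= (0 : R) <= 1 by apply/andP; split; [exact: lexx|exact: ler01].
have t1 : 0 <= (1 : R) <= 1 by apply/andP; split; [exact: ler01|exact: lexx].
have {}E : itg a1 b1 (fun r => itg a2 b2 (Ac 1 r)) =
    itg a1 b1 (fun r => itg a2 b2 (Ac 0 r)).
  apply/eqP; rewrite -subr_eq0 -itgB; [|exact: continuous_int (ltW ab2) (cAc 1)|
    exact: continuous_int (ltW ab2) (cAc 0)].
  rewrite -[X in _ == X]E; apply/eqP; apply: eq_int => r hr.
  rewrite -itgB; [|exact: continuous_slice (cAc 1)|exact: continuous_slice (cAc 0)].
  by apply: eq_int => z hz; rewrite !AcE.
have fst1 r z : phi1 1 r z = g1 r z by rewrite /phi1 /hom subrr mul0r add0r mul1r.
have snd1 r z : phi2 1 r z = g2 r z by rewrite /phi2 /hom subrr mul0r add0r mul1r.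
have fst0 r z : phi1 0 r z = q1 + (r - r1) by rewrite /phi1 /hom subr0 mul0r addr0 mul1r.
have snd0 r z : phi2 0 r z = q2 + (z - z1) by rewrite /phi2 /hom subr0 mul0r addr0 mul1r.
transitivity (itg a1 b1 (fun r => itg a2 b2 (Ac 1 r))).
  apply: eq_int => r hr; apply: eq_int => z hz; rewrite (AcE 1 r z t1 hr hz).
  have -> : A 1 r z = f (g1 r z) (g2 r z) * J (partial i1) (partial i2) 1 r z.
    by rewrite -(fst1 r z) -(snd1 r z).
  apply: (congr1 (fun x => f (g1 r z) (g2 r z) * x)).
  rewrite /jac /J.
  have -> : partial i1 phi1 1 r z = derive1 (g1 ^~ z) r.
    by rewrite /partial/= /D1; congr (derive1 _ _); apply/funext => x; exact: fst1.
  have -> : partial i2 phi2 1 r z = derive1 (g2 r) z.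
    by rewrite /partial/= /D2; congr (derive1 _ _); apply/funext => x; exact: snd1.
  have -> : partial i2 phi1 1 r z = derive1 (g1 r) z.
    by rewrite /partial/= /D2; congr (derive1 _ _); apply/funext => x; exact: fst1.
  have -> : partial i1 phi2 1 r z = derive1 (g2 ^~ z) r.
    by rewrite /partial/= /D1; congr (derive1 _ _); apply/funext => x; exact: snd1.
  by [].
rewrite E; apply: eq_int => r hr; apply: eq_int => z hz; rewrite (AcE 0 r z t0 hr hz).
have -> : A 0 r z = f (q1 + (r - r1)) (q2 + (z - z1)) * J (partial i1) (partial i2) 0 r z.
  by rewrite -(fst0 r z) -(snd0 r z).
rewrite -[RHS]mulr1; apply: (congr1 (fun x => f (q1 + (r - r1)) (q2 + (z - z1)) * x)).
rewrite /J.
have -> : partial i1 phi1 0 r z = 1.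
  rewrite -[RHS](derive1_shift q1 r1 r) /partial/= /D1; congr (derive1 _ _).
  by apply/funext => x; exact: fst0.
have -> : partial i2 phi2 0 r z = 1.
  rewrite -[RHS](derive1_shift q2 z1 z) /partial/= /D2; congr (derive1 _ _).
  by apply/funext => x; exact: snd0.
have -> : partial i2 phi1 0 r z = 0.
  rewrite -[RHS](derive1_cst (q1 + (r - r1)) z) /partial/= /D2; congr (derive1 _ _).
  by apply/funext => x; exact: fst0.
by rewrite mul0r subr0 mulr1.
Qed.

End change_of_variables.

(** * The local degree of a strictly monotone map *)

Section local_degree.
Context {R : realType}.

Lemma itg_shift (a c e : R) (f : R -> R) : 0 <= e -> continuous f ->
  itg (a - e) (a + e) (fun r => f (c + (r - a))) = itg (c - e) (c + e) f.
Proof.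
move=> e0 cf; have ne x : x - e <= x + e by rewrite lerD2l (le_trans _ e0)// oppr_le0.
have cs : continuous (fun r : R => f (c + (r - a))).
  apply: (@continuous_compo _ _ _ (fun r : R => c + (r - a)) f) => // x.
  by apply: cvgD; [exact: cvg_cst|apply: cvgB; [exact: cvg_id|exact: cvg_cst]].
rewrite (int_affine (ne a) cs) (int_affine (ne c) cf); apply: eq_int => l _.
congr (_ * f _); ring.
Qed.

(** The field nu, positively correlated both with the translation and with
    the map, keeps the homotopy between them away from (q1, q2) on the boundary of
    the box. *)
Lemma local_degree (g1 g2 : R -> R -> R) (W : set (R * R)) (nu : R -> R -> R * R)
    (r1 z1 q1 q2 e : R) : open W ->
  Cn 2 [set p : R * (R * R) | W p.2] (fun _ => g1) ->
  Cn 2 [set p : R * (R * R) | W p.2] (fun _ => g2) ->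
  0 < e ->
  (forall r z, r1 - e <= r <= r1 + e -> z1 - e <= z <= z1 + e -> W (r, z)) ->
  (forall r z, r1 - e <= r <= r1 + e -> z1 - e <= z <= z1 + e ->
    (r, z) <> (r1, z1) ->
    0 < dot (nu r z) (r - r1, z - z1) /\
    0 < dot (nu r z) (g1 r z - q1, g2 r z - q2)) ->
  exists d, [/\ 0 < d, d <= e & forall f, Cn 1 setT (fun _ => f) ->
    (forall y w, d <= `|y - q1| \/ d <= `|w - q2| -> f y w = 0) ->
    itg (r1 - e) (r1 + e) (fun r => itg (z1 - e) (z1 + e)
      (fun z => f (g1 r z) (g2 r z) * jac g1 g2 r z)) =
    itg (q1 - e) (q1 + e) (fun y => itg (q2 - e) (q2 + e) (fun w => f y w))].
Proof.
move=> oW h1 h2 e0 BW sep.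
pose U := [set p : R * (R * R) | W p.2].
have oU : open U.
  by apply: (@open_comp _ _ (fun p : R * (R * R) => p.2)) => // x _; exact: cvg_snd.
pose phi1 := hom g1 (fun r _ => q1 + (r - r1)).
pose phi2 := hom g2 (fun _ z => q2 + (z - z1)).
have cU g c : Cn 2 U (fun _ => g) -> Cn 2 U (fun _ => c) ->
    forall x, U x -> differentiable (unc (hom g c)) x.
  move=> hg hc x Ux; have k1 := Cn_sub oU (Cn_cst 2 U 1) (Cn_t 2 U).
  exact: (Cn_diff (Cn_add oU (Cn_mul oU k1 hc) (Cn_mul oU (Cn_t 2 U) hg)) Ux).
have d1 : forall x, U x -> differentiable (unc phi1) x.
  exact (cU _ _ h1 (Cn_add oU (Cn_cst 2 U q1) (Cn_sub oU (Cn_x 2 U) (Cn_cst 2 U r1)))).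
have d2 : forall x, U x -> differentiable (unc phi2) x.
  exact (cU _ _ h2 (Cn_add oU (Cn_cst 2 U q2) (Cn_sub oU (Cn_y 2 U) (Cn_cst 2 U z1)))).
pose B := cbox 0 1 (r1 - e) (r1 + e) (z1 - e) (z1 + e).
have BU : B `<=` U by move=> [t [r z]] [/= _ hr hz]; exact: BW.
have edge : closed [set p : R * (R * R) | e <= `|p.2 - (r1, z1)|].
  apply: (@closed_comp _ _ (fun p : R * (R * R) => `|p.2 - (r1, z1)|) [set x | e <= x]).
    move=> p _; apply: (@cvg_norm _ _ _ _ _ (fun p : R * (R * R) => p.2 - (r1, z1))).
    by apply: cvgB; [exact: cvg_snd|exact: cvg_cst].
  exact: closed_ge.
pose K := B `&` [set p : R * (R * R) | e <= `|p.2 - (r1, z1)|].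
have cK : compact K by apply: compact_closedI => //; exact: compact_cbox.
pose N x := `|unc phi1 x - q1| + `|unc phi2 x - q2|.
have cN : {within K, continuous N}.
  have KU : K `<=` U by apply: subset_trans BU; exact: subIsetl.
  move=> x; apply: cvgD; apply: cvg_norm; apply: cvgB; try exact: cvg_cst.
    exact: (differentiable_within KU d1).
  exact: (differentiable_within KU d2).
have clN : closed [set N x | x in K].
  by apply: compact_closed => //; exact: continuous_compact.
have N0 : ~ [set N x | x in K] 0.
  move=> [[t [r z]] [[/= ht hr hz] he]] /eqP; rewrite /N paddr_eq0// !normr_eq0.
  move=> /andP[/eqP E1 /eqP E2].
  have nx : (r, z) <> (r1, z1).
    by move=> E; move: he; rewrite E subrr normr0 leNgt e0.
  have [s1 s2] := sep r z hr hz nx.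
  have : dot (nu r z) (phi1 t r z - q1, phi2 t r z - q2) =
     (1 - t) * dot (nu r z) (r - r1, z - z1) +
     t * dot (nu r z) (g1 r z - q1, g2 r z - q2).
    by rewrite /phi1 /phi2 /hom /dot/=; ring.
  have -> : (phi1 t r z - q1, phi2 t r z - q2) = (0, 0) by congr pair.
  rewrite {1}/dot/= !mulr0 addr0 => /esym/eqP; apply/negP; rewrite gt_eqF//.
  move: ht => /andP[t0 t1]; have [->|t00] := eqVneq t 0; first by rewrite subr0 mul0r addr0 mul1r.
  rewrite ltr_wpDl// ?mulr_gt0// ?lt0r ?t00//.
  by rewrite mulr_ge0 ?subr_ge0// ltW.
have [d0 d00 hd0] : exists2 d0 : R, 0 < d0 & forall x, K x -> d0 <= N x.
  have /nbhs_ballP[d0 /= d00 h] : nbhs (0 : R) (~` [set N x | x in K]).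
    by apply: open_nbhs_nbhs; split => //; exact: closed_openC.
  exists d0 => // x Kx; rewrite leNgt; apply/negP => Nx.
  apply: (h (N x)); last by exists x.
  by rewrite /ball/= sub0r normrN ger0_norm// addr_ge0.
pose d := Num.min (d0 / 2) e.
exists d; split; first by rewrite lt_min e0 divr_gt0.
  by rewrite ge_min lexx orbT.
move=> f hf f0.
rewrite (@change_of_variables_box _ g1 g2 W oW h1 h2 r1 z1 q1 q2 e e0 BW f hf); last first.
  move=> t r z ht hr hz hb; apply: f0.
  have Kx : K (t, (r, z)).
    split; first by split.
    rewrite /= normr_prodE/= le_max.
    have nn (x : R) : x - e - x = - e by ring.
    have pp (x : R) : x + e - x = e by ring.
    have ee : `|e| = e by exact: ger0_norm (ltW e0).
    by case: hb => [[|]|[|]] ->; rewrite ?nn ?pp ?normrN ee lexx ?orbT.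
  have := hd0 _ Kx; rewrite /N /unc/= => hN.
  have [lt1|] := ltP `|phi1 t r z - q1| d; last by left.
  right; have := ge_min (d0 / 2) (d0 / 2) e; rewrite lexx /= -/d => dd.
  move: lt1 hN dd; clear; rewrite -/d; lra.
have cf : continuous (fun p : R * R => f p.1 p.2).
  have cu : continuous (unc (fun _ : R => f)).
    by move=> x; apply: differentiable_continuous; exact: (Cn_diff hf).
  exact: (continuous_compo (@continuous_pairl _ _ (0 : R)) cu).
have e0' := ltW e0.
have ne (x : R) : x - e <= x + e by rewrite lerD2l (le_trans _ e0')// oppr_le0.
have cH : continuous (fun y => itg (q2 - e) (q2 + e) (f y)) by exact: continuous_int.
rewrite -[RHS](@itg_shift r1 q1 e (fun y => itg (q2 - e) (q2 + e) (f y)) e0' cH).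
by apply: eq_int => r _; rewrite (@itg_shift z1 q2)//; exact: continuous_slice cf.
Qed.

End local_degree.

(** * Rectangles as limits of smooth test functions *)

Section rectangle_tests.
Context {R : realType}.

(** Smooth functions increasing to the indicator of the rectangle with centre
    (c1, c2) and half sides e1, e2. *)
Definition rect_test (c1 e1 c2 e2 : R) (n : nat) (y w : R) : R :=
  let b := bump1 c1 e1 y * bump1 c2 e2 w in n%:R * b * (1 + n%:R * b)^-1.

Variables c1 e1 c2 e2 : R.
Let test := rect_test c1 e1 c2 e2.
Let b y w := bump1 c1 e1 y * bump1 c2 e2 w.

Let nb_ge0 n y w : 0 <= n%:R * b y w.
Proof. by rewrite mulr_ge0// mulr_ge0// bump1_ge0. Qed.

Let den_gt0 n y w : 0 < 1 + n%:R * b y w.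
Proof. by rewrite ltr_pwDl. Qed.

Lemma rect_test_ge0 n y w : 0 <= test n y w.
Proof.
apply: mulr_ge0; first exact: nb_ge0.
by rewrite invr_ge0; apply: ltW; exact: den_gt0.
Qed.

Lemma rect_test_le1 n y w : test n y w <= 1.
Proof. by rewrite /test /rect_test ler_pdivrMr ?den_gt0// mul1r lerDr ler01. Qed.

Lemma rect_test_eq0 n y w : e1 <= `|y - c1| \/ e2 <= `|w - c2| -> test n y w = 0.
Proof.
by move=> -[|] h; rewrite /test /rect_test (bump1_eq0 h) ?(mul0r, mulr0).
Qed.

Lemma Cn_rect_test m n : Cn m setT (fun _ : R => test n).
Proof.
have oT : open [set: R * (R * R)] by exact: openT.
have hb : Cn m setT (fun _ y w => b y w).
  exact: (Cn_mul oT (Cn_bump1 c1 e1 oT (Cn_x m setT)) (Cn_bump1 c2 e2 oT (Cn_y m setT))).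
have hn := Cn_mul oT (Cn_cst m setT n%:R) hb.
apply: (Cn_mul oT hn); apply: (Cn_inv oT) => [x _|]; last exact: (Cn_add oT (Cn_cst m setT 1) hn).
by rewrite gt_eqF// /unc den_gt0.
Qed.

Lemma continuous_rect_test n : continuous (fun q : R * R => test n q.1 q.2).
Proof.
have cu : continuous (unc (fun _ : R => test n)).
  by move=> x; apply: differentiable_continuous; exact: (Cn_diff (Cn_rect_test 0 n)).
exact: (continuous_compo (@continuous_pairl _ _ (0 : R)) cu).
Qed.

Lemma cvg_rect_test q : test n q.1 q.2 @[n --> \oo] -->
  (\1_(orect (c1 - e1) (c1 + e1) (c2 - e2) (c2 + e2)) q : R).
Proof.
case: q => y w /=.
have inE (c e x : R) : (x \in `](c - e), (c + e)[) = (`|x - c| < e).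
  by rewrite in_itv/= ltr_distl.
have [lt1|ge1] := ltP `|y - c1| e1; last first.
  rewrite indicE memNset/=; last by rewrite /orect/= !inE ltNge ge1 => -[].
  rewrite (_ : (fun n => _) = fun=> 0) ?cvg_cst//; first exact: cvg_cst.
  by apply/funext => n; apply: rect_test_eq0; left.
have [lt2|ge2] := ltP `|w - c2| e2; last first.
  rewrite indicE memNset/=; last by rewrite /orect/= !inE => -[_]; rewrite ltNge ge2.
  rewrite (_ : (fun n => _) = fun=> 0) ?cvg_cst//; first exact: cvg_cst.
  by apply/funext => n; apply: rect_test_eq0; right.
rewrite indicE mem_set/=; last by rewrite /orect/= !inE lt1 lt2.
have b0 : 0 < b y w by rewrite mulr_gt0// bump1_gt0.
have tE n : test n y w = 1 - (1 + n%:R * b y w)^-1.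
  rewrite /test /rect_test -/(b y w); have := den_gt0 n y w; move: (b y w) => k hk.
  by field; rewrite gt_eqF.
rewrite (_ : (fun n => _) = fun n => 1 - (1 + n%:R * b y w)^-1); last exact/funext.
rewrite -[X in _ --> X]subr0; apply: cvgB; first exact: cvg_cst.
apply/cvgrPdist_lt => eps eps0; near=> n.
rewrite sub0r normrN ger0_norm ?invr_ge0 ?(ltW (den_gt0 _ _ _))//.
rewrite invf_plt ?posrE//.
have : (eps * b y w)^-1 < n%:R by near: n; exact: nbhs_infty_gtr.
rewrite invfM ltr_pdivrMr// => h; rewrite (lt_trans h)// ltrDr ltr01//.
Unshelve. all: by end_near. Qed.

End rectangle_tests.

Lemma orect_eq_of_tests (R : realType)
    (m1 m2 : {finite_measure set (plane R) -> \bar R}) (c1 e1 c2 e2 : R) :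
  (forall n, (\int[m1]_q (rect_test c1 e1 c2 e2 n q.1 q.2)%:E =
     \int[m2]_q (rect_test c1 e1 c2 e2 n q.1 q.2)%:E)%E) ->
  m1 (orect (c1 - e1) (c1 + e1) (c2 - e2) (c2 + e2)) =
  m2 (orect (c1 - e1) (c1 + e1) (c2 - e2) (c2 + e2)).
Proof.
move=> H; set A := orect _ _ _ _.
have mA : measurable (A : set (plane R)) by exact: measurable_orect.
have lim (m : {finite_measure set (plane R) -> \bar R}) :
    (\int[m]_q (rect_test c1 e1 c2 e2 n q.1 q.2)%:E)%E @[n --> \oo] --> m A.
  have [|||||_ _] := @dominated_convergence _ _ _ m setT measurableT
    (fun n q => (rect_test c1 e1 c2 e2 n q.1 q.2)%:E) (EFin \o \1_A) (EFin \o cst 1).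
  - move=> n; apply/measurable_EFinP; apply: (@continuous_measurable2 R).
    exact: continuous_rect_test.
  - by apply/measurable_EFinP; exact: measurable_indic.
  - apply: aeW => q _; apply: cvg_EFin; first by near=> n.
    exact: cvg_rect_test.
  - exact: finite_measure_integrable_cst.
  - apply: aeW => q n _; rewrite lee_fin ger0_norm ?rect_test_ge0//.
    exact: rect_test_le1.
  by rewrite integral_indic// setIT.
have E : (fun n => \int[m1]_q (rect_test c1 e1 c2 e2 n q.1 q.2)%:E)%E =
    (fun n => \int[m2]_q (rect_test c1 e1 c2 e2 n q.1 q.2)%:E)%E by apply/funext.
have := lim m1; rewrite E => l1.
exact: (cvg_unique _ l1 (lim m2)).
Unshelve. all: by end_near. Qed.

(** * Two measures that agree near a point *)

Lemma integral_zero_outside d (X : measurableType d) (R : realType)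
    (mu : {measure set X -> \bar R}) (A D : set X) (f : X -> \bar R) : A `<=` D ->
  (forall x, D x -> ~ A x -> f x = 0%E) ->
  (\int[mu]_(x in D) f x = \int[mu]_(x in A) f x)%E.
Proof.
move=> AD f0; rewrite integral_mkcond [RHS]integral_mkcond.
apply: eq_integral => x _; rewrite !patchE.
have [/set_mem Ax|nA] := boolP (x \in A); first by rewrite mem_set//; exact: AD.
by case: ifPn => // /set_mem Dx; apply: f0 => // Ax; move/negP: nA; apply; exact: mem_set.
Qed.

Section interval_arithmetic.
Context {R : realType}.
Implicit Types a b c e q k v y : R.

Lemma half_lt v : 0 < v -> v / 2 < v.
Proof. by move=> v0; lra. Qed.

Lemma out_itv c e q k y : q - k <= c - e -> c + e <= q + k ->
  k <= `|y - q| -> e <= `|y - c|.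
Proof.
by move=> h1 h2; rewrite !ler_normr => /orP[h|h]; apply/orP; [left|right]; lra.
Qed.

Lemma in_itv_lt c e q k v y : q - k <= c - e -> c + e <= q + k -> k < v ->
  `|y - c| <= e -> `|q - y| < v.
Proof.
by move=> h1 h2 h3; rewrite ler_distl distrC ltr_distl => /andP[h h']; apply/andP; split; lra.
Qed.

End interval_arithmetic.

Lemma within_mul (R : realType) (T : topologicalType) (A : set T) (f g : T -> R) :
  {within A, continuous f} -> {within A, continuous g} ->
  {within A, continuous (fun x => f x * g x)}.
Proof.
by move=> cf cg x; exact: (@continuousM _ (subspace A) f g x (cf x) (cg x)).
Qed.

Section pushforward_near.
Context {R : realType}.

Definition rect (a b c d : R) : set (R * R) := `[a, b]%classic `*` `[c, d]%classic.

Lemma integral_rect (a b c d : R) (f : R * R -> R) : a <= b -> c <= d ->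
  {within rect a b c d, continuous f} ->
  (\int[leb2 R]_(x in rect a b c d) (f x)%:E =
   (itg a b (fun x => itg c d (fun y => f (x, y))))%:E)%E.
Proof.
move=> ab cd cf; pose k x y := f (cl a b x, cl c d y).
have ck : continuous (fun p : R * R => k p.1 p.2).
  apply: (continuous_within_comp (c := fun p : R * R => (cl a b p.1, cl c d p.2)) cf).
    apply: continuous_pair.
      exact: (continuous_compo (@continuous_fst R R) (@continuous_cl _ _ _)).
    exact: (continuous_compo (@continuous_snd R R) (@continuous_cl _ _ _)).
  by move=> y; split; rewrite /= in_itv/=; exact: cl_itv.
have -> : itg a b (fun x => itg c d (fun y => f (x, y))) = itg a b (fun x => itg c d (k x)).
  by apply: eq_int => x hx; apply: eq_int => y hy; rewrite /k !cl_id.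
rewrite (int_int_prod a b cd ck).
have := integral12_prod_meas1 (integrable_rect a b c d ck).
rewrite /fubini_F => ->; rewrite integral_mkcond; apply: eq_integral => -[x y] _ /=.
rewrite !patchE; case: ifPn => // /set_mem[/=]; rewrite !in_itv/= => hx hy.
by rewrite /k !cl_id.
Qed.

Lemma orect_subball (a b c d q1 q2 k : R) : a < b -> c < d ->
  (forall y w, a < y < b -> c < w < d -> `|y - q1| < k /\ `|w - q2| < k) ->
  [/\ q1 - k <= a, b <= q1 + k, q2 - k <= c & d <= q2 + k].
Proof.
move=> ab cd H.
have mb (u v : R) : u < v -> u < (u + v) / 2 < v by move=> uv; apply/andP; split; lra.
have hy (y : R) : a < y < b -> q1 - k < y < q1 + k.
  by move=> h; have [+ _] := H y ((c + d) / 2) h (mb _ _ cd); rewrite ltr_distl.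
have hw (w : R) : c < w < d -> q2 - k < w < q2 + k.
  by move=> h; have [_] := H ((a + b) / 2) w (mb _ _ ab) h; rewrite ltr_distl.
have gen (u v lo hi : R) : u < v -> (forall y, u < y < v -> lo < y < hi) ->
    lo <= u /\ v <= hi.
  move=> uv h; split; apply/ler_addgt0Pr => e e0.
    have : u < u + Num.min e ((v - u) / 2) < v.
      have := ge_min e e ((v - u) / 2); have := ge_min ((v - u) / 2) e ((v - u) / 2).
      rewrite !lexx orbT /= => h1 h2; rewrite ltrDl lt_min e0 divr_gt0 ?subr_gt0//=.
      by move: h1 uv; clear; lra.
    move=> /h /andP[h1 _]; rewrite ltW// (lt_le_trans h1)// lerD2l ge_min lexx//.
  have : u < v - Num.min e ((v - u) / 2) < v.
    have := ge_min e e ((v - u) / 2); have := ge_min ((v - u) / 2) e ((v - u) / 2).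
    have : 0 < Num.min e ((v - u) / 2) by rewrite lt_min e0 divr_gt0 ?subr_gt0.
    rewrite !lexx orbT /= => h0 h1 h2.
    by move: h0 h1 uv; clear; lra.
  move=> /h /andP[_ h1]; rewrite -lerBlDr ltW// (le_lt_trans _ h1)// lerD2l lerN2.
  by rewrite ge_min lexx.
by have [] := gen _ _ _ _ ab hy; have [] := gen _ _ _ _ cd hw.
Qed.

Lemma Cn_glue n (U1 U2 : set (R * (R * R))) (f : R -> R -> R -> R) :
  Cn n U1 f -> Cn n U2 f -> Cn n (U1 `|` U2) f.
Proof.
Transparent Cn.
elim: n f => [|n IH] f [d1 h1] [d2 h2]; first by split=> // x []; auto.
split=> [x [/d1|/d2]//|i]; exact: (IH _ (h1 i) (h2 i)).
Opaque Cn.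
Qed.

Variables (m1 m2 : {finite_measure set (plane R) -> \bar R}).
Variables (dens : plane R -> R) (D : set (plane R)) (g1 g2 : R -> R -> R)
  (wt : plane R -> R) (m : R -> R -> R).
Let G (x : plane R) : plane R := (g1 x.1 x.2, g2 x.1 x.2).
Hypotheses (mdens : measurable_fun setT dens) (dens0 : forall q, 0 <= dens q).
Hypothesis m1E : forall A : set (plane R), measurable A ->
  (m1 A = \int[leb2 R]_(q in A) (dens q)%:E)%E.
Hypotheses (mD : measurable D) (mG : measurable_fun D G)
  (mwt : measurable_fun D wt) (wt0 : forall x, D x -> 0 <= wt x).
Hypothesis m2E : forall A : set (plane R), measurable A ->
  (m2 A = \int[leb2 R]_(x in D `&` G @^-1` A) (wt x)%:E)%E.
Variables (V W : set (R * R)) (nu : R -> R -> R * R) (r1 z1 q1 q2 e d1 : R).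
Hypotheses (oV : open V) (hm : Cn 1 [set p : R * (R * R) | V p.2] (fun _ => m)).
Hypothesis mdensE : {ae leb2 R, forall q, V q -> m q.1 q.2 = dens q}.
Hypotheses (oW : open W)
  (hg1 : Cn 2 [set p : R * (R * R) | W p.2] (fun _ => g1))
  (hg2 : Cn 2 [set p : R * (R * R) | W p.2] (fun _ => g2)).
Hypotheses (e0 : 0 < e) (Vq : V (q1, q2)).
Let B := rect (r1 - e) (r1 + e) (z1 - e) (z1 + e).
Hypotheses (BW : B `<=` W) (BD : B `<=` D).
Hypothesis sep : forall r z, B (r, z) -> (r, z) <> (r1, z1) ->
  0 < dot (nu r z) (r - r1, z - z1) /\
  0 < dot (nu r z) (g1 r z - q1, g2 r z - q2).
Hypotheses (cwt : {within B, continuous (wt : R * R -> R)})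
  (wtE : forall r z, B (r, z) -> V (g1 r z, g2 r z) ->
    wt (r, z) = m (g1 r z) (g2 r z) * jac g1 g2 r z).
Hypotheses (d10 : 0 < d1) (inj : forall r z, D (r, z) ->
  `|g1 r z - q1| < d1 -> `|g2 r z - q2| < d1 -> B (r, z)).

(** For a test function supported near (q1, q2), its integral against m1 is
    pulled back by the local change of variables, and against m2 by definition of
    an image; rectangles are limits of test functions. *)
Lemma pushforward_near : exists2 U, nbhs (q1, q2) U &
  forall a b c d, orect a b c d `<=` U -> m1 (orect a b c d) = m2 (orect a b c d).
Proof.
have BE r z : r1 - e <= r <= r1 + e -> z1 - e <= z <= z1 + e -> B (r, z).
  by move=> h1 h2; split; rewrite /= in_itv.
have [d [d0 de deg]] := @local_degree R g1 g2 W nu r1 z1 q1 q2 e oW hg1 hg2 e0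
  (fun r z h1 h2 => BW (BE r z h1 h2)) (fun r z h1 h2 => sep (BE r z h1 h2)).
have /nbhs_normP[v /= v0 hv] : nbhs (q1, q2) V by exact: open_nbhs_nbhs.
pose k := Num.min (Num.min d d1) (v / 2).
have k0 : 0 < k by rewrite !lt_min d0 d10 divr_gt0.
have kd : k <= d by rewrite !ge_min lexx.
have kd1 : k <= d1 by rewrite !ge_min lexx orbT.
have kv : k < v.
  have h : k <= v / 2 by rewrite !ge_min lexx orbT.
  by rewrite (le_lt_trans h)// half_lt.
exists (ball (q1, q2) k); first exact: nbhsx_ballx.
move=> a b c c' sub.
have [ab|ba] := ltP a b; last first.
  have -> : orect a b c c' = set0.
    apply/seteqP; split => // -[y w] [/=]; rewrite in_itv/= => /andP[h1 h2] _.
    by have := lt_trans h1 h2; rewrite ltNge ba.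
  by rewrite !measure0.
have [cc|cc] := ltP c c'; last first.
  have -> : orect a b c c' = set0.
    apply/seteqP; split => // -[y w] [/= _]; rewrite in_itv/= => /andP[h1 h2].
    by have := lt_trans h1 h2; rewrite ltNge cc.
  by rewrite !measure0.
have [qa qb qc qd] : [/\ q1 - k <= a, b <= q1 + k, q2 - k <= c & c' <= q2 + k].
  apply: orect_subball => // y w hy hw.
  have [|/= h1 h2] := sub (y, w); first by split; rewrite /= in_itv.
  by rewrite distrC; split => //; rewrite distrC.
pose c1 := (a + b) / 2; pose e1 := (b - a) / 2.
pose c2 := (c + c') / 2; pose e2 := (c' - c) / 2.
have [E1 E2 E3 E4] : [/\ a = c1 - e1, b = c1 + e1, c = c2 - e2 & c' = c2 + e2].
  by split; rewrite /c1 /e1 /c2 /e2; field.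
rewrite E1 E2 E3 E4; apply: orect_eq_of_tests => n.
pose f y w := rect_test c1 e1 c2 e2 n y w.
have f0 y w : k <= `|y - q1| \/ k <= `|w - q2| -> f y w = 0.
  move=> h; apply: rect_test_eq0; case: h => h; [left|right].
    by apply: out_itv h; rewrite -?E1 -?E2.
  by apply: out_itv h; rewrite -?E3 -?E4.
have mf : measurable_fun setT (fun q : plane R => f q.1 q.2).
  by apply: (@continuous_measurable2 R); exact: continuous_rect_test.
pose F y w := f y w * m y w.
have oT : open [set: R * (R * R)] by exact: openT.
have hF : Cn 1 setT (fun _ : R => F).
  pose U1 := [set p : R * (R * R) | V p.2].
  pose U2 := [set p : R * (R * R) | e1 < `|p.2.1 - c1| \/ e2 < `|p.2.2 - c2|].
  have oU1 : open U1.
    by apply: (@open_comp _ _ (fun p : R * (R * R) => p.2)) => // x _; exact: cvg_snd.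
  have c21 : continuous (fun p : R * (R * R) => `|p.2.1 - c1|).
    move=> p; apply: (@cvg_norm _ _ _ _ _ (fun p : R * (R * R) => p.2.1 - c1)).
    apply: cvgB; last exact: cvg_cst.
    exact: (continuous_compo (@continuous_snd _ _) (@continuous_fst _ _)).
  have c22 : continuous (fun p : R * (R * R) => `|p.2.2 - c2|).
    move=> p; apply: (@cvg_norm _ _ _ _ _ (fun p : R * (R * R) => p.2.2 - c2)).
    apply: cvgB; last exact: cvg_cst.
    exact: (continuous_compo (@continuous_snd _ _) (@continuous_snd _ _)).
  have oU2 : open U2.
    apply: openU.
      by apply: (@open_comp _ _ _ [set x | e1 < x]) => [p _|]; [exact: c21|exact: open_gt].
    by apply: (@open_comp _ _ _ [set x | e2 < x]) => [p _|]; [exact: c22|exact: open_gt].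
  have -> : [set: R * (R * R)] = U1 `|` U2.
    apply/esym/seteqP; split => // -[t [y w]] _.
    have [h1|h1] := ltP e1 `|y - c1|; first by right; left.
    have [h2|h2] := ltP e2 `|w - c2|; first by right; right.
    left; apply: hv; rewrite /= normr_prodE/= gt_max.
    rewrite (in_itv_lt _ _ kv h1) -?E1 -?E2// (in_itv_lt _ _ kv h2) -?E3 -?E4//.
  apply: Cn_glue.
    exact: (Cn_mul oU1 (sub_Cn (@subsetT _ _) (Cn_rect_test c1 e1 c2 e2 1 n)) hm).
  apply: (Cn_eq oU2 _ (Cn_cst 1 U2 0)) => -[t [y w]] hU.
  rewrite /unc/= /F /f rect_test_eq0 ?mul0r//.
  by case: hU => /= h; [left|right]; exact: ltW.
have cF : continuous (fun p : R * R => F p.1 p.2).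
  have cu : continuous (unc (fun _ : R => F)).
    by move=> x; apply: differentiable_continuous; exact: (Cn_diff hF).
  exact: (continuous_compo (@continuous_pairl _ _ (0 : R)) cu).
have F0 y w : d <= `|y - q1| \/ d <= `|w - q2| -> F y w = 0.
  move=> h; rewrite /F f0 ?mul0r//.
  by case: h => h; [left|right]; exact: (le_trans kd).
have ne (x : R) : x - e <= x + e by rewrite lerD2l (le_trans _ (ltW e0))// oppr_le0 ltW.
have outB x : D x -> ~ B x -> f (g1 x.1 x.2) (g2 x.1 x.2) = 0.
  case: x => r z /= Dx nB; apply: f0.
  have [h1|] := ltP `|g1 r z - q1| d1; last by left; exact: (le_trans kd1).
  have [h2|] := ltP `|g2 r z - q2| d1; last by right; exact: (le_trans kd1).
  by exfalso; apply: nB; exact: inj.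
have wtF r z : B (r, z) ->
    f (g1 r z) (g2 r z) * wt (r, z) = F (g1 r z) (g2 r z) * jac g1 g2 r z.
  move=> Bx; rewrite /F.
  have [h1|h] := ltP `|g1 r z - q1| k; last by rewrite f0 ?mul0r//; left.
  have [h2|h] := ltP `|g2 r z - q2| k; last by rewrite f0 ?mul0r//; right.
  rewrite wtE ?mulrA//; apply: hv; rewrite /= normr_prodE/= gt_max.
  by rewrite distrC (lt_trans h1)// distrC (lt_trans h2).
rewrite (@integral_weighted_pushforward _ _ _ _ R (leb2 R) m1 setT id dens)//; last first.
  by move=> A mA; rewrite setTI; exact: m1E.
rewrite (@integral_weighted_pushforward _ _ _ _ R (leb2 R) m2 D G wt)//.
rewrite [RHS](@integral_zero_outside _ (plane R) R (leb2 R) B D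
  (fun x => (f (G x).1 (G x).2 * wt x)%:E) BD); last first.
  by move=> x Dx nB; rewrite /G/= -/(f _ _) outB// mul0r.
have cB : {within B, continuous (fun x : R * R =>
    f (g1 x.1 x.2) (g2 x.1 x.2) * wt x)}.
  have cfg : {within B, continuous (fun x : R * R => f (g1 x.1 x.2) (g2 x.1 x.2))}.
    apply: continuous_in_subspaceT => x /set_mem Bx.
    have cg g : Cn 2 [set p : R * (R * R) | W p.2] (fun _ => g) ->
        {for x, continuous (fun p : R * R => g p.1 p.2)}.
      move=> hg.
      apply: (@continuous_comp _ _ _ (fun p : R * R => (0 : R, p)) (unc (fun _ : R => g))).
        exact: continuous_pairl.
      by apply: differentiable_continuous; apply: (Cn_diff hg); exact: BW.
    apply: (@continuous_comp _ _ _ (fun x : R * R => (g1 x.1 x.2, g2 x.1 x.2))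
      (fun p : R * R => f p.1 p.2)); last exact: continuous_rect_test.
    exact: (cvg_pair (cg _ hg1) (cg _ hg2)).
  exact: (within_mul cfg cwt).
transitivity (\int[leb2 R]_q (F q.1 q.2)%:E)%E.
  apply: ae_eq_integral => //.
  - by apply/measurable_EFinP; exact: measurable_funM.
  - by apply/measurable_EFinP; exact: continuous_measurable2.
  - apply: negligibleS mdensE; apply: subsetC => q h _ /=; congr EFin; rewrite /F -/(f _ _).
    have [Vq'|nV] := pselect (V q); first by rewrite h.
    have -> : f q.1 q.2 = 0; last by rewrite !mul0r.
    apply: f0; have [h1|] := ltP `|q.1 - q1| k; last by left.
    have [h2|] := ltP `|q.2 - q2| k; last by right.
    exfalso; apply: nV; case: q h h1 h2 => y w _ /= h1 h2.
    apply: hv; rewrite /= normr_prodE/= gt_max.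
    by rewrite distrC (lt_trans h1)// distrC (lt_trans h2).
rewrite (@integral_zero_outside _ (plane R) R (leb2 R) (rect (q1 - e) (q1 + e) (q2 - e) (q2 + e)) setT)//; last first.
  move=> [y w] _ nq; congr EFin => /=; apply: F0.
  have [h1|] := ltP `|y - q1| d; last by left.
  have [h2|] := ltP `|w - q2| d; last by right.
  exfalso; apply: nq; split; rewrite /= in_itv/= -ler_distl.
    by rewrite (le_trans _ de)// ltW.
  by rewrite (le_trans _ de)// ltW.
rewrite (integral_rect (ne q1) (ne q2) (continuous_subspaceT cF)).
rewrite (integral_rect (ne r1) (ne z1) cB); apply: (congr1 EFin).
rewrite -[LHS](deg F hF F0).
by apply: eq_int => r hr; apply: eq_int => z hz; rewrite -wtF//; exact: BE.
Qed.

End pushforward_near.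

(** * Smooth curves are negligible *)

Section null_curves.
Context {R : realType}.

Lemma leb2_rect (a b c d : R) : a <= b -> c <= d ->
  leb2 R (rect a b c d) = ((b - a) * (d - c))%:E.
Proof.
move=> ab cd; rewrite /rect product_measure1E; [|exact: measurable_itv|exact: measurable_itv].
have h (x y : R) : x <= y -> lebesgue_measure (`[x, y]%classic : set R) = (y - x)%:E.
  move=> xy; rewrite lebesgue_measure_itv/= lte_fin.
  have [//|yx] := ltP x y.
  by have -> : x = y by [apply/eqP; rewrite eq_le xy]; rewrite subrr.
by rewrite EFinM; apply: (congr2 (fun u v => u * v)%E); exact: h.
Qed.

Lemma negligible_of_small (A : set (plane R)) :
  (forall e : R, 0 < e -> exists2 B : set (plane R), measurable B &
    A `<=` B /\ (leb2 R B <= e%:E)%E) -> (leb2 R).-negligible A.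
Proof.
move=> H; have /choice[B hB] : forall n : nat, exists B : set (plane R),
    [/\ measurable B, A `<=` B & (leb2 R B <= (n.+1%:R^-1 : R)%:E)%E].
  by move=> n; have [|B mB [AB bB]] := H n.+1%:R^-1; [rewrite invr_gt0|exists B].
exists (\bigcap_n B n); split.
- by apply: bigcapT_measurable => n; have [] := hB n.
- apply/eqP; rewrite eq_le measure_ge0 andbT; apply/lee_addgt0Pr => e e0.
  rewrite add0e; pose n := Num.truncn e^-1.
  have [mB _ bB] := hB n.
  apply: (le_trans _ (le_trans bB _)).
    apply: le_measure; rewrite ?inE//; last exact: bigcap_inf.
    by apply: bigcapT_measurable => k; have [] := hB k.
  rewrite lee_fin invf_ple ?posrE//.
  have /truncn_itv/andP[_ h] : 0 <= e^-1 by rewrite invr_ge0 ltW.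
  exact: ltW.
- by move=> x Ax n _; have [_ AB _] := hB n; exact: AB.
Qed.

Lemma partition_near (a b x : R) (N : nat) : a <= x <= b -> (0 < N)%N ->
  exists2 i : 'I_N.+1, a <= a + (b - a) * (i%:R / N%:R) <= b &
    `|x - (a + (b - a) * (i%:R / N%:R))| <= (b - a) / N%:R.
Proof.
move=> /andP[ax xb] N0; have N0' : (0 : R) < N%:R by rewrite ltr0n.
have [ab|ab] := eqVneq a b.
  exists ord0; rewrite -ab subrr !mul0r addr0 ?lexx//.
  by move: ax xb; rewrite -ab => ? ?; rewrite normr_le0 subr_eq0 eq_le; apply/andP.
have ab' : 0 < b - a by rewrite subr_gt0 lt_neqAle ab (le_trans ax).
pose k := Num.truncn ((x - a) / (b - a) * N%:R).
have y0 : 0 <= (x - a) / (b - a) * N%:R.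
  by rewrite mulr_ge0 ?ler0n// divr_ge0 ?subr_ge0// ltW// -subr_gt0.
have /andP[k1 k2] := truncn_itv y0.
have kN : (k <= N)%N.
  rewrite -(ler_nat R) (le_trans k1)// ler_piMl ?ler0n//.
  by rewrite ler_pdivrMr// mul1r lerD2r.
have t1 : (k%:R / N%:R : R) * (b - a) <= x - a.
  by rewrite -ler_pdivlMr// ler_pdivrMr.
have t2 : x - a <= ((k%:R + 1) / N%:R) * (b - a).
  by rewrite -ler_pdivrMr// ler_pdivlMr// ltW// natr1.
have t3 : 0 <= (k%:R / N%:R : R) * (b - a).
  by rewrite mulr_ge0 ?divr_ge0 ?ler0n// ltW.
have kN1 : (k < N.+1)%N by [].
exists (Ordinal kN1) => /=.
  by rewrite mulrC lerDl t3/=; move: t1 xb; clear; lra.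
have E : (b - a) / N%:R = ((k%:R + 1) / N%:R) * (b - a) - (k%:R / N%:R) * (b - a).
  by ring.
rewrite E [(b - a) * _]mulrC; move: t1 t2.
move: (k%:R / N%:R * (b - a)) ((k%:R + 1) / N%:R * (b - a)) => u v h1 h2.
by rewrite ger0_norm; lra.
Qed.

(** A Lipschitz arc is covered by N + 1 squares of side O(1/N). *)
Lemma negligible_lipschitz_curve (f1 f2 : R -> R) (a b L : R) : 0 <= L ->
  (forall x y, a <= x <= b -> a <= y <= b ->
    `|f1 x - f1 y| <= L * `|x - y| /\ `|f2 x - f2 y| <= L * `|x - y|) ->
  (leb2 R).-negligible [set (f1 x, f2 x) | x in `[a, b]].
Proof.
move=> L0 lip; have [ba|ab] := ltP b a.
  rewrite (_ : [set _ | _ in _] = set0); first exact: negligible_set0.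
  apply/seteqP; split => // _ [x /= + _]; rewrite in_itv/= => /andP[h1 h2].
  by have := lt_le_trans ba (le_trans h1 h2); rewrite ltxx.
apply: negligible_of_small => e e0.
pose K := 8 * (L * (b - a)) ^+ 2.
have K0 : 0 <= K by rewrite mulr_ge0// sqr_ge0.
pose N := (Num.truncn (K / e)).+1.
have N0 : (0 < N)%N by [].
have N0' : (0 : R) < N%:R by rewrite ltr0n.
have KN : K / N%:R <= e.
  have /truncn_itv/andP[_ h] : 0 <= K / e by rewrite divr_ge0// ltW.
  rewrite ler_pdivrMr// mulrC -ler_pdivrMr//; exact: ltW.
pose h := L * ((b - a) / N%:R).
have h0 : 0 <= h by rewrite mulr_ge0// divr_ge0 ?subr_ge0// ltW.
pose x_ (i : nat) := a + (b - a) * (i%:R / N%:R).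
pose Q i : set (plane R) := rect (f1 (x_ i) - h) (f1 (x_ i) + h) (f2 (x_ i) - h) (f2 (x_ i) + h).
have mQ i : measurable (Q i) by apply: measurableX; exact: measurable_itv.
exists (\big[setU/set0]_(i < N.+1) Q i); first by apply: bigsetU_measurable.
split.
  move=> _ [x /= + <-]; rewrite in_itv/= => hx.
  have [i hi1 hi2] := partition_near hx N0.
  rewrite -bigcup_mkord; exists (val i); first exact: ltn_ord.
  have [l1 l2] := lip x (x_ i) hx hi1.
  have lh : L * `|x - x_ i| <= h by rewrite ler_wpM2l.
  by split; rewrite /= in_itv/= -ler_distl; [exact: le_trans l1 lh|exact: le_trans l2 lh].
apply: (@le_trans _ _ (\sum_(i < N.+1) leb2 R (Q i))%E).
  exact: (@Boole_inequality _ R (plane R) (leb2 R) Q N.+1 (fun i _ => mQ i)).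
have hh (x : R) : x - h <= x + h by rewrite lerD2l (le_trans _ h0)// oppr_le0.
under eq_bigr do rewrite leb2_rect//.
rewrite sumEFin lee_fin (le_trans _ KN)//.
have sq (u v : R) : (u + h - (u - h)) * (v + h - (v - h)) = 4 * h ^+ 2 by ring.
under eq_bigr do rewrite sq.
rewrite sumr_const card_ord -[leLHS]mulr_natl.
have -> : K / N%:R = (2 * N%:R) * (4 * h ^+ 2).
  by rewrite /K /h; field; rewrite gt_eqF.
apply: ler_wpM2r; first by rewrite mulr_ge0// sqr_ge0.
by rewrite -natrM ler_nat mulSn mul1n -addn1 leq_add2l.
Qed.

Lemma Cn_lipschitz (V : set (R * (R * R))) (f : R -> R -> R -> R) (t y a b : R) :
  Cn 1 V f -> (forall x, a <= x <= b -> V (t, (x, y))) ->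
  exists2 L : R, 0 <= L & forall x x', a <= x <= b -> a <= x' <= b ->
    `|f t x y - f t x' y| <= L * `|x - x'|.
Proof.
move=> hf hV.
pose f' x := D1 f t x y.
have df x : a <= x <= b -> is_derive x 1 (fun x => f t x y) (f' x).
  move=> hx; have := is_derive_unc (Cn_diff hf (hV x hx)) (is_derive_cst t x 1)
    (is_derive_id x 1) (is_derive_cst y x 1).
  by rewrite !mul0r mul1r add0r addr0.
have cf : {within `[a, b], continuous f'}.
  apply: continuous_in_subspaceT => x /set_mem/=; rewrite in_itv/= => hx.
  apply: (@continuous_comp _ _ _ (fun x : R => (t, (x, y))) (unc (D1 f))).
    exact: (cvg_pair (cvg_cst t) (cvg_pair cvg_id (cvg_cst y))).
  by apply: differentiable_continuous; apply: (Cn_diff (Cn_D1 hf)); exact: hV.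
have /compact_bounded[M [_ hM]] := continuous_compact cf (@segment_compact R a b).
have {}hM x : a <= x <= b -> `|f' x| <= `|M| + 1.
  move=> hx; apply: (hM (`|M| + 1)); first by rewrite (le_lt_trans (ler_norm M))// ltrDl.
  by exists x => //; rewrite /= in_itv.
exists (`|M| + 1); first by rewrite addr_ge0.
have main x x' : a <= x -> x < x' -> x' <= b ->
    `|f t x' y - f t x y| <= (`|M| + 1) * `|x' - x|.
  move=> ax xx xb.
  have sub z : x <= z <= x' -> a <= z <= b.
    by move=> /andP[h1 h2]; rewrite (le_trans ax h1) (le_trans h2 xb).
  have [z||c hc ->] := @MVT _ (fun x => f t x y) f' x x' xx.
  - by rewrite in_itv/= => /andP[h1 h2]; apply: df; apply: sub; rewrite !ltW.
  - apply: derivable_within_continuous => z; rewrite in_itv/= => hz.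
    by have d := df z (sub z hz); exact: ex_derive.
  rewrite normrM ler_wpM2r//; apply: hM; apply: sub.
  by move: hc; rewrite in_itv/= => /andP[h1 h2]; rewrite !ltW.
move=> x x' /andP[h1 h2] /andP[h3 h4].
have [xx|xx|->] := ltgtP x x'; last by rewrite !subrr normr0 mulr0.
  by rewrite distrC [`|x - _|]distrC; exact: main.
exact: main.
Qed.

Lemma negligible_curve (V : set (R * (R * R))) (f1 f2 : R -> R -> R -> R) (t y a b : R) :
  Cn 1 V f1 -> Cn 1 V f2 -> (forall x, a <= x <= b -> V (t, (x, y))) ->
  (leb2 R).-negligible [set (f1 t x y, f2 t x y) | x in `[a, b]].
Proof.
move=> h1 h2 hV.
have [L1 L10 l1] := Cn_lipschitz h1 hV; have [L2 L20 l2] := Cn_lipschitz h2 hV.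
apply: (@negligible_lipschitz_curve (fun x => f1 t x y) (fun x => f2 t x y) a b (L1 + L2)).
  by rewrite addr_ge0.
move=> x x' hx hx'; split.
  by rewrite (le_trans (l1 x x' hx hx'))// ler_wpM2r// lerDl.
by rewrite (le_trans (l2 x x' hx hx'))// ler_wpM2r// lerDr.
Qed.

End null_curves.

(** * Transport of mass in a moving region *)

(** The derivatives of r h, r h v, r h w in the coordinate l of
    r = r0 + l J(t, z): with k1 = l J_t and k2 = l J_z the derivatives of r. *)
Lemma flatten_algebra (K : comPzRingType)
    (Dtf1 Dlf2 Dzf3 J Jt Jz l r a v w at_ al az vl wl wz ht h1 h2 v1 w1 w2 : K) :
  Dtf1 = J * (r * at_ + a * (l * Jt)) + r * a * Jt ->
  Dlf2 = r * a * (vl - (Jt + Jz * w + l * (Jz * wl))) +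
    (v - l * (Jt + Jz * w)) * (r * al + a * J) ->
  Dzf3 = J * (r * a) * wz + w * (J * (r * az + a * (l * Jz)) + r * a * Jz) ->
  at_ = ht + l * Jt * h1 -> al = J * h1 -> az = l * Jz * h1 + h2 ->
  vl = J * v1 -> wl = J * w1 -> wz = l * Jz * w1 + w2 ->
  Dtf1 + Dlf2 + Dzf3 = J * (r * (ht + v * h1 + w * h2)) + a * (J * (v + r * v1 + r * w2)).
Proof. by move=> -> -> -> -> -> -> -> -> ->; ring. Qed.

Lemma within_comp (T U V : topologicalType) (A : set U) (B : set T) (f : U -> V)
    (c : T -> U) : {within A, continuous f} -> {within B, continuous c} ->
  (forall y, B y -> A (c y)) -> {within B, continuous (fun x => f (c x))}.
Proof.
move=> /subspace_continuousP cf /subspace_continuousP cc cA.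
apply/subspace_continuousP => x Bx.
apply: (@cvg_comp _ _ _ c f (within B (nbhs x)) (within A (nbhs (c x)))); last exact: cf (cA _ Bx).
move=> S wS; have h := cc x Bx _ wS.
exact: (@filterS _ (nbhs x) _ (fun y => B y -> A (c y) -> S (c y))
  (fun y => B y -> S (c y)) (fun y g By => g By (cA y By)) h).
Qed.

Section transport.
Context {R : realType}.
Variables (r0 H t1 t2 : R) (zeta : R -> R -> R).
Hypotheses (H0 : 0 < H) (t12 : t1 < t2).
Variable Z : set (R * (R * R)).
Hypotheses (oZ : open Z) (hZ : Cn 2 Z (fun t z _ => zeta t z))
  (subZ : forall t z, t1 <= t <= t2 -> 0 <= z <= H -> Z (t, (z, 0)))
  (zr : forall t z, t1 <= t <= t2 -> 0 <= z <= H -> r0 <= zeta t z).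

(** The coordinate l in [0, 1] runs from the inner cylinder to the free surface,
    so that the moving region becomes a fixed box. *)
Definition thick : R -> R -> R -> R := fun t _ z => zeta t z - r0.
Definition rad_of (t l z : R) := r0 + l * thick t l z.
Definition pull (f : R -> R -> R -> R) (t l z : R) := f t (rad_of t l z) z.

Let C := cbox t1 t2 0 1 0 H.
Let O := obox t1 t2 0 1 0 H.
Definition moving : set (R * (R * R)) :=
  [set x | t1 <= x.1 <= t2 /\ Gam r0 H zeta x.1 x.2].

Let U : set (R * (R * R)) := [set x | Z (x.1, (x.2.2, 0))].
Let oU : open U.
Proof.
apply: (@open_comp _ _ (fun p : R * (R * R) => (p.1, (p.2.2, 0 : R)))) => // x _.
have c22 : continuous (fun p : R * (R * R) => p.2.2).
  exact: (continuous_compo (@continuous_snd _ _) (@continuous_snd _ _)).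
exact: (cvg_pair cvg_fst (cvg_pair (c22 x) (cvg_cst (0 : R)))).
Qed.

Let CU : C `<=` U.
Proof. by move=> [t [l z]] [ht _ hz]; exact: subZ. Qed.

Let Cn_zeta : Cn 2 U (fun t (_ : R) z => zeta t z).
Proof.
exact: (@Cn_comp R 2 Z U (fun t z _ => zeta t z) (fun t _ _ => t) (fun _ _ z => z)
  (fun _ _ _ => 0) oU (fun x h => h) hZ (Cn_t 2 U) (Cn_y 2 U) (Cn_cst 2 U 0)).
Qed.

Let Cn_thick : Cn 2 U thick.
Proof. exact: (Cn_sub oU Cn_zeta (Cn_cst 2 U r0)). Qed.

Let Cn_rad_of : Cn 2 U rad_of.
Proof. exact: (Cn_add oU (Cn_cst 2 U r0) (Cn_mul oU (Cn_x 2 U) Cn_thick)). Qed.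

Let img (x : R * (R * R)) : R * (R * R) := (x.1, (unc rad_of x, x.2.2)).

Let img_moving x : C x -> moving (img x).
Proof.
case: x => t [l z] [/= ht /andP[l0 l1] hz].
split; [by []|split; [by []|rewrite /unc/= /rad_of /thick]].
have h : 0 <= zeta t z - r0 by rewrite subr_ge0; exact: zr.
by rewrite lerDl mulr_ge0//= -lerBrDl ler_piMl.
Qed.

Let cimg : {within C, continuous img}.
Proof.
apply: continuous_in_subspaceT => x /set_mem Cx.
have c22 : continuous (fun p : R * (R * R) => p.2.2).
  exact: (continuous_compo (@continuous_snd _ _) (@continuous_snd _ _)).
have cr : {for x, continuous (unc rad_of)}.
  by apply: differentiable_continuous; exact: (Cn_diff Cn_rad_of (CU Cx)).
exact: (cvg_pair cvg_fst (cvg_pair cr (c22 x))).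
Qed.

Let pull_within f : {within moving, continuous (unc f)} ->
  {within C, continuous (unc (pull f))}.
Proof. by move=> cf; exact: (within_comp cf cimg img_moving). Qed.

Let partial_id i x : unc (partial i (fun t _ _ => t)) x = (val i == 0%N)%:R :> R /\
  unc (partial i (fun _ _ z => z)) x = (val i == 2)%:R :> R.
Proof.
case: i => -[|[|[|//]]] hi; rewrite /partial/= /unc /Dt /D1 /D2.
- by split; [exact: derive1_id|rewrite derive1_cst].
- by split; rewrite derive1_cst.
- by split; [rewrite derive1_cst|exact: derive1_id].
Qed.

Let pull_partial i f x : U x -> differentiable (unc f) (img x) ->
  partial i (pull f) x.1 x.2.1 x.2.2 = (val i == 0%N)%:R * unc (Dt f) (img x) +
    unc (partial i rad_of) x * unc (D1 f) (img x) + (val i == 2)%:R * unc (D2 f) (img x).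
Proof.
move=> Ux df; have [p1 p2] := partial_id i x.
rewrite [LHS](@partial_comp _ f (fun t _ _ => t) rad_of (fun _ _ z => z))//.
- by rewrite p1 p2.
- exact: (Cn_diff (Cn_t 0 U) Ux).
- exact: (Cn_diff Cn_rad_of Ux).
- exact: (Cn_diff (Cn_y 0 U) Ux).
Qed.

Let thickt : R -> R -> R -> R := fun t l z => derive1 (zeta ^~ z) t.
Let thickz : R -> R -> R -> R := fun t l z => derive1 (zeta t) z.

Let thick_partial x : U x -> [/\ unc (Dt thick) x = unc thickt x,
  unc (D1 thick) x = 0 & unc (D2 thick) x = unc thickz x].
Proof.
move=> Ux; have dz := Cn_diff Cn_zeta Ux; have dc := Cn_diff (Cn_cst 0 U r0) Ux.
have h i := @partial_sub R i _ _ x dz dc.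
have h0 := h (@Ordinal 3 0 isT); have h1 := h (@Ordinal 3 1 isT).
have h2 := h (@Ordinal 3 2 isT).
split.
- by rewrite [LHS]h0 /unc /partial/= /Dt derive1_cst subr0.
- by rewrite [LHS]h1 /unc /partial/= /D1 !derive1_cst subr0.
- by rewrite [LHS]h2 /unc /partial/= /D2 derive1_cst subr0.
Qed.

Let rad_of_partial i x : U x -> unc (partial i rad_of) x =
  x.2.1 * unc (partial i thick) x + unc thick x * (val i == 1%N)%:R.
Proof.
move=> Ux; have dc := Cn_diff (Cn_cst 0 U r0) Ux; have dx := Cn_diff (Cn_x 0 U) Ux.
have dt := Cn_diff Cn_thick Ux.
rewrite [LHS](@partial_add R i (fun _ _ _ => r0) (fun t l z => l * thick t l z) x dc
  (differentiableM dx dt)).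
rewrite {2}/unc (partial_mul i dx dt) (_ : unc (partial i (fun _ _ _ => r0)) x = 0).
  rewrite add0r; congr (_ + _ * _); case: i => -[|[|[|//]]] hi; rewrite /partial/= /unc.
  - by rewrite /Dt derive1_cst.
  - by rewrite /D1 derive1_id.
  - by rewrite /D2 derive1_cst.
by case: i => -[|[|[|//]]] hi; rewrite /partial/= /unc /Dt /D1 /D2 derive1_cst.
Qed.

Variables (h v w : R -> R -> R -> R) (Uh Uv : set (R * (R * R))).
Hypotheses (oUh : open Uh) (hh : Cn 2 Uh h) (subh : moving `<=` Uh).
Hypotheses (oUv : open Uv) (hv : Cn 1 Uv v) (hw : Cn 1 Uv w)
  (subv : forall t l z, O (t, (l, z)) -> Uv (t, (rad_of t l z, z))).
Hypotheses (cv : {within moving, continuous (unc v)})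
  (cw : {within moving, continuous (unc w)}).
(** Components of the space-time flux of r h dr dz in the coordinates (t, l, z):
    the second one involves the normal velocity relative to the moving surfaces of
    constant l. *)
Definition flux1 t l z := thick t l z * (rad_of t l z * pull h t l z).
Definition flux2 t l z := rad_of t l z * pull h t l z *
  (pull v t l z - l * (derive1 (zeta ^~ z) t + derive1 (zeta t) z * pull w t l z)).
Definition flux3 t l z := thick t l z * (rad_of t l z * pull h t l z) * pull w t l z.
Definition transported t l z :=
  thick t l z * (rad_of t l z * pull (material (vfield v w) h) t l z).

Let hthickt : Cn 1 U thickt.
Proof. by apply: (Cn_eq oU _ (Cn_Dt Cn_thick)) => x /thick_partial[]. Qed.
Let hthickz : Cn 1 U thickz.
Proof. by apply: (Cn_eq oU _ (Cn_D2 Cn_thick)) => x /thick_partial[]. Qed.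

Let wU f : Cn 0 U f -> {within C, continuous (unc f)}.
Proof. by move=> hf; apply: (differentiable_within CU) => x Ux; exact: (Cn_diff hf Ux). Qed.

Let wmul f g : {within C, continuous (unc f)} -> {within C, continuous (unc g)} ->
  {within C, continuous (unc (fun t l z => f t l z * g t l z))}.
Proof. exact: within_mul. Qed.
Let wadd f g : {within C, continuous (unc f)} -> {within C, continuous (unc g)} ->
  {within C, continuous (unc (fun t l z => f t l z + g t l z))}.
Proof. by move=> cf cg x; exact: (@continuousD _ _ (subspace C) _ _ x (cf x) (cg x)). Qed.
Let wsub f g : {within C, continuous (unc f)} -> {within C, continuous (unc g)} ->
  {within C, continuous (unc (fun t l z => f t l z - g t l z))}.
Proof. by move=> cf cg x; exact: (@continuousB _ _ (subspace C) _ _ x (cf x) (cg x)). Qed.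

Let wh f : Cn 0 Uh f -> {within C, continuous (unc (pull f))}.
Proof.
move=> hf; apply: pull_within; apply: (differentiable_within subh) => x Ux.
exact: (Cn_diff hf Ux).
Qed.

Lemma continuous_transported : {within C, continuous (unc transported)}.
Proof.
have cJ := wU (CnW (CnW Cn_thick)); have cr := wU (CnW (CnW Cn_rad_of)).
have cpv := pull_within cv; have cpw := pull_within cw.
apply: (wmul cJ); apply: (wmul cr).
have c0 := wh (CnW (Cn_Dt hh)); have c1 := wh (CnW (Cn_D1 hh)).
have c2 := wh (CnW (Cn_D2 hh)).
exact: (wadd (wadd c0 (wmul cpv c1)) (wmul cpw c2)).
Qed.

Definition compression t l z := let r := rad_of t l z in
  v t r z + r * D1 v t r z + r * D2 w t r z.

(** The balance of mass in the coordinates (t, l, z) that flatten the moving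
    region: the space-time flux of r h dr dz changes by the transport of h and
    by the compression of the flow. *)
Lemma flux_divergence : [/\ Cn 1 O flux1, Cn 1 O flux2, Cn 1 O flux3 &
  forall t l z, O (t, (l, z)) -> Dt flux1 t l z + D1 flux2 t l z + D2 flux3 t l z =
    transported t l z + pull h t l z * (thick t l z * compression t l z)].
Proof.
have h0 : Cn 1 Uh h by exact: CnW hh.
have OU : O `<=` U by apply: subset_trans CU; exact: obox_sub_cbox.
have oO : open O by exact: obox_open.
have on n f : Cn n U f -> Cn n O f by exact: sub_Cn.
have pl f V : open V -> (forall x, O x -> V (img x)) -> Cn 1 V f -> Cn 1 O (pull f).
  move=> oV OV hf.
  exact: (@Cn_comp R 1 V O f (fun t _ _ => t) rad_of (fun _ _ z => z) oO OV hf
    (Cn_t 1 O) (on _ _ (CnW Cn_rad_of)) (Cn_y 1 O)).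
have OC : O `<=` C by exact: obox_sub_cbox.
have ph : Cn 1 O (pull h) by apply: (pl _ Uh) => // x Ox; exact: subh (img_moving (OC _ Ox)).
have pv : Cn 1 O (pull v) by apply: (pl _ Uv) => // -[t [l z]]; exact: subv.
have pw : Cn 1 O (pull w) by apply: (pl _ Uv) => // -[t [l z]]; exact: subv.
have nJ := on _ _ (CnW Cn_thick); have nr := on _ _ (CnW Cn_rad_of).
have nt := on _ _ hthickt; have nz := on _ _ hthickz.
have nrh := Cn_mul oO nr ph.
have nQ := Cn_add oO nt (Cn_mul oO nz pw).
have nlQ := Cn_mul oO (Cn_x 1 O) nQ.
have nS := Cn_sub oO pv nlQ.
split.
- exact: (Cn_mul oO nJ nrh).
- exact: (Cn_mul oO nrh nS).
- exact: (Cn_mul oO (Cn_mul oO nJ nrh) pw).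
move=> t l z Ox; pose x : R * (R * R) := (t, (l, z)).
have Ux := OU _ Ox; have d n f (hf : Cn n O f) := Cn_diff hf Ox.
have [J0 J1 J2] := thick_partial Ux.
have hx : Uh (img x) by exact: subh (img_moving (OC _ Ox)).
have vx : Uv (img x) by exact: subv.
have dh := Cn_diff hh hx; have dv := Cn_diff hv vx; have dw := Cn_diff hw vx.
pose i0 := @Ordinal 3 0 isT; pose i1 := @Ordinal 3 1 isT; pose i2 := @Ordinal 3 2 isT.
have R0 := rad_of_partial i0 Ux; have R1 := rad_of_partial i1 Ux.
have R2 := rad_of_partial i2 Ux.
have PH i := pull_partial i Ux dh; have PV := pull_partial i1 Ux dv.
have PW i := pull_partial i Ux dw.
have RH i := partial_mul i (d _ _ nr) (d _ _ ph).
have RH0 : unc (partial i0 (fun t l z => rad_of t l z * pull h t l z)) x =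
    rad_of t l z * Dt (pull h) t l z + pull h t l z * (l * thickt t l z).
  rewrite [LHS](RH i0) R0 (_ : unc (partial i0 thick) x = thickt t l z); last exact: J0.
  by rewrite mulr0 addr0.
have RH1 : unc (partial i1 (fun t l z => rad_of t l z * pull h t l z)) x =
    rad_of t l z * D1 (pull h) t l z + pull h t l z * thick t l z.
  rewrite [LHS](RH i1) R1 (_ : unc (partial i1 thick) x = 0); last exact: J1.
  by rewrite mulr0 add0r mulr1.
have RH2 : unc (partial i2 (fun t l z => rad_of t l z * pull h t l z)) x =
    rad_of t l z * D2 (pull h) t l z + pull h t l z * (l * thickz t l z).
  rewrite [LHS](RH i2) R2 (_ : unc (partial i2 thick) x = thickz t l z); last exact: J2.
  by rewrite mulr0 addr0.
apply: (@flatten_algebra _ (Dt flux1 t l z) (D1 flux2 t l z) (D2 flux3 t l z)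
  (thick t l z) (thickt t l z) (thickz t l z) l (rad_of t l z) (pull h t l z)
  (pull v t l z) (pull w t l z) (Dt (pull h) t l z) (D1 (pull h) t l z)
  (D2 (pull h) t l z) (D1 (pull v) t l z) (D1 (pull w) t l z) (D2 (pull w) t l z)
  (unc (Dt h) (img x)) (unc (D1 h) (img x)) (unc (D2 h) (img x))
  (unc (D1 v) (img x)) (unc (D1 w) (img x)) (unc (D2 w) (img x))).
- transitivity (thick t l z * unc (partial i0 (fun t l z => rad_of t l z * pull h t l z)) x
      + rad_of t l z * pull h t l z * unc (Dt thick) x).
    exact: (partial_mul i0 (d _ _ nJ) (d _ _ nrh)).
  by rewrite RH0 J0.
- transitivity (rad_of t l z * pull h t l z * unc (D1 (fun t l z =>
        pull v t l z - l * (thickt t l z + thickz t l z * pull w t l z))) x +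
      (pull v t l z - l * (thickt t l z + thickz t l z * pull w t l z)) *
      unc (partial i1 (fun t l z => rad_of t l z * pull h t l z)) x).
    exact: (partial_mul i1 (d _ _ nrh) (d _ _ nS)).
  rewrite RH1; apply: (congr2 (fun p q => rad_of t l z * pull h t l z * p + q)) => //.
  transitivity (D1 (pull v) t l z - unc (D1 (fun t l z =>
      l * (thickt t l z + thickz t l z * pull w t l z))) x).
    exact: (partial_sub i1 (d _ _ pv) (d _ _ nlQ)).
  apply: (congr1 (fun p => _ - p)).
  transitivity (l * unc (D1 (fun t l z => thickt t l z + thickz t l z * pull w t l z)) x +
      (thickt t l z + thickz t l z * pull w t l z) * unc (D1 (fun _ l _ => l)) x).
    exact: (partial_mul i1 (Cn_diff (Cn_x 1 O) Ox) (d _ _ nQ)).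
  have -> : unc (D1 (fun _ l _ => l)) x = 1 :> R by exact: derive1_id.
  have -> : unc (D1 (fun t l z => thickt t l z + thickz t l z * pull w t l z)) x =
      0 + (thickz t l z * D1 (pull w) t l z + pull w t l z * 0).
    transitivity (unc (D1 thickt) x + unc (D1 (fun t l z => thickz t l z * pull w t l z)) x).
      exact: (partial_add i1 (d _ _ nt) (d _ _ (Cn_mul oO nz pw))).
    have c0 (c : R) : derive1 (fun _ : R => c) l = 0 by exact: derive1_cst.
    apply: congr2; first exact: c0.
    transitivity (thickz t l z * D1 (pull w) t l z + pull w t l z * unc (D1 thickz) x).
      exact: (partial_mul i1 (d _ _ nz) (d _ _ pw)).
    by apply: (congr1 (fun p => _ + _ * p)); exact: c0.
  by rewrite mulr1 add0r mulr0 addr0 addrC.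
- transitivity (thick t l z * (rad_of t l z * pull h t l z) * D2 (pull w) t l z +
      pull w t l z * unc (D2 (fun t l z => thick t l z * (rad_of t l z * pull h t l z))) x).
    exact: (partial_mul i2 (d _ _ (Cn_mul oO nJ nrh)) (d _ _ pw)).
  apply: (congr1 (fun p => _ + _ * p)).
  transitivity (thick t l z * unc (partial i2 (fun t l z => rad_of t l z * pull h t l z)) x
      + rad_of t l z * pull h t l z * unc (D2 thick) x).
    exact: (partial_mul i2 (d _ _ nJ) (d _ _ nrh)).
  by rewrite RH2 J2.
- rewrite [LHS](PH i0) R0 (_ : unc (partial i0 thick) x = thickt t l z); last exact: J0.
  by rewrite /unc/=; ring.
- rewrite [LHS](PH i1) R1 (_ : unc (partial i1 thick) x = 0); last exact: J1.
  by rewrite /unc/=; ring.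
- rewrite [LHS](PH i2) R2 (_ : unc (partial i2 thick) x = thickz t l z); last exact: J2.
  by rewrite /unc/=; ring.
- rewrite [LHS]PV R1 (_ : unc (partial i1 thick) x = 0); last exact: J1.
  by rewrite /unc/=; ring.
- rewrite [LHS](PW i1) R1 (_ : unc (partial i1 thick) x = 0); last exact: J1.
  by rewrite /unc/=; ring.
- rewrite [LHS](PW i2) R2 (_ : unc (partial i2 thick) x = thickz t l z); last exact: J2.
  by rewrite /unc/=; ring.
Qed.

(** Conservation of r dr dz by an incompressible flow. *)
Lemma transport_flux : (forall t l z, O (t, (l, z)) ->
    thick t l z * compression t l z = 0) ->
  int3 t1 t2 0 1 0 H transported = flux t1 t2 0 1 0 H flux1 flux2 flux3.
Proof.
move=> incompressible; have [n1 n2 n3 dE] := flux_divergence.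
have cJ := wU (CnW (CnW Cn_thick)); have cr := wU (CnW (CnW Cn_rad_of)).
have cl_ := wU (Cn_x 0 U); have cjt := wU (CnW hthickt); have cjz := wU (CnW hthickz).
have ch := wh (CnW (CnW hh)); have cpv := pull_within cv; have cpw := pull_within cw.
have crh := wmul cr ch.
apply: (divergence t12 ltr01 H0).
- exact: (wmul cJ crh).
- exact: (wmul crh (wsub cpv (wmul cl_ (wadd cjt (wmul cjz cpw))))).
- exact: (wmul (wmul cJ crh) cpw).
- exact: continuous_transported.
- exact: n1.
- exact: n2.
- exact: n3.
by move=> t l z Ox; rewrite dE// incompressible// mulr0 addr0.
Qed.
End transport.

(** * The radial change of variables and derivatives along a flow *)

Section radial_coordinate.
Context {R : realType}.
Variable r0 : R.
Hypothesis r0_gt0 : 0 < r0.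

Lemma one_sub_s_of r : 0 < r -> 1 - 2 * r0 ^+ 2 * s_of r0 r = (r0 / r) ^+ 2.
Proof. by move=> r_gt0; rewrite /s_of; field; rewrite !gt_eqF. Qed.

Lemma one_sub_s_of_gt0 r : 0 < r -> 0 < 1 - 2 * r0 ^+ 2 * s_of r0 r.
Proof. by move=> r_gt0; rewrite one_sub_s_of// exprn_gt0// divr_gt0. Qed.

Lemma r_of_s_of r : 0 < r -> r_of r0 (s_of r0 r) = r.
Proof.
move=> r_gt0; rewrite /r_of one_sub_s_of// sqrtr_sqr ger0_norm; last first.
  by rewrite divr_ge0// ltW.
by field; rewrite !gt_eqF.
Qed.

Lemma s_of_r_of s : 0 < 1 - 2 * r0 ^+ 2 * s -> s_of r0 (r_of r0 s) = s.
Proof.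
move=> h; rewrite /s_of.
have -> : r_of r0 s ^- 2 = (1 - 2 * r0 ^+ 2 * s) / r0 ^+ 2.
  by rewrite -exprVn invf_div expr_div_n sqr_sqrtr// ltW.
by field; rewrite gt_eqF.
Qed.

Lemma r_of_gt0 s : 0 < 1 - 2 * r0 ^+ 2 * s -> 0 < r_of r0 s.
Proof. by move=> h; rewrite divr_gt0// sqrtr_gt0. Qed.

Lemma s_of_mono r r' : 0 < r -> 0 < r' -> (s_of r0 r < s_of r0 r') = (r < r').
Proof.
move=> h h'; rewrite /s_of ltr_pM2r// ltrD2l ltrN2 ltf_pV2 ?posrE ?exprn_gt0//.
by rewrite ltr_pXn2r// nnegrE ltW.
Qed.

Lemma s_of_r0 : s_of r0 r0 = 0.
Proof. by rewrite /s_of subrr mul0r. Qed.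

Lemma s_of_ge0 r : r0 <= r -> 0 <= s_of r0 r.
Proof.
rewrite le_eqVlt => /predU1P[<-|h]; first by rewrite s_of_r0.
by rewrite ltW// -s_of_r0 s_of_mono// (lt_trans r0_gt0).
Qed.

Lemma lt_domD s : (s < (2 * r0 ^+ 2)^-1) = (0 < 1 - 2 * r0 ^+ 2 * s).
Proof.
by rewrite subr_gt0 -[X in _ < X]div1r ltr_pdivlMr ?mulr_gt0 ?exprn_gt0// mulrC.
Qed.

Lemma domD_s_of H r z : strip r0 H (r, z) -> domD r0 H (s_of r0 r, z).
Proof.
move=> [/= hr hz]; split=> //=; rewrite s_of_ge0//= lt_domD one_sub_s_of_gt0//.
exact: lt_le_trans hr.
Qed.

Lemma is_derive_s_of (r : R) : 0 < r -> is_derive r 1 (s_of r0) (r ^- 3).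
Proof.
move=> r_gt0; have r0' : r != 0 by rewrite gt_eqF.
have d2 : is_derive r 1 (fun r : R => r * r) (r *: 1 + r *: 1) by apply: is_deriveM.
have d3 : is_derive r 1 (fun r : R => (r * r)^-1)
    (- (r * r) ^- 2 *: (r *: 1 + r *: 1)).
  by apply: (is_deriveV (f := fun r : R => r * r)); rewrite mulf_neq0.
have d4 : is_derive r 1 (fun r : R => 2^-1 *: (r0 ^- 2 - (r * r)^-1))
   (2^-1 *: (0 - - (r * r) ^- 2 *: (r *: 1 + r *: 1))).
  by apply: is_deriveZ; apply: is_deriveB.
have -> : s_of r0 = fun r : R => 2^-1 *: (r0 ^- 2 - (r * r)^-1).
  by apply/funext => x; rewrite /s_of mulrC -expr2.
apply: (is_derive_eq d4); rewrite /GRing.scale/=; field.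
by rewrite r0'.
Qed.

Lemma Cn_s_of n (V : set (R * (R * R))) f : open V -> (forall x, V x -> unc f x != 0) ->
  Cn n V f -> Cn n V (fun t x y => s_of r0 (f t x y)).
Proof.
move=> oV f0 hf.
have hv := Cn_inv oV f0 hf.
have h2 := Cn_sub oV (Cn_cst n V (r0 ^- 2)) (Cn_mul oV hv hv).
apply: (Cn_eq oV _ (Cn_mul oV h2 (Cn_cst n V 2^-1))) => x Vx.
by rewrite /unc /s_of -invfM expr2.
Qed.

Lemma Cn_r_of n (V : set (R * (R * R))) f : open V ->
  (forall x, V x -> 0 < 1 - 2 * r0 ^+ 2 * unc f x) ->
  Cn n V f -> Cn n V (fun t x y => r_of r0 (f t x y)).
Proof.
move=> oV f0 hf.
have h1 := Cn_sub oV (Cn_cst n V 1) (Cn_mul oV (Cn_cst n V (2 * r0 ^+ 2)) hf).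
have h2 := Cn_sqrt oV f0 h1.
apply: (Cn_mul oV (Cn_cst n V r0)); apply: (Cn_inv oV) h2 => x Vx.
by rewrite /unc gt_eqF// sqrtr_gt0; exact: f0.
Qed.

End radial_coordinate.

Section linear_combinations.
Context {K : comPzRingType}.
Variables a b c d e h p q f g k : K.

Lemma alg_add : (a + b) + p * (c + d) + q * (e + h) = (a + p * c + q * e) + (b + p * d + q * h).
Proof. by ring. Qed.

Lemma alg_mul : (f * a + g * b) + p * (f * c + g * d) + q * (f * e + g * h) =
  f * (a + p * c + q * e) + g * (b + p * d + q * h).
Proof. by ring. Qed.

Lemma alg_comp : (1 * k + a * f + b * g) + p * (0 * k + c * f + d * g) +
  q * (0 * k + e * f + h * g) = k + (a + p * c + q * e) * f + (b + p * d + q * h) * g.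
Proof. by ring. Qed.

End linear_combinations.

Section material_rules.
Context {R : realType}.
Variables (X : R -> R -> R -> R * R) (t r z : R).
Let x : R * (R * R) := (t, (r, z)).

Let i0 : 'I_3 := @Ordinal 3 0 isT.
Let i1 : 'I_3 := @Ordinal 3 1 isT.
Let i2 : 'I_3 := @Ordinal 3 2 isT.

Lemma materialE f : material X f t r z =
  unc (partial i0 f) x + (X t r z).1 * unc (partial i1 f) x +
  (X t r z).2 * unc (partial i2 f) x.
Proof. by []. Qed.

Lemma material_near f g : (\forall y \near x, unc f y = unc g y) ->
  material X f t r z = material X g t r z.
Proof.
move=> h; rewrite !materialE.
have E i : unc (partial i f) x = unc (partial i g) x by exact: (near_partial i h).
by rewrite !E.
Qed.

Lemma material_add f g : differentiable (unc f) x -> differentiable (unc g) x ->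
  material X (fun t r z => f t r z + g t r z) t r z =
  material X f t r z + material X g t r z.
Proof.
move=> df dg; rewrite !materialE.
have E i : unc (partial i (fun t r z => f t r z + g t r z)) x =
  unc (partial i f) x + unc (partial i g) x by exact: (partial_add i df dg).
rewrite (E i0) (E i1) (E i2); exact: alg_add.
Qed.

Lemma material_mul f g : differentiable (unc f) x -> differentiable (unc g) x ->
  material X (fun t r z => f t r z * g t r z) t r z =
  f t r z * material X g t r z + g t r z * material X f t r z.
Proof.
move=> df dg; rewrite !materialE.
have E i : unc (partial i (fun t r z => f t r z * g t r z)) x =
  f t r z * unc (partial i g) x + g t r z * unc (partial i f) x.
  exact: (partial_mul i df dg).
rewrite (E i0) (E i1) (E i2); exact: alg_mul.
Qed.

Lemma material_cst c : material X (fun _ _ _ => c) t r z = 0.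
Proof. by rewrite /material /Dt /D1 /D2 !derive1_cst !mulr0 !addr0. Qed.

Lemma material_fst : material X (fun _ r _ => r) t r z = (X t r z).1.
Proof.
have p0 : unc (partial i0 (fun _ r _ => r)) x = 0 :> R.
  by rewrite /partial/= /unc /Dt derive1_cst.
have p1 : unc (partial i1 (fun _ r _ => r)) x = 1 :> R by exact: derive1_id.
by rewrite materialE p0 p1 mulr0 mulr1 addr0 add0r.
Qed.

(** The chain rule along the motion: the image of the flow of X under
    (t, r, z) |-> (t, (g1, g2)) moves with the velocity (D g1, D g2). *)
Lemma material_comp f g1 g2 : differentiable (unc f) (t, (g1 t r z, g2 t r z)) ->
  differentiable (unc g1) x -> differentiable (unc g2) x ->
  material X (fun t r z => f t (g1 t r z) (g2 t r z)) t r z =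
  Dt f t (g1 t r z) (g2 t r z) +
  material X g1 t r z * D1 f t (g1 t r z) (g2 t r z) +
  material X g2 t r z * D2 f t (g1 t r z) (g2 t r z).
Proof.
move=> df d1 d2; rewrite !materialE.
have dt : differentiable (unc (fun t _ _ : R => t)) x by exact: (Cn_diff (Cn_t 0 setT) _).
have E i : unc (partial i (fun t r z => f t (g1 t r z) (g2 t r z))) x =
   unc (partial i (fun t _ _ => t)) x * Dt f t (g1 t r z) (g2 t r z) +
   unc (partial i g1) x * D1 f t (g1 t r z) (g2 t r z) +
   unc (partial i g2) x * D2 f t (g1 t r z) (g2 t r z).
  exact: (@partial_comp _ f (fun t _ _ => t) g1 g2 x i df dt d1 d2).
have p0 : unc (partial i0 (fun t _ _ => t)) x = 1 :> R by exact: derive1_id.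
have p1 : unc (partial i1 (fun t _ _ => t)) x = 0 :> R.
  by rewrite /partial/= /unc /D1 derive1_cst.
by rewrite (E i0) (E i1) (E i2) p0 p1; exact: alg_comp.
Qed.

End material_rules.

Section fluid_domain.
Context {R : realType}.
Variables (r0 H T : R) (zeta : R -> R -> R) (Z : set (R * (R * R))).
Hypotheses (oZ : open Z) (hZ : Cn 0 Z (fun t z _ => zeta t z))
  (subZ : forall t z, 0 <= t <= T -> 0 <= z <= H -> Z (t, (z, 0))).

Definition fluid_int : set (R * (R * R)) :=
  [set x | 0 < x.1 < T /\ Gam_int r0 H zeta x.1 x.2].

Lemma open_fluid_int : open fluid_int.
Proof.
rewrite openE => -[t [r z]] [/= ht [/= hz hr]].
have c1 : {for (t, (r, z)), continuous (fun x : R * (R * R) => x.1)} by exact: cvg_fst.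
have c21 : {for (t, (r, z)), continuous (fun x : R * (R * R) => x.2.1)}.
  exact: (continuous_compo (@continuous_snd _ _) (@continuous_fst _ _)).
have c22 : {for (t, (r, z)), continuous (fun x : R * (R * R) => x.2.2)}.
  exact: (continuous_compo (@continuous_snd _ _) (@continuous_snd _ _)).
have cz : {for (t, (r, z)), continuous (fun x : R * (R * R) => zeta x.1 x.2.2 - x.2.1)}.
  have cc : {for (t, (r, z)), continuous (fun x : R * (R * R) => zeta x.1 x.2.2)}.
    apply: (@continuous_comp _ _ _ (fun x : R * (R * R) => (x.1, (x.2.2, 0 : R)))
      (unc (fun t z _ => zeta t z))).
      exact: (cvg_pair c1 (cvg_pair c22 (cvg_cst (0 : R)))).
    apply: differentiable_continuous; apply: (Cn_diff hZ); apply: subZ => /=.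
      by move: ht => /andP[? ?]; rewrite !ltW.
    by move: hz => /andP[? ?]; rewrite !ltW.
  exact: (cvgB cc c21).
have gt_near (f : R * (R * R) -> R) (a : R) : {for (t, (r, z)), continuous f} ->
    a < f (t, (r, z)) -> \forall x \near (t, (r, z)), a < f x.
  move=> cf af; have h : nbhs (f (t, (r, z))) [set y : R | a < y].
    by apply: open_nbhs_nbhs; split => //; exact: open_gt.
  exact: (cf _ h).
have lt_near (f : R * (R * R) -> R) (a : R) : {for (t, (r, z)), continuous f} ->
    f (t, (r, z)) < a -> \forall x \near (t, (r, z)), f x < a.
  move=> cf af; have h : nbhs (f (t, (r, z))) [set y : R | y < a].
    by apply: open_nbhs_nbhs; split => //; exact: open_lt.
  exact: (cf _ h).
move: ht hz hr => /andP[h1 h2] /andP[h3 h4] /andP[h5 h6].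
have n1 := gt_near _ _ c1 h1; have n2 := lt_near _ _ c1 h2.
have n3 := gt_near _ _ c22 h3; have n4 := lt_near _ _ c22 h4.
have n5 := gt_near _ _ c21 h5.
have h7 : 0 < zeta t z - r by rewrite subr_gt0.
have n6 := gt_near _ _ cz h7.
near=> x.
have m1 : 0 < x.1 by near: x. have m2 : x.1 < T by near: x.
have m3 : 0 < x.2.2 by near: x. have m4 : x.2.2 < H by near: x.
have m5 : r0 < x.2.1 by near: x.
have m6 : 0 < zeta x.1 x.2.2 - x.2.1 by near: x.
by rewrite /fluid_int/= /Gam_int/= m1 m2 m3 m4 m5 -[_ < zeta _ _]subr_gt0 m6.
Unshelve. all: by end_near. Qed.

End fluid_domain.

(** * Potentials in the radial coordinate *)

Lemma open_preimage_on (S T : topologicalType) (V : set S) (U : set T) (f : S -> T) :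
  open V -> open U -> (forall x, V x -> {for x, continuous f}) ->
  open (V `&` f @^-1` U).
Proof.
move=> oV oU cf; rewrite openE => x [Vx Ux].
apply: filterI; first exact: open_nbhs_nbhs.
by apply: (cf x Vx); apply: open_nbhs_nbhs.
Qed.

Lemma continuous_triple (R : realType) (T : topologicalType) (f g h : T -> R) (x : T) :
  {for x, continuous f} -> {for x, continuous g} -> {for x, continuous h} ->
  {for x, continuous (fun x => (f x, (g x, h x)))}.
Proof. by move=> cf cg ch; exact: (cvg_pair cf (cvg_pair cg ch)). Qed.

Section potential.
Context {R : realType}.
Variables (r0 Om : R).
Hypothesis r0_gt0 : 0 < r0.

(** Functions of (s, z) seen in the physical variables. *)
Definition pulled (f : R -> R -> R -> R) : R -> R -> R -> R :=
  fun t r z => f t (s_of r0 r) z.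

Definition pulled_dom (U : set (R * (R * R))) : set (R * (R * R)) :=
  [set x | 0 < x.2.1] `&` [set x | U (x.1, (s_of r0 x.2.1, x.2.2))].

Let c22 : continuous (fun p : R * (R * R) => p.2.2).
Proof. exact: (continuous_compo (@continuous_snd _ _) (@continuous_snd _ _)). Qed.
Let c21 : continuous (fun p : R * (R * R) => p.2.1).
Proof. exact: (continuous_compo (@continuous_snd _ _) (@continuous_fst _ _)). Qed.

Let pos : set (R * (R * R)) := [set x | 0 < x.2.1].
Let opos : open pos.
Proof.
by apply: (@open_comp _ _ (fun x : R * (R * R) => x.2.1) [set y : R | 0 < y]) => [x _|];
  [exact: c21|exact: open_gt].
Qed.
Let Cn_spos n : Cn n pos (fun _ r _ => s_of r0 r).
Proof.
apply: (Cn_s_of r0 opos) (Cn_x n pos) => x hx.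
by rewrite /unc gt_eqF.
Qed.

Lemma open_pulled_dom U : open U -> open (pulled_dom U).
Proof.
move=> oU.
apply: (@open_preimage_on (R * (R * R))%type (R * (R * R))%type pos U
  (fun x : R * (R * R) => (x.1, (s_of r0 x.2.1, x.2.2)))) => // x hx.
have cs : {for x, continuous (fun x : R * (R * R) => s_of r0 x.2.1)}.
  by apply: differentiable_continuous; exact: (Cn_diff (Cn_spos 0) hx).
have c1 : {for x, continuous (fun x : R * (R * R) => x.1)} by exact: cvg_fst.
apply: continuous_triple; [exact: c1|exact: cs|exact: c22].
Qed.

Lemma Cn_pulled n U f : open U -> Cn n U f -> Cn n (pulled_dom U) (pulled f).
Proof.
move=> oU hf; have oV := open_pulled_dom oU.
apply: (@Cn_comp R n U (pulled_dom U) f (fun t _ _ => t) (fun _ r _ => s_of r0 r)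
  (fun _ _ z => z) oV _ hf (Cn_t n _) _ (Cn_y n _)); first by move=> x [].
by apply: sub_Cn (Cn_spos n) => x [].
Qed.

Lemma pulled_partial f t r z : 0 < r ->
  differentiable (unc f) (t, (s_of r0 r, z)) ->
  [/\ differentiable (unc (pulled f)) (t, (r, z)),
      D1 (pulled f) t r z = D1 f t (s_of r0 r) z * r ^- 3 &
      D2 (pulled f) t r z = D2 f t (s_of r0 r) z].
Proof.
move=> r_gt0 df.
have ds : differentiable (unc (fun _ r _ => s_of r0 r)) (t, (r, z)).
  exact: (Cn_diff (Cn_spos 0)).
have dt : differentiable (unc (fun t _ _ : R => t)) (t, (r, z)).
  exact: (Cn_diff (Cn_t 0 setT)).
have dz : differentiable (unc (fun _ _ z : R => z)) (t, (r, z)).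
  exact: (Cn_diff (Cn_y 0 setT)).
split.
- exact: (@differentiable_unc_comp R f (fun t _ _ => t) (fun _ r _ => s_of r0 r)
    (fun _ _ z => z) (t, (r, z))).
- have h := is_derive_unc df (is_derive_cst t r 1) (is_derive_s_of r0 r_gt0)
    (is_derive_cst z r 1).
  rewrite [LHS]derive1E (@derive_val _ _ _ _ _ _ _ h).
  by rewrite /unc/= !mul0r add0r addr0 mulrC.
- by [].
Qed.

Lemma phi_of_partial P t r z : 0 < r -> differentiable (unc P) (t, (s_of r0 r, z)) ->
  [/\ differentiable (unc (phi_of r0 Om P)) (t, (r, z)),
      D1 (phi_of r0 Om P) t r z = D1 P t (s_of r0 r) z * r ^- 3 - Om ^+ 2 * r &
      D2 (phi_of r0 Om P) t r z = D2 P t (s_of r0 r) z].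
Proof.
move=> r_gt0 dP; have [d1 e1 e2] := pulled_partial r_gt0 dP.
pose k : R -> R -> R -> R := fun _ r _ => Om ^+ 2 * r ^+ 2 / 2.
have hk : Cn 1 setT k.
  have oT : open [set: R * (R * R)] by exact: openT.
  apply: (Cn_eq oT _ (Cn_mul oT (Cn_mul oT (Cn_cst 1 setT (Om ^+ 2))
    (Cn_mul oT (Cn_x 1 setT) (Cn_x 1 setT))) (Cn_cst 1 setT 2^-1))) => x _.
  by rewrite /unc /k expr2.
have dk : differentiable (unc k) (t, (r, z)) by exact: (Cn_diff hk).
have k1 : D1 k t r z = Om ^+ 2 * r.
  have d2 : is_derive r 1 (fun r : R => r * r) (r *: 1 + r *: 1) by apply: is_deriveM.
  have d3 : is_derive r 1 (fun r : R => (Om ^+ 2 / 2) *: (r * r))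
    ((Om ^+ 2 / 2) *: (r *: 1 + r *: 1)) by apply: is_deriveZ.
  rewrite /D1 (_ : (fun a => k t a z) = fun r : R => (Om ^+ 2 / 2) *: (r * r)).
    by rewrite derive1E (@derive_val _ _ _ _ _ _ _ d3) /GRing.scale/=; field.
  by apply/funext => x; rewrite /k /GRing.scale/=; ring.
have k2 : D2 k t r z = 0 by exact: derive1_cst.
split.
- exact: (differentiableB d1 dk).
- rewrite -e1 -k1; exact: (partial_sub (@Ordinal 3 1 isT) d1 dk).
- rewrite -e2 -[RHS]subr0 -k2; exact: (partial_sub (@Ordinal 3 2 isT) d1 dk).
Qed.

End potential.

(** The radial balance E3, in terms of the angular momentum u r + Om r^2. *)
Lemma balanceE (K : fieldType) (u r Om G : K) : r != 0 ->
  (u ^+ 2 / r + 2 * Om * u = G * r ^- 3 - Om ^+ 2 * r) <->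
  ((u * r + r ^+ 2 * Om) ^+ 2 = G).
Proof.
move=> r0; split=> [h|<-]; last by field.
have -> : G = (u ^+ 2 / r + 2 * Om * u + Om ^+ 2 * r) * r ^+ 3 by rewrite h; field.
by field.
Qed.

(** * The velocity in the dual variables *)

Lemma near_radius_gt0 (R : realType) (t r z : R) : 0 < r ->
  \forall y \near (t, (r, z)), 0 < y.2.1.
Proof.
move=> r_gt0.
have o : open [set x : R * (R * R) | 0 < x.2.1].
  apply: (@open_comp _ _ (fun x : R * (R * R) => x.2.1) [set y : R | 0 < y]).
    by move=> x _; exact: (continuous_compo (@continuous_snd _ _) (@continuous_fst _ _)).
  exact: open_gt.
by apply: open_nbhs_nbhs; split.
Qed.

Section forward_potential.
Context {R : realType}.
Variables (r0 H Om T : R).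
Hypothesis r0_gt0 : 0 < r0.

Lemma r_of_ge s : 0 <= s -> 0 < 1 - 2 * r0 ^+ 2 * s -> r0 <= r_of r0 s.
Proof.
move=> s0 h; rewrite /r_of ler_pdivlMr ?sqrtr_gt0// ler_piMr ?(ltW r0_gt0)//.
rewrite -[leRHS]sqrtr1; apply: ler_wsqrtr; rewrite gerBl mulr_ge0// mulr_ge0//.
by rewrite exprn_ge0// ltW.
Qed.

Let c22 : continuous (fun p : R * (R * R) => p.2.2).
Proof. exact: (continuous_compo (@continuous_snd _ _) (@continuous_snd _ _)). Qed.
Let c21 : continuous (fun p : R * (R * R) => p.2.1).
Proof. exact: (continuous_compo (@continuous_snd _ _) (@continuous_fst _ _)). Qed.

Definition sdom : set (R * (R * R)) := [set x | 0 < 1 - 2 * r0 ^+ 2 * x.2.1].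

Lemma open_sdom : open sdom.
Proof.
apply: (@open_comp _ _ (fun x : R * (R * R) => 1 - 2 * r0 ^+ 2 * x.2.1) [set y : R | 0 < y]);
  last exact: open_gt.
move=> x _; apply: cvgB; first exact: cvg_cst.
by apply: cvgM; [exact: cvg_cst|exact: c21].
Qed.

Lemma Cn_r_of_snd n : Cn n sdom (fun _ s _ => r_of r0 s).
Proof. by apply: (Cn_r_of open_sdom) (Cn_x n sdom) => x. Qed.

Lemma continuous_r_of x : sdom x ->
  {for x, continuous (fun x : R * (R * R) => (x.1, (r_of r0 x.2.1, x.2.2)))}.
Proof.
move=> hx.
have cs : {for x, continuous (fun x : R * (R * R) => r_of r0 x.2.1)}.
  by apply: differentiable_continuous; exact: (Cn_diff (Cn_r_of_snd 0) hx).
by apply: continuous_triple; [exact: cvg_fst|exact: cs|exact: c22].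
Qed.

Lemma P_of_smooth phi :
  smooth_on [set x : R * (R * R) | 0 <= x.1 <= T /\ strip r0 H x.2] phi ->
  exists U, [/\ open U, [set x : R * (R * R) | 0 <= x.1 <= T /\ domD r0 H x.2] `<=` U &
    forall n, Cn n U (P_of r0 Om phi)].
Proof.
move=> /smooth_onP[W [oW subW hW]].
pose U := sdom `&` (fun x : R * (R * R) => (x.1, (r_of r0 x.2.1, x.2.2))) @^-1` W.
have oU : open U by apply: open_preimage_on oW continuous_r_of; exact: open_sdom.
exists U; split=> //.
  move=> [t [s z]] [/= ht [/= /andP[s0 s1] hz]].
  have h : 0 < 1 - 2 * r0 ^+ 2 * s by rewrite -lt_domD.
  by split => //; apply: subW; split => //; split => //=; exact: r_of_ge.
move=> n; have hr : Cn n U (fun _ s _ => r_of r0 s).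
  by apply: sub_Cn (Cn_r_of_snd n) => x [].
have h1 : Cn n U (fun t s z => phi t (r_of r0 s) z).
  by apply: (@Cn_comp R n W U phi (fun t _ _ => t) (fun _ s _ => r_of r0 s)
    (fun _ _ z => z) oU _ (hW n) (Cn_t n _) hr (Cn_y n _)) => x [].
have h2 := Cn_mul oU (Cn_mul oU (Cn_cst n U (Om ^+ 2)) (Cn_mul oU hr hr)) (Cn_cst n U 2^-1).
apply: (Cn_eq oU _ (Cn_add oU h1 h2)) => x _.
by rewrite /unc /P_of -expr2.
Qed.

Lemma phi_of_P_of phi t r z : 0 < r -> phi_of r0 Om (P_of r0 Om phi) t r z = phi t r z.
Proof. by move=> r_gt0; rewrite /phi_of /P_of r_of_s_of// addrK. Qed.

Lemma phi_partial phi t r z : 0 < r ->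
  differentiable (unc (P_of r0 Om phi)) (t, (s_of r0 r, z)) ->
  D1 phi t r z = D1 (P_of r0 Om phi) t (s_of r0 r) z * r ^- 3 - Om ^+ 2 * r /\
  D2 phi t r z = D2 (P_of r0 Om phi) t (s_of r0 r) z.
Proof.
move=> r_gt0 dP; have [_ <- <-] := phi_of_partial Om r_gt0 dP.
have h : \forall y \near (t, (r, z)), unc phi y = unc (phi_of r0 Om (P_of r0 Om phi)) y.
  apply: filterS (near_radius_gt0 t z r_gt0) => -[t' [r' z']] /= hr.
  by rewrite /unc/= phi_of_P_of.
split; first exact: (near_partial (@Ordinal 3 1 isT) h).
exact: (near_partial (@Ordinal 3 2 isT) h).
Qed.

End forward_potential.

Section velocity.
Context {R : realType}.
Variables (r0 H Om g th0 T : R) (F S phi u v w theta : R -> R -> R -> R)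
  (zeta : R -> R -> R).
Hypotheses (r0_gt0 : 0 < r0) (g_gt0 : 0 < g) (th0_gt0 : 0 < th0).
Let P := P_of r0 Om phi.
Let Psi := Psi_of r0 H P.
Hypothesis phi_smooth :
  smooth_on [set x : R * (R * R) | 0 <= x.1 <= T /\ strip r0 H x.2] phi.
Hypothesis P_convex : forall t, 0 <= t <= T ->
  convex_function (E := (R * R)%type) (domD r0 H) (fun p => P t p.1 p.2).
Hypothesis zeta_smooth : smooth_on
  [set x : R * (R * R) | 0 <= x.1 <= T /\ 0 <= x.2.1 <= H] (fun t z _ => zeta t z).
Hypotheses
  (u_ge0 : forall t r z, 0 < t < T -> Gam_int r0 H zeta t (r, z) ->
     0 <= u t r z * r + r ^+ 2 * Om)
  (e1 : E1 r0 H Om T F u v w zeta) (e2 : E2 r0 H T S v w theta zeta)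
  (e3 : E3 r0 H Om T u phi zeta) (e4 : E4 r0 H g th0 T phi theta zeta)
  (st : ST r0 H Om T phi zeta).
Let X := vfield v w.

Lemma forward_gradient t r z : 0 < t < T -> Gam_int r0 H zeta t (r, z) ->
  (u t r z * r + r ^+ 2 * Om) ^+ 2 = D1 P t (s_of r0 r) z /\
  g / th0 * theta t r z = D2 P t (s_of r0 r) z.
Proof.
move=> ht hx; have [U [oU subU hU]] := P_of_smooth Om r0_gt0 phi_smooth.
have ht' : 0 <= t <= T by move: ht => /andP[? ?]; rewrite !ltW.
move: (hx) => [/= /andP[z0 zH] /andP[r1 r2]].
have r_gt0 : 0 < r by exact: lt_trans r1.
have dP : differentiable (unc P) (t, (s_of r0 r, z)).
  apply: (Cn_diff (hU 0)); apply: subU; split => //.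
  by apply: domD_s_of => //; split; rewrite /= ?ltW.
have [p1 p2] := phi_partial r0_gt0 r_gt0 dP.
have [_ h3] := e3 ht hx; have [_ h4] := e4 ht hx.
split; first by apply/balanceE; [rewrite gt_eqF|rewrite h3 p1].
by rewrite -[RHS]p2 -[RHS]subr0 -h4; ring.
Qed.

Lemma forward_material t r z : 0 < t < T -> Gam_int r0 H zeta t (r, z) ->
  material X (pulled r0 (D1 P)) t r z =
    2 * (u t r z * r + r ^+ 2 * Om) * F t r z /\
  material X (pulled r0 (D2 P)) t r z = g / th0 * S t r z.
Proof.
move=> ht hx; have [Z [oZ subZ hZ]] := smooth_onP zeta_smooth.
have near_fluid : \forall y \near (t, (r, z)), fluid_int r0 H T zeta y.
  apply: open_nbhs_nbhs; split => //; apply: (open_fluid_int (hZ 0)).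
  by move=> t' z' h1 h2; exact: subZ.
have [du h1] := e1 ht hx; have [dth h2] := e2 ht hx.
have r_neq0 : r != 0 by move: hx => [_ /= /andP[h _]]; rewrite gt_eqF// (lt_trans r0_gt0).
pose k := fun t r z => u t r z * r + r * r * Om.
have dr : differentiable (unc (fun _ r _ : R => r)) (t, (r, z)) by exact: (Cn_diff (Cn_x 0 setT)).
have dc c : differentiable (unc (fun _ _ _ : R => c : R)) (t, (r, z)).
  exact: (Cn_diff (Cn_cst 0 setT c)).
have dur := differentiableM du dr; have drr := differentiableM dr dr.
have drrO := differentiableM drr (dc Om).
have dk : differentiable (unc k) (t, (r, z)) by exact: (differentiableD dur drrO).
split.
  have -> : material X (pulled r0 (D1 P)) t r z = material X (fun t r z => k t r z * k t r z) t r z.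
    apply: material_near; apply: filterS near_fluid => -[t' [r' z']] [/= ht' hx'].
    have [hG _] := forward_gradient ht' hx'.
    by rewrite /unc/= /pulled -hG /k expr2 expr2.
  rewrite (material_mul X dk dk).
  have -> : material X k t r z = r * (material X u t r z) + u t r z * v t r z + 2 * r * v t r z * Om.
    rewrite (material_add X dur drrO) (material_mul X du dr) (material_mul X drr (dc Om)).
    by rewrite (material_mul X dr dr) material_cst material_fst /X /vfield/=; ring.
  have -> : F t r z = r * (material X u t r z + u t r z * v t r z / r + 2 * Om * v t r z).
    by rewrite h1; field.
  by rewrite /k expr2; field.
have -> : material X (pulled r0 (D2 P)) t r z =
    material X (fun t r z => (g / th0) * theta t r z) t r z.
  apply: material_near; apply: filterS near_fluid => -[t' [r' z']] [/= ht' hx'].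
  have [_ hG] := forward_gradient ht' hx'.
  by rewrite /unc/= /pulled -hG.
by rewrite (material_mul X (dc _) dth) material_cst h2 mulr0 addr0.
Qed.

(** The gradient of P at p is attained at p only, so that Psi has gradient p there
    by strict maximality; the interior position of p is used to exclude the other
    points by convexity. *)
Lemma forward_legendre t r z : 0 < t < T -> Gam_int r0 H zeta t (r, z) ->
  is_grad (fun q => Psi t q.1 q.2) (grad P t (s_of r0 r) z) (s_of r0 r, z).
Proof.
move=> ht hx; have [U [oU subU hU]] := P_of_smooth Om r0_gt0 phi_smooth.
have [Z [oZ subZ hZ]] := smooth_onP zeta_smooth.
have ht' : 0 <= t <= T by move: ht => /andP[? ?]; rewrite !ltW.
have r_gt0 : 0 < r by move: hx => [_ /= /andP[h _]]; rewrite (lt_trans r0_gt0).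
pose p := (s_of r0 r, z).
have sp : sdom r0 (t, p) by exact: one_sub_s_of_gt0.
have near_fluid : \forall y \near p, sdom r0 (t, y) /\
    fluid_int r0 H T zeta (t, (r_of r0 y.1, y.2)).
  have ct : {for p, continuous (fun y : R * R => (t, y))}.
    exact: (cvg_pair (cvg_cst t) cvg_id).
  have n1 : nbhs p (fun y : R * R => sdom r0 (t, y)).
    by apply: ct; apply: open_nbhs_nbhs; split => //; exact: open_sdom.
  apply: filterI => //.
  have c2 := continuous_comp ct (continuous_r_of sp).
  apply: c2; apply: open_nbhs_nbhs; split.
    by apply: (open_fluid_int (hZ 0)) => t' z' h1 h2; exact: subZ.
  by rewrite /= r_of_s_of.
have /nbhs_normP[e /= e0 he] := near_fluid.
have e20 : 0 < e / 2 by rewrite divr_gt0.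
have inb p' : cball p (e / 2) p' -> sdom r0 (t, p') /\
    fluid_int r0 H T zeta (t, (r_of r0 p'.1, p'.2)).
  move=> hp'; apply: he; rewrite /= distrC.
  by apply: le_lt_trans hp' _; exact: half_lt.
have inD p' : cball p (e / 2) p' -> domD r0 H p'.
  move=> /inb[h [_ [/= hz hr]]]; case: p' h hz hr => s' z' h /= /andP[hz hz'] /andP[hr _].
  have -> : s' = s_of r0 (r_of r0 s') by rewrite s_of_r_of.
  by apply: domD_s_of => //; split; rewrite /= ltW// ltW.
have dP p' : domD r0 H p' -> differentiable (unc P) (t, p').
  by move=> hp'; apply: (Cn_diff (hU 0)); exact: subU.
apply: (@legendre_is_grad R (domD r0 H) (fun p => P t p.1 p.2) (P_convex ht') p _ (e / 2)
  (fun p => grad P t p.1 p.2) e20).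
- exact: inD.
- by move=> p' /inD /dP; exact: is_grad_slice.
- by [].
move=> [s' z'] hp' E; have [h [_ hx']] := inb _ hp'.
have rgt : 0 < r_of r0 s' by exact: r_of_gt0.
have Gsub r1 z1 : Gam_int r0 H zeta t (r1, z1) -> Gam r0 H zeta t (r1, z1).
  by move=> [/= /andP[? ?] /andP[? ?]]; split; rewrite /= !ltW.
have stE r1 z1 : 0 < r1 -> domD r0 H (s_of r0 r1, z1) ->
   (r1 ^+ 3 * D1 (fun t r z => phi t r z + Om ^+ 2 * r ^+ 2 / 2) t r1 z1,
    D2 (fun t r z => phi t r z + Om ^+ 2 * r ^+ 2 / 2) t r1 z1) =
   grad P t (s_of r0 r1) z1.
  move=> r1_gt0 /dP dP1; have [_ p1 p2] := pulled_partial r1_gt0 dP1.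
  have nE : \forall y \near (t, (r1, z1)),
      unc (fun t r z => phi t r z + Om ^+ 2 * r ^+ 2 / 2) y = unc (pulled r0 P) y.
    apply: filterS (near_radius_gt0 t z1 r1_gt0) => -[t2 [r2 z2]] /= hr.
    by rewrite /unc/= /pulled /P /P_of r_of_s_of.
  have q1 := near_partial (@Ordinal 3 1 isT) nE.
  have q2 := near_partial (@Ordinal 3 2 isT) nE.
  rewrite [X in (_ * X, _)]q1 [X in (_, X)]q2 /grad; apply: congr2 => //.
  by rewrite [X in _ * X]p1; field; rewrite gt_eqF.
have E2 : (r_of r0 s', z') = (r, z).
  apply: (st ht); rewrite ?inE; [exact: Gsub|exact: Gsub|].
  rewrite /= stE// ?stE//; first by rewrite s_of_r_of.
    by apply: (inD p); rewrite /cball/= subrr normr0 ltW.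
  by rewrite s_of_r_of//; exact: inD.
by move: E2 => [Er Ez]; rewrite /p -Er -Ez s_of_r_of.
Qed.

(** The derivatives of the two components of grad P along the flow are computed
    from E1 and E2, and p is recovered as the gradient of Psi. *)
Lemma forward_velocity t r z : 0 < t < T -> Gam_int r0 H zeta t (r, z) ->
  let q := grad P t (s_of r0 r) z in
  differentiable (fun q' : R * R => Psi t q'.1 q'.2) q /\
  (material X (pulled r0 (D1 P)) t r z, material X (pulled r0 (D2 P)) t r z) =
  VEL r0 g th0 F S Psi t q.1 q.2.
Proof.
move=> ht hx q; have gPsi := forward_legendre ht hx.
have r_gt0 : 0 < r by move: hx => [_ /= /andP[h _]]; rewrite (lt_trans r0_gt0).
split; first by case: gPsi.
have /is_grad_diff gP2 : differentiable (fun q' : R * R => Psi t q'.1 q'.2) q by case: gPsi.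
have [d1 d2] : D1 Psi t q.1 q.2 = s_of r0 r /\ D2 Psi t q.1 q.2 = z.
  by have [-> ->] := is_grad_uniq gP2 gPsi.
have [-> ->] := forward_material ht hx.
rewrite /VEL d1 d2 r_of_s_of//; congr (_ * _, _).
have [/= <- _] := forward_gradient ht hx.
by rewrite sqrtr_sqr ger0_norm// u_ge0.
Qed.

End velocity.

(** * Integrals against the dual measure *)

Lemma within_compT (T U V : topologicalType) (B : set T) (f : U -> V) (c : T -> U) :
  continuous f -> {within B, continuous c} -> {within B, continuous (fun x => f (c x))}.
Proof.
move=> cf cc.
exact: (@within_comp _ _ _ setT B f c (continuous_subspaceT cf) cc (fun _ _ => Logic.I)).
Qed.

Section pushforward_space.
Context {R : realType}.
Variables (r0 H : R) (zeta : R -> R) (sg : probability (plane R) R)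
  (G : R * R -> R * R).
Hypotheses (r0_gt0 : 0 < r0) (H_ge0 : 0 <= H).
Hypothesis czeta : {within `[0, H], continuous zeta}.
Hypothesis zeta_ge : forall z, 0 <= z <= H -> r0 <= zeta z.
Let D := region r0 H zeta.
Hypothesis cG : {within D, continuous G}.
Hypothesis sgE : forall A : set (plane R), measurable A ->
  (sg A = \int[leb2 R]_(x in D `&` G @^-1` A) (x.1)%:E)%E.

Let K := [set G x | x in D].

Let cD : compact D. Proof. exact: compact_region. Qed.
Let mD : measurable (D : set (plane R)). Proof. exact: measurable_region. Qed.

Let image_closed (C : set (R * R)) : closed C -> closed [set G x | x in D `&` C].
Proof.
move=> clC; apply: compact_closed => //; apply: continuous_compact.
  by apply: continuous_subspaceW cG; exact: subIsetl.
exact: compact_closedI.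
Qed.

Lemma closed_image : closed K.
Proof. by rewrite /K -(setIT D); apply: image_closed; exact: closedT. Qed.

Lemma image_null : sg (~` K) = 0%E.
Proof.
have clK := closed_image.
rewrite sgE; last first.
  by apply: measurableC; exact: closed_measurable2.
rewrite (_ : _ `&` _ = set0) ?integral_set0//.
by apply/seteqP; split => // x [Dx]; apply; exists x.
Qed.

Lemma spt_sub_image : spt sg `<=` K.
Proof. exact: spt_sub closed_image image_null. Qed.

Variable f : R * R -> R.
Hypothesis cf : {within D, continuous (fun x => f (G x))}.

(** A function on the compact image of G which becomes continuous after
    composition with G is Borel: preimages of closed sets are images of compact
    sets. *)
Lemma measurable_on_image : measurable_fun setT (f \_ K : plane R -> R).
Proof.
have clK := closed_image; have mK := closed_measurable2 clK.
apply/(measurable_restrictT _ mK).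
apply: (measurability _ (measurable_realfun.RGenOpens.measurableE R)).
move=> _ [_ [a [b ->] <-]].
have clab : closed (~` `]a, b[%classic : set R) by apply: open_closedC; exact: interval_open.
have /closed_subspaceP[C clC CE] : closed ((fun x => f (G x) : R) @^-1` (~` `]a, b[%classic) : set (subspace D)).
  by move/continuous_closedP: cf; apply.
have -> : K `&` f @^-1` `]a, b[%classic = K `\` [set G x | x in D `&` C].
  apply/seteqP; split=> [y [Ky fy]|y [Ky nC]]; split=> //.
    move=> [x [Dx Cx] Gx]; have : (C `&` D) x by [].
    by rewrite CE => -[] /=; rewrite Gx => /(_ fy).
  case: (Ky) => x Dx Gx; rewrite /= -Gx; apply: contrapT => nab; apply: nC.
  have : (((fun x => f (G x) : R) @^-1` (~` `]a, b[%classic)) `&` D) x by [].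
  by rewrite -CE => -[Cx _]; exists x.
by apply: measurableD => //; apply: closed_measurable2; exact: image_closed.
Qed.

Lemma pushforward_space_integrable :
  sg.-integrable (spt sg) (fun q => (f q)%:E).
Proof.
have mS : measurable (spt sg : set (plane R)) by apply: closed_measurable2; exact: spt_closed.
apply: (@measurable_bounded_integrable _ (plane R) R sg f (spt sg)) => //.
- by rewrite (le_lt_trans (probability_le1 _ _))// ltry.
- have h : measurable_fun (spt sg) (f \_ K : plane R -> R).
    by apply: measurable_funTS; exact: measurable_on_image.
  apply: eq_measurable_fun h => q; rewrite inE => hq.
  by rewrite patchE mem_set//; exact: spt_sub_image.
- have /compact_bounded[N [_ mrt]] := continuous_compact cf cD.
  exists N; split; rewrite ?num_real// => y Ny q /spt_sub_image[x Dx <-].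
  by apply: mrt => //; exists x.
Qed.

(** The integrand is only known on the image of the region, which carries the
    whole measure. *)
Lemma pushforward_space_int :
  \int[sg]_(q in spt sg) f q =
  itg 0 H (fun z => itg 0 1 (fun l => (zeta z - r0) *
    (f (G (r0 + l * (zeta z - r0), z)) * (r0 + l * (zeta z - r0))))).
Proof.
have mS : measurable (spt sg : set (plane R)) by apply: closed_measurable2; exact: spt_closed.
rewrite /Rintegral.
have -> : (\int[sg]_(q in spt sg) (f q)%:E = \int[sg]_q ((f \_ K) q)%:E)%E.
  rewrite integral_mkcond; apply: ae_eq_integral => //.
  - by apply/(measurable_restrictT _ mS); have /measurable_int := pushforward_space_integrable.
  - by apply/measurable_EFinP; exact: measurable_on_image.
  exists (~` spt sg); split; [exact: measurableC|exact: spt_null|].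
  move=> q /= h hq; apply: h => _; rewrite !patchE mem_set// mem_set//.
  exact: spt_sub_image.
have mG : measurable_fun D (G : plane R -> plane R).
  have m1 := @measurable_restrict2 R D (fun x => (G x).1) (closed_region H_ge0 czeta).
  have m2 := @measurable_restrict2 R D (fun x => (G x).2) (closed_region H_ge0 czeta).
  have c1 : {within D, continuous (fun x => (G x).1)}.
    exact: (within_compT (@continuous_fst R R) cG).
  have c2 : {within D, continuous (fun x => (G x).2)}.
    exact: (within_compT (@continuous_snd R R) cG).
  apply: eq_measurable_fun (measurable_funTS (measurable_fun_pair (m1 c1) (m2 c2))).
  by move=> x xD; rewrite !patchE xD; case: (G x).
rewrite (@integral_weighted_pushforward _ _ (plane R) (plane R) R (leb2 R) sg D G (fun x => x.1))//.
- transitivity (fine (\int[leb2 R]_(x in D) (f (G x) * x.1)%:E)%E).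
    congr fine; apply: eq_integral => x; rewrite inE => Dx.
    by rewrite patchE mem_set//; exists x.
  rewrite integral_region//.
  apply: within_mul => //; apply: continuous_subspaceT; exact: continuous_fst.
- by apply: measurable_funTS; exact: measurable_fst.
- by move=> x [_ /andP[h _]]; rewrite (le_trans (ltW r0_gt0)).
- exact: measurable_on_image.
Qed.

End pushforward_space.

(** * The weak continuity equation along a flow *)

Lemma within_pair (T U V : topologicalType) (A : set T) (f : T -> U) (g : T -> V) :
  {within A, continuous f} -> {within A, continuous g} ->
  {within A, continuous (fun x => (f x, g x))}.
Proof. by move=> cf cg x; exact: (cvg_pair (cf x) (cg x)). Qed.

Section weak_form.
Context {R : realType}.
Variables (r0 H T t1 t2 : R) (zeta : R -> R -> R) (sg : R -> probability (plane R) R)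
  (V : R -> R -> R -> R * R) (G1 G2 v w eta : R -> R -> R -> R).
Variables (Z Ug : set (R * (R * R))).
Hypotheses (r0_gt0 : 0 < r0) (H_gt0 : 0 < H) (t1_gt0 : 0 < t1) (t12 : t1 < t2)
  (t2_lt : t2 < T).
Hypotheses (oZ : open Z) (hZ : Cn 2 Z (fun t z _ => zeta t z))
  (subZ : forall t z, 0 < t < T -> 0 <= z <= H -> Z (t, (z, 0)))
  (zr : forall t z, 0 < t < T -> 0 <= z <= H -> r0 <= zeta t z).
Definition movingT : set (R * (R * R)) :=
  [set x | 0 < x.1 < T /\ Gam r0 H zeta x.1 x.2].
Hypotheses (oUg : open Ug) (subUg : movingT `<=` Ug) (hG1 : Cn 2 Ug G1) (hG2 : Cn 2 Ug G2).
Hypothesis sgE : forall t (A : set (plane R)), 0 < t < T -> measurable A ->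
  (sg t A = \int[leb2 R]_(x in Gam r0 H zeta t `&`
    [set x | A (G1 t x.1 x.2, G2 t x.1 x.2)]) (x.1)%:E)%E.
Hypotheses (cv : {within movingT, continuous (unc v)})
  (cw : {within movingT, continuous (unc w)}).
Hypothesis VE : forall t r z, 0 < t < T -> Gam r0 H zeta t (r, z) ->
  V t (G1 t r z) (G2 t r z) =
    (material (vfield v w) G1 t r z, material (vfield v w) G2 t r z).
Hypotheses (heta : Cn 2 setT eta)
  (eta0 : forall t y z, t <= t1 \/ t2 <= t -> eta t y z = 0).

Let X := vfield v w.
Definition along_flow (t r z : R) := eta t (G1 t r z) (G2 t r z).
Let h := along_flow.

Let hh : Cn 2 Ug h.
Proof.
exact: (@Cn_comp R 2 setT Ug eta (fun t _ _ => t) G1 G2 oUg (fun _ _ => Logic.I) heta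
  (Cn_t 2 Ug) hG1 hG2).
Qed.

Let mat_eq t r z : 0 < t < T -> Gam r0 H zeta t (r, z) ->
  material V eta t (G1 t r z) (G2 t r z) = material X h t r z.
Proof.
move=> ht hx; have Ux : Ug (t, (r, z)) by exact: subUg.
rewrite (material_comp X (Cn_diff heta Logic.I) (Cn_diff hG1 Ux) (Cn_diff hG2 Ux)).
by rewrite /material VE.
Qed.

Let cmat : {within movingT, continuous (unc (material X h))}.
Proof.
have c f : Cn 0 Ug f -> {within movingT, continuous (unc f)}.
  by move=> hf; apply: (differentiable_within subUg) => x Ux; exact: (Cn_diff hf Ux).
have c0 := c _ (CnW (Cn_Dt hh)).
have c1 := within_mul cv (c _ (CnW (Cn_D1 hh))).
have c2 := within_mul cw (c _ (CnW (Cn_D2 hh))).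
move=> x; apply: (@continuousD _ _ (subspace movingT)
  (fun x => unc (Dt h) x + unc v x * unc (D1 h) x) _ x _ (c2 x)).
exact: (@continuousD _ _ (subspace movingT) _ _ x (c0 x) (c1 x)).
Qed.

Let slice_within t f : 0 < t < T -> {within movingT, continuous (unc f)} ->
  {within region r0 H (zeta t), continuous (fun x : R * R => f t x.1 x.2)}.
Proof.
move=> ht cf; apply: (@within_comp _ _ _ movingT (region r0 H (zeta t)) (unc f)
  (fun x : R * R => (t, x)) cf); last by move=> x Dx; split.
by apply: continuous_subspaceT; exact: continuous_pairl.
Qed.

Let czeta t : 0 < t < T -> {within `[0, H], continuous (zeta t)}.
Proof.
move=> ht; apply: continuous_in_subspaceT => z /set_mem/=; rewrite in_itv/= => hz.
apply: (@continuous_comp _ _ _ (fun z : R => (t, (z, 0 : R))) (unc (fun t z _ => zeta t z))).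
  exact: (cvg_pair (cvg_cst t) (cvg_pair cvg_id (cvg_cst (0 : R)))).
by apply: differentiable_continuous; exact: (Cn_diff hZ (subZ ht hz)).
Qed.

Let space_int_flow t : 0 < t < T ->
  (sg t).-integrable (spt (sg t)) (fun q => (material V eta t q.1 q.2)%:E) /\
  space_int sg V eta t =
  itg 0 H (fun z => itg 0 1 (fun l => transported r0 zeta h v w t l z)).
Proof.
move=> ht; have cz := czeta ht.
have cGi f : Cn 2 Ug f -> {within region r0 H (zeta t), continuous (fun x : R * R => f t x.1 x.2)}.
  by move=> hf; apply: slice_within => //; apply: (differentiable_within subUg) => x Ux;
    exact: (Cn_diff hf Ux).
pose G (x : R * R) := (G1 t x.1 x.2, G2 t x.1 x.2).
have cG : {within region r0 H (zeta t), continuous G}.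
  exact: (within_pair (cGi _ hG1) (cGi _ hG2)).
have cf : {within region r0 H (zeta t), continuous
    (fun x => material V eta t (G x).1 (G x).2)}.
  have := slice_within ht cmat; apply: subspace_eq_continuous => -[r z]; rewrite inE => Dx.
  exact: (esym (mat_eq ht Dx)).
have zt z : 0 <= z <= H -> r0 <= zeta t z by exact: zr.
have sE' (A : set (plane R)) : measurable A -> (sg t A =
    \int[leb2 R]_(x in region r0 H (zeta t) `&` G @^-1` A) (x.1)%:E)%E.
  exact: sgE.
pose f (q : R * R) := material V eta t q.1 q.2.
have si := @pushforward_space_integrable R r0 H (zeta t) (sg t) G (ltW H_gt0) cz cG sE' f cf.
have sE := @pushforward_space_int R r0 H (zeta t) (sg t) G r0_gt0 (ltW H_gt0) cz zt cG sE' f cf.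
split; [exact: si|rewrite [LHS]sE].
apply: eq_int => z hz; apply: eq_int => l /andP[l0 l1].
have hG : Gam r0 H zeta t (r0 + l * (zeta t z - r0), z).
  split=> //=; have hJ : 0 <= zeta t z - r0 by rewrite subr_ge0 zt.
  by rewrite lerDl mulr_ge0//= -lerBrDl ler_piMl.
have fE : f (G (r0 + l * (zeta t z - r0), z)) =
    material X h t (r0 + l * (zeta t z - r0)) z by exact: mat_eq.
by rewrite fE [_ * (r0 + _)]mulrC.
Qed.

(** Under q = G(t, r, z) the derivative of eta along V becomes the derivative of
    h = eta(t, G) along the flow.  The integrals are over [t1, t2] because eta
    vanishes at other times. *)
Lemma weak_form_flow : weak_integrable T sg V eta /\
  weak_int T sg V eta = int3 t1 t2 0 1 0 H (transported r0 zeta h v w).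
Proof.
pose C := cbox t1 t2 0 1 0 H.
have in0T t : t1 <= t <= t2 -> 0 < t < T.
  by move=> /andP[h1 h2]; rewrite (lt_le_trans t1_gt0 h1) (le_lt_trans h2 t2_lt).
have subm : moving r0 H t1 t2 zeta `<=` movingT.
  by move=> x [ht hx]; split => //; exact: in0T.
have ct : {within C, continuous (unc (transported r0 zeta h v w))}.
  apply: (@continuous_transported R r0 H t1 t2 zeta Z oZ hZ _ _ h v w Ug) => //.
  - by move=> t z ht hz; apply: subZ => //; exact: in0T.
  - by move=> t z ht hz; apply: zr => //; exact: in0T.
  - by move=> x /subm; exact: subUg.
  - exact: continuous_subspaceW cv.
  - exact: continuous_subspaceW cw.
pose tc := clamp t1 t2 0 1 0 H (transported r0 zeta h v w).
have ctc : continuous (unc tc) by apply: clamp_continuous => //; exact: ltr01.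
have ctc2 t : continuous (fun p : R * R => tc t p.1 p.2).
  exact: (continuous_compo (@continuous_pairl _ _ t) ctc).
pose k t := itg 0 1 (fun l => itg 0 H (tc t l)).
have ck : continuous k.
  exact: (@continuous_int2 R _ 0 1 0 H tc ler01 (ltW H_gt0) ctc).
have kE t : t1 <= t <= t2 -> space_int sg V eta t = k t.
  move=> ht; have [_ ->] := space_int_flow (in0T _ ht).
  rewrite /k (int_swap ler01 (ltW H_gt0) (ctc2 t)).
  by apply: eq_int => z hz; apply: eq_int => l hl; rewrite /tc clampE.
have k0 t : ~ (t1 <= t <= t2) -> space_int sg V eta t = 0.
  move=> ht; rewrite /space_int /Rintegral (_ : (fun q => _) = fun=> 0%E) ?integral0//.
  apply/funext => q; congr EFin.
  have nz : \forall y \near (t, (q.1, q.2)), unc eta y = unc (fun _ _ _ => 0) y.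
    have o : open [set x : R * (R * R) | x.1 < t1 \/ t2 < x.1].
      apply: openU.
        by apply: (@open_comp _ _ (fun x : R * (R * R) => x.1) [set y : R | y < t1]);
          [move=> x _; exact: cvg_fst|exact: open_lt].
      by apply: (@open_comp _ _ (fun x : R * (R * R) => x.1) [set y : R | t2 < y]);
        [move=> x _; exact: cvg_fst|exact: open_gt].
    have : nbhs (t, (q.1, q.2)) [set x : R * (R * R) | x.1 < t1 \/ t2 < x.1].
      apply: open_nbhs_nbhs; split => //=.
      have [h1|h1] := ltP t t1; first by left.
      have [h2|h2] := ltP t2 t; first by right.
      by exfalso; apply: ht; rewrite h1 h2.
    apply: filterS => -[t' [y z]] /= hy; rewrite /unc/= eta0//.
    by case: hy => hy; [left|right]; exact: ltW.
  by rewrite (material_near V nz) material_cst.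
have sub : `[t1, t2]%classic `<=` `]0, T[%classic.
  by move=> t; rewrite /= !in_itv/=; exact: in0T.
have patch : (fun t => (space_int sg V eta t)%:E) \_ `[t1, t2]%classic =
    (fun t => (k t)%:E) \_ `[t1, t2]%classic :> (R -> \bar R).
  apply/funext => t; rewrite !patchE; case: ifPn => // /set_mem/=; rewrite in_itv/=.
  by move=> /kE ->.
have patch2 : (fun t => (space_int sg V eta t)%:E) \_ `]0, T[%classic =
    (fun t => (k t)%:E) \_ `[t1, t2]%classic :> (R -> \bar R).
  rewrite -patch; apply/funext => t; rewrite !patchE.
  have [h1|h1] := boolP (t \in `[t1, t2]%classic).
    by rewrite mem_set//; apply: sub; exact: set_mem h1.
  case: ifPn => // _; rewrite k0// => ht; move/negP: h1; apply.
  by apply: mem_set; rewrite /= in_itv.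
have mI (i : interval R) : measurable ([set` i] : set R) by exact: measurable_itv.
split; first split.
- by move=> t /space_int_flow[].
- have im (i : interval R) (f : R -> \bar R) :=
    @integrable_mkcond _ _ R (@lebesgue_measure R) [set` i] f (mI i).
  have ik : (@lebesgue_measure R).-integrable `[t1, t2] (fun t => (k t)%:E).
    exact: continuous_integrable.
  by apply/im; rewrite patch2; apply/im.
rewrite /weak_int /Rintegral integral_mkcond patch2 -integral_mkcond.
transitivity (itg t1 t2 k); first by rewrite -EFin_int.
by rewrite clamp_int3.
Qed.

End weak_form.

(** * Conservation of mass implies the continuity equation *)

Section forward_continuity.
Context {R : realType}.

Lemma compact_time_bounds (K : set (R * (R * R))) (T : R) : 0 < T -> compact K ->
  K `<=` [set x | 0 < x.1 < T] ->
  exists t1 t2, [/\ 0 < t1, t1 < t2, t2 < T & K `<=` [set x | t1 < x.1 < t2]].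
Proof.
move=> T0 cK KT.
have clF : closed [set x.1 | x in K].
  apply: compact_closed => //; apply: continuous_compact => //.
  by apply: continuous_subspaceT => x; exact: cvg_fst.
have away (a : R) : ~ [set x.1 | x in K] a ->
    exists2 d : R, 0 < d & forall x, K x -> d <= `|a - x.1|.
  move=> na; have /nbhs_ballP[d /= d0 hd] : nbhs a (~` [set x.1 | x in K]).
    by apply: open_nbhs_nbhs; split => //; exact: closed_openC.
  exists d => // x Kx; rewrite leNgt; apply/negP => h.
  by apply: (hd x.1 h); exists x.
have [|d1 d10 h1] := away 0.
  by move=> [x /KT/= + x0]; rewrite x0 ltxx.
have [|d2 d20 h2] := away T.
  by move=> [x /KT/= + x0]; rewrite x0 ltxx andbF.
pose d := Num.min (Num.min d1 d2) (T / 2).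
have d0 : 0 < d by rewrite !lt_min d10 d20 divr_gt0.
have dd1 : d <= d1 by rewrite !ge_min lexx.
have dd2 : d <= d2 by rewrite !ge_min lexx orbT.
have dT : d <= T / 2 by rewrite ge_min lexx orbT.
have dh := half_lt d0.
exists (d / 2), (T - d / 2); split.
- by rewrite divr_gt0.
- by clear -dh dT T0; lra.
- by rewrite ltrBlDr ltrDl divr_gt0.
- move=> x Kx; have /andP[x0 xT] := KT _ Kx; have := h1 _ Kx; have := h2 _ Kx.
  rewrite sub0r normrN (gtr0_norm x0) gtr0_norm ?subr_gt0// => k1 k2.
  by apply/andP; split; clear -k1 k2 dh dd1 dd2; lra.
Qed.

Lemma test_function_bounds (T : R) (eta : R -> R -> R -> R) : 0 < T ->
  test_function [set x : R * (R * R) | 0 < x.1 < T] eta ->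
  Cn 2 setT eta /\ exists t1 t2, [/\ 0 < t1, t1 < t2, t2 < T &
    forall t y z, t <= t1 \/ t2 <= t -> eta t y z = 0].
Proof.
move=> T0 [/smooth_onP[W [oW WT hW]] [K [cK KT K0]]]; split.
  exact: sub_Cn WT (hW 2).
have [t1 [t2 [h1 h2 h3 h4]]] := compact_time_bounds T0 cK KT.
exists t1, t2; split=> // t y z h; apply: (K0 (t, (y, z))) => /h4/= /andP[k1 k2].
by case: h => h; [move: k1|move: k2]; rewrite ltNge h.
Qed.

Lemma incompressibleE (v w : R -> R -> R -> R) (t r z : R) : r != 0 ->
  differentiable (unc v) (t, (r, z)) ->
  r^-1 * D1 (fun t' r' z' => r' * v t' r' z') t r z + D2 w t r z = 0 <->
  v t r z + r * D1 v t r z + r * D2 w t r z = 0.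
Proof.
move=> r0 dv.
have dr : differentiable (unc (fun _ r _ : R => r)) (t, (r, z)).
  exact: (Cn_diff (Cn_x 0 setT)).
have -> : D1 (fun t' r' z' => r' * v t' r' z') t r z = r * D1 v t r z + v t r z * 1.
  have := partial_mul (@Ordinal 3 1 isT) dr dv; rewrite /partial/= /unc/= => ->.
  by congr (_ + _ * _); exact: derive1_id.
have -> : v t r z + r * D1 v t r z + r * D2 w t r z =
    r * (r^-1 * (r * D1 v t r z + v t r z * 1) + D2 w t r z) by field.
split=> [->|/eqP]; first by rewrite mulr0.
by rewrite mulf_eq0 (negbTE r0)/= => /eqP.
Qed.

Variables (r0 H T : R) (zeta : R -> R -> R) (v w : R -> R -> R -> R).

Lemma fluid_of_box t l z : (forall t z, 0 <= t <= T -> 0 <= z <= H -> r0 <= zeta t z) ->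
  0 <= t <= T -> 0 <= l <= 1 -> 0 <= z <= H ->
  Gam r0 H zeta t (rad_of r0 zeta t l z, z).
Proof.
move=> zr ht /andP[l0 l1] hz; split=> //=; rewrite /rad_of /thick.
have hJ : 0 <= zeta t z - r0 by rewrite subr_ge0 zr.
by rewrite lerDl mulr_ge0//= -lerBrDl ler_piMl.
Qed.

(** No mass leaves the fluid: on the walls by the impermeability conditions, on
    the free surface because it is carried by the flow. *)
Lemma flux_eq0 (h : R -> R -> R -> R) (t1 t2 : R) : 0 < H ->
  (forall t z, 0 <= t <= T -> 0 <= z <= H -> r0 <= zeta t z) ->
  0 < t1 -> t1 < t2 -> t2 < T -> FB r0 H T v w zeta ->
  (forall t r z, t <= t1 \/ t2 <= t -> h t r z = 0) ->
  flux t1 t2 0 1 0 H (flux1 r0 zeta h) (flux2 r0 zeta h v w) (flux3 r0 zeta h w) = 0.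
Proof.
move=> H0 zr t10 t12 t2T fb h0.
have zero (F : R -> R -> R) a b c d : a <= b -> c <= d ->
    (forall x y, a <= x <= b -> c <= y <= d -> F x y = 0) ->
    itg a b (fun x => itg c d (F x)) = 0.
  move=> ab cd F0; rewrite (@eq_int _ a b _ (fun=> 0)) ?int_cst ?mul0r// => x hx.
  by rewrite (@eq_int _ c d _ (fun=> 0)) ?int_cst ?mul0r// => y hy; exact: F0.
have inT t : t1 <= t <= t2 -> 0 < t < T.
  by move=> /andP[k1 k2]; rewrite (lt_le_trans t10 k1) (le_lt_trans k2 t2T).
have inT' t : t1 <= t <= t2 -> 0 <= t <= T.
  by move=> /inT/andP[k1 k2]; rewrite !ltW.
have H0' := ltW H0; have t12' := ltW t12.
have l0 : 0 <= (0 : R) <= 1 by apply/andP; split; [exact: lexx|exact: ler01].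
have l1 : 0 <= (1 : R) <= 1 by apply/andP; split; [exact: ler01|exact: lexx].
have z0 : 0 <= (0 : R) <= H by rewrite lexx H0'.
have zH : 0 <= H <= H by rewrite lexx H0'.
have r1E t z : rad_of r0 zeta t 1 z = zeta t z by rewrite /rad_of /thick mul1r addrC subrK.
have r0E t z : rad_of r0 zeta t 0 z = r0 by rewrite /rad_of /thick mul0r addr0.
rewrite /flux.
rewrite (zero (fun x y => flux1 r0 zeta h t2 x y - flux1 r0 zeta h t1 x y) 0 1 0 H
  ler01 H0'); last first.
  by move=> l z _ _; rewrite /flux1 /pull !h0 ?lexx; [rewrite !mulr0 subrr|left|right].
rewrite (zero (fun t y => flux2 r0 zeta h v w t 1 y - flux2 r0 zeta h v w t 0 y) t1 t2 0 H
  t12' H0'); last first.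
  move=> t z ht hz; have [f1 _ _ f4] := fb t (inT t ht); have [_ f4'] := f4 z hz.
  have g0 : Gam r0 H zeta t (r0, z).
    by have := fluid_of_box zr (inT' t ht) l0 hz; rewrite r0E.
  have v0 : v t r0 z = 0.
    have := f1 z g0; rewrite /dot /vfield/= mulr0 addr0 mulrN1 => /eqP.
    by rewrite oppr_eq0 => /eqP.
  rewrite /flux2 /pull r1E r0E v0 mul1r -f4' mul0r subrr mulr0 subr0.
  by rewrite [_ * derive1 (zeta t) z]mulrC subrr mulr0.
rewrite (zero (fun t l => flux3 r0 zeta h w t l H - flux3 r0 zeta h w t l 0) t1 t2 0 1
  t12' ler01) ?addr0//.
move=> t l ht hl; have [_ f2 f3 _] := fb t (inT t ht).
have w0 : pull r0 zeta w t l 0 = 0.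
  have := f2 _ (fluid_of_box zr (inT' t ht) hl z0).
  rewrite /dot /vfield/= mulr0 add0r mulrN1 => /eqP.
  by rewrite oppr_eq0 => /eqP.
have wH : pull r0 zeta w t l H = 0.
  have := f3 _ (fluid_of_box zr (inT' t ht) hl zH).
  by rewrite /dot /vfield/= mulr0 add0r mulr1.
by rewrite /flux3 w0 wH !mulr0 subrr.
Qed.

Variables (Om : R) (phi : R -> R -> R -> R) (V : R -> R -> R -> R * R)
  (sg : R -> probability (plane R) R).
Let P := P_of r0 Om phi.
Let fluid := [set x : R * (R * R) | 0 <= x.1 <= T /\ Gam r0 H zeta x.1 x.2].
Hypotheses (r0_gt0 : 0 < r0) (H_gt0 : 0 < H) (T_gt0 : 0 < T).
Hypotheses
  (phi_smooth : smooth_on [set x : R * (R * R) | 0 <= x.1 <= T /\ strip r0 H x.2] phi)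
  (v_smooth : smooth_on fluid v) (w_smooth : smooth_on fluid w)
  (zeta_smooth : smooth_on
    [set x : R * (R * R) | 0 <= x.1 <= T /\ 0 <= x.2.1 <= H] (fun t z _ => zeta t z))
  (zeta_ge : forall t z, 0 <= t <= T -> 0 <= z <= H -> r0 <= zeta t z)
  (VE : forall t r z, 0 < t < T -> Gam r0 H zeta t (r, z) ->
    V t (D1 P t (s_of r0 r) z) (D2 P t (s_of r0 r) z) =
      (material (vfield v w) (pulled r0 (D1 P)) t r z,
       material (vfield v w) (pulled r0 (D2 P)) t r z))
  (sgE : forall t (A : set (plane R)), 0 <= t <= T -> measurable A ->
    (sg t A = \int[leb2 R]_(x in Gam r0 H zeta t `&`
      [set x | A (grad P t (s_of r0 x.1) x.2)]) (x.1)%:E)%E)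
  (e5 : E5 r0 H T v w zeta) (fb : FB r0 H T v w zeta).

(** The weak form is the transport of h along the flow, whose total is the flux
    of mass through the boundary of the fluid. *)
Lemma forward_continuity : continuity_equation T sg V.
Proof.
move=> eta /(test_function_bounds T_gt0)[heta [t1 [t2 [t10 t12 t2T eta0]]]].
have [Z [oZ subZ hZ]] := smooth_onP zeta_smooth.
have [UP [oUP subUP hUP]] := P_of_smooth Om r0_gt0 phi_smooth.
have [Uv [oUv subUv hv]] := smooth_onP v_smooth.
have [Uw [oUw subUw hw]] := smooth_onP w_smooth.
have wk t : 0 < t < T -> 0 <= t <= T by move=> /andP[? ?]; rewrite !ltW.
pose Ug := pulled_dom r0 UP; have oUg : open Ug by exact: open_pulled_dom.
have subUg : movingT r0 H T zeta `<=` Ug.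
  move=> [t [r z]] [/= ht [/= hz /andP[hr _]]]; split; first exact: lt_le_trans hr.
  by apply: subUP; split; [exact: wk|exact: domD_s_of].
have hG1 : Cn 2 Ug (pulled r0 (D1 P)) by apply: Cn_pulled => //; exact: Cn_D1 (hUP 3).
have hG2 : Cn 2 Ug (pulled r0 (D2 P)) by apply: Cn_pulled => //; exact: Cn_D2 (hUP 3).
have subf : movingT r0 H T zeta `<=` fluid by move=> x [/wk].
have cv : {within movingT r0 H T zeta, continuous (unc v)}.
  apply: (@differentiable_within _ Uv); first exact: subset_trans subf subUv.
  by move=> x Ux; exact: (Cn_diff (hv 0) Ux).
have cw : {within movingT r0 H T zeta, continuous (unc w)}.
  apply: (@differentiable_within _ Uw); first exact: subset_trans subf subUw.
  by move=> x Ux; exact: (Cn_diff (hw 0) Ux).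
have [] := @weak_form_flow R r0 H T t1 t2 zeta sg V (pulled r0 (D1 P)) (pulled r0 (D2 P))
  v w eta Z Ug r0_gt0 H_gt0 t10 t12 t2T oZ (hZ 2) (fun t z ht => subZ (t, (z, 0)) \o conj (wk t ht))
  (fun t z ht => zeta_ge (wk t ht)) oUg subUg hG1 hG2
  (fun t A ht => sgE (wk t ht)) cv cw VE heta eta0.
move=> wi ->; split => //.
have inT t : t1 <= t <= t2 -> 0 < t < T.
  by move=> /andP[k1 k2]; rewrite (lt_le_trans t10 k1) (le_lt_trans k2 t2T).
pose h := along_flow (pulled r0 (D1 P)) (pulled r0 (D2 P)) eta.
have hh : Cn 2 Ug h.
  exact: (@Cn_comp R 2 setT Ug eta (fun t _ _ => t) _ _ oUg (fun _ _ => Logic.I) heta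
    (Cn_t 2 Ug) hG1 hG2).
pose Uvw := Uv `&` Uw; have oUvw : open Uvw by exact: openI.
have subm : moving r0 H t1 t2 zeta `<=` movingT r0 H T zeta.
  by move=> x [ht hx]; split => //; exact: inT.
have bx t l z : obox t1 t2 0 1 0 H (t, (l, z)) ->
    0 < t < T /\ Gam r0 H zeta t (rad_of r0 zeta t l z, z).
  move=> /obox_sub_cbox[/= /inT ht hl hz]; split => //.
  by apply: fluid_of_box => //; exact: wk.
transitivity (flux t1 t2 0 1 0 H (flux1 r0 zeta h) (flux2 r0 zeta h v w) (flux3 r0 zeta h w));
  last by apply: flux_eq0 => // t r z /eta0 e; rewrite /h /along_flow e.
apply: (@transport_flux R r0 H t1 t2 zeta H_gt0 t12 Z oZ (hZ 2) _ _ h v w Ug Uvw oUg hh _ oUvw).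
- by move=> t z ht hz; apply: subZ; split => //=; exact: wk (inT _ ht).
- by move=> t z ht hz; apply: zeta_ge => //; exact: wk (inT _ ht).
- by move=> x /subm; exact: subUg.
- by apply: sub_Cn (hv 1) => x [].
- by apply: sub_Cn (hw 1) => x [].
- by move=> t l z /bx[ht hx]; split; [apply: subUv|apply: subUw]; split => //; exact: wk.
- exact: continuous_subspaceW subm cv.
- exact: continuous_subspaceW subm cw.
move=> t l z Ox; have [ht hx] := bx _ _ _ Ox.
move: Ox => [/= _ /andP[l0 l1] hz].
have [->|J0] := eqVneq (thick r0 zeta t l z) 0; first by rewrite mul0r.
have Jgt : 0 < thick r0 zeta t l z.
  rewrite lt_neqAle eq_sym J0 subr_ge0; apply: zeta_ge; first exact: wk.
  by move: hz => /andP[? ?]; rewrite !ltW.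
have hi : Gam_int r0 H zeta t (rad_of r0 zeta t l z, z).
  split=> //=; rewrite /rad_of ltrDl mulr_gt0//=.
  by rewrite -ltrBrDl gtr_pMl.
rewrite /compression /=; have [dv _ /incompressibleE ->//] := e5 ht hi; first by rewrite mulr0.
by rewrite gt_eqF// (lt_trans r0_gt0)//; case: hi => _ /andP[].
Qed.

End forward_continuity.

(** * Paths from the boundary, and monotone gradients *)

Lemma closed_at1 (R : realType) (T : topologicalType) (C : set T) (c : R -> T) :
  closed C -> continuous c -> (forall k, 0 < k < 1 -> C (c k)) -> C (c 1).
Proof.
move=> clC cc hC.
have cvg1 : c k @[k --> (1 : R)^'-] --> c 1 by apply: cvg_at_left_filter; exact: cc.
apply: (@closed_cvg _ _ _ _ c C clC _ _ cvg1); near=> k.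
apply: hC; apply/andP; split; near: k; first exact: nbhs_left_gt.
exact: nbhs_left_lt.
Unshelve. all: by end_near. Qed.

(** Every point of the region is the endpoint of a path which otherwise stays
    in the interior. *)
Lemma region_approx (R : realType) (r0 H : R) (zeta : R -> R) (x : R * R) : 0 < H ->
  {within `[0, H], continuous zeta} -> (forall z, 0 <= z <= H -> r0 < zeta z) ->
  region r0 H zeta x ->
  exists c : R -> R * R, [/\ continuous c, c 1 = x, forall k, region r0 H zeta (c k) &
    forall k, 0 < k < 1 -> 0 < (c k).2 < H /\ r0 < (c k).1 < zeta (c k).2].
Proof.
case: x => r z H0 cz zr [/= hz /andP[hr hr']].
have J0 := zr z hz; have J0' : 0 < zeta z - r0 by rewrite subr_gt0.
pose l := (r - r0) / (zeta z - r0).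
have l0 : 0 <= l by rewrite divr_ge0 ?subr_ge0// ltW.
have l1 : l <= 1 by rewrite ler_pdivrMr// mul1r lerD2r.
pose kk := cl (0 : R) 1.
have kk01 k : 0 <= kk k <= 1 by apply: cl_itv; exact: ler01.
pose zk k := cl 0 H (kk k * z + (1 - kk k) * (H / 2)).
pose lk k := kk k * l + (1 - kk k) * (1 / 2).
have zkH k : 0 <= zk k <= H by apply: cl_itv; exact: ltW.
have zkE k : zk k = kk k * z + (1 - kk k) * (H / 2).
  move: (kk01 k) hz => /andP[k0 k1] /andP[z0 z1].
  have H2 : 0 <= H / 2 <= H by apply/andP; split; clear -H0; lra.
  rewrite /zk cl_id//; move: H2 => /andP[h1 h2]; apply/andP; split; clear -k0 k1 z0 z1 h1 h2; nra.
have ckk : continuous kk by exact: continuous_cl.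
have cc (a : R) : continuous (fun _ : R => a) by move=> ?; exact: cvg_cst.
have czk : continuous zk.
  have h1 := continuous_mul ckk (cc z).
  have h2 := continuous_mul (continuous_sub (cc 1) ckk) (cc (H / 2)).
  exact: (continuous_compo (continuous_add h1 h2) (@continuous_cl _ _ _)).
have clk : continuous lk.
  have h1 := continuous_mul ckk (cc l).
  have h2 := continuous_mul (continuous_sub (cc 1) ckk) (cc (1 / 2)).
  exact: continuous_add h1 h2.
have czz : continuous (fun k => zeta (zk k)).
  by apply: (continuous_within_comp cz czk) => k; rewrite /= in_itv/=; exact: zkH.
exists (fun k => (r0 + lk k * (zeta (zk k) - r0), zk k)); split.
- apply: continuous_pair => //; apply: (continuous_add (cc r0)).
  exact: (continuous_mul clk (continuous_sub czz (cc r0))).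
- have k1 : kk 1 = 1 by rewrite /kk cl_id// ler01 lexx.
  have -> : zk 1 = z by rewrite zkE k1 mul1r subrr mul0r addr0.
  rewrite /lk k1 mul1r subrr mul0r addr0 /l divfK ?gt_eqF//.
  by rewrite addrC subrK.
- move=> k; split=> //=; have h := zr _ (zkH k).
  have hl : 0 <= lk k <= 1.
    by move: (kk01 k) => /andP[k0 k1]; rewrite /lk; apply/andP; split; clear -k0 k1 l0 l1; nra.
  have hJ : 0 <= zeta (zk k) - r0 by rewrite subr_ge0 ltW.
  move: hl => /andP[h0 h1]; rewrite lerDl mulr_ge0//= -lerBrDl.
  exact: ler_piMl.
move=> k /andP[k0 k1] /=.
have kE : kk k = k by rewrite /kk cl_id// !ltW.
have hzk : 0 < zk k < H.
  rewrite zkE kE; move: hz => /andP[z0 z1].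
  by apply/andP; split; clear -k0 k1 z0 z1 H0; nra.
split=> //; have h := zr _ (zkH k); have hJ : 0 < zeta (zk k) - r0 by rewrite subr_gt0.
have hl : 0 < lk k < 1.
  by rewrite /lk kE; apply/andP; split; clear -k0 k1 l0 l1; nra.
move: hl => /andP[h0 h1]; rewrite ltrDl mulr_gt0//= -ltrBrDl.
by rewrite gtr_pMl.
Qed.

Section weighted_measure.
Context d1 d2 (X : measurableType d1) (Y : measurableType d2) (R : realType).
Variables (mu : {measure set X -> \bar R}) (D : set X) (phi : X -> Y) (w : X -> R).
Hypotheses (mD : measurable D) (mphi : measurable_fun D phi)
  (mw : measurable_fun D w) (w0 : forall x, D x -> 0 <= w x).

Lemma weighted_pushforward_measure :
  (\int[mu]_(x in D) (w x)%:E < +oo)%E ->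
  exists nu : {finite_measure set Y -> \bar R}, forall A,
    (nu A = \int[mu]_(x in D `&` phi @^-1` A) (w x)%:E)%E.
Proof.
move=> fin; pose nu A := (\int[mu]_(x in D `&` phi @^-1` A) (w x)%:E)%E.
have nu0 : nu set0 = 0%E by rewrite /nu preimage_set0 setI0 integral_set0.
have nu_ge0 A : (0 <= nu A)%E.
  by apply: integral_ge0 => x [Dx _]; rewrite lee_fin; exact: w0.
have nu_add : semi_sigma_additive nu.
  move=> F mF tF mU.
  have -> : nu (\bigcup_n F n) = (\sum_(0 <= i <oo) nu (F i))%E.
    rewrite /nu preimage_bigcup setI_bigcupr ge0_integral_bigcup//.
    - by move=> k; exact: mphi.
    - apply/measurable_EFinP; apply: measurable_funS mw => //.
      by move=> x [k _ []].
    - by move=> x [k _ [Dx _]]; rewrite lee_fin; exact: w0.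
    - apply/trivIsetP => i j _ _ ij; apply/seteqP; split=> // x [[_ Fi] [_ Fj]].
      move/trivIsetP : tF => /(_ i j Logic.I Logic.I ij) => E.
      by have : (F i `&` F j) (phi x) by []; rewrite E.
  exact: is_cvg_nneseries.
pose B := isMeasure.Build _ Y R nu nu0 nu_ge0 nu_add.
pose nuM : {measure set Y -> \bar R} := HB.pack nu B.
have finM : fin_num_fun nuM.
  apply: lty_fin_num_fun => /=; rewrite /nuM/= /nu preimage_setT setIT.
  exact: fin.
pose nuF : {finite_measure set Y -> \bar R} := HB.pack nu B
  (Measure_isFinite.Build _ Y R nuM finM).
by exists nuF.
Qed.

End weighted_measure.

Lemma compact_separated (R : realType) (T : topologicalType) (K : set T) (N : T -> R) :
  compact K -> {within K, continuous N} -> (forall x, K x -> 0 < N x) ->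
  exists2 d : R, 0 < d & forall x, K x -> d <= N x.
Proof.
move=> cK cN N0.
have clN : closed [set N x | x in K].
  by apply: compact_closed => //; exact: continuous_compact.
have /nbhs_ballP[d /= d0 h] : nbhs (0 : R) (~` [set N x | x in K]).
  apply: open_nbhs_nbhs; split; first exact: closed_openC.
  by move=> [x /N0 + x0]; rewrite x0 ltxx.
exists d => // x Kx; rewrite leNgt; apply/negP => Nx.
apply: (h (N x)); last by exists x.
by rewrite /ball/= sub0r normrN gtr0_norm//; exact: N0.
Qed.

(** The gradient of a convex function is strictly monotone where it is
    injective. *)
Lemma gradient_strict_mono (R : realType) (D : set (R * R)) (f : R * R -> R)
    (G : R * R -> R * R) (p p1 : R * R) (e : R) :
  convex_function (E := (R * R)%type) D f -> 0 < e -> cball p e `<=` D -> D p1 ->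
  (forall p', D p' -> is_grad f p' (G p')) -> G p <> G p1 ->
  0 < dot (p - p1) (G p - G p1).
Proof.
move=> cf e0 eD Dp1 gf ne; have Dp : D p by apply: eD; rewrite /cball/= subrr normr0 ltW.
rewrite ltNge; apply/negP => le0; apply: ne.
have h1 := convex_subgradient cf Dp (gf _ Dp) Dp1.
apply: (is_grad_min (gf _ Dp) e0) => p' hp'.
have h2 := convex_subgradient cf Dp1 (gf _ Dp1) (eD _ (ltW hp')).
move: h1 h2 le0; rewrite !dotBl !dotBr; clear; lra.
Qed.

(** * Second derivatives on flat pieces *)

Lemma derive1_near_affine (K : realType) (f : K -> K) (x c d r : K) : 0 < r ->
  (forall k, `|k| < r -> f (x + k) = d + k * c) -> derive1 f x = c.
Proof.
move=> r0 h.
have h1 : is_derive x 1 (fun y : K => c *: (y - x)) (c *: (1 - 0)).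
  by apply: is_deriveZ; apply: is_deriveB.
have h2 : is_derive x 1 (fun y : K => d + c *: (y - x)) (0 + c *: (1 - 0)).
  exact: is_deriveD.
have nr : \forall y \near x, d + c *: (y - x) = f y.
  have : nbhs x (ball x r) by exact: nbhsx_ballx.
  apply: filterS => y /= hy; have := h (y - x); rewrite distrC => /(_ hy).
  by rewrite addrC subrK => ->; rewrite /GRing.scale/= mulrC.
have h3 := near_eq_is_derive1 nr h2.
by rewrite derive1E (@derive_val _ _ _ _ _ _ _ h3) subr0 add0r /GRing.scale/= mulr1.
Qed.

(** If f is affine along each line in the first direction, with a common slope, then
    D1 f is locally constant. *)
Lemma hess_det_flat1 (K : realType) (f : K -> K -> K -> K) (t : K) (q : K * K) (r c : K) :
  0 < r -> (forall q' k, `|q' - q| < r -> `|q' + k *: (1, 0) - q| < r ->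
    f t (q' + k *: (1, 0)).1 (q' + k *: (1, 0)).2 = f t q'.1 q'.2 + k * c) ->
  hess_det f t q.1 q.2 = 0.
Proof.
case: q => y z r0 h /=.
have d1 y' z' : `|y' - y| < r -> `|z' - z| < r -> D1 f t y' z' = c.
  move=> hy hz; have e0 : 0 < r - `|y' - y| by rewrite subr_gt0.
  apply: (derive1_near_affine (d := f t y' z') e0) => k hk.
  have := h (y', z') k; rewrite !normr_prodE/= scaler0 addr0 !gt_max hy hz/= andbT.
  rewrite /GRing.scale/= mulr1; apply => //.
  rewrite addrAC (le_lt_trans (ler_normD _ _))//.
  by move: hk; rewrite ltrBrDl.
have zz (x : K) : `|x - x| < r by rewrite subrr normr0.
have d11 : D1 (D1 f) t y z = 0.
  apply: (derive1_near_affine (d := c) r0) => k hk.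
  by rewrite d1 ?mulr0 ?addr0//; rewrite addrAC subrr add0r.
have d21 : D2 (D1 f) t y z = 0.
  apply: (derive1_near_affine (d := c) r0) => k hk.
  by rewrite d1 ?mulr0 ?addr0//; rewrite addrAC subrr add0r.
by rewrite /hess_det d11 d21 !mul0r subrr.
Qed.

(** The same in the second direction; e is the sign of its orientation. *)
Lemma hess_det_flat2 (K : realType) (f : K -> K -> K -> K) (t : K) (q : K * K) (r c e : K) :
  0 < r -> e * e = 1 -> (forall q' k, `|q' - q| < r -> `|q' + k *: (0, e) - q| < r ->
    f t (q' + k *: (0, e)).1 (q' + k *: (0, e)).2 = f t q'.1 q'.2 + k * c) ->
  hess_det f t q.1 q.2 = 0.
Proof.
case: q => y z r0 ee h /=.
have d2 y' z' : `|y' - y| < r -> `|z' - z| < r -> D2 f t y' z' = e * c.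
  move=> hy hz; have e0 : 0 < r - `|z' - z| by rewrite subr_gt0.
  apply: (derive1_near_affine (d := f t y' z') e0) => k hk.
  have := h (y', z') (k * e); rewrite !normr_prodE/= scaler0 addr0 !gt_max hy hz/=.
  rewrite /GRing.scale/= -mulrA ee mulr1 -mulrA; apply => //.
  rewrite addrAC (le_lt_trans (ler_normD _ _))//.
  by move: hk; rewrite ltrBrDl.
have zz (x : K) : `|x - x| < r by rewrite subrr normr0.
have d22 : D2 (D2 f) t y z = 0.
  apply: (derive1_near_affine (d := e * c) r0) => k hk.
  by rewrite d2 ?mulr0 ?addr0//; rewrite addrAC subrr add0r.
have d12 : D1 (D2 f) t y z = 0.
  apply: (derive1_near_affine (d := e * c) r0) => k hk.
  by rewrite d2 ?mulr0 ?addr0//; rewrite addrAC subrr add0r.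
by rewrite /hess_det d22 d12 !mulr0 subrr.
Qed.

Lemma measurable_region_map (K : realType) (r0 H : K) (zeta : K -> K) (G : K * K -> K * K) :
  0 <= H -> {within `[0, H], continuous zeta} ->
  {within region r0 H zeta, continuous G} ->
  measurable_fun (region r0 H zeta) (G : plane K -> plane K).
Proof.
move=> H_ge0 czeta cG; have cl := closed_region H_ge0 czeta (r0 := r0).
have m1 := @measurable_restrict2 K _ (fun x => (G x).1) cl.
have m2 := @measurable_restrict2 K _ (fun x => (G x).2) cl.
have c1 := within_compT (@continuous_fst K K) cG.
have c2 := within_compT (@continuous_snd K K) cG.
apply: eq_measurable_fun (measurable_funTS (measurable_fun_pair (m1 c1) (m2 c2))).
by move=> x xD; rewrite !patchE xD; case: (G x).
Qed.

(** * Localization of integrals *)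

Transparent itg Cn.

Section localization.
Context {R : realType}.

Lemma itg_restrict (a b a' b' : R) (f : R -> R) : a <= a' -> b' <= b ->
  (forall x, a <= x <= b -> ~ (a' <= x <= b') -> f x = 0) -> itg a b f = itg a' b' f.
Proof.
move=> aa bb f0; rewrite /itg /Rintegral; congr fine; apply: integral_zero_outside.
  move=> x; rewrite /= !in_itv/= => /andP[h1 h2].
  by rewrite (le_trans aa h1) (le_trans h2 bb).
by move=> x; rewrite /= !in_itv/= => h1 /f0 ->.
Qed.

Lemma itg_eq0 (a b : R) (f : R -> R) : a <= b ->
  (forall x, a <= x <= b -> f x = 0) -> itg a b f = 0.
Proof. by move=> ab f0; rewrite (@eq_int _ a b f (fun=> 0))// int_cst// mul0r. Qed.

Lemma int3_restrict (a1 b1 a2 b2 a3 b3 c1 d1 c2 d2 c3 d3 : R) (f : R -> R -> R -> R) :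
  a1 <= c1 -> d1 <= b1 -> a2 <= c2 -> d2 <= b2 -> a3 <= c3 -> d3 <= b3 ->
  a2 <= b2 -> a3 <= b3 ->
  (forall t x y, cbox a1 b1 a2 b2 a3 b3 (t, (x, y)) ->
    ~ cbox c1 d1 c2 d2 c3 d3 (t, (x, y)) -> f t x y = 0) ->
  int3 a1 b1 a2 b2 a3 b3 f = int3 c1 d1 c2 d2 c3 d3 f.
Proof.
move=> h1 h2 h3 h4 h5 h6 ab2 ab3 f0.
have sub (a b c d x : R) : a <= c -> d <= b -> c <= x <= d -> a <= x <= b.
  by move=> ac db /andP[k1 k2]; rewrite (le_trans ac k1) (le_trans k2 db).
rewrite /int3 (itg_restrict h1 h2); last first.
  move=> t ht nt; apply: itg_eq0 => // x hx; apply: itg_eq0 => // y hy.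
  by apply: f0 => // -[].
apply: eq_int => t ht; have ht' := sub _ _ _ _ _ h1 h2 ht.
rewrite (itg_restrict h3 h4); last first.
  by move=> x hx nx; apply: itg_eq0 => // y hy; apply: f0 => // -[].
apply: eq_int => x hx; have hx' := sub _ _ _ _ _ h3 h4 hx.
apply: itg_restrict => // y hy ny; apply: f0 => //.
by move=> [].
Qed.

Lemma int2_gt0 (a b c d x0 y0 : R) (f : R -> R -> R) : a < b -> c < d ->
  {within [set p : R * R | a <= p.1 <= b /\ c <= p.2 <= d], continuous (fun p => f p.1 p.2)} ->
  (forall x y, a <= x <= b -> c <= y <= d -> 0 <= f x y) ->
  a <= x0 <= b -> c <= y0 <= d -> 0 < f x0 y0 ->
  0 < itg a b (fun x => itg c d (f x)).
Proof.
move=> ab cd cf f0 hx0 hy0 fgt; have ab' := ltW ab; have cd' := ltW cd.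
pose k x y := f (cl a b x) (cl c d y).
have ck : continuous (fun p : R * R => k p.1 p.2).
  apply: (continuous_within_comp (c := fun p : R * R => (cl a b p.1, cl c d p.2)) cf).
    move=> p; have k1 : {for p, continuous (fun p : R * R => cl a b p.1)}.
      by apply: (@continuous_comp _ _ _ fst (cl a b)); [exact: cvg_fst|exact: continuous_cl].
    have k2 : {for p, continuous (fun p : R * R => cl c d p.2)}.
      by apply: (@continuous_comp _ _ _ snd (cl c d)); [exact: cvg_snd|exact: continuous_cl].
    exact: (cvg_pair k1 k2).
  by move=> p; split; exact: cl_itv.
have -> : itg a b (fun x => itg c d (f x)) = itg a b (fun x => itg 0 1 (fun _ => itg c d (k x))).
  apply: eq_int => x hx; rewrite int_cst ?ler01// subr0 mulr1.
  by apply: eq_int => y hy; rewrite /k !cl_id.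
apply: (int_gt0 (x0 := x0)) => //.
- apply: (@continuous_int2 R R 0 1 c d (fun x _ y => k x y) ler01 cd').
  have cc : continuous (fun p : R * (R * R) => (p.1, p.2.2)).
    move=> p; have k2 : {for p, continuous (fun p : R * (R * R) => p.2.2)}.
      by apply: (@continuous_comp _ _ _ snd snd); exact: cvg_snd.
    exact: (cvg_pair cvg_fst k2).
  exact: (continuous_compo cc ck).
- move=> x hx; rewrite int_cst ?ler01// subr0 mulr1; apply: int_ge0 => y hy.
  by apply: f0; exact: cl_itv.
- rewrite int_cst ?ler01// subr0 mulr1; apply: (int_gt0 (x0 := y0)) => //.
  + by move=> y; apply: (continuous_compo (@continuous_pairl _ _ x0) ck).
  + by move=> y hy; apply: f0; exact: cl_itv.
  + by rewrite /k !cl_id.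
Qed.

Lemma int3_gt0 (a1 b1 a2 b2 a3 b3 : R) (f : R -> R -> R -> R) t0 x0 y0 :
  a1 < b1 -> a2 < b2 -> a3 < b3 -> {within cbox a1 b1 a2 b2 a3 b3, continuous (unc f)} ->
  (forall t x y, cbox a1 b1 a2 b2 a3 b3 (t, (x, y)) -> 0 <= f t x y) ->
  cbox a1 b1 a2 b2 a3 b3 (t0, (x0, y0)) -> 0 < f t0 x0 y0 -> 0 < int3 a1 b1 a2 b2 a3 b3 f.
Proof.
move=> h1 h2 h3 cf f0 hp fgt; pose k := clamp a1 b1 a2 b2 a3 b3 f.
have ck : continuous (unc k) by exact: clamp_continuous.
have [/= k1 k2 k3] := hp.
have -> : int3 a1 b1 a2 b2 a3 b3 f = int3 a1 b1 a2 b2 a3 b3 k.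
  by apply: eq_int => t ht; apply: eq_int => x hx; apply: eq_int => y hy; rewrite /k clampE.
have kge t x y : 0 <= k t x y by apply: f0; split; apply: cl_itv; exact: ltW.
apply: (int_gt0 (x0 := t0)) => //.
- exact: (@continuous_int2 R R a2 b2 a3 b3 k (ltW h2) (ltW h3) ck).
- by move=> t ht; apply: int_ge0 => x hx; exact: int_ge0.
- apply: (int2_gt0 (x0 := x0) (y0 := y0)) => //; last by rewrite /k clampE.
  apply: continuous_subspaceT.
  exact: (continuous_compo (@continuous_pairl _ _ t0) ck).
Qed.

Lemma within_pos_near (A : set (R * (R * R))) (f : R * (R * R) -> R) x0 :
  {within A, continuous f} -> A x0 -> 0 < f x0 -> exists2 e : R, 0 < e &
  forall x, A x -> `|x.1 - x0.1| < e -> `|x.2.1 - x0.2.1| < e -> `|x.2.2 - x0.2.2| < e -> 0 < f x.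
Proof.
move=> /subspace_continuousP cf Ax fx.
have /(cf x0 Ax) : nbhs (f x0) [set y : R | 0 < y].
  by apply: open_nbhs_nbhs; split => //; exact: open_gt.
move=> /nbhs_ballP[e /= e0 he]; exists e => // x hx h1 h2 h3; apply: he => //.
by split; [rewrite /ball/= distrC|split; rewrite /ball/= distrC].
Qed.

Lemma int3_within_add (a1 b1 a2 b2 a3 b3 : R) (f k : R -> R -> R -> R) :
  a1 < b1 -> a2 < b2 -> a3 < b3 -> {within cbox a1 b1 a2 b2 a3 b3, continuous (unc f)} ->
  {within cbox a1 b1 a2 b2 a3 b3, continuous (unc k)} ->
  int3 a1 b1 a2 b2 a3 b3 (fun t x y => f t x y + k t x y) =
  int3 a1 b1 a2 b2 a3 b3 f + int3 a1 b1 a2 b2 a3 b3 k.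
Proof.
move=> h1 h2 h3 cf ck.
have cE (j : R -> R -> R -> R) : int3 a1 b1 a2 b2 a3 b3 (clamp a1 b1 a2 b2 a3 b3 j) =
    int3 a1 b1 a2 b2 a3 b3 j.
  by apply: eq_int => t ht; apply: eq_int => x hx; apply: eq_int => y hy; rewrite clampE.
rewrite -(cE f) -(cE k) -cE; apply: int3D; try exact: ltW.
- exact: clamp_continuous.
- exact: clamp_continuous.
Qed.

Lemma int3_sign (a1 b1 a2 b2 a3 b3 s : R) (f : R -> R -> R -> R) t0 x0 y0 :
  a1 < b1 -> a2 < b2 -> a3 < b3 -> {within cbox a1 b1 a2 b2 a3 b3, continuous (unc f)} ->
  (forall t x y, cbox a1 b1 a2 b2 a3 b3 (t, (x, y)) -> 0 <= s * f t x y) ->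
  cbox a1 b1 a2 b2 a3 b3 (t0, (x0, y0)) -> 0 < s * f t0 x0 y0 ->
  int3 a1 b1 a2 b2 a3 b3 f <> 0.
Proof.
move=> h1 h2 h3 cf f0 hp fgt I0; have [s0|s0|s0] := ltgtP s 0.
- have cn : {within cbox a1 b1 a2 b2 a3 b3, continuous (unc (fun t x y => - f t x y))}.
    move=> x; exact: (@continuousN _ _ (subspace (cbox a1 b1 a2 b2 a3 b3)) _ x (cf x)).
  have : 0 < int3 a1 b1 a2 b2 a3 b3 (fun t x y => - f t x y).
    apply: (int3_gt0 (t0 := t0) (x0 := x0) (y0 := y0)) => //.
      by move=> t x y /f0; rewrite nmulr_rge0// oppr_ge0.
    by rewrite oppr_gt0 -(nmulr_rgt0 _ s0).
  have A := int3_within_add h1 h2 h3 cf cn.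
  have B : int3 a1 b1 a2 b2 a3 b3 (fun t x y => f t x y + - f t x y) = 0.
    apply: itg_eq0 => [|t ht]; first exact: ltW.
    apply: itg_eq0 => [|x hx]; first exact: ltW.
    by apply: itg_eq0 => [|y hy]; [exact: ltW|rewrite subrr].
  by rewrite B I0 add0r in A; rewrite -A ltxx.
- have : 0 < int3 a1 b1 a2 b2 a3 b3 f.
    apply: (int3_gt0 (t0 := t0) (x0 := x0) (y0 := y0)) => //.
      by move=> t x y /f0; rewrite pmulr_rge0.
    by rewrite -(pmulr_rgt0 _ s0).
  by rewrite I0 ltxx.
- by move: fgt; rewrite s0 mul0r ltxx.
Qed.

Lemma int2_sign (a b c d s : R) (f : R -> R -> R) x0 y0 : a < b -> c < d ->
  {within [set p : R * R | a <= p.1 <= b /\ c <= p.2 <= d], continuous (fun p => f p.1 p.2)} ->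
  (forall x y, a <= x <= b -> c <= y <= d -> 0 <= s * f x y) ->
  a <= x0 <= b -> c <= y0 <= d -> 0 < s * f x0 y0 ->
  itg a b (fun x => itg c d (f x)) <> 0.
Proof.
move=> ab cd cf f0 hx hy fgt.
have -> : itg a b (fun x => itg c d (f x)) = int3 a b 0 1 c d (fun x _ y => f x y).
  by apply: eq_int => x _; rewrite int_cst ?ler01// subr0 mulr1.
apply: (@int3_sign a b 0 1 c d s _ x0 0 y0) => //.
- have cc : continuous (fun p : R * (R * R) => (p.1, p.2.2)).
    move=> p; have k2 : {for p, continuous (fun p : R * (R * R) => p.2.2)}.
      by apply: (@continuous_comp _ _ _ snd snd); exact: cvg_snd.
    exact: (cvg_pair cvg_fst k2).
  apply: (@within_comp _ _ _ _ (cbox a b 0 1 c d) (fun p : R * R => f p.1 p.2)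
    (fun p : R * (R * R) => (p.1, p.2.2)) cf (continuous_subspaceT cc)).
  by move=> p [].
- by move=> t x y [/= h1 _ h2]; exact: f0.
- by split => //=; rewrite lexx ler01.
Qed.

(** A nonnegative function has vanishing derivatives at its zeros. *)
Lemma partial_zero_ge0 (U : set (R * (R * R))) (h : R -> R -> R -> R) t x y : open U ->
  (forall p, U p -> differentiable (unc h) p) -> U (t, (x, y)) ->
  (forall t x y, 0 <= h t x y) -> h t x y = 0 ->
  [/\ Dt h t x y = 0, D1 h t x y = 0 & D2 h t x y = 0].
Proof.
move=> oU dh Ux h0 hz.
have gen (l m n : R -> R) (l' m' n' s : R) : (forall u : R, is_derive u 1 l l') ->
    (forall u : R, is_derive u 1 m m') -> (forall u : R, is_derive u 1 n n') ->
    (l s, (m s, n s)) = (t, (x, y)) -> derive1 (fun y => h (l y) (m y) (n y)) s = 0.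
  move=> dl dm dn E.
  have ct (k : R -> R) k' : is_derive s 1 k k' -> {for s, continuous k}.
    by move=> [dk _]; apply: differentiable_continuous; exact/derivable1_diffP.
  have : \forall u \near s, U (l u, (m u, n u)).
    have c : {for s, continuous (fun u => (l u, (m u, n u)))}.
      by apply: continuous_triple; [exact: ct (dl s)|exact: ct (dm s)|exact: ct (dn s)].
    by apply: c; apply: open_nbhs_nbhs; rewrite E.
  move=> /nbhs_ballP[e /= e0 he].
  have inb u : u \in `]s - e, s + e[ -> U (l u, (m u, n u)).
    rewrite in_itv/= => hu; apply: he; rewrite /ball/= distrC ltr_distl.
    exact: hu.
  have [||||_ dE] := @derive1_at_min R (fun y => h (l y) (m y) (n y)) (s - e) (s + e) s.
  - by rewrite lerD2l ge0_cp ?ltW.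
  - by move=> u /inb Uu; have [] := is_derive_unc (dh _ Uu) (dl u) (dm u) (dn u).
  - by rewrite in_itv/= ltrBlDr !ltrDl e0.
  - by move=> u _; case: E => -> -> ->; rewrite hz.
  by rewrite derive1E dE.
split.
- by apply: (gen id (cst x) (cst y) 1 0 0 t) => // u; exact: is_derive_cst.
- by apply: (gen (cst t) id (cst y) 0 1 0 x) => // u; exact: is_derive_cst.
- by apply: (gen (cst t) (cst x) id 0 0 1 y) => // u; exact: is_derive_cst.
Qed.
(** The endpoints of an interval are reached from its interior. *)
Lemma zero_on_closure (b : R) (f : R -> R) : 0 < b -> {within `[0, b], continuous f} ->
  (forall x, 0 < x < b -> f x = 0) -> forall x, 0 <= x <= b -> f x = 0.
Proof.
move=> b0 cf f0 x hx; pose c k := cl 0 b (k * x + (1 - k) * (b / 2)).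
have cm : continuous (fun k : R => k * x + (1 - k) * (b / 2)).
  move=> k; have c1 : {for k, continuous (fun k : R => k * x)} by exact: (cvgM cvg_id (cvg_cst x)).
  have c2 : {for k, continuous (fun k : R => (1 - k) * (b / 2))}.
    exact: (cvgM (cvgB (cvg_cst (1 : R)) cvg_id) (cvg_cst _)).
  exact: (cvgD c1 c2).
have cc : continuous c := continuous_compo cm (@continuous_cl _ 0 b).
have cI k : `[0, b]%classic (c k) by rewrite /= in_itv/=; apply: cl_itv; exact: ltW.
have := eq_at1 (continuous_within_comp cf cc cI) (fun k => cvg_cst (0 : R)).
rewrite /c mul1r subrr mul0r addr0 cl_id//; apply => k hk.
have hm : 0 < k * x + (1 - k) * (b / 2) < b.
  move: hx hk => /andP[x0 xb] /andP[k0 k1].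
  have h1 : 0 <= k * x by rewrite mulr_ge0// ltW.
  have h2 : k * x <= k * b by rewrite ler_wpM2l// ltW.
  have h3 : 0 < (1 - k) * (b / 2) by rewrite mulr_gt0 ?subr_gt0// divr_gt0.
  have h4 : (1 - k) * (b / 2) < (1 - k) * b by rewrite ltr_pM2l ?subr_gt0// half_lt.
  by clear -h1 h2 h3 h4; apply/andP; split; lra.
by rewrite cl_id ?f0//; case/andP: hm => *; rewrite !ltW.
Qed.
End localization.

(** * Algebra of the inverse differential *)

Lemma material_snd (K : realType) (X : K -> K -> K -> K * K) t r z :
  material X (fun _ _ z => z) t r z = (X t r z).2.
Proof.
have p0 : Dt (fun _ _ z => z) t r z = 0 :> K by exact: derive1_cst.
have p1 : D1 (fun _ _ z => z) t r z = 0 :> K by exact: derive1_cst.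
have p2 : D2 (fun _ _ z => z) t r z = 1 :> K by exact: derive1_id.
by rewrite /material p0 p1 p2 mulr0 mulr1 addr0 add0r.
Qed.

(** A square matrix with a right inverse is injective. *)
Lemma jac_inv (K : comPzRingType) (a1 a2 b1 b2 n11 n12 n21 n22 d1 d2 : K) :
  n11 * a1 + n21 * a2 = 1 -> n12 * a1 + n22 * a2 = 0 ->
  n11 * b1 + n21 * b2 = 0 -> n12 * b1 + n22 * b2 = 1 ->
  d1 * a1 + d2 * a2 = 0 -> d1 * b1 + d2 * b2 = 0 -> d1 = 0 /\ d2 = 0.
Proof.
move=> h1 h2 h3 h4 k1 k2.
have e : (a1 * b2 - a2 * b1) * (n11 * n22 - n12 * n21) = 1.
  transitivity ((n11 * a1 + n21 * a2) * (n12 * b1 + n22 * b2) -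
    (n12 * a1 + n22 * a2) * (n11 * b1 + n21 * b2)); first by ring.
  by rewrite h1 h2 h3 h4 mul1r mul0r subr0.
split.
- transitivity (d1 * ((a1 * b2 - a2 * b1) * (n11 * n22 - n12 * n21))).
    by rewrite e mulr1.
  transitivity ((b2 * (d1 * a1 + d2 * a2) - a2 * (d1 * b1 + d2 * b2)) *
    (n11 * n22 - n12 * n21)); first by ring.
  by rewrite k1 k2 !mulr0 subrr mul0r.
- transitivity (d2 * ((a1 * b2 - a2 * b1) * (n11 * n22 - n12 * n21))).
    by rewrite e mulr1.
  transitivity ((a1 * (d1 * b1 + d2 * b2) - b1 * (d1 * a1 + d2 * a2)) *
    (n11 * n22 - n12 * n21)); first by ring.
  by rewrite k1 k2 !mulr0 subrr mul0r.
Qed.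

Lemma diff_comb (K : comPzRingType) (x d m1 m2 V1 V2 a1 a2 : K) :
  x = d + m1 * a1 + m2 * a2 -> x = d + V1 * a1 + V2 * a2 ->
  (m1 - V1) * a1 + (m2 - V2) * a2 = 0.
Proof.
move=> h1 h2.
transitivity ((d + m1 * a1 + m2 * a2) - (d + V1 * a1 + V2 * a2)); first by ring.
by rewrite -h1 -h2 subrr.
Qed.

(** The chain rule for the inverse map, as an identity of determinants. *)
Lemma jac_det (K : comPzRingType) (p1 p2 q1 q2 a11 a12 a21 a22 s : K) :
  s = p1 * a11 + q1 * a12 -> 0 = p2 * a11 + q2 * a12 ->
  0 = p1 * a21 + q1 * a22 -> 1 = p2 * a21 + q2 * a22 ->
  (a11 * a22 - a12 * a21) * (p1 * q2 - p2 * q1) = s.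
Proof.
move=> h1 h2 h3 h4.
transitivity ((p1 * a11 + q1 * a12) * (p2 * a21 + q2 * a22) -
  (p2 * a11 + q2 * a12) * (p1 * a21 + q1 * a22)); first by ring.
by rewrite -h1 -h2 -h3 -h4 mulr1 mul0r subr0.
Qed.

Lemma within_sub (R : realType) (W : topologicalType) (A : set W) (f k : W -> R) :
  {within A, continuous f} -> {within A, continuous k} ->
  {within A, continuous (fun x => f x - k x)}.
Proof. by move=> cf ck x; exact: (@continuousB _ _ (subspace A) f k x (cf x) (ck x)). Qed.

(** * From the dual measure to the fluid: duality and static balances *)

Section converse.
Context {R : realType}.
Variables (r0 H Om g th0 T : R) (F S : R -> R -> R -> R)
  (sigma : R -> probability (plane R) R) (dens : R -> R * R -> R)
  (P Psi : R -> R -> R -> R) (rho : R -> R -> R) (u theta v w : R -> R -> R -> R).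
Hypotheses (r0_gt0 : 0 < r0) (H_gt0 : 0 < H) (g_gt0 : 0 < g)
  (th0_gt0 : 0 < th0).
Let phi := phi_of r0 Om P.
Let zeta := zeta_of r0 rho.
Let V := VEL r0 g th0 F S Psi.
Hypotheses
  (F_smooth : smooth_on [set x : R * (R * R) | 0 <= x.1 <= T /\ strip r0 H x.2] F)
  (S_smooth : smooth_on [set x : R * (R * R) | 0 <= x.1 <= T /\ strip r0 H x.2] S)
  (spt_bounded : exists M : R, forall t, 0 <= t <= T -> spt (sigma t) `<=`
    [set q | [/\ 0 <= q.1, 0 <= q.2 & q.1 ^+ 2 + q.2 ^+ 2 <= M ^+ 2]])
  (sigma_dens : forall t, 0 <= t <= T -> [/\ measurable_fun [set: plane R] (dens t),
    forall q, 0 <= dens t q &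
    forall A : set (plane R), measurable A ->
      (sigma t A = \int[leb2 R]_(q in A) (dens t q)%:E)%E])
  (P_smooth : smooth_on [set x : R * (R * R) | 0 <= x.1 <= T /\ domD r0 H x.2] P)
  (Psi_smooth : smooth_on
    [set x : R * (R * R) | 0 <= x.1 <= T /\ (spt (sigma x.1))° x.2] Psi)
  (Psi_diff : forall t q, 0 <= t <= T -> spt (sigma t) q ->
    differentiable (fun q' : R * R => Psi t q'.1 q'.2) q)
  (rho_smooth : smooth_on [set x : R * (R * R) | 0 <= x.1 <= T /\ 0 <= x.2.1 <= H]
    (fun t z _ => rho t z))
  (rho_bounds : forall t z, 0 <= t <= T -> 0 <= z <= H ->
    0 < rho t z < (2 * r0 ^+ 2)^-1)
  (duality : forall t, 0 <= t <= T ->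
    [/\ convex_function (E := (R * R)%type) (domD r0 H) (fun p => P t p.1 p.2),
        convex_function (E := (R * R)%type) setT (fun q => Psi t q.1 q.2),
        forall q, Psi t q.1 q.2 = Psi_of r0 H P t q.1 q.2 &
        forall p, domD r0 H p ->
          P t p.1 p.2 = legendre setT (fun q => Psi t q.1 q.2) p])
  (monge_ampere : forall t, 0 <= t <= T -> {ae leb2 R, forall q, spt (sigma t) q ->
    e_ r0 (D1 Psi t q.1 q.2) * hess_det Psi t q.1 q.2 = dens t q})
  (image_spt : forall t, 0 <= t <= T ->
    [set grad Psi t q.1 q.2 | q in spt (sigma t)] = Drho H rho t)
  (P_boundary : forall t, 0 <= t <= T ->
    P t (rho t H) H = Om ^+ 2 * r0 ^+ 2 / (2 * (1 - 2 * r0 ^+ 2 * rho t H)))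
  (u_theta : forall t r z, 0 <= t <= T -> Gam r0 H zeta t (r, z) ->
    [/\ (u t r z * r + r ^+ 2 * Om) ^+ 2 = D1 P t (s_of r0 r) z,
        0 <= u t r z * r + r ^+ 2 * Om &
        g / th0 * theta t r z = D2 P t (s_of r0 r) z])
  (velocity : forall t q, 0 < t < T -> (spt (sigma t))° q ->
    vfield v w t (r_of r0 (D1 Psi t q.1 q.2)) (D2 Psi t q.1 q.2) =
      (material V (fun t' Y Z => r_of r0 (D1 Psi t' Y Z)) t q.1 q.2,
       material V (D2 Psi) t q.1 q.2))
  (v_cont : {within movingT r0 H T zeta, continuous (unc v)})
  (w_cont : {within movingT r0 H T zeta, continuous (unc w)})
  (transport : continuity_equation_init T sigma V).

Let Z := proj1_sig (cid (smooth_onP rho_smooth)).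
Let oZ : open Z. Proof. by rewrite /Z; case: cid => ? []. Qed.
Let subZ t z : 0 <= t <= T -> 0 <= z <= H -> Z (t, (z, 0)).
Proof. by rewrite /Z; case: cid => ? /= [_ h _] h1 h2; exact: h. Qed.
Let hZ n : Cn n Z (fun t z _ => rho t z).
Proof. by rewrite /Z; case: cid => ? []. Qed.

Let UP := proj1_sig (cid (smooth_onP P_smooth)).
Let oUP : open UP. Proof. by rewrite /UP; case: cid => ? []. Qed.
Let subUP t p : 0 <= t <= T -> domD r0 H p -> UP (t, p).
Proof. by rewrite /UP; case: cid => ? /= [_ h _] h1 h2; exact: h. Qed.
Let hUP n : Cn n UP P.
Proof. by rewrite /UP; case: cid => ? []. Qed.

Let closed_time t : 0 < t < T -> 0 <= t <= T.
Proof. by move=> /andP[? ?]; rewrite !ltW. Qed.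

Let G t (p : R * R) : R * R := grad P t p.1 p.2.
Let D := domD r0 H.

Let gradP t p : 0 <= t <= T -> D p -> is_grad (fun p => P t p.1 p.2) p (G t p).
Proof. by move=> ht Dp; apply: is_grad_slice; exact: (Cn_diff (hUP 0) (subUP ht Dp)). Qed.

Let gradPsi t q : 0 <= t <= T -> spt (sigma t) q ->
  is_grad (fun q => Psi t q.1 q.2) q (grad Psi t q.1 q.2).
Proof. by move=> ht hq; apply: is_grad_diff; exact: Psi_diff. Qed.

Let Drho_D t p : 0 <= t <= T -> Drho H rho t p -> D p.
Proof.
case: p => s z ht [/= hz /andP[s0 sr]]; split=> //=; rewrite s0/=.
by have /andP[_] := rho_bounds ht hz; exact: le_lt_trans.
Qed.

Let Drho_int_sub t p : Drho_int H rho t p -> Drho H rho t p.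
Proof. by move=> [/andP[? ?] /andP[? ?]]; split; rewrite !ltW. Qed.

Let D_nonempty : D !=set0.
Proof. by exists (0, 0); split; rewrite /= lexx//= ?ltW// invr_gt0 mulr_gt0// exprn_gt0. Qed.

Let D_bounded p : D p -> `|p| <= Num.max (2 * r0 ^+ 2)^-1 H.
Proof.
case: p => s z [/= /andP[s0 s1] /andP[z0 z1]].
by rewrite normr_prodE/= ger0_norm// ger0_norm// ge_max !le_max (ltW s1) z1 orbT.
Qed.

Let near_Drho_int t p : 0 <= t <= T -> Drho_int H rho t p ->
  exists2 e : R, 0 < e & cball p e `<=` Drho_int H rho t.
Proof.
move=> ht; case: p => s z [/= /andP[z0 zH] /andP[s0 sr]].
have hz : 0 <= z <= H by rewrite !ltW.
have cr : {for (s, z), continuous (fun x : R * R => rho t x.2 - x.1)}.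
  have c1 : {for (s, z), continuous (fun x : R * R => rho t x.2)}.
    apply: (@continuous_comp _ _ _ (fun x : R * R => (t, (x.2, 0 : R)))
      (unc (fun t z _ => rho t z))).
      by apply: continuous_triple; [exact: cvg_cst|exact: cvg_snd|exact: cvg_cst].
    by apply: differentiable_continuous; exact: (Cn_diff (hZ 0) (subZ ht hz)).
  exact: (cvgB c1 cvg_fst).
have c1 : {for (s, z), continuous (fun x : R * R => x.1)} by exact: cvg_fst.
have c2 : {for (s, z), continuous (fun x : R * R => x.2)} by exact: cvg_snd.
have gt_near (f : R * R -> R) : {for (s, z), continuous f} ->
    0 < f (s, z) -> \forall x \near (s, z), 0 < f x.
  move=> cf af; have h : nbhs (f (s, z)) [set y : R | 0 < y].
    by apply: open_nbhs_nbhs; split => //; exact: open_gt.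
  exact: (cf _ h).
have n1 := gt_near _ c1 s0; have n2 := gt_near _ c2 z0.
have n3 : \forall x \near (s, z), 0 < H - x.2.
  by apply: gt_near; [exact: (cvgB (cvg_cst H) c2)|rewrite subr_gt0].
have n4 : \forall x \near (s, z), 0 < rho t x.2 - x.1.
  by apply: gt_near => //; rewrite subr_gt0.
have : \forall x \near (s, z), Drho_int H rho t x.
  near=> x; split.
    apply/andP; split; first by near: x.
    by rewrite -subr_gt0; near: x.
  apply/andP; split; first by near: x.
  by rewrite -[_ < rho _ _]subr_gt0; near: x.
move=> /nbhs_normP[e /= e0 he]; exists (e / 2); first by rewrite divr_gt0.
move=> x hx; apply: he; rewrite /= distrC; apply: le_lt_trans hx _; exact: half_lt.
Unshelve. all: by end_near. Qed.

(** Since grad Psi maps the support onto D_rho, some q in the support has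
    gradient p; then q is a subgradient of P at p, and at an interior point this
    is the gradient. *)
Let grad_of_image t p : 0 <= t <= T -> Drho_int H rho t p -> spt (sigma t) (G t p).
Proof.
move=> ht hp; have : Drho H rho t p by exact: Drho_int_sub.
rewrite -(image_spt ht) => -[q hq qp].
have [c1 c2 e1 e2] := duality ht.
have Dp : D p by apply: (Drho_D ht); exact: Drho_int_sub.
have gq := gradPsi ht hq; rewrite qp in gq.
have sub := legendre_subgradient c1 c2 D_nonempty D_bounded (fun p => gradP (p := p) ht) e1 e2 gq Dp.
have [e e0 he] := near_Drho_int ht hp.
have -> : G t p = q; last by [].
apply: (is_grad_min (gradP ht Dp) e0) => p' hp'.
have Dp' : D p'.
  by apply: (Drho_D ht); apply: Drho_int_sub; apply: he; exact: ltW.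
by have := sub p' Dp'; rewrite dotBl => h; rewrite lerBrDr addrAC -addrA.
Qed.

Let crho t : 0 <= t <= T -> {within `[0, H], continuous (rho t)}.
Proof.
move=> ht; apply: continuous_in_subspaceT => z /set_mem/=; rewrite in_itv/= => hz.
apply: (@continuous_comp _ _ _ (fun z : R => (t, (z, 0 : R))) (unc (fun t z _ => rho t z))).
  by apply: continuous_triple; [exact: cvg_cst|exact: cvg_id|exact: cvg_cst].
by apply: differentiable_continuous; exact: (Cn_diff (hZ 0) (subZ ht hz)).
Qed.

Let cG t p : 0 <= t <= T -> D p -> {for p, continuous (G t)}.
Proof.
move=> ht Dp; have c f : Cn 0 UP f -> {for p, continuous (fun p : R * R => f t p.1 p.2)}.
  move=> hf; apply: (@continuous_comp _ _ _ (fun p : R * R => (t, p)) (unc f)).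
    exact: continuous_pairl.
  by apply: differentiable_continuous; exact: (Cn_diff hf (subUP ht Dp)).
exact: (cvg_pair (c _ (Cn_D1 (hUP 1))) (c _ (Cn_D2 (hUP 1)))).
Qed.

(** The boundary of D_rho is reached by paths from its interior, and the support
    is closed. *)
Let spt_G t p : 0 <= t <= T -> Drho H rho t p -> spt (sigma t) (G t p).
Proof.
move=> ht hp.
have [|c [cc <- cD cI]] := @region_approx R 0 H (rho t) p H_gt0 (crho ht) _ hp.
  by move=> z hz; case/andP: (rho_bounds ht hz).
apply: (@closed_at1 R _ (spt (sigma t)) (fun k => G t (c k))) => [|k|k hk].
- exact: spt_closed.
- by apply: continuous_comp; [exact: cc|apply: cG => //; apply: (Drho_D ht); exact: cD].
- by apply: grad_of_image => //; exact: cI.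
Qed.

Let gradPsi_G t p : 0 <= t <= T -> Drho H rho t p -> grad Psi t (G t p).1 (G t p).2 = p.
Proof.
move=> ht hp; have [c1 c2 e1 e2] := duality ht.
exact: (grad_legendreK c1 D_nonempty D_bounded (fun p => gradP (p := p) ht) e1
  (Drho_D ht hp) erefl (gradPsi ht (spt_G ht hp))).
Qed.

Let G_inj t p p' : 0 <= t <= T -> Drho H rho t p -> Drho H rho t p' ->
  G t p = G t p' -> p = p'.
Proof. by move=> ht h h' E; rewrite -(gradPsi_G ht h) -(gradPsi_G ht h') E. Qed.

(** Invariance of domain for the gradient of a convex function. *)
Let G_near t p : 0 <= t <= T -> Drho_int H rho t p ->
  \forall q \near G t p, exists2 p', Drho_int H rho t p' & G t p' = q.
Proof.
move=> ht hp; have [c1 _ _ _] := duality ht.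
have [e e0 he] := near_Drho_int ht hp.
have inD p' : cball p e p' -> D p'.
  by move=> h; apply: (Drho_D ht); apply: Drho_int_sub; exact: he.
have h := @gradient_open R D (fun p => P t p.1 p.2) c1 p (G t p) e (G t) e0 inD
  (fun p' h => gradP ht (inD p' h)) erefl.
have {}h := h (fun p' hp' E => G_inj ht (Drho_int_sub (he _ hp')) (Drho_int_sub hp) E).
apply: filterS h => q [p' hp' E]; exists p' => //; apply: he; exact: ltW.
Qed.

Let int_spt t p : 0 <= t <= T -> Drho_int H rho t p -> (spt (sigma t))° (G t p).
Proof.
move=> ht hp; apply: filterS (G_near ht hp) => q [p' hp' <-].
by apply: spt_G => //; exact: Drho_int_sub.
Qed.

Let one_sub_rho t z : 0 <= t <= T -> 0 <= z <= H -> 0 < 1 - 2 * r0 ^+ 2 * rho t z.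
Proof. by move=> ht hz; rewrite -lt_domD//; case/andP: (rho_bounds ht hz). Qed.

Let zeta_gt t z : 0 <= t <= T -> 0 <= z <= H -> r0 < zeta t z.
Proof.
move=> ht hz; have h := one_sub_rho ht hz; have /andP[h0 _] := rho_bounds ht hz.
by rewrite -(s_of_mono r0 r0_gt0 (r_of_gt0 r0_gt0 h)) s_of_r0 s_of_r_of.
Qed.

Let Drho_s t r z : 0 <= t <= T -> Gam r0 H zeta t (r, z) -> Drho H rho t (s_of r0 r, z).
Proof.
move=> ht hx; have hs : strip r0 H (r, z) by case: hx => /= hz /andP[hr _].
have hb z' : 0 <= z' <= H -> 0 <= rho t z' < (2 * r0 ^+ 2)^-1.
  by move=> hz'; have /andP[h1 h2] := rho_bounds ht hz'; rewrite (ltW h1).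
exact: (proj1 (@Gam_zeta_of R r0 H rho t (r, z) r0_gt0 hb hs) hx).
Qed.

Let Gam_gt0 t r z : Gam r0 H zeta t (r, z) -> 0 < r.
Proof. by move=> [_ /= /andP[h _]]; exact: lt_le_trans h. Qed.

Let Gam_int_sub t x : Gam_int r0 H zeta t x -> Gam r0 H zeta t x.
Proof. by move=> [/andP[? ?] /andP[? ?]]; split; rewrite !ltW. Qed.

Let Drho_int_s t r z : 0 <= t <= T -> Gam_int r0 H zeta t (r, z) ->
  Drho_int H rho t (s_of r0 r, z).
Proof.
move=> ht [/= /andP[z0 zH] /andP[h1 h2]]; have hz : 0 <= z <= H by rewrite !ltW.
have h := one_sub_rho ht hz; have r_gt0 : 0 < r by exact: lt_trans h1.
have rgt := r_of_gt0 r0_gt0 h.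
split; rewrite /= ?z0// -[X in X < _](s_of_r0 r0) s_of_mono// h1/=.
by rewrite -[X in _ < X](s_of_r_of r0_gt0 h) s_of_mono.
Qed.

Let G1 := pulled r0 (D1 P).
Let G2 := pulled r0 (D2 P).
Let GE t r z : G t (s_of r0 r, z) = (G1 t r z, G2 t r z). Proof. by []. Qed.

Let strip_D t r z : Gam r0 H zeta t (r, z) -> D (s_of r0 r, z).
Proof. by move=> [/= hz /andP[hr _]]; apply: domD_s_of. Qed.

Lemma converse_E3 : E3 r0 H Om T u phi zeta.
Proof.
move=> t r z ht /Gam_int_sub hx; have ht' := closed_time ht.
have r_gt0 := Gam_gt0 hx.
have [d1 e1 _] := phi_of_partial Om r_gt0 (Cn_diff (hUP 0) (subUP ht' (strip_D hx))).
split => //; rewrite e1; apply/balanceE; first by rewrite gt_eqF.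
by have [] := u_theta ht' hx.
Qed.

Lemma converse_E4 : E4 r0 H g th0 T phi theta zeta.
Proof.
move=> t r z ht /Gam_int_sub hx; have ht' := closed_time ht.
have r_gt0 := Gam_gt0 hx.
have [d1 _ e2] := phi_of_partial Om r_gt0 (Cn_diff (hUP 0) (subUP ht' (strip_D hx))).
split => //; rewrite e2; have [_ _ <-] := u_theta ht' hx.
by rewrite mulrAC mulrA subrr.
Qed.

Lemma converse_PB : PB H T phi zeta.
Proof.
move=> t /closed_time ht; have zH : 0 <= H <= H by rewrite lexx ltW.
have h := one_sub_rho ht zH.
rewrite /phi /phi_of /zeta /zeta_of s_of_r_of// P_boundary//.
rewrite /r_of expr_div_n sqr_sqrtr ?(ltW h)//; field.
by rewrite gt_eqF.
Qed.

(** Multiplying the radial derivative by r^3 turns it into the derivative with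
    respect to s. *)
Lemma converse_ST : ST r0 H Om T phi zeta.
Proof.
pose Phi := fun t r z => phi t r z + Om ^+ 2 * r ^+ 2 / 2.
move=> t ht [r z] [r' z'] /set_mem hx /set_mem hx' EE; have ht' := closed_time ht.
have E r1 z1 : Gam r0 H zeta t (r1, z1) ->
    (r1 ^+ 3 * D1 Phi t r1 z1, D2 Phi t r1 z1) = G t (s_of r0 r1, z1).
  move=> h1; have r1_gt0 := Gam_gt0 h1.
  have [_ p1 p2] := pulled_partial r1_gt0 (Cn_diff (hUP 0) (subUP ht' (strip_D h1))).
  have PhiE : Phi = pulled r0 P.
    apply/funext => t2; apply/funext => r2; apply/funext => z2.
    by rewrite /Phi /phi /phi_of subrK.
  rewrite PhiE p1 p2 /G /grad; congr (_, _).
  by field; rewrite gt_eqF.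
have : G t (s_of r0 r, z) = G t (s_of r0 r', z') by rewrite -(E r z hx) -(E r' z' hx').
move=> /(G_inj ht' (Drho_s ht' hx) (Drho_s ht' hx'))[Es <-].
by rewrite -(r_of_s_of r0_gt0 (Gam_gt0 hx)) Es r_of_s_of//; exact: (Gam_gt0 hx').
Qed.

(** * From the dual measure to the fluid: evolution equations *)

Let UPsi := proj1_sig (cid (smooth_onP Psi_smooth)).
Let oUPsi : open UPsi. Proof. by rewrite /UPsi; case: cid => ? []. Qed.
Let subUPsi t q : 0 <= t <= T -> (spt (sigma t))° q -> UPsi (t, q).
Proof. by rewrite /UPsi; case: cid => ? /= [_ h _] h1 h2; exact: h. Qed.
Let hUPsi n : Cn n UPsi Psi.
Proof. by rewrite /UPsi; case: cid => ? []. Qed.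

Let positive_part (U : set (R * (R * R))) (f : R -> R -> R -> R) : set (R * (R * R)) :=
  U `&` [set x | 0 < 1 - 2 * r0 ^+ 2 * unc f x].
Let open_positive_part U f : open U -> Cn 0 U f -> open (positive_part U f).
Proof.
move=> oU hf; have h := Cn_sub oU (Cn_cst 0 U 1) (Cn_mul oU (Cn_cst 0 U (2 * r0 ^+ 2)) hf).
apply: (@open_preimage_on (R * (R * R))%type R U [set y | 0 < y]
  (unc (fun t x y => 1 - 2 * r0 ^+ 2 * f t x y))) => // x Ux.
by apply: differentiable_continuous; exact: (Cn_diff h Ux).
Qed.

Let Zz := positive_part Z (fun t z _ => rho t z).
Let oZz : open Zz. Proof. exact: open_positive_part (hZ 0). Qed.
Let subZz t z : 0 <= t <= T -> 0 <= z <= H -> Zz (t, (z, 0)).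
Proof. by move=> ht hz; split; [exact: subZ|exact: one_sub_rho]. Qed.
Let hZz n : Cn n Zz (fun t z _ => zeta t z).
Proof.
apply: (@Cn_r_of R r0 n Zz (fun t z _ => rho t z)) => //; first by move=> x [].
by apply: sub_Cn (hZ n) => x [].
Qed.

Let fluid := fluid_int r0 H T zeta.
Let ofluid : open fluid. Proof. exact: (open_fluid_int (hZz 0) subZz). Qed.

Let Ua := positive_part UPsi (D1 Psi).
Let oUa : open Ua. Proof. exact: open_positive_part (Cn_D1 (hUPsi 1)). Qed.
Let a : R -> R -> R -> R := fun t Y Z => r_of r0 (D1 Psi t Y Z).
Let Cn_a n : Cn n Ua a.
Proof.
apply: (@Cn_r_of R r0 n Ua (D1 Psi)) => //; first by move=> x [].
by apply: sub_Cn (Cn_D1 (hUPsi n.+1)) => x [].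
Qed.
Let Cn_b n : Cn n Ua (D2 Psi).
Proof. by apply: sub_Cn (Cn_D2 (hUPsi n.+1)) => x []. Qed.

Let UG := pulled_dom r0 UP.
Let oUG : open UG. Proof. exact: open_pulled_dom. Qed.
Let Cn_G1 n : Cn n UG G1. Proof. exact: (Cn_pulled r0 oUP (Cn_D1 (hUP n.+1))). Qed.
Let Cn_G2 n : Cn n UG G2. Proof. exact: (Cn_pulled r0 oUP (Cn_D2 (hUP n.+1))). Qed.
Let subUG t r z : 0 <= t <= T -> Gam r0 H zeta t (r, z) -> UG (t, (r, z)).
Proof. by move=> ht hx; split; [exact: Gam_gt0 hx|apply: subUP => //; exact: strip_D hx]. Qed.
Let fluid_UG : fluid `<=` UG.
Proof. by move=> [t [r z]] [/closed_time ht /Gam_int_sub hx]; exact: subUG. Qed.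

Let gradPsi_x t r z : 0 <= t <= T -> Gam r0 H zeta t (r, z) ->
  D1 Psi t (G1 t r z) (G2 t r z) = s_of r0 r /\ D2 Psi t (G1 t r z) (G2 t r z) = z.
Proof.
move=> ht hx; have := gradPsi_G ht (Drho_s ht hx).
by rewrite GE /grad => -[].
Qed.

Let int_spt_x t r z : 0 <= t <= T -> Gam_int r0 H zeta t (r, z) ->
  (spt (sigma t))° (G1 t r z, G2 t r z).
Proof. by move=> ht hx; rewrite -GE; apply: int_spt => //; exact: Drho_int_s. Qed.

Let G_Ua x : fluid x -> Ua (x.1, (unc G1 x, unc G2 x)).
Proof.
case: x => t [r z] [/closed_time ht hx]; split; first by apply: subUPsi => //; exact: int_spt_x.
have [h _] := gradPsi_x ht (Gam_int_sub hx).
rewrite /= /unc/= h; apply: one_sub_s_of_gt0 => //; exact: Gam_gt0 (Gam_int_sub hx).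
Qed.

Let X := vfield v w.

Let along_G f k t r z : fluid (t, (r, z)) ->
  differentiable (unc f) (t, (G1 t r z, G2 t r z)) ->
  (forall t r z, fluid (t, (r, z)) -> f t (G1 t r z) (G2 t r z) = k t r z) ->
  let f1 := D1 f t (G1 t r z) (G2 t r z) in let f2 := D2 f t (G1 t r z) (G2 t r z) in
  [/\ D1 k t r z = D1 G1 t r z * f1 + D1 G2 t r z * f2,
      D2 k t r z = D2 G1 t r z * f1 + D2 G2 t r z * f2 &
      material X k t r z = Dt f t (G1 t r z) (G2 t r z) +
        material X G1 t r z * f1 + material X G2 t r z * f2].
Proof.
move=> hx df fk f1 f2; have Ux := fluid_UG hx.
have d1 := Cn_diff (Cn_G1 0) Ux; have d2 := Cn_diff (Cn_G2 0) Ux.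
have dt : differentiable (unc (fun t _ _ : R => t)) (t, (r, z)).
  exact: (Cn_diff (Cn_t 0 setT)).
have near : \forall y \near (t, (r, z)),
    unc k y = unc (fun t r z => f t (G1 t r z) (G2 t r z)) y.
  have : nbhs (t, (r, z)) fluid by exact: open_nbhs_nbhs.
  by apply: filterS => -[t' [r' z']] /fk; rewrite /unc /= => ->.
split.
- rewrite [LHS](near_partial (@Ordinal 3 1 isT) near).
  rewrite [LHS](@partial_comp R f (fun t _ _ => t) G1 G2 (t, (r, z)) (@Ordinal 3 1 isT) df dt d1 d2).
  rewrite (_ : unc (partial _ (fun t _ _ => t)) _ = 0) ?mul0r ?add0r//.
  exact: derive1_cst.
- rewrite [LHS](near_partial (@Ordinal 3 2 isT) near).
  rewrite [LHS](@partial_comp R f (fun t _ _ => t) G1 G2 (t, (r, z)) (@Ordinal 3 2 isT) df dt d1 d2).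
  rewrite (_ : unc (partial _ (fun t _ _ => t)) _ = 0) ?mul0r ?add0r//.
  exact: derive1_cst.
- by rewrite (material_near X near) (material_comp X df d1 d2).
Qed.

(** The velocity in the dual variables is transported to the physical velocity
    by the differential of the inverse of G; inverting this differential gives
    the evolution of G along the fluid trajectories. *)
Let material_G t r z : fluid (t, (r, z)) ->
  (material X G1 t r z, material X G2 t r z) = V t (G1 t r z) (G2 t r z).
Proof.
move=> hx; have [ht hi] := hx; have ht' := closed_time ht.
have Uax := G_Ua hx; have hc := Gam_int_sub hi.
have ar t' r' z' : fluid (t', (r', z')) -> a t' (G1 t' r' z') (G2 t' r' z') = r'.
  move=> [/closed_time h1 /Gam_int_sub h2]; have [e1 _] := gradPsi_x h1 h2.
  by rewrite /a e1 r_of_s_of//; exact: Gam_gt0 h2.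
have bz t' r' z' : fluid (t', (r', z')) -> D2 Psi t' (G1 t' r' z') (G2 t' r' z') = z'.
  by move=> [/closed_time h1 /Gam_int_sub h2]; have [_] := gradPsi_x h1 h2.
have [a1 a2 am] := along_G hx (Cn_diff (Cn_a 0) Uax) ar.
have [b1 b2 bm] := along_G hx (Cn_diff (Cn_b 0) Uax) bz.
rewrite material_fst in am; rewrite material_snd in bm.
have dr1 : D1 (fun _ r _ => r) t r z = 1 :> R by exact: derive1_id.
have dr2 : D2 (fun _ r _ => r) t r z = 0 :> R by exact: derive1_cst.
have dz1 : D1 (fun _ _ z => z) t r z = 0 :> R by exact: derive1_cst.
have dz2 : D2 (fun _ _ z => z) t r z = 1 :> R by exact: derive1_id.
rewrite dr1 in a1; rewrite dr2 in a2; rewrite dz1 in b1; rewrite dz2 in b2.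
have [va wb] : v t r z = material V a t (G1 t r z) (G2 t r z) /\
    w t r z = material V (D2 Psi) t (G1 t r z) (G2 t r z).
  have := velocity ht (int_spt_x ht' hi); have [e1 e2] := gradPsi_x ht' hc.
  by rewrite /= e1 e2 r_of_s_of ?(Gam_gt0 hc)// => -[-> ->].
have [k1 k2] := jac_inv (esym a1) (esym a2) (esym b1) (esym b2)
  (diff_comb am va) (diff_comb bm wb).
by apply: congr2; [move/eqP: k1|move/eqP: k2]; rewrite subr_eq0 => /eqP.
Qed.

Let V_G t r z : 0 < t < T -> Gam r0 H zeta t (r, z) ->
  V t (G1 t r z) (G2 t r z) =
  (2 * (u t r z * r + r ^+ 2 * Om) * F t r z, g / th0 * S t r z).
Proof.
move=> /closed_time ht hx; have [e1 e2] := gradPsi_x ht hx.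
have [h1 h2 _] := u_theta ht hx.
rewrite /V /VEL e1 e2 r_of_s_of ?(Gam_gt0 hx)//; congr (_ * _ * _, _).
rewrite (_ : G1 t r z = D1 P t (s_of r0 r) z)// -h1 sqrtr_sqr ger0_norm//.
Qed.

Let G1_gt0 t r z : fluid (t, (r, z)) -> 0 < G1 t r z.
Proof.
move=> [/closed_time ht hi]; have [M hM] := spt_bounded.
have /nbhs_normP[e /= e0 he] := int_spt_x ht hi.
have e20 : 0 < e / 2 by rewrite divr_gt0.
have : spt (sigma t) (G1 t r z - e / 2, G2 t r z).
  apply: he; rewrite /= normr_prodE/= opprB addrCA subrr addr0 subrr normr0 gt_max e0.
  by rewrite gtr0_norm// half_lt.
move=> /(hM t ht)[/= h _ _]; rewrite subr_ge0 in h.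
exact: lt_le_trans h.
Qed.

Let momentum : R -> R -> R -> R := fun t r z => u t r z * r + r * r * Om.

Let momentumE t r z : fluid (t, (r, z)) -> momentum t r z = Num.sqrt (G1 t r z).
Proof.
move=> [/closed_time ht hi]; have [h1 h2 _] := u_theta ht (Gam_int_sub hi).
by rewrite /momentum (_ : G1 t r z = D1 P t (s_of r0 r) z)// -h1 sqrtr_sqr ger0_norm.
Qed.

Let fluid_r_gt0 t r z : fluid (t, (r, z)) -> 0 < r.
Proof. by move=> [_ hi]; exact: Gam_gt0 (Gam_int_sub hi). Qed.

Let Cn_fluid n f : Cn n UG f -> Cn n fluid f. Proof. exact: sub_Cn. Qed.

Let Cn_momentum n : Cn n fluid (fun t r z => Num.sqrt (G1 t r z)).
Proof.
apply: (Cn_sqrt ofluid) (Cn_fluid (Cn_G1 n)) => -[t [r z]].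
exact: G1_gt0.
Qed.

(** The first component of G is the square of the angular momentum
    u r + Om r^2; dividing the evolution of the square by twice the momentum gives
    the equation. *)
Lemma converse_E1 : E1 r0 H Om T F u v w zeta.
Proof.
move=> t r z ht hi; have hx : fluid (t, (r, z)) by [].
have r_gt0 := fluid_r_gt0 hx; have r_neq0 : r != 0 by rewrite gt_eqF.
have near : \forall y \near (t, (r, z)), fluid y by exact: open_nbhs_nbhs.
have hr : Cn 0 fluid (fun _ r _ => r^-1).
  apply: (Cn_inv ofluid) (Cn_x 0 fluid) => -[t' [r' z']] /fluid_r_gt0 h.
  by rewrite /unc/= gt_eqF.
have hrr := Cn_mul ofluid (Cn_mul ofluid (Cn_x 0 fluid) (Cn_x 0 fluid)) (Cn_cst 0 fluid Om).
have hu := Cn_mul ofluid (Cn_sub ofluid (Cn_momentum 0) hrr) hr.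
have du : differentiable (unc u) (t, (r, z)).
  apply: near_eq_differentiable (Cn_diff hu hx).
  apply: filterS near => -[t' [r' z']] h; have h0 := fluid_r_gt0 h.
  rewrite /unc/= -(momentumE h) /momentum addrK mulfK//.
  by rewrite gt_eqF.
split => //.
have dr : differentiable (unc (fun _ r _ : R => r)) (t, (r, z)) by exact: (Cn_diff (Cn_x 0 setT)).
have dc c : differentiable (unc (fun _ _ _ : R => c : R)) (t, (r, z)).
  exact: (Cn_diff (Cn_cst 0 setT c)).
have dur := differentiableM du dr; have drr := differentiableM dr dr.
have drrO := differentiableM drr (dc Om).
have dk : differentiable (unc momentum) (t, (r, z)) by exact: (differentiableD dur drrO).
have E : material X G1 t r z = 2 * momentum t r z * material X momentum t r z.
  transitivity (material X (fun t r z => momentum t r z * momentum t r z) t r z).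
    apply: material_near; apply: filterS near => -[t' [r' z']] h.
    rewrite /unc/= (momentumE h) -expr2 sqr_sqrtr// ltW//; exact: G1_gt0.
  by rewrite (material_mul X dk dk); ring.
have mk : material X momentum t r z =
    r * material X u t r z + u t r z * v t r z + 2 * r * v t r z * Om.
  rewrite (material_add X dur drrO) (material_mul X du dr) (material_mul X drr (dc Om)).
  by rewrite (material_mul X dr dr) material_cst material_fst /X /vfield/=; ring.
have [eG _] : (material X G1 t r z, material X G2 t r z) =
    (2 * momentum t r z * F t r z, g / th0 * S t r z).
  by rewrite material_G// V_G//; exact: Gam_int_sub.
have k0 : 2 * momentum t r z != 0.
  by rewrite mulf_neq0// (momentumE hx) gt_eqF// sqrtr_gt0; exact: G1_gt0.
have {}mk : r * material X u t r z + u t r z * v t r z + 2 * r * v t r z * Om = F t r z.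
  by rewrite -mk; apply: (mulfI k0); rewrite -E.
by rewrite -mk; field.
Qed.

Lemma converse_E2 : E2 r0 H T S v w theta zeta.
Proof.
move=> t r z ht hi; have hx : fluid (t, (r, z)) by [].
have near : \forall y \near (t, (r, z)), fluid y by exact: open_nbhs_nbhs.
have c0 : g / th0 != 0 by rewrite mulf_neq0 ?invr_eq0 ?gt_eqF.
have thE : \forall y \near (t, (r, z)), unc theta y =
    unc (fun t r z => (g / th0)^-1 * G2 t r z) y.
  apply: filterS near => -[t' [r' z']] [/closed_time h1 /Gam_int_sub h2].
  have [_ _ h3] := u_theta h1 h2.
  by rewrite /unc/= (_ : G2 t' r' z' = D2 P t' (s_of r0 r') z')// -h3 mulKf.
have hG := Cn_mul oUG (Cn_cst 0 UG (g / th0)^-1) (Cn_G2 0).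
have d2 := Cn_diff (Cn_G2 0) (fluid_UG hx).
split.
  apply: near_eq_differentiable (Cn_diff hG (fluid_UG hx)).
  by apply: filterS thE => y ->.
have dc : differentiable (unc (fun _ _ _ : R => (g / th0)^-1)) (t, (r, z)).
  exact: (Cn_diff (Cn_cst 0 setT _)).
rewrite (material_near _ thE) (material_mul _ dc d2) material_cst mulr0 addr0.
have [_ eG] : (material X G1 t r z, material X G2 t r z) =
    (2 * (u t r z * r + r ^+ 2 * Om) * F t r z, g / th0 * S t r z).
  by rewrite material_G// V_G//; exact: Gam_int_sub.
by rewrite eG mulKf.
Qed.

(** * Regularity up to the boundary *)

Let czeta t : 0 <= t <= T -> {within `[0, H], continuous (zeta t)}.
Proof.
move=> ht; apply: continuous_in_subspaceT => z /set_mem/=; rewrite in_itv/= => hz.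
apply: (@continuous_comp _ _ _ (fun z : R => (t, (z, 0 : R))) (unc (fun t z _ => zeta t z))).
  by apply: continuous_triple; [exact: cvg_cst|exact: cvg_id|exact: cvg_cst].
by apply: differentiable_continuous; exact: (Cn_diff (hZz 0) (subZz ht hz)).
Qed.

Let movT := movingT r0 H T zeta.
Let movT_UG : movT `<=` UG.
Proof. by move=> [t [r z]] [/= /closed_time ht hx]; exact: subUG. Qed.

Let within_UG f : Cn 0 UG f -> {within movT, continuous (unc f)}.
Proof.
by move=> hf; apply: (differentiable_within movT_UG) => x Ux; exact: (Cn_diff hf Ux).
Qed.

Let within_strip f :
  smooth_on [set x : R * (R * R) | 0 <= x.1 <= T /\ strip r0 H x.2] f ->
  {within movT, continuous (unc f)}.
Proof.
move=> /smooth_onP[W [oW subW hW]]; apply: (@differentiable_within _ W).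
  by move=> [t [r z]] [/= /closed_time ht [/= hz /andP[hr _]]]; apply: subW.
by move=> x Wx; exact: (Cn_diff (hW 0) Wx).
Qed.

(** Two fields continuous up to the boundary which agree inside the fluid agree
    on the closed fluid domain. *)
Let eq_on_closure f k : {within movT, continuous (unc f)} ->
  {within movT, continuous (unc k)} ->
  (forall t r z, fluid (t, (r, z)) -> f t r z = k t r z) ->
  forall t r z, 0 < t < T -> Gam r0 H zeta t (r, z) -> f t r z = k t r z.
Proof.
move=> cf ck fk t r z ht hx; have ht' := closed_time ht.
have [|c [cc c1 cD cI]] := @region_approx R r0 H (zeta t) (r, z) H_gt0 (czeta ht') _ hx.
  by move=> z' hz'; exact: zeta_gt.
have cct : continuous (fun y => (t, c y) : R * (R * R)).
  exact: (continuous_compo cc (@continuous_pairl _ _ t)).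
have cM y : movT (t, c y) by split => //; exact: cD.
have := eq_at1 (continuous_within_comp cf cct cM) (continuous_within_comp ck cct cM).
rewrite c1; apply => y hy; have := cI y hy; case: (c y) => r' z' [h1 h2].
by apply: fk.
Qed.

Let material_within f : Cn 1 UG f -> {within movT, continuous (unc (material X f))}.
Proof.
move=> hf; have c0 := within_UG (Cn_Dt hf).
have c1 := within_mul v_cont (within_UG (Cn_D1 hf)).
have c2 := within_mul w_cont (within_UG (Cn_D2 hf)).
move=> x; apply: (@continuousD _ _ (subspace movT)
  (fun x => unc (Dt f) x + unc v x * unc (D1 f) x) _ x _ (c2 x)).
exact: (@continuousD _ _ (subspace movT) _ _ x (c0 x) (c1 x)).
Qed.

(** The identity holds inside the fluid; all terms are continuous up to the
    boundary. *)
Let VE t r z : 0 < t < T -> Gam r0 H zeta t (r, z) ->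
  V t (G1 t r z) (G2 t r z) = (material X G1 t r z, material X G2 t r z).
Proof.
move=> ht hx; rewrite V_G//; apply: congr2.
  transitivity (2 * Num.sqrt (G1 t r z) * F t r z).
    have [h1 h2 _] := u_theta (closed_time ht) hx.
    by rewrite (_ : G1 t r z = D1 P t (s_of r0 r) z)// -h1 sqrtr_sqr ger0_norm.
  apply: (@eq_on_closure (fun t r z => 2 * Num.sqrt (G1 t r z) * F t r z)
    (material X G1)) => //; [|exact: material_within (Cn_G1 1)|].
    apply: (@within_mul _ _ movT (fun x => 2 * Num.sqrt (unc G1 x)) (unc F)); last exact: within_strip.
    have c2 : {within movT, continuous (fun _ => 2 : R)} by apply: continuous_subspaceT => y; exact: cvg_cst.
    apply: (within_mul c2); apply: (@within_compT _ _ _ movT (@Num.sqrt R) (unc G1)).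
      exact: sqrt_continuous.
    exact: within_UG (Cn_G1 0).
  move=> t' r' z' h; have [h1 h2] := h; have := material_G h.
  rewrite V_G//; last exact: Gam_int_sub.
  move=> [-> _]; by rewrite -(momentumE h) /momentum expr2.
apply: (@eq_on_closure (fun t r z => g / th0 * S t r z) (material X G2)) => //.
- have c2 : {within movT, continuous (fun _ => g / th0 : R)} by apply: continuous_subspaceT => y; exact: cvg_cst.
  exact: (within_mul c2 (within_strip S_smooth)).
- exact: material_within (Cn_G2 1).
move=> t' r' z' h; have [h1 h2] := h; have := material_G h.
by rewrite V_G//; [move=> [_ ->]|exact: Gam_int_sub].
Qed.

Section pushforward.
Variable t : R.
Hypothesis ht : 0 < t < T.
Let ht' := closed_time ht.
Let Dz := region r0 H (zeta t).
Let Gt (x : R * R) : R * R := (G1 t x.1 x.2, G2 t x.1 x.2).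
Let m (y z : R) := e_ r0 (D1 Psi t y z) * hess_det Psi t y z.

Let cGt : {within Dz, continuous Gt}.
Proof.
have c f : Cn 0 UG f -> {within Dz, continuous (fun x : R * R => f t x.1 x.2)}.
  move=> hf; apply: (@within_comp _ _ _ movT Dz (unc f) (fun x : R * R => (t, x)) (within_UG hf)).
    by apply: continuous_subspaceT; exact: continuous_pairl.
  by move=> x Dx; split.
exact: (within_pair (c _ (Cn_G1 0)) (c _ (Cn_G2 0))).
Qed.

Let cDz : compact Dz.
Proof. by apply: compact_region; [exact: ltW|exact: czeta]. Qed.
Let mDz : measurable (Dz : set (plane R)).
Proof. by apply: measurable_region; [exact: ltW|exact: czeta]. Qed.

Let Gt_inj x y : Dz x -> Dz y -> Gt x = Gt y -> x = y.
Proof.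
case: x y => [r z] [r' z'] hx hy; rewrite /Gt/= -!GE => /(G_inj ht' (Drho_s ht' hx) (Drho_s ht' hy)).
move=> [E ->]; congr pair.
by rewrite -(r_of_s_of r0_gt0 (Gam_gt0 hx)) E r_of_s_of//; exact: (Gam_gt0 hy).
Qed.

Let int_spt_Ua q : (spt (sigma t))° q -> Ua (t, q).
Proof.
move=> hq; split; first exact: subUPsi.
have : Drho H rho t (grad Psi t q.1 q.2).
  by rewrite -(image_spt ht'); exists q => //; exact: interior_subset.
move=> [/= hz /andP[_ h]]; have := one_sub_rho ht' hz.
rewrite /unc/= !subr_gt0; apply: le_lt_trans.
by rewrite ler_wpM2l// mulr_ge0// exprn_ge0// ltW.
Qed.

Let Cn_m : Cn 1 [set p : R * (R * R) | (spt (sigma t))° p.2] (fun _ => m).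
Proof.
set U := [set p | _]; have oU : open U.
  apply: (@open_comp _ _ (fun p : R * (R * R) => p.2)); last exact: open_interior.
  by move=> x _; exact: cvg_snd.
have h1 : Cn 1 Ua (D1 Psi) by apply: sub_Cn (Cn_D1 (hUPsi 2)) => x [].
have h2 : Cn 1 Ua (D2 Psi) by apply: sub_Cn (Cn_D2 (hUPsi 2)) => x [].
have k n f : Cn n UPsi f -> Cn n Ua f by apply: sub_Cn => x [].
have h11 := k _ _ (Cn_D1 (Cn_D1 (hUPsi 3))); have h22 := k _ _ (Cn_D2 (Cn_D2 (hUPsi 3))).
have h12 := k _ _ (Cn_D1 (Cn_D2 (hUPsi 3))); have h21 := k _ _ (Cn_D2 (Cn_D1 (hUPsi 3))).
have hd := Cn_sub oUa (Cn_mul oUa h11 h22) (Cn_mul oUa h21 h12).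
have he := Cn_sub oUa (Cn_cst 1 Ua 1) (Cn_mul oUa (Cn_mul oUa (Cn_cst 1 Ua 2) h1) (Cn_cst 1 Ua (r0 ^+ 2))).
have hee := Cn_mul oUa he he.
have hi : Cn 1 Ua (fun t y z => e_ r0 (D1 Psi t y z)).
  have e0 x : Ua x -> unc (fun t r z => (1 - 2 * D1 Psi t r z * r0 ^+ 2) *
      (1 - 2 * D1 Psi t r z * r0 ^+ 2)) x != 0.
    move=> [_ /= h]; rewrite /unc -expr2 expf_neq0// gt_eqF//.
    by rewrite mulrAC -/(unc (D1 Psi) x).
  have := Cn_mul oUa (Cn_cst 1 Ua (r0 ^+ 4)) (Cn_inv oUa e0 hee).
  by apply: (Cn_eq oUa) => x _; rewrite /unc /e_ expr2.
have sub x : U x -> Ua (t, (x.2.1, x.2.2)) by case: x => t' [y z]; exact: int_spt_Ua.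
exact: (@Cn_comp R 1 Ua U _ (fun _ _ _ => t) (fun _ y _ => y) (fun _ _ z => z) oU
  sub (Cn_mul oUa hi hd) (Cn_cst 1 U t) (Cn_x 1 U) (Cn_y 1 U)).
Qed.

(** The Monge-Ampere measure in the physical variables is r dr dz. *)
Let m_jac r z : Gam_int r0 H zeta t (r, z) ->
  r = m (G1 t r z) (G2 t r z) * jac (G1 t) (G2 t) r z.
Proof.
move=> hi; have hx : fluid (t, (r, z)) by [].
have r_gt0 := fluid_r_gt0 hx; have Uax := G_Ua hx.
have sr t' r' z' : fluid (t', (r', z')) -> D1 Psi t' (G1 t' r' z') (G2 t' r' z') = s_of r0 r'.
  by move=> [/closed_time h1 /Gam_int_sub h2]; have [] := gradPsi_x h1 h2.
have bz t' r' z' : fluid (t', (r', z')) -> D2 Psi t' (G1 t' r' z') (G2 t' r' z') = z'.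
  by move=> [/closed_time h1 /Gam_int_sub h2]; have [_] := gradPsi_x h1 h2.
have UPx : UPsi (t, (G1 t r z, G2 t r z)) by case: Uax.
have [a1 a2 _] := along_G (k := fun _ r _ => s_of r0 r) hx (Cn_diff (Cn_D1 (hUPsi 1)) UPx) sr.
have [b1 b2 _] := along_G (k := fun _ _ z => z) hx (Cn_diff (Cn_D2 (hUPsi 1)) UPx) bz.
have ds1 : D1 (fun _ r _ => s_of r0 r) t r z = r ^- 3.
  have d := is_derive_s_of r0 r_gt0.
  by rewrite /D1 derive1E (@derive_val _ _ _ _ _ _ _ d).
have ds2 : D2 (fun _ r _ => s_of r0 r) t r z = 0 by exact: derive1_cst.
have dz1 : D1 (fun _ _ z => z) t r z = 0 :> R by exact: derive1_cst.
have dz2 : D2 (fun _ _ z => z) t r z = 1 :> R by exact: derive1_id.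
rewrite ds1 in a1; rewrite ds2 in a2; rewrite dz1 in b1; rewrite dz2 in b2.
have e1 : e_ r0 (s_of r0 r) = r ^+ 4.
  have -> : e_ r0 (s_of r0 r) = r0 ^+ 4 / (1 - 2 * r0 ^+ 2 * s_of r0 r) ^+ 2.
    by congr (_ / (1 - _) ^+ 2); rewrite mulrAC.
  by rewrite one_sub_s_of//; field; rewrite !gt_eqF.
have det : hess_det Psi t (G1 t r z) (G2 t r z) * jac (G1 t) (G2 t) r z = r ^- 3.
  have -> : jac (G1 t) (G2 t) r z =
    D1 G1 t r z * D2 G2 t r z - D2 G1 t r z * D1 G2 t r z by [].
  exact: (jac_det a1 a2 b1 b2).
have [s1 _] := gradPsi_x ht' (Gam_int_sub hi).
rewrite /m -mulrA det s1 e1; field.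
by rewrite gt_eqF.
Qed.

(** * From the dual measure to the fluid: the image of the mass *)

Let mGt : measurable_fun Dz (Gt : plane R -> plane R).
Proof. by apply: measurable_region_map; [exact: ltW|exact: czeta|exact: cGt]. Qed.

Let Gam_of_Drho p : Drho H rho t p -> Dz (r_of r0 p.1, p.2) /\
  Gt (r_of r0 p.1, p.2) = G t p /\ (Drho_int H rho t p -> Gam_int r0 H zeta t (r_of r0 p.1, p.2)).
Proof.
case: p => s z [/= hz /andP[s0 sr]]; have hr := one_sub_rho ht' hz.
have hs : 0 < 1 - 2 * r0 ^+ 2 * s.
  rewrite -lt_domD//; apply: le_lt_trans sr _; by rewrite lt_domD.
have sE := s_of_r_of r0_gt0 hs; have rs := r_of_gt0 r0_gt0 hs; have rr := r_of_gt0 r0_gt0 hr.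
split.
  split=> //=; rewrite r_of_ge//= leNgt /zeta /zeta_of -(s_of_mono r0 rr rs) sE s_of_r_of//.
  by rewrite -leNgt.
split; first by rewrite /Gt -GE /= sE.
move=> [/= hz2 /andP[s0' sr']]; split => //=.
rewrite -(s_of_mono r0 r0_gt0 rs) s_of_r0 sE s0'/= /zeta /zeta_of.
by rewrite -(s_of_mono r0 rs rr) sE s_of_r_of.
Qed.

Let O := [set Gt x | x in Gam_int r0 H zeta t].
Let KD := [set Gt x | x in Dz].
Let bdry := Dz `\` Gam_int r0 H zeta t.

Let oO : open O.
Proof.
rewrite openE => _ [[r z] hi <-]; rewrite /interior /Gt -GE.
have := G_near ht' (Drho_int_s ht' hi); apply: filterS => q [p hp <-].
have [h1 [h2 h3]] := Gam_of_Drho (Drho_int_sub hp).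
by exists (r_of r0 p.1, p.2); [exact: h3|].
Qed.

Let clKD : closed KD.
Proof. by apply: compact_closed => //; exact: (continuous_compact cGt). Qed.

(** A support point which is not a value of the gradient of P lies on a flat
    piece of Psi, generated by a face of the domain of P. *)
Let flat_outside q : spt (sigma t) q -> ~ KD q -> hess_det Psi t q.1 q.2 = 0.
Proof.
move=> hq nq; have [p pE] : exists p, p = grad Psi t q.1 q.2 by eexists.
have hp : Drho H rho t p by rewrite pE -(image_spt ht'); exists q.
have Dp : D p by exact: Drho_D hp.
have [Dx [GxE _]] := Gam_of_Drho hp.
have neq : q <> G t p by move=> E; apply: nq; rewrite E -GxE; exists (r_of r0 p.1, p.2).
have [c1 c2 e1 e2] := duality ht'.
have gP := fun p (Dp : D p) => gradP ht' Dp.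
have gq : is_grad (fun q => Psi t q.1 q.2) q p by rewrite pE; exact: gradPsi.
have sub := legendre_subgradient c1 c2 D_nonempty D_bounded gP e1 e2 gq Dp.
have inward (vec : R * R) (e : R) : 0 < e -> (forall k, 0 < k < e -> D (k *: vec + p)) ->
    dot vec q <= dot vec (G t p).
  move=> e0 hD; apply: (is_grad_ge (gP p Dp) e0) => k hk.
  by have := sub _ (hD k hk); rewrite addrK dotZl.
have flat nu c pr := legendre_flat c1 c2 D_nonempty D_bounded gP e1 e2 (nu := nu) (c := c) (pr := pr) gq Dp.
have cdot nu : {for p, continuous (fun x => dot nu (G t x))}.
  apply: (@continuous_comp _ _ _ (G t) (dot nu)); first exact: cG.
  have -> : dot nu = dotr nu by apply/funext => y; rewrite /dotr /dot mulrC [nu.2 * _]mulrC.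
  exact: continuous_dotr.
have half_in (A B : R) : 0 < B -> A < B -> exists2 e : R, 0 < e & forall k, 0 < k < e -> A + k < B.
  move=> _ AB; exists (B - A); first by rewrite subr_gt0.
  by move=> k /andP[_ k1]; rewrite -ltrBrDl.
move: (Dp) => [/andP[p10 p11] /andP[p20 p21]].
have dirE (x y k : R) : k *: (x, y) + p = (k * x + p.1, k * y + p.2) by case: (p).
have le1 : q.1 <= (G t p).1.
  have e0 : 0 < (2 * r0 ^+ 2)^-1 - p.1 by rewrite subr_gt0.
  have := inward (1, 0) _ e0; rewrite /dot/= !mul1r !mul0r !addr0; apply=> k /andP[k0 k1].
  rewrite dirE mulr1 mulr0 add0r; split; rewrite /= ?p20 ?p21//.
  by rewrite addr_ge0 ?(ltW k0)//= -ltrBrDr.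
have ge1 : 0 < p.1 -> (G t p).1 <= q.1.
  move=> e0; have := inward (-1, 0) _ e0.
  rewrite /dot/= !mulN1r !mul0r !addr0 lerN2; apply=> k /andP[k0 k1].
  rewrite dirE mulrN1 mulr0 add0r; split; rewrite /= ?p20 ?p21//.
  by rewrite addrC subr_ge0 (ltW k1)/= (lt_trans _ p11)// gtrBl.
have le2 : p.2 < H -> q.2 <= (G t p).2.
  move=> pH; have e0 : 0 < H - p.2 by rewrite subr_gt0.
  have := inward (0, 1) _ e0; rewrite /dot/= !mul1r !mul0r !add0r; apply=> k /andP[k0 k1].
  rewrite dirE mulr1 mulr0 add0r; split; rewrite /= ?p10 ?p11//.
  by rewrite addr_ge0 ?(ltW k0)//= -lerBrDr ltW.
have ge2 : 0 < p.2 -> (G t p).2 <= q.2.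
  move=> e0; have := inward (0, -1) _ e0.
  rewrite /dot/= !mulN1r !mul0r !add0r lerN2; apply=> k /andP[k0 k1].
  rewrite dirE mulrN1 mulr0 add0r; split; rewrite /= ?p10 ?p11//.
  by rewrite addrC subr_ge0 (ltW k1)/= (le_trans _ p21)// gerBl ltW.
have n1 (x : R * R) k : x = (k, 0) -> `|x| = `|k|.
  by move=> ->; rewrite normr_prodE/= normr0; apply/max_idPl.
have n2 (x : R * R) k : x = (0, k) -> `|x| = `|k|.
  by move=> ->; rewrite normr_prodE/= normr0; apply/max_idPr.
have [q1|q1] := eqVneq q.1 (G t p).1; last first.
  have lt1 : q.1 < (G t p).1 by rewrite lt_neqAle q1.
  have p1 : p.1 = 0.
    apply/eqP; rewrite eq_le p10 andbT leNgt; apply/negP => /ge1; rewrite leNgt => /negP.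
    by apply.
  have [x [/andP[x0 x1] hx]||r rr hr] := flat (1, 0) 0 (fun x => (0, x.2)) _ (cdot _).
  - split.
    + by split => //=; rewrite lexx/= invr_gt0 mulr_gt0// exprn_gt0.
    + by rewrite /dot/= mulr0 mul0r addr0.
    + rewrite !normr_prodE/= p1 subrr normr0 ge_max le_max normr_ge0/=.
      by rewrite le_max lexx orbT.
    + exists x.1 => //; case: (x) => a1 a2; change ((a1 - 0, a2 - a2) = (a1 * 1, a1 * 0)).
      by rewrite subr0 mulr1 subrr mulr0.
  - by rewrite /dot/= !mul1r !mul0r !addr0.
  by apply: (hess_det_flat1 (c := 0) rr) => q' k h1 h2; rewrite hr.
have q2 : q.2 != (G t p).2.
  by apply/eqP => q2; apply: neq; rewrite [LHS]surjective_pairing q1 q2 -surjective_pairing.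
have [lt2|gt2|eq2] := ltgtP q.2 (G t p).2; last by rewrite eq2 eqxx in q2.
  have p2 : p.2 = 0.
    apply/eqP; rewrite eq_le p20 andbT leNgt; apply/negP => /ge2; rewrite leNgt => /negP.
    by apply.
  have [x [hx /andP[x0 x1]]||r rr hr] := flat (0, 1) 0 (fun x => (x.1, 0)) _ (cdot _).
  - split.
    + by split => //=; rewrite lexx ltW.
    + by rewrite /dot/= mul0r mulr0 addr0.
    + rewrite !normr_prodE/= p2 subrr normr0 ge_max.
      by apply/andP; split; rewrite le_max ?lexx ?normr_ge0.
    + exists x.2 => //; case: (x) => a1 a2; change ((a1 - a1, a2 - 0) = (a2 * 0, a2 * 1)).
      by rewrite subr0 mulr1 subrr mulr0.
  - by rewrite /dot/= !mul1r !mul0r !add0r.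
  by apply: (hess_det_flat2 (e := 1) (c := 0) rr (mulr1 1)) => q' k h1 h2; rewrite hr.
have p2 : p.2 = H.
  apply/eqP; rewrite eq_le p21/= leNgt; apply/negP => /le2; rewrite leNgt => /negP.
  by apply.
have [x [hx /andP[x0 x1]]||r rr hr] := flat (0, -1) (- H) (fun x => (x.1, H)) _ (cdot _).
- split.
  + by split => //=; rewrite lexx ltW.
  + by rewrite /dot/= mulr0 add0r mulrN1.
  + rewrite !normr_prodE/= p2 subrr normr0 ge_max.
    by apply/andP; split; rewrite le_max ?lexx ?normr_ge0.
  + exists (H - x.2); first by rewrite subr_ge0.
    case: (x) => a1 a2; change ((a1 - a1, a2 - H) = ((H - a2) * 0, (H - a2) * -1)).
    by rewrite mulrN1 opprB subrr mulr0.
- by rewrite /dot/= !mulN1r !mul0r !add0r ltrN2.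
apply: (hess_det_flat2 (e := -1) (c := - H) rr); first by rewrite mulrNN mulr1.
by move=> q' k h1 h2; rewrite hr.
Qed.

Let curve_null U (f1 f2 : R -> R -> R -> R) (y c d : R) : open U -> Cn 1 U f1 -> Cn 1 U f2 ->
  (forall x, c <= x <= d -> U (t, (x, y)) /\ Dz (f1 t x y, f2 t x y)) ->
  (leb2 R).-negligible [set (f1 t x y, f2 t x y) | x in `[c, d]] /\
  (leb2 R).-negligible [set Gt x | x in [set (f1 t x y, f2 t x y) | x in `[c, d]]].
Proof.
move=> oU h1 h2 hU; split; first by apply: negligible_curve h1 h2 _ => x /hU[].
pose W := U `&` (fun x => (x.1, (unc f1 x, unc f2 x))) @^-1` UG.
have oW : open W.
  apply: open_preimage_on => // x Ux; have d1 := Cn_diff h1 Ux; have d2 := Cn_diff h2 Ux.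
  by apply: continuous_triple; [exact: cvg_fst|exact: differentiable_continuous..].
have sW f : Cn 1 U f -> Cn 1 W f by apply: sub_Cn => x [].
have sub x : W x -> UG (x.1, (f1 x.1 x.2.1 x.2.2, f2 x.1 x.2.1 x.2.2)) by case.
have k1 := @Cn_comp R 1 UG W G1 (fun t _ _ => t) f1 f2 oW sub (Cn_G1 1) (Cn_t 1 W) (sW _ h1) (sW _ h2).
have k2 := @Cn_comp R 1 UG W G2 (fun t _ _ => t) f1 f2 oW sub (Cn_G2 1) (Cn_t 1 W) (sW _ h1) (sW _ h2).
have k x : c <= x <= d -> W (t, (x, y)) by move=> /hU[Ux Dx]; split => //; exact: subUG.
apply: negligibleS (@negligible_curve R W _ _ t y c d k1 k2 k).
by move=> _ [_ [x hx <-] <-]; exists x.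
Qed.

(** The boundary consists of four smooth arcs. *)
Let bdry_null : (leb2 R).-negligible bdry /\ (leb2 R).-negligible [set Gt x | x in bdry].
Proof.
have oUz : open [set x : R * (R * R) | Zz (x.1, (x.2.1, 0))].
  apply: (@open_comp _ _ (fun x : R * (R * R) => (x.1, (x.2.1, 0 : R)))); last exact: oZz.
  move=> x _; apply: continuous_triple; [exact: cvg_fst| |exact: cvg_cst].
  exact: (@continuous_comp _ _ _ snd fst _ cvg_snd cvg_fst).
have hr0z z : 0 <= z <= H -> Dz (r0, z).
  by move=> hz; split => //=; rewrite lexx ltW//; exact: zeta_gt.
have hzz z : 0 <= z <= H -> Dz (zeta t z, z).
  by move=> hz; split => //=; rewrite lexx andbT ltW//; exact: zeta_gt.
have H00 : 0 <= (0 : R) <= H by rewrite lexx ltW.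
have H0H : 0 <= H <= H by rewrite lexx ltW.
have [a1 b1] := @curve_null setT (fun _ _ _ => r0) (fun _ z _ => z) 0 0 H openT
  (Cn_cst 1 setT r0) (Cn_x 1 setT) (fun z hz => conj Logic.I (hr0z z hz)).
have [a2 b2] := @curve_null Zz (fun t z _ => zeta t z) (fun _ z _ => z) 0 0 H oZz
  (hZz 1) (Cn_x 1 Zz) (fun z hz => conj (subZz ht' hz) (hzz z hz)).
have [|a3 b3] := @curve_null setT (fun _ r _ => r) (fun _ _ z => z) 0 r0 (zeta t 0) openT
  (Cn_x 1 setT) (Cn_y 1 setT); first by move=> r hr; split.
have [|a4 b4] := @curve_null setT (fun _ r _ => r) (fun _ _ z => z) H r0 (zeta t H) openT
  (Cn_x 1 setT) (Cn_y 1 setT); first by move=> r hr; split.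
set c1 := [set _ | _ in _] in a1 b1; set c2 := [set _ | _ in _] in a2 b2.
set c3 := [set _ | _ in _] in a3 b3; set c4 := [set _ | _ in _] in a4 b4.
have sub : bdry `<=` c1 `|` (c2 `|` (c3 `|` c4)).
  move=> [r z] [[/= /andP[z0 zH] /andP[h1 h2]] ni].
  have inI x c d : c <= x <= d -> `[c, d]%classic x by rewrite /= in_itv.
  have [rE|r1] := eqVneq r r0; first by left; exists z; [apply: inI; rewrite z0|rewrite rE].
  have [rE|r2] := eqVneq r (zeta t z); first by right; left; exists z; [apply: inI; rewrite z0|rewrite rE].
  have [zE|z1] := eqVneq z 0.
    by right; right; left; exists r; [apply: inI; rewrite -zE h1|rewrite zE].
  have [zE|z2] := eqVneq z H.
    by right; right; right; exists r; [apply: inI; rewrite -zE h1|rewrite zE].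
  exfalso; apply: ni; split; rewrite /= !lt_neqAle.
    by rewrite eq_sym z1 z0 z2 zH.
  by rewrite eq_sym r1 h1 r2 h2.
split; first by apply: negligibleS (negligibleU a1 (negligibleU a2 (negligibleU a3 a4))); exact: sub.
have sub2 : [set Gt x | x in bdry] `<=` [set Gt x | x in c1] `|` ([set Gt x | x in c2] `|`
    ([set Gt x | x in c3] `|` [set Gt x | x in c4])).
  move=> _ [x /sub[h|[h|[h|h]]] <-]; [left|right;left|right;right;left|right;right;right];
  by exists x.
by apply: negligibleS (negligibleU b1 (negligibleU b2 (negligibleU b3 b4))); exact: sub2.
Qed.

Let Cn_Gt n f : Cn n UG f -> Cn n [set p | UG (t, p.2)] (fun _ => f t).
Proof.
move=> hf; apply: (@Cn_comp R n UG [set p | UG (t, p.2)] f (fun _ _ _ => t)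
  (fun _ y _ => y) (fun _ _ z => z) _ _ hf (Cn_cst n _ t) (Cn_x n _) (Cn_y n _)).
  apply: (@open_comp _ _ (fun x : R * (R * R) => (t, x.2))); last exact: oUG.
  move=> x _; exact: (@continuous_comp _ _ _ snd (pair t) x cvg_snd (@continuous_pairl _ _ t x.2)).
by case=> t' [].
Qed.

(** The change of variables by G near an interior point: the vector
    (s(r) - s(r1), z - z1) is positively correlated with the displacement because s
    is increasing, and with that of G because P is convex.  Injectivity on the
    compact region keeps the other values away. *)
Let near_equal (m2 : {finite_measure set plane R -> \bar R}) :
  (forall A : set (plane R), measurable A ->
    (m2 A = \int[leb2 R]_(x in (Dz : set (plane R)) `&` (Gt : plane R -> plane R) @^-1` A) (x.1)%:E)%E) ->
  forall q, O q -> exists2 U, nbhs q U & forall a b c d, orect a b c d `<=` U ->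
     sigma t (orect a b c d) = m2 (orect a b c d).
Proof.
move=> m2E q [[r1 z1] hi <-]; rewrite /Gt/=; set q1 := G1 _ _ _; set q2 := G2 _ _ _.
have /nbhs_normP[e' /= e'0 he'] : nbhs (r1, z1) [set x | fluid (t, x)].
  apply: open_nbhs_nbhs; split => //; apply: (@open_comp _ _ (pair t)) ofluid => x _.
  exact: continuous_pairl.
pose e := e' / 2; have e0 : 0 < e by rewrite divr_gt0.
have ee' : e < e' by exact: half_lt.
have Bf r z : rect (r1 - e) (r1 + e) (z1 - e) (z1 + e) (r, z) -> fluid (t, (r, z)).
  move=> [/=]; rewrite !in_itv/= -!ler_distl => h1 h2; apply: he' => /=.
  rewrite normr_prodE/= gt_max distrC (le_lt_trans h1 ee')/=.
  by rewrite distrC (le_lt_trans h2 ee').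
have Bi r z : rect (r1 - e) (r1 + e) (z1 - e) (z1 + e) (r, z) -> Gam_int r0 H zeta t (r, z).
  by move=> /Bf[].
pose K := Dz `&` [set x : R * R | e <= `|x - (r1, z1)|].
have cK : compact K.
  apply: compact_closedI => //; apply: (@preimage_closed _ _ (fun x : R * R => `|x - (r1, z1)|) [set y | e <= y]).
    by move=> x _; apply: cvg_norm; exact: (cvgB cvg_id (cvg_cst _)).
  exact: closed_ge.
have [|x [Dx hx]|d d0 hd] := @compact_separated R _ K (fun x => `|Gt x - (q1, q2)|) cK.
- apply: (continuous_subspaceW (B := Dz)); first by move=> x [].
  apply: (@within_compT _ _ _ Dz (fun y : R * R => `|y - (q1, q2)|) Gt _ cGt) => y.
  by apply: cvg_norm; exact: (cvgB cvg_id (cvg_cst _)).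
- rewrite normr_gt0 subr_eq0; apply/eqP => E.
  have := Gt_inj Dx (Gam_int_sub hi) E => {}E.
  by move: hx; rewrite /= E subrr normr0 leNgt e0.
have [mdens dens0 sE] := sigma_dens ht'.
have hg1 := Cn_Gt (Cn_G1 2); have hg2 := Cn_Gt (Cn_G2 2).
have mwt : measurable_fun (Dz : set (plane R)) (fun x : plane R => x.1 : R).
  exact: measurable_funS measurable_fst.
have wt0 (x : plane R) : (Dz : set (plane R)) x -> 0 <= (x.1 : R) by case: x => r z /Gam_gt0 /ltW.
have oV : open (spt (sigma t))° by exact: open_interior.
have hm := Cn_m.
have mdensE : {ae leb2 R, forall q, (spt (sigma t))° q -> m q.1 q.2 = dens t q}.
  have := monge_ampere ht'; apply: negligibleS; apply: subsetC => q' h Vq.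
  exact: h (interior_subset Vq).
have oW : open [set x | UG (t, x)].
  by apply: (@open_comp _ _ (pair t)) oUG => x _; exact: continuous_pairl.
have Vq : (spt (sigma t))° (q1, q2) by exact: int_spt_x.
have BW : rect (r1 - e) (r1 + e) (z1 - e) (z1 + e) `<=` [set x | UG (t, x)].
  by move=> [r z] /Bf /fluid_UG.
have BD : rect (r1 - e) (r1 + e) (z1 - e) (z1 + e) `<=` Dz.
  by move=> [r z] /Bi /Gam_int_sub.
have sep r z : rect (r1 - e) (r1 + e) (z1 - e) (z1 + e) (r, z) -> (r, z) <> (r1, z1) ->
    0 < dot (s_of r0 r - s_of r0 r1, z - z1) (r - r1, z - z1) /\
    0 < dot (s_of r0 r - s_of r0 r1, z - z1) (G1 t r z - q1, G2 t r z - q2).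
  move=> hB ne; have hr := Bi r z hB; have r_gt0 := Gam_gt0 (Gam_int_sub hr).
  have r1_gt0 := Gam_gt0 (Gam_int_sub hi).
  have hp := Drho_int_s ht' hr; have hp1 := Drho_int_s ht' hi.
  split; last first.
    have [ep ep0 hep] := near_Drho_int ht' hp; have [c1 _ _ _] := duality ht'.
    have hD : cball (s_of r0 r, z) ep `<=` D by move=> p /hep /Drho_int_sub; exact: Drho_D.
    have hD1 : D (s_of r0 r1, z1) by apply: (Drho_D ht'); exact: Drho_int_sub.
    apply: (@gradient_strict_mono R D (fun p => P t p.1 p.2) (G t) (s_of r0 r, z) (s_of r0 r1, z1) ep c1 ep0 hD hD1).
      by move=> p; exact: gradP.
    move=> /(G_inj ht' (Drho_int_sub hp) (Drho_int_sub hp1))[Es zE]; apply: ne.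
    by rewrite zE -(r_of_s_of r0_gt0 r_gt0) Es r_of_s_of.
  rewrite /dot/=; have m1 := s_of_mono r0 r_gt0 r1_gt0; have m2' := s_of_mono r0 r1_gt0 r_gt0.
  have [lt|gt|rE] := ltgtP r r1.
  + by rewrite ltr_pwDl//; [rewrite nmulr_rgt0 subr_lt0 ?m1|rewrite -expr2 sqr_ge0].
  + by rewrite ltr_pwDl//; [rewrite mulr_gt0// subr_gt0 ?m2'|rewrite -expr2 sqr_ge0].
  + rewrite rE !subrr mulr0 add0r -expr2 exprn_even_gt0//= subr_eq0.
    by apply/eqP => zE; apply: ne; rewrite rE zE.
have cwt : {within rect (r1 - e) (r1 + e) (z1 - e) (z1 + e), continuous (fun x : R * R => x.1)}.
  by apply: continuous_subspaceT => x; exact: cvg_fst.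
have wtE r z : rect (r1 - e) (r1 + e) (z1 - e) (z1 + e) (r, z) ->
    (spt (sigma t))° (G1 t r z, G2 t r z) -> r = m (G1 t r z) (G2 t r z) * jac (G1 t) (G2 t) r z.
  by move=> /Bi hr _; exact: m_jac.
have inj r z : Dz (r, z) -> `|G1 t r z - q1| < d -> `|G2 t r z - q2| < d ->
    rect (r1 - e) (r1 + e) (z1 - e) (z1 + e) (r, z).
  move=> Dx h1 h2; have [hB|hB] := ltP `|(r, z) - (r1, z1)| e.
    move: hB; rewrite normr_prodE/= gt_max => /andP[/ltW k1 /ltW k2].
    by split; rewrite /= in_itv/= -ler_distl.
  have := hd (r, z) (conj Dx hB); rewrite /Gt leNgt normr_prodE gt_max.
  by rewrite -[(_ - _).1]/(G1 t r z - q1) -[(_ - _).2]/(G2 t r z - q2) h1 h2.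
have PN := @pushforward_near R (sigma t) m2 (dens t) Dz (G1 t) (G2 t) (fun x => x.1) m mdens dens0 sE.
have {}PN := PN mDz mGt mwt wt0 m2E.
have {}PN := PN (spt (sigma t))° [set x | UG (t, x)] (fun r z => (s_of r0 r - s_of r0 r1, z - z1)).
have {}PN := PN r1 z1 q1 q2 e d oV hm mdensE oW hg1 hg2 e0 Vq BW BD.
exact (PN sep cwt wtE d0 inj).
Qed.

Let null_integral (E : set (plane R)) (f : plane R -> R) : measurable E -> measurable_fun E f ->
  (forall x, E x -> 0 <= f x) -> (leb2 R).-negligible (E `&` [set x | f x != 0]) ->
  (\int[leb2 R]_(x in E) (f x)%:E)%E = 0%E.
Proof.
move=> mE mf f0 nf; transitivity (\int[leb2 R]_(x in E) (cst 0%E x))%E; last by rewrite integral0.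
apply: ge0_ae_eq_integral => //; first by apply/measurable_EFinP.
apply: negligibleS nf => x /= h; split.
  by apply: contrapT => nE; apply: h => Ex; case: nE.
by apply/negP => /eqP fx; apply: h => _; rewrite fx.
Qed.

(** The dual measure is the image of r dr dz: both agree near every interior
    point, and charge neither the image of the boundary nor its complement. *)
Lemma pushforward_formula (A : set (plane R)) : measurable A ->
  (sigma t A = \int[leb2 R]_(x in (Dz : set (plane R)) `&` (Gt : plane R -> plane R) @^-1` A) (x.1)%:E)%E.
Proof.
move=> mA.
have mw : measurable_fun (Dz : set (plane R)) (fun x : plane R => x.1 : R) by exact: measurable_funS measurable_fst.
have w0 (x : plane R) : Dz x -> 0 <= (x.1 : R) by case: x => r z /Gam_gt0 /ltW.
have fin : (\int[leb2 R]_(x in (Dz : set (plane R))) (x.1 : R)%:E < +oo)%E.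
  have zr z : 0 <= z <= H -> r0 <= zeta t z by move=> hz; apply/ltW; exact: zeta_gt.
  rewrite (integral_region (ltW H_gt0) (czeta ht') zr (f := fst)) ?ltry//.
  by apply: continuous_subspaceT => x; exact: cvg_fst.
have [nu nuE] := weighted_pushforward_measure mDz mGt mw w0 fin.
have [mdens dens0 sE] := sigma_dens ht'.
have mO : measurable (O : set (plane R)) := open_measurable2 oO.
have mOC := measurableC mO.
have drop (mu : {measure set (plane R) -> \bar R}) : mu (~` O) = 0%E -> mu A = mu (A `&` O).
  move=> h; have z : mu (A `\` O) = 0%E.
    have sub : A `\` O `<=` ~` O by move=> x [].
    exact: (subset_measure0 (measurableD mA mO) mOC sub h).
  transitivity (mu (A `\` O) + mu (A `&` O))%E; first exact: (measureDI mu mA mO).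
  by rewrite z add0e.
have null_s (N : set (plane R)) : (leb2 R).-negligible N -> (sigma t).-negligible N.
  move=> [M [mM M0 NM]]; exists M; split => //; rewrite sE//.
  apply: null_integral => //; first exact: measurable_funS mdens.
  by exists M; split => // x [].
have cspt : closed (spt (sigma t)) := spt_closed (mu := sigma t).
have sO : sigma t (~` O) = 0%E.
  apply: measure_negligible => //.
  have n1 : (sigma t).-negligible (~` spt (sigma t)).
    exists (~` spt (sigma t)); split => //; last exact: spt_null.
    by apply: open_measurable2; exact: closed_openC.
  have n2 := null_s _ (proj2 bdry_null).
  have mKD : measurable (spt (sigma t) `\` KD : set (plane R)).
    rewrite setDE; apply: measurableI; last by apply: open_measurable2; exact: closed_openC.
    rewrite -[X in measurable X]setCK; apply: measurableC.
    by apply: open_measurable2; exact: closed_openC.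
  have n3 : (sigma t).-negligible (spt (sigma t) `\` KD).
    exists (spt (sigma t) `\` KD); split => //; rewrite sE//; apply: null_integral => //.
      exact: measurable_funS mdens.
    have := monge_ampere ht'; apply: negligibleS => q [[sq nq] dq] /= h.
    by move: dq; rewrite /= -(h sq) (flat_outside sq nq) mulr0 eqxx.
  apply: (negligibleS _ (negligibleU n1 (negligibleU n2 n3))) => q nO.
  have [sq|] := pselect (spt (sigma t) q); last by left.
  right; have [[x Dx xq]|] := pselect (KD q); last by right.
  left; exists x => //; split => // hi; apply: nO; by exists x.
have nO : nu (~` O) = 0%E.
  rewrite nuE; apply: null_integral.
  - exact: mGt.
  - by apply: measurable_funS mw => // x [].
  - by move=> x [/w0].
  - apply: negligibleS (proj1 bdry_null) => x [[Dx nx] _]; split => // hi; apply: nx.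
    by exists x.
rewrite -nuE (drop (sigma t) sO) (drop nu nO).
apply: (@measure_eq_local R (sigma t) nu O).
- by apply: (@le_lt_trans _ _ 1%E); [rewrite le_eqVlt; apply/orP; left; apply/eqP; exact: probability_setT|exact: ltry].
- exact: near_equal.
- exact: measurableI.
- by move=> x [].
Qed.

Lemma sigma_formula (A : set (plane R)) : measurable A ->
  (sigma t A = \int[leb2 R]_(x in Gam r0 H zeta t `&`
    [set x | A (G1 t x.1 x.2, G2 t x.1 x.2)]) (x.1)%:E)%E.
Proof. exact: pushforward_formula. Qed.

End pushforward.

(** * From the dual measure to the fluid: local test functions *)

Let movT_Zz t z : 0 < t < T -> 0 <= z <= H -> Zz (t, (z, 0)).
Proof. by move=> /closed_time; exact: subZz. Qed.
Let zeta_ge t z : 0 < t < T -> 0 <= z <= H -> r0 <= zeta t z.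
Proof. by move=> /closed_time ht hz; apply/ltW; exact: zeta_gt. Qed.

Let img (x : R * (R * R)) : R * (R * R) := (x.1, (unc (rad_of r0 zeta) x, x.2.2)).

Let img_movT t l z : 0 < t < T -> 0 <= l <= 1 -> 0 <= z <= H ->
  Gam r0 H zeta t (rad_of r0 zeta t l z, z).
Proof.
move=> ht hl hz; apply: (@fluid_of_box R r0 H T zeta) => //; last exact: closed_time.
by move=> t' z' h1 h2; apply/ltW; exact: zeta_gt.
Qed.

Let img_fluid t l z : 0 < t < T -> 0 < l < 1 -> 0 < z < H ->
  fluid (t, (rad_of r0 zeta t l z, z)).
Proof.
move=> ht /andP[l0 l1] /andP[z0 zH]; split => //; split; first by rewrite /= z0.
have hz : 0 <= z <= H by rewrite !ltW.
have J : 0 < zeta t z - r0 by rewrite subr_gt0; apply: zeta_gt => //; exact: closed_time.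
by rewrite /rad_of /thick/= ltrDl mulr_gt0//= -ltrBrDl gtr_pMl.
Qed.

Let rad_inj t l l' z : 0 < t < T -> 0 <= z <= H ->
  rad_of r0 zeta t l z = rad_of r0 zeta t l' z -> l = l'.
Proof.
move=> ht hz /addrI; apply: mulIf; rewrite gt_eqF// subr_gt0.
by apply: zeta_gt => //; exact: closed_time.
Qed.

Let open_time : open [set x : R * (R * R) | Zz (x.1, (x.2.2, 0))].
Proof.
apply: (@open_comp _ _ (fun x : R * (R * R) => (x.1, (x.2.2, 0 : R)))); last exact: oZz.
move=> x _; apply: continuous_triple; [exact: cvg_fst| |exact: cvg_cst].
exact: (@continuous_comp _ _ _ snd snd _ cvg_snd cvg_snd).
Qed.

Let Cn_rad n : Cn n [set x : R * (R * R) | Zz (x.1, (x.2.2, 0))] (rad_of r0 zeta).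
Proof.
set U := [set _ | _]; have oU : open U := open_time.
have hz : Cn n U (fun t (_ : R) z => zeta t z).
  exact: (@Cn_comp R n Zz U (fun t z _ => zeta t z) (fun t _ _ => t) (fun _ _ z => z)
    (fun _ _ _ => 0) oU (fun x h => h) (hZz n) (Cn_t n U) (Cn_y n U) (Cn_cst n U 0)).
exact: (Cn_add oU (Cn_cst n U r0) (Cn_mul oU (Cn_x n U) (Cn_sub oU hz (Cn_cst n U r0)))).
Qed.

Let cimg (A : set (R * (R * R))) : (forall x, A x -> 0 < x.1 < T /\ 0 <= x.2.2 <= H) ->
  {within A, continuous img}.
Proof.
move=> hA; apply: continuous_in_subspaceT => x /set_mem /hA[ht hz].
apply: continuous_triple; first exact: cvg_fst.
  apply: differentiable_continuous; apply: (Cn_diff (Cn_rad 0)); exact: movT_Zz.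
exact: (@continuous_comp _ _ _ snd snd _ cvg_snd cvg_snd).
Qed.

(** Near any point of the closed moving domain there is a test function in the
    dual variables whose pullback by the gradient map is positive at the point
    and vanishes away from it: the gradient map is injective on a compact set.
    The transported mass of such a function is zero. *)
Lemma local_test t0 l0 z0 e : 0 < e -> 0 < t0 - e -> t0 + e < T -> 0 <= l0 <= 1 ->
  0 <= z0 <= H -> exists eta, let h := along_flow G1 G2 eta in
  [/\ Cn 2 UG h /\ (forall t r z, 0 <= h t r z),
      int3 (t0 - e) (t0 + e) 0 1 0 H (transported r0 zeta h v w) = 0,
      forall t r z, t <= t0 - e \/ t0 + e <= t -> h t r z = 0,
      0 < pull r0 zeta h t0 l0 z0 &
      forall t l z, cbox (t0 - e) (t0 + e) 0 1 0 H (t, (l, z)) -> pull r0 zeta h t l z != 0 ->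
        [/\ `|t - t0| < e, `|l - l0| < e & `|z - z0| < e]].
Proof.
move=> e0 t1_gt0 t2_lt hl0 hz0.
have inT t : t0 - e <= t <= t0 + e -> 0 < t < T.
  by move=> /andP[h1 h2]; rewrite (lt_le_trans t1_gt0 h1) (le_lt_trans h2 t2_lt).
have t0e : t0 - e <= t0 <= t0 + e by rewrite lerBlDr !lerDl (ltW e0).
have ht0 := inT _ t0e.
pose C := cbox (t0 - e) (t0 + e) 0 1 0 H.
pose K := C `&` ~` obox (t0 - e) (t0 + e) (l0 - e) (l0 + e) (z0 - e) (z0 + e).
have cK : compact K.
  apply: compact_closedI; first exact: compact_cbox.
  by apply: open_closedC; exact: obox_open.
pose g1 := pull r0 zeta G1; pose g2 := pull r0 zeta G2.
have C_mov x : C x -> movT (img x).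
  by case: x => t [l z] [/= /inT ht hl hz]; split => //; exact: img_movT.
have cg f : Cn 0 UG f -> {within C, continuous (unc (pull r0 zeta f))}.
  move=> hf; apply: (within_comp (within_UG hf) _ C_mov).
  by apply: cimg => -[t [l z]] [/= /inT].
pose N (x : R * (R * R)) := `|x.1 - t0| + `|unc g1 x - g1 t0 l0 z0| + `|unc g2 x - g2 t0 l0 z0|.
have abs_within (f : R * (R * R) -> R) (c : R) : {within C, continuous f} ->
    {within C, continuous (fun x => `|f x - c|)}.
  move=> cf; apply: (@within_compT _ _ _ C (fun y : R => `|y - c|) f _ cf) => y.
  by apply: cvg_norm; exact: (cvgB cvg_id (cvg_cst _)).
have cN : {within K, continuous N}.
  apply: (continuous_subspaceW (B := C)); first by move=> x [].
  have c1 := abs_within fst t0 (continuous_subspaceT (@continuous_fst _ _)).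
  have c2 := abs_within _ (g1 t0 l0 z0) (cg _ (Cn_G1 0)).
  have c3 := abs_within _ (g2 t0 l0 z0) (cg _ (Cn_G2 0)).
  move=> x; have c12 := @continuousD _ _ (subspace C) _ _ x (c1 x) (c2 x).
  exact: (@continuousD _ _ (subspace C) _ _ x c12 (c3 x)).
have [|d d0 hd] := compact_separated cK cN.
  move=> [t [l z]] [[/= ht hl hz] nO]; rewrite lt_neqAle addr_ge0 ?addr_ge0// andbT.
  apply/eqP => /esym/eqP; rewrite !paddr_eq0 ?addr_ge0// !normr_eq0 !subr_eq0 /=.
  move=> /andP[/andP[/eqP tE /eqP E1] /eqP E2]; apply: nO; move: E1 E2; rewrite /unc/= tE => E1 E2.
  have hx := Drho_s (closed_time ht0) (img_movT ht0 hl hz).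
  have hx0 := Drho_s (closed_time ht0) (img_movT ht0 hl0 hz0).
  have EG : G t0 (s_of r0 (rad_of r0 zeta t0 l z), z) = G t0 (s_of r0 (rad_of r0 zeta t0 l0 z0), z0).
    by rewrite !GE; exact: (congr2 pair E1 E2).
  have [Es zE] := G_inj (closed_time ht0) hx hx0 EG.
  have rE : rad_of r0 zeta t0 l z = rad_of r0 zeta t0 l0 z0.
    have k1 := Gam_gt0 (img_movT ht0 hl hz); have k2 := Gam_gt0 (img_movT ht0 hl0 hz0).
    by rewrite -(r_of_s_of r0_gt0 k1) Es r_of_s_of.
  rewrite zE in rE; have lE := rad_inj ht0 hz0 rE.
  by split; rewrite /= ?tE ?lE ?zE ltrBlDr !ltrDl e0.
pose d' := Num.min (d / 3) e.
have d'0 : 0 < d' by rewrite lt_min e0 divr_gt0.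
have d'e : d' <= e by rewrite ge_min lexx orbT.
have d'd : d' <= d / 3 by rewrite ge_min lexx.
pose c0 : R * (R * R) := (t0, (g1 t0 l0 z0, g2 t0 l0 z0)).
pose eta := bump c0 d'; pose h := along_flow G1 G2 eta.
have heta : Cn 2 setT eta by apply: Cn_bump; exact: openT.
have eta_ge0 t y z : 0 <= eta t y z by exact: bump_ge0.
have eta0 t y z : t <= t0 - e \/ t0 + e <= t -> eta t y z = 0.
  move=> ht; apply: (@bump_eq0 R c0 (t, (y, z)) d'); left; apply: (le_trans d'e) => /=.
  by rewrite ler_normr; case: ht => ht; apply/orP; [right; rewrite opprB lerBrDr -lerBrDl|left; rewrite lerBrDl].
exists eta; split.
- split; last by move=> t r z; exact: eta_ge0.
  exact: (@Cn_comp R 2 setT UG eta (fun t _ _ => t) G1 G2 oUG (fun _ _ => Logic.I) heta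
    (Cn_t 2 UG) (Cn_G1 2) (Cn_G2 2)).
- have te : test_function [set x : R * (R * R) | x.1 < T] eta.
    apply: bump_test_function => x h1 _ _ /=; apply: le_lt_trans t2_lt.
    by rewrite -lerBlDl; apply: le_trans (ler_norm _) _; exact: le_trans h1 d'e.
  have [_ wE] := transport te.
  have i0 : \int[sigma 0]_q eta 0 q.1 q.2 = 0.
    rewrite /Rintegral (_ : (fun q => _) = fun=> 0%E) ?integral0//.
    by apply/funext => q; rewrite eta0//; left; exact: ltW.
  rewrite i0 addr0 in wE.
  have t12 : t0 - e < t0 + e by rewrite ltrD2l gtrN.
  have [_ wE2] := @weak_form_flow R r0 H T (t0 - e) (t0 + e) zeta sigma V G1 G2 v w eta Zz UG
    r0_gt0 H_gt0 t1_gt0 t12 t2_lt oZz (hZz 2) movT_Zz zeta_ge oUG movT_UG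
    (Cn_G1 2) (Cn_G2 2) (fun t A ht mA => sigma_formula ht mA) v_cont w_cont VE heta eta0.
  by rewrite -wE2.
- by move=> t r z; exact: eta0.
- by apply: (@bump_gt0 R c0 (t0, (g1 t0 l0 z0, g2 t0 l0 z0)) d') => /=; rewrite subrr normr0.
- move=> t l z Cx nz.
  have [kt k1 k2] : [/\ `|t - t0| < d', `|g1 t l z - g1 t0 l0 z0| < d' & `|g2 t l z - g2 t0 l0 z0| < d'].
    have b0 := @bump_eq0 R c0 (t, (g1 t l z, g2 t l z)) d'.
    split; rewrite ltNge; apply/negP => k; move/eqP: nz; apply; apply: b0; [by left|by right; left|by right; right].
  have nK : ~ K (t, (l, z)).
    move=> /hd; rewrite leNgt => /negP; apply.
    have -> : d = d / 3 + d / 3 + d / 3 by field.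
    apply: ltrD; first apply: ltrD; exact: lt_le_trans d'd.
  have [k3|nO] := pselect (obox (t0 - e) (t0 + e) (l0 - e) (l0 + e) (z0 - e) (z0 + e) (t, (l, z)));
    last by exfalso; apply: nK.
  by case: k3 => /= *; split; rewrite ltr_distl.
Qed.

Let Cn_vw : Cn 1 fluid v /\ Cn 1 fluid w.
Proof.
have aG n f : Cn n Ua f -> Cn n fluid (fun t r z => f t (G1 t r z) (G2 t r z)).
  move=> hf; exact: (@Cn_comp R n Ua fluid f (fun t _ _ => t) G1 G2 ofluid (fun x => @G_Ua x) hf
    (Cn_t n fluid) (Cn_fluid (Cn_G1 n)) (Cn_fluid (Cn_G2 n))).
have hs k : smooth_on [set x : R * (R * R) | 0 <= x.1 <= T /\ strip r0 H x.2] k -> Cn 1 fluid k.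
  move=> /smooth_onP[W [_ subW hW]]; apply: sub_Cn (hW 1) => -[t [r z]] [/closed_time ht].
  by move=> /Gam_int_sub[/= hz /andP[hr _]]; apply: subW.
have V1 := Cn_mul ofluid (Cn_mul ofluid (Cn_cst 1 fluid 2) (Cn_momentum 1)) (hs _ F_smooth).
have V2 := Cn_mul ofluid (Cn_cst 1 fluid (g / th0)) (hs _ S_smooth).
have mat f : Cn 2 Ua f -> Cn 1 fluid (fun t r z => material V f t (G1 t r z) (G2 t r z)).
  move=> hf; have k0 := aG _ _ (Cn_Dt hf); have k1 := aG _ _ (Cn_D1 hf); have k2 := aG _ _ (Cn_D2 hf).
  have k := Cn_add ofluid (Cn_add ofluid k0 (Cn_mul ofluid V1 k1)) (Cn_mul ofluid V2 k2).
  apply: (Cn_eq ofluid _ k) => -[t [r z]] [/closed_time ht /Gam_int_sub hi].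
  have [e1 e2] := gradPsi_x ht hi.
  by rewrite /unc/= /material /V /VEL e1 e2 r_of_s_of ?(Gam_gt0 hi).
have E t r z : fluid (t, (r, z)) -> v t r z = material V a t (G1 t r z) (G2 t r z) /\
    w t r z = material V (D2 Psi) t (G1 t r z) (G2 t r z).
  move=> [ht hi]; have ht' := closed_time ht; have hc := Gam_int_sub hi.
  have := velocity ht (int_spt_x ht' hi); have [e1 e2] := gradPsi_x ht' hc.
  by rewrite /= e1 e2 r_of_s_of ?(Gam_gt0 hc)// => -[-> ->].
split.
- by apply: (Cn_eq ofluid _ (mat _ (Cn_a 2))) => -[t [r z]] /E[h _]; rewrite /unc/= h.
- by apply: (Cn_eq ofluid _ (mat _ (Cn_b 2))) => -[t [r z]] /E[_ h]; rewrite /unc/= h.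
Qed.

(** * From the dual measure to the fluid: incompressibility *)

Let Cn_thickness n : Cn n [set x : R * (R * R) | Zz (x.1, (x.2.2, 0))] (thick r0 zeta).
Proof.
set U := [set _ | _]; have oU : open U := open_time.
have hz : Cn n U (fun t (_ : R) z => zeta t z).
  exact: (@Cn_comp R n Zz U (fun t z _ => zeta t z) (fun t _ _ => t) (fun _ _ z => z)
    (fun _ _ _ => 0) oU (fun x h => h) (hZz n) (Cn_t n U) (Cn_y n U) (Cn_cst n U 0)).
exact: (Cn_sub oU hz (Cn_cst n U r0)).
Qed.

Let thick_gt0 t l z : 0 < t < T -> 0 <= z <= H -> 0 < thick r0 zeta t l z.
Proof. by move=> /closed_time ht hz; rewrite /thick subr_gt0; exact: zeta_gt. Qed.

Let moving_movT t1 t2 : 0 < t1 -> t2 < T -> moving r0 H t1 t2 zeta `<=` movT.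
Proof.
move=> t10 t2T [t x] [/= /andP[h1 h2] hx]; split => //=.
by rewrite (lt_le_trans t10 h1) (le_lt_trans h2 t2T).
Qed.

(** If the velocity compressed the fluid at an interior point, the balance of
    mass in a small box around it, weighted by a local test function, would
    have a nonzero source. *)
Let incompressible_flow t0 r z0 : fluid (t0, (r, z0)) ->
  v t0 r z0 + r * D1 v t0 r z0 + r * D2 w t0 r z0 = 0.
Proof.
move=> hx; have [hv hw] := Cn_vw; have [ht0 [/= /andP[z00 z0H] /andP[r0r rz]]] := hx.
have hz0 : 0 <= z0 <= H by rewrite !ltW.
have J0 : 0 < zeta t0 z0 - r0 by exact: (thick_gt0 0 ht0 hz0).
pose l0 := (r - r0) / (zeta t0 z0 - r0).
have l00 : 0 < l0 by rewrite divr_gt0// subr_gt0.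
have l01 : l0 < 1 by rewrite ltr_pdivrMr// mul1r ltrD2r.
have rE : rad_of r0 zeta t0 l0 z0 = r by rewrite /rad_of /thick /l0 divfK ?gt_eqF// addrC subrK.
pose beta t r z := v t r z + r * D1 v t r z + r * D2 w t r z.
apply/eqP; apply: contrapT => /negP nz.
pose s := Num.sg (beta t0 r z0).
have hb : Cn 0 fluid beta.
  exact: (Cn_add ofluid (Cn_add ofluid (CnW hv) (Cn_mul ofluid (Cn_x 0 fluid) (Cn_D1 hv)))
    (Cn_mul ofluid (Cn_x 0 fluid) (Cn_D2 hw))).
have cb : {within obox 0 T 0 1 0 H, continuous (fun x => unc beta (img x))}.
  apply: (@within_comp _ _ _ fluid _ (unc beta) img).
  - by apply: (@differentiable_within _ fluid fluid) => // x Ux; exact: (Cn_diff hb Ux).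
  - by apply: cimg => x [? _ /andP[? ?]]; rewrite !ltW.
  - by move=> [t [l z]] [/= h1 h2 h3]; exact: img_fluid.
have cs : {within obox 0 T 0 1 0 H, continuous (fun x => s * unc beta (img x))}.
  have c2 : {within obox 0 T 0 1 0 H, continuous (fun _ => s)}.
    by apply: continuous_subspaceT => y; exact: cvg_cst.
  exact: (within_mul c2 cb).
have [||e1 e10 he1] := within_pos_near cs (x0 := (t0, (l0, z0))).
- by split => //=; rewrite ?l00 ?l01 ?z00 ?z0H.
- by rewrite /img /unc/= rE -normrEsg normr_gt0.
move: (ht0) => /andP[t00 t0T].
pose m := Num.min e1 (Num.min (Num.min t0 (T - t0)) (Num.min (Num.min l0 (1 - l0)) (Num.min z0 (H - z0)))).
have m0 : 0 < m by rewrite !lt_min e10 t00 l00 z00 !subr_gt0 t0T l01 z0H.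
have [me1 [mt [mT [ml [ml1 [mz mH]]]]]] : m <= e1 /\ m <= t0 /\ m <= T - t0 /\ m <= l0 /\
    m <= 1 - l0 /\ m <= z0 /\ m <= H - z0.
  by rewrite /m !ge_min !lexx !orbT.
pose f := m / 2; have f0 : 0 < f by rewrite divr_gt0.
have fm : f < m by exact: half_lt.
pose e := f / 2; have e0 : 0 < e by rewrite divr_gt0.
have ef : e < f by exact: half_lt.
have em : e < m by exact: lt_trans fm.
have t1_gt0 : 0 < t0 - f by rewrite subr_gt0 (lt_le_trans fm).
have t2_lt : t0 + f < T by rewrite -ltrBrDl (lt_le_trans fm).
have t1e : 0 < t0 - e by rewrite subr_gt0 (lt_le_trans em).
have t2e : t0 + e < T by rewrite -ltrBrDl (lt_le_trans em).
have hl0 : 0 <= l0 <= 1 by rewrite !ltW.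
have [eta [[hh h0] I0 ht hp hloc]] := local_test e0 t1e t2e hl0 hz0.
set h := along_flow G1 G2 eta in hh h0 I0 ht hp hloc.
have inT t : t0 - f <= t <= t0 + f -> 0 < t < T.
  by move=> /andP[k1 k2]; rewrite (lt_le_trans t1_gt0 k1) (le_lt_trans k2 t2_lt).
have zsub t z : t0 - f <= t <= t0 + f -> 0 <= z <= H -> Zz (t, (z, 0)).
  by move=> /inT k; exact: movT_Zz.
have zr t z : t0 - f <= t <= t0 + f -> 0 <= z <= H -> r0 <= zeta t z.
  by move=> /inT k; exact: zeta_ge.
have mm := @moving_movT _ _ t1_gt0 t2_lt.
have subh : moving r0 H (t0 - f) (t0 + f) zeta `<=` UG by move=> x /mm /movT_UG.
have subv t l z : obox (t0 - f) (t0 + f) 0 1 0 H (t, (l, z)) -> fluid (t, (rad_of r0 zeta t l z, z)).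
  by move=> [/= /andP[k1 k2] k3 k4]; apply: img_fluid => //; apply: inT; rewrite !ltW.
have [n1 n2 n3 dE] := @flux_divergence R r0 H _ _ zeta Zz oZz (hZz 2) zsub zr h v w UG fluid oUG hh
  subh ofluid hv hw subv.
have ctr : {within cbox (t0 - f) (t0 + f) 0 1 0 H, continuous (unc (transported r0 zeta h v w))}.
  apply: (@continuous_transported R r0 H _ _ zeta Zz oZz (hZz 2) zsub zr h v w UG) => //.
  - exact: continuous_subspaceW mm v_cont.
  - exact: continuous_subspaceW mm w_cont.
pose b := cbox (t0 - e) (t0 + e) (l0 - e) (l0 + e) (z0 - e) (z0 + e).
have bO t l z : b (t, (l, z)) -> obox (t0 - f) (t0 + f) 0 1 0 H (t, (l, z)).
  move=> [/= /andP[k1 k2] /andP[k3 k4] /andP[k5 k6]]; split=> /=.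
  - by rewrite (lt_le_trans _ k1) ?(le_lt_trans k2)// ?ltrD2l ?ltrN2.
  - rewrite (lt_le_trans _ k3) ?subr_gt0 ?(lt_le_trans em)//=.
    by rewrite (le_lt_trans k4)// -ltrBrDl (lt_le_trans em).
  - rewrite (lt_le_trans _ k5) ?subr_gt0 ?(lt_le_trans em)//=.
    by rewrite (le_lt_trans k6)// -ltrBrDl (lt_le_trans em).
have bO' : b `<=` obox (t0 - f) (t0 + f) 0 1 0 H by move=> [t [l z]]; exact: bO.
have bA t l z : b (t, (l, z)) -> obox 0 T 0 1 0 H (t, (l, z)).
  by move=> /bO[/= /andP[k1 k2] k3 k4]; split => //=; apply: inT; rewrite !ltW.
have e12 x : x - e < x + e by rewrite ltrD2l gtrN.
pose src t l z := pull r0 zeta h t l z * (thick r0 zeta t l z * compression r0 zeta v w t l z).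
have csrc : {within b, continuous (unc src)}.
  have c1 : {within b, continuous (unc (pull r0 zeta h))}.
    apply: (@within_comp _ _ _ UG b (unc h) img).
    - by apply: (@differentiable_within _ UG UG) => // x Ux; exact: (Cn_diff hh Ux).
    - by apply: cimg => -[t [l z]] /bA[/= ? _ /andP[? ?]]; rewrite !ltW.
    - by move=> [t [l z]] /bO/subv/fluid_UG.
  have c2 : {within b, continuous (unc (thick r0 zeta))}.
    apply: (@differentiable_within _ [set x : R * (R * R) | Zz (x.1, (x.2.2, 0))]).
      by move=> [t [l z]] /bA[/= k1 _ /andP[k2 k3]]; apply: movT_Zz; rewrite // !ltW.
    by move=> x Ux; exact: (Cn_diff (Cn_thickness 0) Ux).
  have c3 : {within b, continuous (unc (compression r0 zeta v w))}.
    apply: (continuous_subspaceW (B := obox 0 T 0 1 0 H)) cb.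
    by move=> [t [l z]]; exact: bA.
  exact: (within_mul c1 (within_mul c2 c3)).
have Isrc : int3 (t0 - e) (t0 + e) (l0 - e) (l0 + e) (z0 - e) (z0 + e) src = 0.
  have D0 := divergence_smooth (e12 t0) (e12 l0) (e12 z0) bO' n1 n2 n3.
  have ctrb : {within b, continuous (unc (transported r0 zeta h v w))}.
    by apply: continuous_subspaceW ctr => x /bO'/obox_sub_cbox.
  have A0 := int3_within_add (e12 t0) (e12 l0) (e12 z0) ctrb csrc.
  have E0 : int3 (t0 - e) (t0 + e) (l0 - e) (l0 + e) (z0 - e) (z0 + e)
      (fun t l z => transported r0 zeta h v w t l z + src t l z) = 0.
    rewrite -[RHS](_ : flux (t0 - e) (t0 + e) (l0 - e) (l0 + e) (z0 - e) (z0 + e)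
      (flux1 r0 zeta h) (flux2 r0 zeta h v w) (flux3 r0 zeta h w) = 0).
      rewrite -D0; apply: eq_int => t k1; apply: eq_int => l k2; apply: eq_int => z k3.
      by rewrite dE//; exact: bO.
    have out t l z : b (t, (l, z)) -> ~ [/\ `|t - t0| < e, `|l - l0| < e & `|z - z0| < e] ->
        pull r0 zeta h t l z = 0.
      move=> hb' nb; apply/eqP; apply: contrapT => /negP k; apply: nb; apply: hloc k.
      have [/= _ k2 k3] := bA _ _ _ hb'; case: hb' => /= k1 _ _.
      by split => //=; move: k2 k3 => /andP[? ?] /andP[? ?]; rewrite !ltW.
    have aE (x : R) : `|x + e - x| = e /\ `|x - e - x| = e.
      by rewrite addrAC subrr add0r addrAC subrr add0r normrN gtr0_norm.
    have le2 x : x - e <= x + e by exact: ltW.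
    have iE x : x - e <= x + e <= x + e /\ x - e <= x - e <= x + e by rewrite !lexx le2.
    have z1 t l z : b (t, (l, z)) -> ~ [/\ `|t - t0| < e, `|l - l0| < e & `|z - z0| < e] ->
        [/\ flux1 r0 zeta h t l z = 0, flux2 r0 zeta h v w t l z = 0 & flux3 r0 zeta h w t l z = 0].
      by move=> k1 k2; rewrite /flux1 /flux2 /flux3 out// !(mulr0, mul0r).
    rewrite /flux (itg_eq0 (a := l0 - e))// ?(itg_eq0 (a := t0 - e))// ?addr0//.
    - move=> t k1; apply: itg_eq0 => // x k2.
      have [_ _ ->] : [/\ flux1 r0 zeta h t x (z0 + e) = 0, flux2 r0 zeta h v w t x (z0 + e) = 0 &
          flux3 r0 zeta h w t x (z0 + e) = 0].
        by apply: z1; [split => //=; case: (iE z0)|move=> [_ _]; rewrite (proj1 (aE z0)) ltxx].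
      have [_ _ ->] : [/\ flux1 r0 zeta h t x (z0 - e) = 0, flux2 r0 zeta h v w t x (z0 - e) = 0 &
          flux3 r0 zeta h w t x (z0 - e) = 0].
        by apply: z1; [split => //=; case: (iE z0)|move=> [_ _]; rewrite (proj2 (aE z0)) ltxx].
      by rewrite subrr.
    - move=> t k1; apply: itg_eq0 => // y k2.
      have [_ -> _] : [/\ flux1 r0 zeta h t (l0 + e) y = 0, flux2 r0 zeta h v w t (l0 + e) y = 0 &
          flux3 r0 zeta h w t (l0 + e) y = 0].
        by apply: z1; [split => //=; case: (iE l0)|move=> [_ + _]; rewrite (proj1 (aE l0)) ltxx].
      have [_ -> _] : [/\ flux1 r0 zeta h t (l0 - e) y = 0, flux2 r0 zeta h v w t (l0 - e) y = 0 &
          flux3 r0 zeta h w t (l0 - e) y = 0].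
        by apply: z1; [split => //=; case: (iE l0)|move=> [_ + _]; rewrite (proj2 (aE l0)) ltxx].
      by rewrite subrr.
    - move=> x k1; apply: itg_eq0 => // y k2.
      have [-> _ _] : [/\ flux1 r0 zeta h (t0 + e) x y = 0, flux2 r0 zeta h v w (t0 + e) x y = 0 &
          flux3 r0 zeta h w (t0 + e) x y = 0].
        by apply: z1; [split => //=; case: (iE t0)|move=> [+ _ _]; rewrite (proj1 (aE t0)) ltxx].
      have [-> _ _] : [/\ flux1 r0 zeta h (t0 - e) x y = 0, flux2 r0 zeta h v w (t0 - e) x y = 0 &
          flux3 r0 zeta h w (t0 - e) x y = 0].
        by apply: z1; [split => //=; case: (iE t0)|move=> [+ _ _]; rewrite (proj2 (aE t0)) ltxx].
      by rewrite subrr.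
  rewrite E0 in A0.
  have T0 : int3 (t0 - e) (t0 + e) (l0 - e) (l0 + e) (z0 - e) (z0 + e)
      (transported r0 zeta h v w) = 0.
    rewrite -I0; symmetry; apply: int3_restrict => //.
    - by rewrite subr_ge0 ltW// (lt_le_trans em).
    - by rewrite -lerBrDl ltW// (lt_le_trans em).
    - by rewrite subr_ge0 ltW// (lt_le_trans em).
    - by rewrite -lerBrDl ltW// (lt_le_trans em).
    - exact: ltW.
    move=> t l z Cx nb; have hz : pull r0 zeta h t l z = 0.
      apply/eqP; apply: contrapT => /negP /(hloc _ _ _ Cx)[k1 k2 k3]; apply: nb.
      by split; rewrite /= -ler_distl ltW.
    case: Cx => /= /andP[k1 k2] kl kz.
    have ht' : 0 < t < T by rewrite (lt_le_trans t1e k1) (le_lt_trans k2 t2e).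
    have Ux := movT_UG (conj ht' (img_movT ht' kl kz) : movT (t, (rad_of r0 zeta t l z, z))).
    have [p0 p1 p2] := partial_zero_ge0 oUG (fun p Up => Cn_diff hh Up) Ux h0 hz.
    by rewrite /transported /pull /material p0 p1 p2 !(mulr0, addr0).
  by rewrite T0 add0r in A0; rewrite -A0.
apply: (@int3_sign R _ _ _ _ _ _ s src t0 l0 z0 (e12 t0) (e12 l0) (e12 z0) csrc) Isrc.
- move=> t l z hb'; have hA := bA _ _ _ hb'.
  have k : 0 < s * unc beta (img (t, (l, z))).
    case: hb' => /=; rewrite -!ler_distl => k1 k2 k3.
    by apply: he1 => //=; [apply: le_lt_trans k1 _|apply: le_lt_trans k2 _|apply: le_lt_trans k3 _];
      exact: lt_le_trans em me1.
  have J : 0 < thick r0 zeta t l z.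
    by case: hA => /= ? _ /andP[? ?]; apply: thick_gt0 => //; rewrite !ltW.
  rewrite /src mulrCA mulr_ge0//; first exact: h0.
  by rewrite mulrCA mulr_ge0// ltW.
- by split; rewrite /= lerBlDr !lerDl ltW.
rewrite /src mulrCA mulr_gt0// mulrCA mulr_gt0//.
by rewrite /compression /= rE -normrEsg normr_gt0.
Qed.

Lemma converse_E5 : E5 r0 H T v w zeta.
Proof.
move=> t r z ht hi; have hx : fluid (t, (r, z)) by [].
have [hv hw] := Cn_vw; have dv := Cn_diff hv hx; split => //; first exact: (Cn_diff hw hx).
apply/incompressibleE => //; first by rewrite gt_eqF// (fluid_r_gt0 hx).
exact: incompressible_flow.
Qed.

(** * From the dual measure to the fluid: boundary conditions *)

Let closed_flow : set (R * (R * R)) :=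
  [set x | [/\ 0 < x.1 < T, 0 <= x.2.1 <= 1 & 0 <= x.2.2 <= H]].

Let pull_within f : {within movT, continuous (unc f)} ->
  {within closed_flow, continuous (unc (pull r0 zeta f))}.
Proof.
move=> cf; apply: (within_comp cf (c := img)); first by apply: cimg => x [].
by move=> [t [l z]] [/= ht hl hz]; split => //; exact: img_movT.
Qed.

(** Relative normal velocity of the fluid and of the surface r = rad_of l. *)
Let normal_speed t l z := pull r0 zeta v t l z -
  l * (derive1 (zeta ^~ z) t + derive1 (zeta t) z * pull r0 zeta w t l z).

Let differentiable_flow f n : Cn n [set x : R * (R * R) | Zz (x.1, (x.2.2, 0))] f ->
  {within closed_flow, continuous (unc f)}.
Proof.
move=> hf; apply: (@differentiable_within _ [set x : R * (R * R) | Zz (x.1, (x.2.2, 0))]).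
  by move=> x [/= ht _ hz]; exact: movT_Zz.
by move=> x Ux; exact: (Cn_diff hf Ux).
Qed.

Let continuous_normal_speed : {within closed_flow, continuous (unc normal_speed)}.
Proof.
set U := [set x : R * (R * R) | Zz (x.1, (x.2.2, 0))]; have oU : open U := open_time.
have slope k : Cn 0 Zz k -> {within closed_flow, continuous (unc (fun t _ z => k t z 0))}.
  move=> hk; apply: (@differentiable_flow _ 0).
  exact: (@Cn_comp R 0 Zz U k (fun t _ _ => t) (fun _ _ z => z)
    (fun _ _ _ => 0) oU (fun x h => h) hk (Cn_t 0 U) (Cn_y 0 U) (Cn_cst 0 U 0)).
have c1 := slope _ (Cn_Dt (hZz 1)); have c2 := slope _ (Cn_D1 (hZz 1)).
have cl := @differentiable_flow _ 0 (Cn_x 0 U).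
have c3 := within_mul c2 (pull_within w_cont).
have c4 : {within closed_flow, continuous (unc (fun t l z =>
    derive1 (zeta ^~ z) t + derive1 (zeta t) z * pull r0 zeta w t l z))}.
  by move=> x; exact: (@continuousD _ _ (subspace closed_flow) _ _ x (c1 x) (c3 x)).
exact: (within_sub (pull_within v_cont) (within_mul cl c4)).
Qed.

(** A local test function only sees the flux through the faces close to its
    support, since the flow is incompressible. *)
Let local_flux t0 l0 z0 e : 0 < e -> 0 < t0 - e -> t0 + e < T -> 0 <= l0 <= 1 ->
  0 <= z0 <= H -> exists h,
  [/\ (forall t r z, 0 <= h t r z) /\ {within closed_flow, continuous (unc (pull r0 zeta h))},
      0 < pull r0 zeta h t0 l0 z0,
      forall t l z, t0 - e <= t <= t0 + e -> 0 <= l <= 1 -> 0 <= z <= H ->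
        pull r0 zeta h t l z != 0 -> [/\ `|t - t0| < e, `|l - l0| < e & `|z - z0| < e] &
      itg (t0 - e) (t0 + e) (fun t => itg 0 H (fun z =>
          flux2 r0 zeta h v w t 1 z - flux2 r0 zeta h v w t 0 z)) +
        itg (t0 - e) (t0 + e) (fun t => itg 0 1 (fun l =>
          flux3 r0 zeta h w t l H - flux3 r0 zeta h w t l 0)) = 0].
Proof.
move=> e0 t1_gt0 t2_lt hl0 hz0.
have [eta [[hh h0] I0 ht hp hloc]] := local_test e0 t1_gt0 t2_lt hl0 hz0.
set h := along_flow G1 G2 eta in hh h0 I0 ht hp hloc; have [hv hw] := Cn_vw.
have inT t : t0 - e <= t <= t0 + e -> 0 < t < T.
  by move=> /andP[k1 k2]; rewrite (lt_le_trans t1_gt0 k1) (le_lt_trans k2 t2_lt).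
have zsub t z : t0 - e <= t <= t0 + e -> 0 <= z <= H -> Zz (t, (z, 0)).
  by move=> /inT k; exact: movT_Zz.
have zr t z : t0 - e <= t <= t0 + e -> 0 <= z <= H -> r0 <= zeta t z.
  by move=> /inT k; exact: zeta_ge.
have mm := @moving_movT _ _ t1_gt0 t2_lt.
have subh : moving r0 H (t0 - e) (t0 + e) zeta `<=` UG by move=> x /mm /movT_UG.
have subv t l z : obox (t0 - e) (t0 + e) 0 1 0 H (t, (l, z)) -> fluid (t, (rad_of r0 zeta t l z, z)).
  by move=> [/= /andP[k1 k2] k3 k4]; apply: img_fluid => //; apply: inT; rewrite !ltW.
have t12 : t0 - e < t0 + e by rewrite ltrD2l gtrN.
have inc t l z : obox (t0 - e) (t0 + e) 0 1 0 H (t, (l, z)) ->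
    thick r0 zeta t l z * compression r0 zeta v w t l z = 0.
  by move=> /subv k; rewrite /compression /= (incompressible_flow k) mulr0.
have F0 := @transport_flux R r0 H _ _ zeta H_gt0 t12 Zz oZz (hZz 2) zsub zr h v w UG fluid oUG hh
  subh ofluid hv hw subv (continuous_subspaceW mm v_cont) (continuous_subspaceW mm w_cont) inc.
exists h; split => //.
- split => //; exact: pull_within (within_UG (CnW (CnW hh))).
- by move=> t l z h1 h2 h3; apply: hloc; split.
rewrite I0 /flux in F0; rewrite [RHS]F0 [X in _ = X + _ + _]itg_eq0 ?ler01 ?add0r//.
move=> l _; apply: itg_eq0 => [|z _]; first exact: ltW.
by rewrite /flux1 /pull !ht ?lexx; [rewrite !mulr0 subrr|left|right].
Qed.

Let flow_box t0 e : 0 < t0 - e -> t0 + e < T -> forall t, t0 - e <= t <= t0 + e -> 0 < t < T.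
Proof. by move=> h1 h2 t /andP[k1 k2]; rewrite (lt_le_trans h1 k1) (le_lt_trans k2 h2). Qed.

Let slice_within (f : R -> R -> R -> R) t1 t2 (k : R * R -> R * R) a2 b2 :
  {within closed_flow, continuous (unc f)} -> continuous k ->
  (forall t y, t1 <= t <= t2 -> a2 <= y <= b2 -> closed_flow (t, k (t, y))) ->
  {within [set p : R * R | t1 <= p.1 <= t2 /\ a2 <= p.2 <= b2],
    continuous (fun p => f p.1 (k p).1 (k p).2)}.
Proof.
move=> cf ck sub.
apply: (@within_comp _ _ _ closed_flow _ (unc f) (fun p : R * R => (p.1, k p)) cf).
  by apply: continuous_subspaceT => p; exact: (cvg_pair cvg_fst (ck p)).
by case=> t y [/= h1 h2]; exact: sub.
Qed.

(** If the normal velocity had a sign at a point of the inner cylinder or of the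
    free surface, the flux of a local test function through this face would not
    vanish. *)
Let side_face t0 c z0 : 0 < t0 < T -> c = 0 \/ c = 1 -> 0 < z0 < H -> normal_speed t0 c z0 = 0.
Proof.
move=> ht0 hc /andP[z00 z0H]; apply/eqP; apply: contrapT => /negP nz.
have hz0 : 0 <= z0 <= H by rewrite !ltW.
have c01 : 0 <= c <= 1 by case: hc => ->; rewrite ?lexx ler01.
pose s := Num.sg (normal_speed t0 c z0).
have cs : {within closed_flow, continuous (fun x => s * unc normal_speed x)}.
  have c2 : {within closed_flow, continuous (fun _ => s)}.
    by apply: continuous_subspaceT => y; exact: cvg_cst.
  exact: (within_mul c2 continuous_normal_speed).
have [||e1 e10 he1] := within_pos_near cs (x0 := (t0, (c, z0))); first by split.
  by rewrite /unc/= -normrEsg normr_gt0.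
move: (ht0) => /andP[t00 t0T].
pose m := Num.min e1 (Num.min (Num.min t0 (T - t0)) (Num.min 1 (Num.min z0 (H - z0)))).
have m0 : 0 < m by rewrite !lt_min e10 t00 z00 ltr01 !subr_gt0 t0T z0H.
have [me1 [mt [mT [m1 [mz mH]]]]] : m <= e1 /\ m <= t0 /\ m <= T - t0 /\ m <= 1 /\
    m <= z0 /\ m <= H - z0.
  by rewrite /m !ge_min !lexx !orbT.
pose e := m / 2; have e0 : 0 < e by rewrite divr_gt0.
have em : e < m by exact: half_lt.
have t1e : 0 < t0 - e by rewrite subr_gt0 (lt_le_trans em).
have t2e : t0 + e < T by rewrite -ltrBrDl (lt_le_trans em).
have t12 : t0 - e < t0 + e by rewrite ltrD2l gtrN.
have inT := flow_box t1e t2e.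
have [h [[h0 ch] hp hloc F0]] := local_flux e0 t1e t2e c01 hz0.
have l0 : 0 <= (0 : R) <= 1 by rewrite lexx ler01.
have l1 : 0 <= (1 : R) <= 1 by rewrite lexx ler01.
have H00 : 0 <= (0 : R) <= H by rewrite lexx ltW.
have H0H : 0 <= H <= H by rewrite lexx ltW.
have far t l z : t0 - e <= t <= t0 + e -> 0 <= l <= 1 -> 0 <= z <= H ->
    e <= `|l - c| \/ e <= `|z - z0| -> pull r0 zeta h t l z = 0.
  move=> k1 k2 k3 k; apply/eqP; apply: contrapT => /negP /(hloc _ _ _ k1 k2 k3)[_ k4 k5].
  by case: k; rewrite leNgt ?k4 ?k5.
have F3 : itg (t0 - e) (t0 + e) (fun t => itg 0 1 (fun l =>
    flux3 r0 zeta h w t l H - flux3 r0 zeta h w t l 0)) = 0.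
  apply: itg_eq0 => [|t ht]; first exact: ltW.
  apply: itg_eq0 => [|l hl]; first exact: ler01.
  rewrite /flux3 !far//; first by rewrite !(mulr0, mul0r) subrr.
    by right; rewrite sub0r normrN gtr0_norm// ltW// (lt_le_trans em).
  by right; rewrite gtr0_norm ?subr_gt0// ltW// (lt_le_trans em).
rewrite F3 addr0 in F0.
have far' t z : t0 - e <= t <= t0 + e -> 0 <= z <= H ->
    flux2 r0 zeta h v w t 1 z - flux2 r0 zeta h v w t 0 z =
    (if c == 0 then -1 else 1) * flux2 r0 zeta h v w t c z.
  move=> k1 k2; case: hc => cE.
    rewrite cE eqxx {1}/flux2 (far t 1 z)// ?(mulr0, mul0r) ?sub0r ?mulN1r//.
    by left; rewrite cE subr0 normr1 ltW// (lt_le_trans em).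
  rewrite cE oner_eq0 mul1r [X in _ - X]/flux2 (far t 0 z)// ?(mulr0, mul0r) ?subr0//.
  by left; rewrite cE sub0r normrN normr1 ltW// (lt_le_trans em).
pose sc : R := if c == 0 then -1 else 1.
have sc1 : sc * sc = 1 by rewrite /sc; case: ifP; rewrite ?mulrNN mulr1.
have cf2 : {within closed_flow, continuous (unc (flux2 r0 zeta h v w))}.
  exact: (within_mul (within_mul (differentiable_flow (Cn_rad 0)) ch) continuous_normal_speed).
have r_gt0 t l z : 0 < t < T -> 0 <= l <= 1 -> 0 <= z <= H -> 0 < rad_of r0 zeta t l z.
  by move=> k1 k2 k3; exact: Gam_gt0 (img_movT k1 k2 k3).
have cslice (d : R) : 0 <= d <= 1 -> {within [set p : R * R | t0 - e <= p.1 <= t0 + e /\ 0 <= p.2 <= H],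
    continuous (fun p => flux2 r0 zeta h v w p.1 d p.2)}.
  move=> hd; apply: (@slice_within (flux2 r0 zeta h v w) _ _ (fun p => (d, p.2)) _ _ cf2).
    by move=> p; exact: (cvg_pair (cvg_cst d) cvg_snd).
  by move=> t y k1 k2; split => //=; exact: inT.
apply: (@int2_sign R (t0 - e) (t0 + e) 0 H (sc * s) (fun t z =>
    flux2 r0 zeta h v w t 1 z - flux2 r0 zeta h v w t 0 z) t0 z0 t12 H_gt0 _ _ _ hz0 _ F0).
- exact: (within_sub (cslice _ l1) (cslice _ l0)).
- move=> t z k1 k2; rewrite (far' t z k1 k2) -/sc mulrACA sc1 mul1r.
  rewrite /flux2 -/(normal_speed t c z) mulrCA.
  have [->|k] := eqVneq (pull r0 zeta h t c z) 0; first by rewrite mulr0 mul0r.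
  have [k3 _ k4] := hloc t c z k1 c01 k2 k.
  have hr := r_gt0 t c z (inT t k1) c01 k2.
  rewrite mulr_ge0//; first by rewrite mulr_ge0 ?(ltW hr)//; exact: h0.
  apply/ltW/(he1 (t, (c, z))) => //=.
  + by split => //=; exact: inT.
  + by rewrite (lt_trans k3)// (lt_le_trans em).
  + by rewrite subrr normr0.
  + by rewrite (lt_trans k4)// (lt_le_trans em).
- by rewrite lerBlDr !lerDl ltW.
have tt : t0 - e <= t0 <= t0 + e by rewrite lerBlDr !lerDl ltW.
rewrite (far' t0 z0 tt hz0) -/sc mulrACA sc1 mul1r /flux2 -/(normal_speed t0 c z0) mulrCA.
by rewrite mulr_gt0//; [rewrite mulr_gt0//; exact: r_gt0|rewrite -normrEsg normr_gt0].
Qed.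

(** The same on the bottom and the top, where the flux is carried by w. *)
Let wall_face t0 l0 c : 0 < t0 < T -> 0 < l0 < 1 -> c = 0 \/ c = H -> pull r0 zeta w t0 l0 c = 0.
Proof.
move=> ht0 /andP[l00 l01] hc; apply/eqP; apply: contrapT => /negP nz.
have hl0 : 0 <= l0 <= 1 by rewrite !ltW.
have c0H : 0 <= c <= H by case: hc => ->; rewrite lexx ltW.
pose s := Num.sg (pull r0 zeta w t0 l0 c).
have cw := pull_within w_cont.
have cs : {within closed_flow, continuous (fun x => s * unc (pull r0 zeta w) x)}.
  have c2 : {within closed_flow, continuous (fun _ => s)}.
    by apply: continuous_subspaceT => y; exact: cvg_cst.
  exact: (within_mul c2 cw).
have [||e1 e10 he1] := within_pos_near cs (x0 := (t0, (l0, c))); first by split.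
  by rewrite /unc/= -normrEsg normr_gt0.
move: (ht0) => /andP[t00 t0T].
pose m := Num.min e1 (Num.min (Num.min t0 (T - t0)) (Num.min H (Num.min l0 (1 - l0)))).
have m0 : 0 < m by rewrite !lt_min e10 t00 l00 H_gt0 !subr_gt0 t0T l01.
have [me1 [mt [mT [m1 [mz mH]]]]] : m <= e1 /\ m <= t0 /\ m <= T - t0 /\ m <= H /\
    m <= l0 /\ m <= 1 - l0.
  by rewrite /m !ge_min !lexx !orbT.
pose e := m / 2; have e0 : 0 < e by rewrite divr_gt0.
have em : e < m by exact: half_lt.
have t1e : 0 < t0 - e by rewrite subr_gt0 (lt_le_trans em).
have t2e : t0 + e < T by rewrite -ltrBrDl (lt_le_trans em).
have t12 : t0 - e < t0 + e by rewrite ltrD2l gtrN.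
have inT := flow_box t1e t2e.
have [h [[h0 ch] hp hloc F0]] := local_flux e0 t1e t2e hl0 c0H.
have k0 : 0 <= (0 : R) <= 1 by rewrite lexx ler01.
have k1 : 0 <= (1 : R) <= 1 by rewrite lexx ler01.
have H00 : 0 <= (0 : R) <= H by rewrite lexx ltW.
have H0H : 0 <= H <= H by rewrite lexx ltW.
have far t l z : t0 - e <= t <= t0 + e -> 0 <= l <= 1 -> 0 <= z <= H ->
    e <= `|l - l0| \/ e <= `|z - c| -> pull r0 zeta h t l z = 0.
  move=> h1 h2 h3 k; apply/eqP; apply: contrapT => /negP /(hloc _ _ _ h1 h2 h3)[_ k4 k5].
  by case: k; rewrite leNgt ?k4 ?k5.
have F3 : itg (t0 - e) (t0 + e) (fun t => itg 0 H (fun z =>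
    flux2 r0 zeta h v w t 1 z - flux2 r0 zeta h v w t 0 z)) = 0.
  apply: itg_eq0 => [|t ht]; first exact: ltW.
  apply: itg_eq0 => [|z hz]; first exact: ltW.
  rewrite /flux2 !far//; first by rewrite !(mulr0, mul0r) subrr.
    by left; rewrite sub0r normrN gtr0_norm// ltW// (lt_le_trans em).
  by left; rewrite gtr0_norm ?subr_gt0// ltW// (lt_le_trans em).
rewrite F3 add0r in F0.
have far' t l : t0 - e <= t <= t0 + e -> 0 <= l <= 1 ->
    flux3 r0 zeta h w t l H - flux3 r0 zeta h w t l 0 =
    (if c == 0 then -1 else 1) * flux3 r0 zeta h w t l c.
  move=> h1 h2; case: hc => cE.
    rewrite cE eqxx {1}/flux3 (far t l H)// ?(mulr0, mul0r) ?sub0r ?mulN1r//.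
    by right; rewrite cE subr0 gtr0_norm// ltW// (lt_le_trans em).
  rewrite cE (gt_eqF H_gt0) mul1r [X in _ - X]/flux3 (far t l 0)// ?(mulr0, mul0r) ?subr0//.
  by right; rewrite cE sub0r normrN gtr0_norm// ltW// (lt_le_trans em).
pose sc : R := if c == 0 then -1 else 1.
have sc1 : sc * sc = 1 by rewrite /sc; case: ifP; rewrite ?mulrNN mulr1.
have cf3 : {within closed_flow, continuous (unc (flux3 r0 zeta h w))}.
  exact: (within_mul (within_mul (differentiable_flow (Cn_thickness 0))
    (within_mul (differentiable_flow (Cn_rad 0)) ch)) cw).
have mass_gt0 t l z : 0 < t < T -> 0 <= l <= 1 -> 0 <= z <= H ->
    0 < thick r0 zeta t l z * rad_of r0 zeta t l z.
  move=> h1 h2 h3; rewrite mulr_gt0//; first exact: thick_gt0.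
  exact: Gam_gt0 (img_movT h1 h2 h3).
have cslice (d : R) : 0 <= d <= H -> {within [set p : R * R | t0 - e <= p.1 <= t0 + e /\ 0 <= p.2 <= 1],
    continuous (fun p => flux3 r0 zeta h w p.1 p.2 d)}.
  move=> hd; apply: (@slice_within (flux3 r0 zeta h w) _ _ (fun p => (p.2, d)) _ _ cf3).
    by move=> p; exact: (cvg_pair cvg_snd (cvg_cst d)).
  by move=> t y h1 h2; split => //=; exact: inT.
apply: (@int2_sign R (t0 - e) (t0 + e) 0 1 (sc * s) (fun t l =>
    flux3 r0 zeta h w t l H - flux3 r0 zeta h w t l 0) t0 l0 t12 ltr01 _ _ _ hl0 _ F0).
- exact: (within_sub (cslice _ H0H) (cslice _ H00)).
- move=> t l h1 h2; rewrite (far' t l h1 h2) -/sc mulrACA sc1 mul1r /flux3 mulrA mulrCA.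
  have [->|k] := eqVneq (pull r0 zeta h t l c) 0; first by rewrite mulr0 mul0r.
  have [k3 k4 _] := hloc t l c h1 h2 c0H k.
  have hr := mass_gt0 t l c (inT t h1) h2 c0H.
  rewrite mulr_ge0//; first by rewrite mulr_ge0 ?(ltW hr)//; exact: h0.
  apply/ltW/(he1 (t, (l, c))) => //=.
  + by split => //=; exact: inT.
  + by rewrite (lt_trans k3)// (lt_le_trans em).
  + by rewrite (lt_trans k4)// (lt_le_trans em).
  + by rewrite subrr normr0.
- by rewrite lerBlDr !lerDl ltW.
have tt : t0 - e <= t0 <= t0 + e by rewrite lerBlDr !lerDl ltW.
rewrite (far' t0 l0 tt hl0) -/sc mulrACA sc1 mul1r /flux3 mulrA mulrCA.
by rewrite mulr_gt0//; [rewrite mulr_gt0//; exact: mass_gt0|rewrite -normrEsg normr_gt0].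
Qed.

Let side_face_closed t c z : 0 < t < T -> c = 0 \/ c = 1 -> 0 <= z <= H -> normal_speed t c z = 0.
Proof.
move=> ht hc; apply: (zero_on_closure H_gt0 (f := normal_speed t c)).
  apply: (@within_comp _ _ _ closed_flow _ (unc normal_speed) (fun z : R => (t, (c, z)))).
  - exact: continuous_normal_speed.
  - apply: continuous_subspaceT => x.
    by apply: continuous_triple; [exact: cvg_cst|exact: cvg_cst|exact: cvg_id].
  - by move=> x; rewrite /= in_itv/= => hx; split => //=; case: hc => ->; rewrite ?lexx ler01.
by move=> x; exact: side_face.
Qed.

Let wall_face_closed t l c : 0 < t < T -> 0 <= l <= 1 -> c = 0 \/ c = H -> pull r0 zeta w t l c = 0.
Proof.
move=> ht hl hc; have cw := pull_within w_cont.
apply: (zero_on_closure ltr01 (f := fun l => pull r0 zeta w t l c)) hl.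
  apply: (@within_comp _ _ _ closed_flow _ (unc (pull r0 zeta w)) (fun l : R => (t, (l, c))) cw).
  - apply: continuous_subspaceT => x.
    by apply: continuous_triple; [exact: cvg_cst|exact: cvg_id|exact: cvg_cst].
  - by move=> x; rewrite /= in_itv/= => hx; split => //=; case: hc => ->; rewrite lexx ltW.
by move=> x hx; exact: wall_face.
Qed.

Lemma converse_FB : FB r0 H T v w zeta.
Proof.
move=> t ht; have H0 := ltW H_gt0.
have coord r z : Gam r0 H zeta t (r, z) -> exists2 l, 0 <= l <= 1 & rad_of r0 zeta t l z = r.
  move=> [/= hz /andP[h1 h2]]; have J : 0 < zeta t z - r0 by exact: (thick_gt0 0 ht hz).
  exists ((r - r0) / (zeta t z - r0)).
    apply/andP; split; first by apply: divr_ge0; [rewrite subr_ge0|exact: ltW].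
    by rewrite ler_pdivrMr// mul1r lerD2r.
  by rewrite /rad_of /thick divfK ?gt_eqF// addrC subrK.
split.
- move=> z [/= hz _]; have := side_face_closed ht (or_introl erefl) hz.
  rewrite /normal_speed mul0r subr0 /pull /rad_of mul0r addr0 => vz.
  by rewrite /dot/= vz mul0r mulr0 addr0.
- move=> r /coord[l hl <-]; have := wall_face_closed ht hl (or_introl erefl).
  by rewrite /pull => wz; rewrite /dot/= wz mulr0 mul0r addr0.
- move=> r /coord[l hl <-]; have := wall_face_closed ht hl (or_intror erefl).
  by rewrite /pull => wz; rewrite /dot/= wz mulr0 mul0r addr0.
move=> z hz; split.
  have d := Cn_diff (hZz 0) (subZz (closed_time ht) hz).
  apply: (@differentiable_comp _ _ _ _ (fun x : R * R => (x.1, (x.2, 0 : R)))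
    (unc (fun t z _ => zeta t z))); last exact: d.
  apply: differentiable_pair; first exact: differentiable_fst.
  by apply: differentiable_pair; [exact: differentiable_snd|exact: differentiable_cst].
have := side_face_closed ht (or_intror erefl) hz.
have rE : r0 + (zeta t z - r0) = zeta t z by rewrite addrC subrK.
rewrite /normal_speed mul1r /pull /rad_of /thick mul1r rE => /eqP; rewrite subr_eq0 => /eqP ->.
by rewrite [w _ _ _ * _]mulrC.
Qed.
Lemma converse_system : [/\ E1 r0 H Om T F u v w zeta,
  E2 r0 H T S v w theta zeta, E3 r0 H Om T u phi zeta, E4 r0 H g th0 T phi theta zeta &
  [/\ E5 r0 H T v w zeta, FB r0 H T v w zeta, PB H T phi zeta & ST r0 H Om T phi zeta]].
Proof.
split; [exact: converse_E1|exact: converse_E2|exact: converse_E3|exact: converse_E4|].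
split; [exact: converse_E5|exact: converse_FB|exact: converse_PB|exact: converse_ST].
Qed.
End converse.

(** * Equivalence of the two formulations *)

Theorem proposition3p2 (R : realType) (r0 H Om g th0 T : R)
    (F S : R -> R -> R -> R) :
  0 < r0 -> 0 < H -> 0 < Om -> 0 < g -> 0 < th0 -> 0 < T ->
  (forall (phi u v w theta : R -> R -> R -> R) (zeta : R -> R -> R)
      (V : R -> R -> R -> R * R),
    let P := P_of r0 Om phi in
    let Psi := Psi_of r0 H P in
    let fluid := [set x : R * (R * R) |
      0 <= x.1 <= T /\ Gam r0 H zeta x.1 x.2] in
    smooth_on [set x | 0 <= x.1 <= T /\ strip r0 H x.2] phi ->
    (forall t, 0 <= t <= T ->
      convex_function (E := (R * R)%type) (domD r0 H)
        (fun p => P t p.1 p.2)) ->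
    smooth_on fluid u -> smooth_on fluid theta ->
    smooth_on fluid v -> smooth_on fluid w ->
    smooth_on [set x | 0 <= x.1 <= T /\ 0 <= x.2.1 <= H]
      (fun t z _ => zeta t z) ->
    (forall t z, 0 <= t <= T -> 0 <= z <= H -> r0 <= zeta t z) ->
    (forall t, 0 <= t <= T ->
      (\int[leb2 R]_(x in Gam r0 H zeta t) (x.1)%:E = 1)%E) ->
    (forall t r z, 0 < t < T -> Gam r0 H zeta t (r, z) ->
      let q := grad P t (s_of r0 r) z in
      V t q.1 q.2 =
        (material (vfield v w) (fun t' r' z' => D1 P t' (s_of r0 r') z') t r z,
         material (vfield v w) (fun t' r' z' => D2 P t' (s_of r0 r') z') t r z)) ->
    ((forall t r z, 0 < t < T -> Gam_int r0 H zeta t (r, z) ->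
        0 <= u t r z * r + r ^+ 2 * Om) ->
     E1 r0 H Om T F u v w zeta -> E2 r0 H T S v w theta zeta ->
     E3 r0 H Om T u phi zeta -> E4 r0 H g th0 T phi theta zeta ->
     ST r0 H Om T phi zeta ->
     forall t r z, 0 < t < T -> Gam_int r0 H zeta t (r, z) ->
       let q := grad P t (s_of r0 r) z in
       differentiable (fun q' : R * R => Psi t q'.1 q'.2) q /\
       V t q.1 q.2 = VEL r0 g th0 F S Psi t q.1 q.2) /\
    (forall sigma : R -> probability (plane R) R,
     (forall t, 0 <= t <= T -> sigma t `<< leb2 R) ->
     (forall t (A : set (plane R)), 0 <= t <= T -> measurable A ->
       (sigma t A = \int[leb2 R]_(x in Gam r0 H zeta t `&`
          [set x | A (grad P t (s_of r0 x.1) x.2)]) (x.1)%:E)%E) ->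
     E5 r0 H T v w zeta -> FB r0 H T v w zeta ->
     continuity_equation T sigma V)) /\
  (forall (sigma : R -> probability (plane R) R) (dens : R -> R * R -> R)
      (P Psi : R -> R -> R -> R) (rho : R -> R -> R)
      (u theta v w : R -> R -> R -> R),
    let phi := phi_of r0 Om P in
    let zeta := zeta_of r0 rho in
    let V := VEL r0 g th0 F S Psi in
    smooth_on [set x | 0 <= x.1 <= T /\ strip r0 H x.2] F ->
    smooth_on [set x | 0 <= x.1 <= T /\ strip r0 H x.2] S ->
    (exists M : R, forall t, 0 <= t <= T -> spt (sigma t) `<=`
      [set q | [/\ 0 <= q.1, 0 <= q.2 & q.1 ^+ 2 + q.2 ^+ 2 <= M ^+ 2]]) ->
    (forall t, 0 <= t <= T -> sigma t `<< leb2 R) ->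
    (forall t, 0 <= t <= T -> [/\ measurable_fun [set: plane R] (dens t),
      forall q, 0 <= dens t q &
      forall A : set (plane R), measurable A ->
        (sigma t A = \int[leb2 R]_(q in A) (dens t q)%:E)%E]) ->
    smooth_on [set x | 0 <= x.1 <= T /\ domD r0 H x.2] P ->
    smooth_on [set x | 0 <= x.1 <= T /\ (spt (sigma x.1))° x.2] Psi ->
    (forall t q, 0 <= t <= T -> spt (sigma t) q ->
      differentiable (fun q' : R * R => Psi t q'.1 q'.2) q) ->
    smooth_on [set x | 0 <= x.1 <= T /\ 0 <= x.2.1 <= H]
      (fun t z _ => rho t z) ->
    (forall t z, 0 <= t <= T -> 0 <= z <= H ->
      0 < rho t z < (2 * r0 ^+ 2)^-1) ->
    (forall t, 0 <= t <= T ->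
      [/\ convex_function (E := (R * R)%type) (domD r0 H)
            (fun p => P t p.1 p.2),
          convex_function (E := (R * R)%type) setT (fun q => Psi t q.1 q.2),
          forall q, Psi t q.1 q.2 = Psi_of r0 H P t q.1 q.2 &
          forall p, domD r0 H p ->
            P t p.1 p.2 = legendre setT (fun q => Psi t q.1 q.2) p]) ->
    (forall t p, 0 <= t <= T -> Drho_int H rho t p ->
      let q := grad P t p.1 p.2 in grad Psi t q.1 q.2 = p) ->
    (forall t q, 0 <= t <= T -> (spt (sigma t))° q ->
      let p := grad Psi t q.1 q.2 in grad P t p.1 p.2 = q) ->
    (forall t, 0 <= t <= T -> {ae leb2 R, forall q, spt (sigma t) q ->
      e_ r0 (D1 Psi t q.1 q.2) * hess_det Psi t q.1 q.2 = dens t q}) ->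
    (forall t, 0 <= t <= T ->
      [set grad Psi t q.1 q.2 | q in spt (sigma t)] = Drho H rho t) ->
    (forall t, 0 <= t <= T ->
      P t (rho t H) H =
        Om ^+ 2 * r0 ^+ 2 / (2 * (1 - 2 * r0 ^+ 2 * rho t H))) ->
    (forall t r z, 0 <= t <= T -> Gam r0 H zeta t (r, z) ->
      [/\ (u t r z * r + r ^+ 2 * Om) ^+ 2 = D1 P t (s_of r0 r) z,
          0 <= u t r z * r + r ^+ 2 * Om &
          g / th0 * theta t r z = D2 P t (s_of r0 r) z]) ->
    (forall t q, 0 < t < T -> (spt (sigma t))° q ->
      vfield v w t (r_of r0 (D1 Psi t q.1 q.2)) (D2 Psi t q.1 q.2) =
        (material V (fun t' Y Z => r_of r0 (D1 Psi t' Y Z)) t q.1 q.2,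
         material V (D2 Psi) t q.1 q.2)) ->
    {within [set x : R * (R * R) | 0 < x.1 < T /\ Gam r0 H zeta x.1 x.2],
      continuous (unc v)} ->
    {within [set x : R * (R * R) | 0 < x.1 < T /\ Gam r0 H zeta x.1 x.2],
      continuous (unc w)} ->
    continuity_equation_init T sigma V ->
    [/\ E1 r0 H Om T F u v w zeta,
        E2 r0 H T S v w theta zeta,
        E3 r0 H Om T u phi zeta,
        E4 r0 H g th0 T phi theta zeta &
        [/\ E5 r0 H T v w zeta,
            FB r0 H T v w zeta,
            PB H T phi zeta &
            ST r0 H Om T phi zeta]]).
Proof.
move=> r0_gt0 H_gt0 Om_gt0 g_gt0 th0_gt0 T_gt0; split.
  move=> phi u v w theta zeta V P Psi fluid phi_smooth P_convex _ _ v_smooth w_smooth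
    zeta_smooth zeta_ge _ VE; split.
    move=> u_ge0 e1 e2 e3 e4 st t r z ht hx q.
    have [d m] := forward_velocity r0_gt0 phi_smooth P_convex zeta_smooth u_ge0 e1 e2 e3 e4 st ht hx.
    split => //; have hg : Gam r0 H zeta t (r, z).
      by move: hx => [/andP[? ?] /andP[? ?]]; split; rewrite !ltW.
    by rewrite [LHS](VE t r z ht hg); exact: m.
  move=> sigma _ sigmaE e5 fb.
  exact: (forward_continuity r0_gt0 H_gt0 T_gt0 phi_smooth v_smooth w_smooth zeta_smooth
    zeta_ge VE sigmaE e5 fb).
move=> sigma dens P Psi rho u theta v w phi zeta V F_smooth S_smooth spt_bounded _ sigma_dens
  P_smooth Psi_smooth Psi_diff rho_smooth rho_bounds duality _ _ monge_ampere image_spt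
  P_boundary u_theta velocity v_cont w_cont transport.
exact: (converse_system r0_gt0 H_gt0 g_gt0 th0_gt0 F_smooth S_smooth spt_bounded
  sigma_dens P_smooth Psi_smooth Psi_diff rho_smooth rho_bounds duality monge_ampere image_spt
  P_boundary u_theta velocity v_cont w_cont transport).
Qed.
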